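(* Let $T>0$ and let $v$ be a limit of Galerkin approximations $v^{N_k}$ on $[0,T]$ with initial value $v_0$, as described in the context, and let $v_p=|v|^{p-2}v$. Then the time differences $D_h^+v_p(t)\,1_{[0,T-h]}(t)$ and $D_h^-v_p(t)\,1_{[h,T]}(t)$ are bounded in $V'$ uniformly in $h$, and both have subsequences converging weakly in $V'$ to $\partial_tv_p$ as $h\to0$. Moreover, there is a version of the mapping $t\mapsto H(t)$, where $$H(t)=\frac1q\int_\Omega|v(x,t)|^p\,dx=\frac1q\int_\Omega|v_p(x,t)|^q\,dx,$$ that is continuous with $H(0)=\frac1q\|v_0\|_{L^p}^p$ and satisfies, for any $0\le s\le t\le T$, $$\int_s^t\int_\Omega v(\tau)\cdot\partial_tv_p(\tau)\,dx\,d\tau=H(t)-H(s).$$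
   Context: Standing assumptions: $\Omega\subset\mathbb{R}^d$ is simply connected, bounded, with $C^\infty$ boundary; $p\ge d\ge2$; $\frac1p+\frac1q=1$; $\nu>0$. Notation: $(\nabla v)_{ij}=\partial_iv_j$, $\mathcal{D}(v)=\frac12(\nabla v+\nabla v^T)$, $A:B=\sum_{ij}A_{ij}B_{ij}$, $|A|=(A:A)^{1/2}$, $(a\cdot\nabla b)_k=\sum_ja_j\partial_jb_k$. Spaces: for $r>1$, $U_r(\Omega)=\{w\in L^r(\Omega;\mathbb{R}^d):\int_\Omega w\cdot\nabla\varphi\,dx=0\ \forall\varphi\in C^1(\overline\Omega)\}$; $W=\{v\in W_0^{1,p}(\Omega;\mathbb{R}^d):\nabla\cdot v=0\}$; $V=L^p(0,T;W)$ with the $L^p(0,T;W^{1,p})$ norm; $V'$ is its dual, with pairing extending $\int_0^T\int_\Omega u\cdot w\,dxdt$. Basis: for an integer $m$, if $m=2k$ put $S=L=\{0,\dots,k-1\}$; if $m=2k+1$ put $S=\{0,\dots,k\}$, $L=\{0,\dots,k-1\}$; $\tilde H^m=\{u\in H^m(\Omega;\mathbb{R}^d):\mathrm{div}\,u=0,\ \Delta^su|_{\partial\Omega}=0\ (s\in S),\ \partial_n\Delta^\ell u|_{\partial\Omega}=0\ (\ell\in L)\}$; $B[u,v]=\int_\Omega\Delta^ku\cdot\Delta^kv\,dx$ ($m=2k$) or $\int_\Omega\nabla\Delta^ku:\nabla\Delta^kv\,dx$ ($m=2k+1$); $\mathcal{S}f$ is the unique $u\in\tilde H^m$ with $B[u,v]=\int_\Omega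 f\cdot v\,dx$ for all $v\in\tilde H^m$. The integer $m$ is fixed sufficiently large, and $\{\phi_n\}_{n\ge1}$ is the complete $L^2$-orthogonal system in $U_2(\Omega)$ of eigenfunctions of $\mathcal{S}$, which is a Schauder basis of both $U_p(\Omega)$ and $W$. Galerkin approximation: $v_0\in U_p(\Omega)$, $v_0\ne0$, $v_0=\sum_nc_{0,n}\phi_n$ in $U_p(\Omega)$; $n_*$ is the least $n$ with $c_{0,n}\ne0$; for $N\ge n_*$, $W_N=\mathrm{span}\{\phi_1,\dots,\phi_N\}$ and $v^N(t)=\sum_{n=1}^Nc_n^N(t)\phi_n$ is the (global in time) solution of $c_n^N(0)=c_{0,n}$ and, for all $\varphi\in W_N$, with $v_p^N=|v^N|^{p-2}v^N$, $$\frac{d}{dt}\int_\Omega\varphi\cdot v_p^Ndx+\int_\Omega\varphi\cdot(v^N\cdot\nabla v_p^N)dx+\nu\int_\Omega\nabla\varphi:\mathcal{D}(v^N)|\mathcal{D}(v^N)|^{p-2}dx=0.$$ Limit: $v\in L^\infty(0,T;U_p(\Omega))\cap L^p(0,T;W)$ and $\chi\in L^q(0,T;L^q(\Omega;\mathbb{R}^{d\times d}))$ symmetric are such that along a subsequence $N_k$: $v^{N_k}\to v$ strongly in $L^p(0,T;L^p)$, $v_p^{N_k}\to v_p$ strongly in $L^q(0,T;L^q)$, $\nabla v^{N_k}\rightharpoonup\nabla v$ weakly in $L^p(0,T;L^p)$, $|\mathcal{D}(v^{N_k})|^{p-2}\mathcal{D}(v^{N_k})\rightharpoonup\chi$ weakly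 in $L^q(0,T;L^q)$, and $Q_{N_k}^*\partial_tv_p^{N_k}\rightharpoonup\partial_tv_p$ weakly in $V'$, where $Q_N:W\to W_N$, $Q_N(\sum_kc_k\phi_k)=\sum_{k\le N}c_k\phi_k$, acts pointwise in time on $V$ and $Q_N^*:V'\to V'$ is its conjugate. Time derivative: $\partial_tv_p\in V'$ is the weak time derivative of $v_p$ with initial value $|v_0|^{p-2}v_0$, i.e. $\langle\psi,\partial_tv_p\rangle=-\int_0^T\int_\Omega\partial_t\psi\cdot v_p\,dxdt-\int_\Omega\psi(x,0)\cdot|v_0|^{p-2}v_0\,dx$ for all divergence-free $\psi\in C_c^\infty(\Omega\times[0,T);\mathbb{R}^d)$. The integral $\int_s^t\int_\Omega v\cdot\partial_tv_p\,dxd\tau$ means the pairing $\langle v1_{[s,t]},\partial_tv_p\rangle$ of $V$ with $V'$. Finite differences ($0<h<T$): $D_h^+g(t)=\frac1h(g(t+h)-g(t))$, $D_h^-g(t)=\frac1h(g(t)-g(t-h))$. *)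

(* Defs.v *)
From HB Require Import structures.
From mathcomp Require Import all_boot all_order all_algebra.
From mathcomp Require Import all_classical all_reals all_analysis.
Set Implicit Arguments.
Unset Strict Implicit.
Unset Printing Implicit Defensive.
Import Order.TTheory GRing.Theory Num.Theory numFieldNormedType.Exports.

Local Open Scope classical_set_scope.
Local Open Scope ring_scope.

(* The Borel sets of R^n, generated by the coordinates *)
Section measurable_rV.
Context {R : realType} {n : nat}.

Let coors (i : 'I_n) (x : 'rV[R]_n) : measurableTypeR R := x ord0 i.

Let rV_set0 : g_sigma_preimage coors set0.
Proof. exact: sigma_algebra0. Qed.

Let rV_setC A : g_sigma_preimage coors A -> g_sigma_preimage coors (~` A).
Proof. exact: sigma_algebraC. Qed.

Let rV_bigcup (F : _^nat) : (forall i, g_sigma_preimage coors (F i)) ->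
  g_sigma_preimage coors (\bigcup_i (F i)).
Proof. exact: sigma_algebra_bigcup. Qed.

HB.instance Definition _ := @isMeasurable.Build default_measure_display
  'rV[R]_n (g_sigma_preimage coors) rV_set0 rV_setC rV_bigcup.

Lemma measurable_coor_rV (i : 'I_n) :
  measurable_fun [set: 'rV[R]_n] (fun x => x ord0 i : measurableTypeR R).
Proof.
move=> _ Y mY; rewrite setTI; apply: sub_sigma_algebra => /=.
rewrite -bigcup_seq/=; exists i => /=; first by rewrite mem_index_enum.
by exists Y => //; rewrite setTI.
Qed.

Lemma measurable_fun_rVP d (T : measurableType d) (f : T -> 'rV[R]_n) :
  (forall i, measurable_fun [set: T] (fun x => f x ord0 i : measurableTypeR R)) ->
  measurable_fun [set: T] f.
Proof.
move=> mf _ Y mY; rewrite setTI.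
suff : g_sigma_preimage coors `<=` (fun A => measurable (f @^-1` A)).
  by apply.
apply: smallest_sub.
  split => [|A mA|F mF].
  - by rewrite preimage_set0; exact: measurable0.
  - by rewrite setTD preimage_setC; exact: measurableC.
  - by rewrite preimage_bigcup; exact: bigcup_measurable.
move=> A; rewrite -bigcup_seq/= => -[i _ [B mB <-]].
by have := mf i measurableT B mB; rewrite !setTI.
Qed.

End measurable_rV.

Lemma product_sigma_finite d1 d2 (T1 : measurableType d1)
    (T2 : measurableType d2) (R : realType)
    (m1 : {sigma_finite_measure set T1 -> \bar R})
    (m2 : {sigma_finite_measure set T2 -> \bar R}) :
  sigma_finite setT (m1 \x m2)%E.
Proof.
have /sigma_finiteP[F [TF ndF Foo]] := sigma_finiteT m1.
have /sigma_finiteP[G [TG ndG Goo]] := sigma_finiteT m2.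
exists (fun n => F n `*` G n).
  rewrite -setXTT TF TG predeqE => -[x y]; split.
    move=> [/= [n _ Fnx] [k _ Gky]]; exists (maxn n k) => //; split.
    - by move: x Fnx; exact/subsetPset/ndF/leq_maxl.
    - by move: y Gky; exact/subsetPset/ndG/leq_maxr.
  by move=> [n _ []/= ? ?]; split; exists n.
move=> k; have [? ?] := Foo k; have [? ?] := Goo k.
split; first exact: measurableX.
by rewrite product_measure1E// lte_mul_pinfty// ge0_fin_numE.
Qed.

Section lebesgue_rV.
Context {R : realType}.
Notation mR := (measurableTypeR R).

Section step.
Variables (n : nat) (mu : {sigma_finite_measure set (n.-tuple mR) -> \bar R}).

Let cons_pair (x : mR * n.-tuple mR) : n.+1.-tuple mR := [tuple of x.1 :: x.2].

Let mcons_pair : measurable_fun setT cons_pair.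
Proof. by apply: measurable_cons. Qed.

Let step := pushforward (@lebesgue_measure R \x mu)%E cons_pair.

Definition lebesgue_step (A : set (n.+1.-tuple mR)) : \bar R := step A.

Let step0 : lebesgue_step set0 = 0%E.
Proof. by rewrite /lebesgue_step /step /pushforward preimage_set0 measure0. Qed.

Let step_ge0 A : (0 <= lebesgue_step A)%E.
Proof. exact: measure_ge0. Qed.

Let mpre A : measurable A -> measurable (cons_pair @^-1` A).
Proof. by move=> mA; rewrite -[X in measurable X]setTI; exact: mcons_pair. Qed.

Let step_sigma_additive : semi_sigma_additive lebesgue_step.
Proof.
move=> F mF tF mUF; rewrite /lebesgue_step /step /pushforward preimage_bigcup.
apply: measure_semi_sigma_additive.
- by move=> k; exact: mpre.
- apply/trivIsetP => /= i j _ _ ij; rewrite -preimage_setI.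
  by move/trivIsetP : tF => /(_ _ _ _ _ ij) ->//; rewrite preimage_set0.
- by rewrite -preimage_bigcup; exact: mpre.
Qed.

HB.instance Definition _ := isMeasure.Build _ _ _ lebesgue_step
  step0 step_ge0 step_sigma_additive.

Let uncons (t : n.+1.-tuple mR) : mR * n.-tuple mR :=
  (tnth t ord0, [tuple of behead t]).

Let muncons : measurable_fun setT uncons.
Proof.
apply/measurable_fun_pairP; split; first exact: measurable_tnth.
exact: measurable_behead.
Qed.

Let consK : cancel cons_pair uncons.
Proof.
move=> [x t]; rewrite /uncons /cons_pair /=; congr pair.
by apply/val_inj.
Qed.

Let step_sigma_finite : sigma_finite setT lebesgue_step.
Proof.
have [F FT Foo] := product_sigma_finite (@lebesgue_measure R) mu.
exists (fun k => uncons @^-1` F k).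
  by rewrite -preimage_bigcup -FT preimage_setT.
move=> k; have [mF Fk] := Foo k; split.
  by rewrite -[X in measurable X]setTI; exact: muncons.
rewrite /lebesgue_step /step /pushforward -comp_preimage.
rewrite (_ : _ \o _ = id) ?preimage_id//.
by apply/funext => x; exact: consK.
Qed.

HB.instance Definition _ := Measure_isSigmaFinite.Build _ _ _ lebesgue_step
  step_sigma_finite.
End step.

Fixpoint lebesgue_tuple n : {sigma_finite_measure set (n.-tuple mR) -> \bar R} :=
  match n with
  | 0 => \d_([tuple] : 0.-tuple mR)
  | k.+1 => lebesgue_step (lebesgue_tuple k)
  end.

Section row.
Variable n : nat.

Let row_of_tuple (t : n.-tuple mR) : 'rV[R]_n := \row_i tnth t i.

Let mrow_of_tuple : measurable_fun setT row_of_tuple.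
Proof.
apply: measurable_fun_rVP => i.
rewrite (_ : (fun _ => _) = fun t : n.-tuple mR => tnth t i).
  exact: measurable_tnth.
by apply/funext => t; rewrite mxE.
Qed.

(* n-dimensional Lebesgue measure on 'rV[R]_n: the image of the n-fold product
   of the one-dimensional one *)
Definition leb (A : set 'rV[R]_n) : \bar R :=
  lebesgue_tuple n (row_of_tuple @^-1` A).

Let leb0 : leb set0 = 0%E.
Proof. by rewrite /leb preimage_set0 measure0. Qed.

Let leb_ge0 A : (0 <= leb A)%E.
Proof. exact: measure_ge0. Qed.

Let mpre A : measurable A -> measurable (row_of_tuple @^-1` A).
Proof. by move=> mA; rewrite -[X in measurable X]setTI; exact: mrow_of_tuple. Qed.

Let leb_sigma_additive : semi_sigma_additive leb.
Proof.
move=> F mF tF mUF; rewrite /leb preimage_bigcup.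
apply: measure_semi_sigma_additive.
- by move=> k; exact: mpre.
- apply/trivIsetP => /= i j _ _ ij; rewrite -preimage_setI.
  by move/trivIsetP : tF => /(_ _ _ _ _ ij) ->//; rewrite preimage_set0.
- by rewrite -preimage_bigcup; exact: mpre.
Qed.

HB.instance Definition _ := isMeasure.Build _ _ _ leb
  leb0 leb_ge0 leb_sigma_additive.

End row.

End lebesgue_rV.

Section frobenius.
Context {R : realType}.

Definition dot m n (A B : 'M[R]_(m, n)) : R := \sum_i \sum_j A i j * B i j.

Definition frob m n (A : 'M[R]_(m, n)) : R := Num.sqrt (dot A A).

End frobenius.

Definition discrete_alias (T : Type) := T.

HB.instance Definition _ (T : pointedType) := Pointed.on (discrete_alias T).
HB.instance Definition _ (T : pointedType) :=
  @isMeasurable.Build default_measure_display (discrete_alias T)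
    discrete_measurable discrete_measurable0 discrete_measurableC
    discrete_measurableU.

(* Hausdorff measure of dimension s on R^n, for the Euclidean distance and up
   to the normalizing constant.  Every set of [discrete_alias T] is measurable,
   so that the [mu_ext] below is an infimum over all countable covers *)
Section hausdorff.
Context {R : realType} (n s : nat).
Notation E := 'rV[R]_n.
Local Open Scope ereal_scope.

Definition diam (A : set E) : \bar R :=
  ereal_sup [set (frob (x.1 - x.2)%R)%:E | x in A `*` A].

Definition diam_gauge (r : R) (A : set (discrete_alias E)) : \bar R :=
  if A == set0 then 0 else if diam A <= r%:E then diam A `^ s%:R else +oo.

Definition hausdorff (A : set E) : \bar R :=
  ereal_sup [set mu_ext (diam_gauge r) A | r in [set r | (0 < r)%R]].

Let gauge0 r : diam_gauge r set0 = 0.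
Proof. by rewrite /diam_gauge eqxx. Qed.

Let gauge_ge0 r A : 0 <= diam_gauge r A.
Proof.
rewrite /diam_gauge; case: ifP => // _; case: ifP => _; last exact: leey.
exact: poweR_ge0.
Qed.

Let hausdorff0 : hausdorff set0 = 0.
Proof.
apply/eqP; rewrite eq_le; apply/andP; split.
  apply: ge_ereal_sup => _ [r _ <-]; rewrite mu_ext0//.
apply: ereal_sup_ubound; exists 1%R => //=.
by rewrite mu_ext0.
Qed.

Let hausdorff_ge0 A : 0 <= hausdorff A.
Proof.
apply: (@le_trans _ _ (mu_ext (diam_gauge 1) A)); first exact: (mu_ext_ge0 (gauge_ge0 1)).
by apply: ereal_sup_ubound; exists 1%R => //=.
Qed.

Let le_hausdorff : {homo hausdorff : A B / A `<=` B >-> A <= B}.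
Proof.
move=> A B AB; apply: ge_ereal_sup => _ [r r0 <-].
apply: (@le_trans _ _ (mu_ext (diam_gauge r) B)); first exact: le_mu_ext.
by apply: ereal_sup_ubound; exists r.
Qed.

Let hausdorff_sigma_subadditive : sigma_subadditive hausdorff.
Proof.
move=> F; apply: ge_ereal_sup => _ [r r0 <-].
apply: (le_trans (mu_ext_sigma_subadditive (gauge_ge0 r) F)).
apply: lee_nneseries => [k _ _|k _]; first exact: (mu_ext_ge0 (gauge_ge0 r)).
by apply: ereal_sup_ubound; exists r.
Qed.

HB.instance Definition _ := isOuterMeasure.Build R E hausdorff
  hausdorff0 hausdorff_ge0 le_hausdorff hausdorff_sigma_subadditive.

End hausdorff.

(* C^oo in finite dimension: all iterated directional derivatives exist and are
   continuous *)
Section smooth.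
Context {R : realType}.

Definition iter_deriv (V W : normedModType R) (s : seq V) (f : V -> W) : V -> W :=
  foldr (fun v g => 'D_v g) f s.

Definition smooth (V W : normedModType R) (f : V -> W) :=
  forall s, continuous (iter_deriv s f) /\
    forall v x, derivable (iter_deriv s f) x v.

(* C_c^oo(D) *)
Definition test_fun (V W : normedModType R) (D : set V) (f : V -> W) :=
  smooth f /\ exists K, [/\ compact K, K `<=` D & forall x, ~ K x -> f x = 0].

End smooth.

Section domain.
Context {R : realType} {d : nat}.
Notation E := 'rV[R]_d.
Implicit Types (D : set E).

Definition e_ (i : 'I_d) : E := delta_mx ord0 i.

Definition grad (f : E -> R) (x : E) : E := \row_i 'D_(e_ i) f x.

Definition bdry D := closure D `\` interior D.

(* near a boundary point, g is a smooth function with D = {g < 0} *)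
Definition local_defining D (x : E) (g : E -> R) :=
  smooth g /\ exists U : set E, open_nbhs x U /\ forall y, U y ->
    [/\ D y <-> g y < 0, bdry D y <-> g y = 0 & grad g y != 0].

Definition smooth_boundary D :=
  forall x, bdry D x -> exists g, local_defining D x g.

Definition outer_normal D (x n : E) :=
  exists2 g, local_defining D x g & n = (frob (grad g x))^-1 *: grad g x.

Definition path_connected D := forall x y, D x -> D y ->
  exists g : R -> E, [/\ {within `[0, 1], continuous g},
    forall t, t \in `[0, 1] -> D (g t), g 0 = x & g 1 = y].

Definition loops_contractible D := forall g : R -> E,
  {within `[0, 1], continuous g} -> (forall t, t \in `[0, 1] -> D (g t)) ->
  g 0 = g 1 ->
  exists h : R * R -> E,
    [/\ {within `[0, 1] `*` `[0, 1], continuous h},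
        forall z, (`[0, 1] `*` `[0, 1]) z -> D (h z),
        forall t, t \in `[0, 1] -> h (0, t) = g t,
        forall t, t \in `[0, 1] -> h (1, t) = g 0 &
        forall s, s \in `[0, 1] -> h (s, 0) = g 0 /\ h (s, 1) = g 0].

Definition simply_connected D := path_connected D /\ loops_contractible D.

Definition regular_domain D :=
  [/\ open D, bounded_set D, simply_connected D & smooth_boundary D].

End domain.

(* A vector space E comes with a subset and an extended-valued seminorm; when E
   is a space of functions, equality almost everywhere is not quotiented out,
   being the same as vanishing of the seminorm of the difference *)
Record seminormed_space (R : realType) (E : Type) :=
  SeminormedSpace { sp_mem : set E ; sp_norm : E -> \bar R }.

Section spaces.
Context {R : realType} (E : lmodType R).
Implicit Types (X : seminormed_space R E) (u : nat -> E).

Definition scvg X u (l : E) :=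
  sp_norm X (u k - l) @[k --> \oo] --> (0 : \bar R).

(* Functionals are total on E, but only their values on X matter *)
Definition dual X : seminormed_space R (E -> R) :=
  SeminormedSpace
  [set F | (forall (a : R) x y, sp_mem X x -> sp_mem X y ->
              F (a *: x + y) = a * F x + F y) /\
           exists C : R, forall x, sp_mem X x ->
              (`|F x|%:E <= C%:E * sp_norm X x)%E]
  (fun F => ereal_sup [set `|F x|%:E | x in [set x | sp_mem X x /\
                                               (sp_norm X x <= 1)%E]]).

(* Weak convergence in X: tested against all of the dual of X, so that in the
   dual of a space it is tested against the bidual *)
Definition wcvg X u (l : E) :=
  [/\ forall k, sp_mem X (u k), sp_mem X l &
      forall F, sp_mem (dual X) F -> F (u k) @[k --> \oo] --> F l].

Definition expansion X (phi : nat -> E) (w : E) (c : nat -> R) :=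
  scvg X (fun N => \sum_(n < N) c n *: phi n) w.

Definition schauder_basis X (phi : nat -> E) :=
  (forall n, sp_mem X (phi n)) /\
  forall w, sp_mem X w -> exists! c, expansion X phi w c.

Definition coefs X (phi : nat -> E) (w : E) : nat -> R :=
  xget (fun=> 0) (expansion X phi w).

Definition proj_span X (phi : nat -> E) N (w : E) : E :=
  \sum_(n < N) coefs X phi w n *: phi n.

Definition simple_fun X (s : R -> E) :=
  exists n (A : 'I_n -> set (measurableTypeR R)) (x : 'I_n -> E),
    (forall j, measurable (A j) /\ sp_mem X (x j)) /\
    s = (fun t => \sum_(j < n) \1_(A j) t *: x j).

(* L^r(0, T; X) in the sense of Bochner; r may be +oo *)
Definition bochner (r : \bar R) (T : R) X : seminormed_space R (R -> E) :=
  SeminormedSpace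
  [set u : R -> E |
    (exists s : nat -> R -> E, (forall k, simple_fun X (s k)) /\
       {ae @lebesgue_measure R, forall t, t \in `]0, T[ ->
          sp_mem X (u t) /\ sp_norm X (s k t - u t) @[k --> \oo] --> (0 : \bar R)}) /\
    (Lnorm (@lebesgue_measure R) r ((fun t => sp_norm X (u t)) \_ `]0%R, T[) < +oo)%E]
  (fun u : R -> E => Lnorm (@lebesgue_measure R) r ((fun t => sp_norm X (u t)) \_ `]0%R, T[)).

End spaces.

Section sobolev.
Context {R : realType} {d : nat} (D : set 'rV[R]_d).
Notation E := 'rV[R]_d.

Definition comp_ n (v : E -> 'rV[R]_n) (j : 'I_n) : E -> R := fun x => v x ord0 j.

(* |A|^{p-2} A *)
Definition pw m n (p : R) (A : 'M[R]_(m, n)) : 'M[R]_(m, n) :=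
  (frob A `^ (p - 2)) *: A.

Definition Lr (r : R) m n : seminormed_space R (E -> 'M[R]_(m, n)) :=
  SeminormedSpace
  [set f : E -> 'M[R]_(m, n) | (forall i j, measurable_fun D (fun x => f x i j)) /\
           (Lnorm (@leb R d) r%:E ((fun x => (frob (f x))%:E) \_ D) < +oo)%E]
  (fun f : E -> 'M[R]_(m, n) => Lnorm (@leb R d) r%:E ((fun x => (frob (f x))%:E) \_ D)).

(* Scalar functions, with the same norm as Lr *)
Definition Lrs (r : R) : seminormed_space R (E -> R) :=
  SeminormedSpace
  [set f : E -> R | measurable_fun D f /\
           (Lnorm (@leb R d) r%:E ((fun x => (f x)%:E) \_ D) < +oo)%E]
  (fun f : E -> R => Lnorm (@leb R d) r%:E ((fun x => (f x)%:E) \_ D)).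

Definition L1loc (f : E -> R) := measurable_fun D f /\
  forall K, compact K -> K `<=` D -> (@leb R d).-integrable K (EFin \o f).

(* g is the weak derivative of u along the multi-index s *)
Definition weak_deriv (s : seq 'I_d) (u g : E -> R) :=
  [/\ L1loc u, L1loc g & forall f : E -> R, test_fun D f ->
    \int[@leb R d]_(x in D) (u x * iter_deriv (map e_ s) f x) =
    (-1) ^+ size s * \int[@leb R d]_(x in D) (g x * f x)].

Definition wpart (i : 'I_d) (u : E -> R) : E -> R :=
  xget (fun=> 0) (weak_deriv [:: i] u).

Definition wgrad n (v : E -> 'rV[R]_n) (x : E) : 'M[R]_(d, n) :=
  \matrix_(i, j) wpart i (comp_ v j) x.

Definition wdiv (v : E -> 'rV[R]_d) (x : E) : R := \tr (wgrad v x).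

Definition sym_grad (v : E -> 'rV[R]_d) (x : E) : 'M[R]_d :=
  2^-1 *: (wgrad v x + (wgrad v x)^T).

Definition wlap n (v : E -> 'rV[R]_n) (x : E) : 'rV[R]_n :=
  \row_j \sum_i wpart i (wpart i (comp_ v j)) x.

Definition W1r (r : R) n : seminormed_space R (E -> 'rV[R]_n) :=
  SeminormedSpace
  [set v : E -> 'rV[R]_n | [/\ sp_mem (Lr r 1 n) v,
     forall i j, exists g, weak_deriv [:: i] (comp_ v j) g &
     sp_mem (Lr r d n) (wgrad v)]]
  (fun v : E -> 'rV[R]_n => ((sp_norm (Lr r 1 n) v) `^ r + (sp_norm (Lr r d n) (wgrad v)) `^ r)
              `^ r^-1)%E.

Definition W01r (r : R) n : seminormed_space R (E -> 'rV[R]_n) :=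
  SeminormedSpace
  [set v | sp_mem (W1r r n) v /\ exists f : nat -> E -> 'rV[R]_n,
     (forall k, test_fun D (f k)) /\ scvg (W1r r n) f v]
  (sp_norm (W1r r n)).

Definition Wdiv (p : R) : seminormed_space R (E -> 'rV[R]_d) :=
  SeminormedSpace
  [set v | sp_mem (W01r p d) v /\ {ae @leb R d, forall x, D x -> wdiv v x = 0}]
  (sp_norm (W01r p d)).

Definition C1_closure (f : E -> R) := {within closure D, continuous f} /\
  forall i, exists g : E -> R, {within closure D, continuous g} /\
    forall x, D x -> derivable f x (e_ i) /\ 'D_(e_ i) f x = g x.

Definition Usol (r : R) : seminormed_space R (E -> 'rV[R]_d) :=
  SeminormedSpace
  [set w | sp_mem (Lr r 1 d) w /\ forall f, C1_closure f ->
     \int[@leb R d]_(x in D) dot (w x) (grad f x) = 0]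
  (sp_norm (Lr r 1 d)).

Definition Hm (m n : nat) (v : E -> 'rV[R]_n) := sp_mem (Lr 2 1 n) v /\
  forall j s, (size s <= m)%N ->
    exists2 g, sp_mem (Lrs 2) g & weak_deriv s (comp_ v j) g.

(* Surface measure on the boundary (up to a constant factor) *)
Notation surf := (hausdorff d.-1 : set (caratheodory_type (@hausdorff R d d.-1)) -> \bar R).

(* g is the boundary trace of the H^1 function f *)
Definition is_trace (f g : E -> R) :=
  measurable_fun (bdry D : set (caratheodory_type (@hausdorff R d d.-1)))
    (g : caratheodory_type (@hausdorff R d d.-1) -> R) /\
  exists h : nat -> E -> R,
    [/\ forall k, smooth (h k), scvg (Lrs 2) h f,
        forall i, scvg (Lrs 2) (fun k => 'D_(e_ i) (h k)) (wpart i f) &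
        (\int[surf]_(x in bdry D) ((h k x - g x) ^+ 2)%:E)%E @[k --> \oo]
          --> (0 : \bar R)].

Definition zero_trace (f : E -> R) := is_trace f (fun=> 0).

Definition zero_normal_deriv (f : E -> R) := exists g : 'I_d -> E -> R,
  (forall i, is_trace (wpart i f) (g i)) /\
  {ae surf, forall x, bdry D x -> forall n : E, outer_normal D x n ->
     \sum_i n ord0 i * g i x = 0}.

(* The index sets are S = {s < uphalf m} and L = {l < m./2} *)
Definition Htilde (m : nat) (u : E -> 'rV[R]_d) :=
  [/\ Hm m u, {ae @leb R d, forall x, D x -> wdiv u x = 0},
      forall s, (s < uphalf m)%N -> forall j,
        zero_trace (comp_ (iter s (@wlap d) u) j) &
      forall l, (l < m./2)%N -> forall j,
        zero_normal_deriv (comp_ (iter l (@wlap d) u) j)].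

Definition Bform (m : nat) (u v : E -> 'rV[R]_d) : R :=
  let Du := iter m./2 (@wlap d) u in let Dv := iter m./2 (@wlap d) v in
  if odd m then \int[@leb R d]_(x in D) dot (wgrad Du x) (wgrad Dv x)
  else \int[@leb R d]_(x in D) dot (Du x) (Dv x).

(* u = S f *)
Definition solution_op (m : nat) (f u : E -> 'rV[R]_d) := Htilde m u /\
  forall v, Htilde m v -> Bform m u v = \int[@leb R d]_(x in D) dot (f x) (v x).

Definition eigenfunction (m : nat) (f : E -> 'rV[R]_d) :=
  [/\ sp_mem (Usol 2) f, sp_norm (Usol 2) f != 0%E &
      exists lam : R, solution_op m f (lam *: f)].

Definition eigenbasis (m : nat) (phi : nat -> E -> 'rV[R]_d) :=
  [/\ forall n, eigenfunction m (phi n),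
      forall n k, n <> k ->
        \int[@leb R d]_(x in D) dot (phi n x) (phi k x) = 0 &
      forall f, sp_mem (Usol 2) f -> forall e : R, 0 < e ->
        exists N (a : nat -> R),
          (sp_norm (Usol 2) (f - \sum_(n < N) a n *: phi n)%R < e%:E)%E].

Section galerkin.
Variables (p nu : R) (phi : nat -> E -> 'rV[R]_d).

Definition galerkin_fun (N : nat) (c : nat -> R -> R) (t : R) : E -> 'rV[R]_d :=
  \sum_(n < N) c n t *: phi n.

(* v_p for a function v of t and x *)
Definition vpow (v : R -> E -> 'rV[R]_d) : R -> E -> 'rV[R]_d :=
  fun t x => pw p (v t x).

Definition C1_halfline (c : R -> R) := {within `[0, +oo[, continuous c} /\
  exists c' : R -> R, {within `[0, +oo[, continuous c'} /\
    forall t : R, 0 < t -> is_derive t 1 c (c' t).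

(* (a . grad b)_k = sum_j a_j d_j b_k is the row vector a *m grad b *)
Definition galerkin_solution (c0 : nat -> R) (N : nat) (c : nat -> R -> R) :=
  (forall n, (n < N)%N -> C1_halfline (c n) /\ c n 0 = c0 n) /\
  let v := galerkin_fun N c in
  forall t : R, 0 < t -> forall a : nat -> R,
    let w := \sum_(n < N) a n *: phi n in
    is_derive t 1 (fun s => \int[@leb R d]_(x in D) dot (w x) (vpow v s x))
      (- (\int[@leb R d]_(x in D) dot (w x) (v t x *m wgrad (vpow v t) x))
       - nu * (\int[@leb R d]_(x in D)
                 dot (wgrad w x) (pw p (sym_grad (v t) x)))).

End galerkin.

Definition pairing (T : R) (w u : R -> E -> 'rV[R]_d) : R :=
  \int[@lebesgue_measure R]_(t in `]0, T[)
    \int[@leb R d]_(x in D) dot (u t x) (w t x).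

Definition Vsp (p T : R) : seminormed_space R (R -> E -> 'rV[R]_d) :=
  bochner p%:E T (Wdiv p).

Definition Vdual (p T : R) := dual (Vsp p T).

(* Q_N^* F, where Q_N acts pointwise in time *)
Definition proj_adj (p : R) (phi : nat -> E -> 'rV[R]_d) (N : nat)
    (F : (R -> E -> 'rV[R]_d) -> R) : (R -> E -> 'rV[R]_d) -> R :=
  fun psi => F (fun t => proj_span (Wdiv p) phi N (psi t)).

(* C_c^oo(D x [0, T)): restrictions to t >= 0 of test functions on
   D x (-oo, T) *)
Definition weak_time_derivative (p T : R) (v0 : E -> 'rV[R]_d)
    (v : R -> E -> 'rV[R]_d) (F : (R -> E -> 'rV[R]_d) -> R) :=
  sp_mem (Vdual p T) F /\
  forall psi : R * E -> 'rV[R]_d,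
    test_fun [set z | D z.2 /\ z.1 < T] psi ->
    (forall t x, 0 <= t -> \sum_i 'D_(0, e_ i) psi (t, x) ord0 i = 0) ->
    F (fun t x => psi (t, x)) =
      - (\int[@lebesgue_measure R]_(t in `]0, T[)
           \int[@leb R d]_(x in D) dot ('D_(1, 0) psi (t, x)) (vpow p v t x))
      - (\int[@leb R d]_(x in D) dot (psi (0, x)) (pw p (v0 x))).

(* v is a limit of the Galerkin approximations along the subsequence N, with
   weak limit chi and dtvp the weak time derivative of v_p *)
Record galerkin_limit (p q T : R) (phi : nat -> E -> 'rV[R]_d)
    (v0 : E -> 'rV[R]_d) (c : nat -> nat -> R -> R) (N : nat -> nat)
    (v : R -> E -> 'rV[R]_d) (chi : R -> E -> 'M[R]_d)
    (dtvp : (R -> E -> 'rV[R]_d) -> R) : Prop := {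
  limit_Linfty : sp_mem (bochner +oo%E T (Usol p)) v ;
  limit_V : sp_mem (Vsp p T) v ;
  limit_chi : sp_mem (bochner q%:E T (Lr q d d)) chi ;
  limit_chi_sym : {ae @lebesgue_measure R, forall t, t \in `]0, T[ ->
    {ae @leb R d, forall x, D x -> (chi t x)^T = chi t x}} ;
  limit_strong : scvg (bochner p%:E T (Lr p 1 d))
    (fun k => galerkin_fun phi (N k) (c (N k))) v ;
  limit_strong_vp : scvg (bochner q%:E T (Lr q 1 d))
    (fun k => vpow p (galerkin_fun phi (N k) (c (N k)))) (vpow p v) ;
  limit_weak_grad : wcvg (bochner p%:E T (Lr p d d))
    (fun k t => wgrad (galerkin_fun phi (N k) (c (N k)) t))
    (fun t => wgrad (v t)) ;
  limit_weak_D : wcvg (bochner q%:E T (Lr q d d))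
    (fun k t x => pw p (sym_grad (galerkin_fun phi (N k) (c (N k)) t) x)) chi ;
  limit_dt : weak_time_derivative p T v0 v dtvp ;
  limit_weak_dt : wcvg (Vdual p T)
    (fun k => proj_adj p phi (N k) (pairing T (fun t x =>
       derive1 (fun s => vpow p (galerkin_fun phi (N k) (c (N k))) s x) t)))
    dtvp }.

(* D_h^+ g 1_[0, T - h] and D_h^- g 1_[h, T] *)
Definition diff_fwd (T h : R) (g : R -> E -> 'rV[R]_d) : R -> E -> 'rV[R]_d :=
  fun t => \1_(`[0, T - h]%classic) t *: (h^-1 *: (g (t + h) - g t)).

Definition diff_bwd (T h : R) (g : R -> E -> 'rV[R]_d) : R -> E -> 'rV[R]_d :=
  fun t => \1_(`[h, T]%classic) t *: (h^-1 *: (g t - g (t - h))).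

(* Every sequence h_n -> 0+ has a subsequence along which F h converges weakly *)
Definition weak_subseq_limit
    (X : seminormed_space R ((R -> E -> 'rV[R]_d) -> R)) (T : R)
    (F : R -> (R -> E -> 'rV[R]_d) -> R)
    (l : (R -> E -> 'rV[R]_d) -> R) :=
  forall h : nat -> R, (forall n, 0 < h n < T) -> h n @[n --> \oo] --> 0 ->
    exists2 s : nat -> nat, (forall k, s k < s k.+1)%N &
      wcvg X (fun k => F (h (s k))) l.

End sobolev.

(* Main.v *)
Require Import Defs.
From HB Require Import structures.
From mathcomp Require Import all_boot all_order all_algebra.
From mathcomp Require Import all_classical all_reals all_analysis.
From mathcomp Require Import measurable_realfun ring lra.
Set Implicit Arguments.
Unset Strict Implicit.
Unset Printing Implicit Defensive.
Import Order.TTheory GRing.Theory Num.Theory numFieldNormedType.Exports.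
Local Open Scope classical_set_scope.
Local Open Scope ring_scope.

(** Write F for the weak time derivative of v_p = |v|^(p-2) v.  Testing the
    Galerkin equations with phi_n 1_]0,t] and passing to the limit gives, for
    almost every t and every w in W,
      (K)   int_D w . v_p(t) = int_D w . |v_0|^(p-2) v_0 + F(1_]0,t] w).
    By (K), the pairing of psi with D_h^+ v_p 1_[0,T-h] is the average
    (1/h) int_0^(T-h) F(1_]t,t+h] psi(t)) dt.  Splitting [0,T-h] into the
    translates of a grid of step h bounds it by the norm of F times that of
    psi, and it tends to F(psi) for step functions psi, hence for all psi; for
    D_h^- one gets the same average of psi(. + h).  These functionals have norm
    at most |F| and the norm of V is uniformly smooth, so their pointwise
    convergence to F is convergence in the norm of V'.
    Let H(t) = |v(t)|_p^p / q.  Young's inequality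
    int_D w . |u|^(p-2) u <= |w|_p^p / p + |u|_p^p / q and (K) bound the mean
    over ]0,a] of the difference quotient of H from below by the average above
    at psi = 1_]0,a] v and from above by that at 1_]0,a] v(. + h).  Letting
    h tend to 0 gives H(a) = H(0) + F(1_]0,a] v) for almost every a by
    Lebesgue's differentiation theorem; that the means of H over ]0,h] tend to
    |v_0|_p^p / q follows by testing (K) with v and with the partial sums of
    the expansion of v_0.  The right-hand side is continuous in a. *)

(** * Pointwise inequalities for the map a |-> |a|^(p-2) a *)

(** Weak convergence in V' is tested against the whole bidual, whereas pointwise convergence on V
    only controls evaluations at elements of V. Convergence in norm settles every functional at
    once, but the smoothness argument behind it tolerates no loss of constant: the approximating
    functionals must have norm at most |F|, not a multiple of it. This dictates the grid bound. For
    a fixed offset t the intervals ]t + ih, t + (i+1)h] are disjoint, so by linearity the values of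
    F merge into one value at a single step function, and integrating Young's inequality over the
    offsets in ]0, h] returns exactly |F|. F is a functional on V and not a function of time, so its
    pairing with v has no pointwise meaning and no chain rule applies. Young's inequality replaces
    the chain rule because it is an equality for w = u: the vectors v(t) and v(t + h), inserted in
    (K) at both times, bound the same increment of H from opposite sides. The two bounds share their
    limit because translations are continuous in V. *)

Section frobenius_theory.
Context {R : realType} {m n : nat}.
Implicit Types (a b c : 'M[R]_(m, n)) (r p q : R).

Lemma dotC a b : dot a b = dot b a.
Proof. by apply: eq_bigr => i _; apply: eq_bigr => j _; rewrite mulrC. Qed.

Lemma dotDl a b c : dot (a + b) c = dot a c + dot b c.
Proof.
rewrite -big_split; apply: eq_bigr => i _ /=.
by rewrite -big_split; apply: eq_bigr => j _ /=; rewrite mxE mulrDl.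
Qed.

Lemma dotZl r a b : dot (r *: a) b = r * dot a b.
Proof.
rewrite mulr_sumr; apply: eq_bigr => i _; rewrite mulr_sumr.
by apply: eq_bigr => j _; rewrite mxE mulrA.
Qed.

Lemma dotDr a b c : dot c (a + b) = dot c a + dot c b.
Proof. by rewrite dotC dotDl !(dotC c). Qed.

Lemma dotZr r a b : dot b (r *: a) = r * dot b a.
Proof. by rewrite dotC dotZl dotC. Qed.

Lemma dotNl a b : dot (- a) b = - dot a b.
Proof. by rewrite -scaleN1r dotZl mulN1r. Qed.

Lemma dotNr a b : dot b (- a) = - dot b a.
Proof. by rewrite dotC dotNl dotC. Qed.

Lemma dot0l a : dot 0 a = 0.
Proof. by rewrite -(scale0r 0) dotZl mul0r. Qed.

Lemma dot0r a : dot a 0 = 0.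
Proof. by rewrite dotC dot0l. Qed.

Lemma dot_ge0 a : 0 <= dot a a.
Proof. by apply: sumr_ge0 => i _; apply: sumr_ge0 => j _; rewrite -expr2 sqr_ge0. Qed.

Lemma frob_ge0 a : 0 <= frob a. Proof. exact: sqrtr_ge0. Qed.

Lemma sqr_frob a : frob a ^+ 2 = dot a a.
Proof. by rewrite sqr_sqrtr// dot_ge0. Qed.

Lemma normr_entry_le_frob a i j : `|a i j| <= frob a.
Proof.
rewrite -sqrtr_sqr; apply: ler_wsqrtr.
rewrite /dot (bigD1 i)//= (bigD1 j)//= -expr2 -addrA lerDl.
apply: addr_ge0; first by apply: sumr_ge0 => k _; rewrite -expr2 sqr_ge0.
by apply: sumr_ge0 => k _; apply: sumr_ge0 => l _; rewrite -expr2 sqr_ge0.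
Qed.

Lemma frob_eq0 a : (frob a == 0) = (a == 0).
Proof.
apply/idP/eqP => [/eqP a0|->]; last by rewrite /frob dot0l sqrtr0.
apply/matrixP => i j; rewrite mxE; apply/eqP.
by rewrite -normr_le0 -a0 normr_entry_le_frob.
Qed.

Lemma frob0 : frob (0 : 'M[R]_(m, n)) = 0.
Proof. by apply/eqP; rewrite frob_eq0. Qed.

Lemma frobZ r a : frob (r *: a) = `|r| * frob a.
Proof. by rewrite /frob dotZl dotZr mulrA -expr2 sqrtrM ?sqr_ge0// sqrtr_sqr. Qed.

Lemma frobN a : frob (- a) = frob a.
Proof. by rewrite -scaleN1r frobZ normrN1 mul1r. Qed.

Lemma frobB a b : frob (a - b) = frob (b - a).
Proof. by rewrite -opprB frobN. Qed.

Lemma dot_le_frob a b : dot a b <= frob a * frob b.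
Proof.
have [a0|a0] := eqVneq (frob a) 0.
  by move/eqP: (a0); rewrite frob_eq0 => /eqP ->; rewrite dot0l frob0 mul0r.
have [b0|b0] := eqVneq (frob b) 0.
  by move/eqP: (b0); rewrite frob_eq0 => /eqP ->; rewrite dot0r frob0 mulr0.
(* The square of |b| a - |a| b is 2 |a| |b| (|a| |b| - a . b). *)
have := dot_ge0 ((frob b) *: a - (frob a) *: b).
rewrite dotDl !dotDr !(dotNl, dotNr) !(dotZl, dotZr) -!sqr_frob (dotC b a).
have a1 : 0 < frob a by rewrite lt_neqAle eq_sym a0 frob_ge0.
have b1 : 0 < frob b by rewrite lt_neqAle eq_sym b0 frob_ge0.
move=> h; rewrite -subr_ge0.
have : 0 <= (2 * frob a * frob b) * (frob a * frob b - dot a b) by nra.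
by rewrite pmulr_rge0// mulr_gt0// mulr_gt0.
Qed.

Lemma normr_dot_le_frob a b : `|dot a b| <= frob a * frob b.
Proof. by rewrite ler_norml dot_le_frob andbT lerNl -dotNl -[frob a]frobN dot_le_frob. Qed.

Lemma frobD a b : frob (a + b) <= frob a + frob b.
Proof.
rewrite -(@ler_pXn2r _ 2)// ?nnegrE ?frob_ge0 ?addr_ge0 ?frob_ge0//.
rewrite sqr_frob dotDl !dotDr (dotC b a) -!sqr_frob.
have := dot_le_frob a b; nra.
Qed.

Lemma ler_dist_frob a b : `|frob a - frob b| <= frob (a - b).
Proof.
have h c1 c2 : frob c1 - frob c2 <= frob (c1 - c2).
  by rewrite lerBlDr (le_trans _ (frobD _ _))// subrK.
by rewrite ler_norml h andbT lerNl opprB frobB h.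
Qed.

Lemma frob_sum (I : Type) (s : seq I) (F : I -> 'M[R]_(m, n)) :
  frob (\sum_(i <- s) F i) <= \sum_(i <- s) frob (F i).
Proof.
elim/big_rec2 : _ => [|i x y _ h]; first by rewrite frob0.
by rewrite (le_trans (frobD _ _))// lerD2l.
Qed.

Lemma frob_le_entries a : frob a <= \sum_i \sum_j `|a i j|.
Proof.
have s0 : 0 <= \sum_i \sum_j `|a i j|.
  by apply: sumr_ge0 => i _; apply: sumr_ge0.
rewrite -(@ler_pXn2r _ 2)// ?nnegrE ?frob_ge0//.
have le i j : `|a i j| <= \sum_i \sum_j `|a i j|.
  rewrite (bigD1 i)//= (bigD1 j)//= -addrA lerDl addr_ge0//.
    by apply: sumr_ge0 => k _.
  by apply: sumr_ge0 => k _; apply: sumr_ge0.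
rewrite sqr_frob expr2 mulr_suml; apply: ler_sum => i _.
rewrite mulr_suml; apply: ler_sum => j _.
apply: (le_trans (ler_norm _)); rewrite normrM ler_wpM2l//.
Qed.

Section exponent.
Variables (p q : R).
Hypotheses (p2 : 2 <= p) (pq : p^-1 + q^-1 = 1).

Let p_gt0 : 0 < p. Proof. have := p2; lra. Qed.
Let pV : 0 < p^-1 <= 2^-1.
Proof. by rewrite invr_gt0 p_gt0 /= lef_pV2 ?posrE. Qed.
Let q_gt0 : 0 < q. Proof. by rewrite -invr_gt0; have := pV; have := pq; lra. Qed.

Lemma mul_frob_powR a : frob a * frob a `^ (p - 1) = frob a `^ p.
Proof. by rewrite mulr_powRB1// frob_ge0. Qed.

Lemma mul_frob_powR2 a : frob a * frob a `^ (p - 2) = frob a `^ (p - 1).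
Proof.
have -> : p - 2 = (p - 1) - 1 by lra.
by rewrite mulr_powRB1 ?frob_ge0//; have := p2; lra.
Qed.

Lemma frob_pw a : frob (pw p a) = frob a `^ (p - 1).
Proof. by rewrite frobZ ger0_norm ?powR_ge0// mulrC mul_frob_powR2. Qed.

Lemma dot_pw a : dot a (pw p a) = frob a `^ p.
Proof. by rewrite dotZr -sqr_frob expr2 mulrCA [X in _ * X]mulrC mul_frob_powR2 mul_frob_powR. Qed.

Lemma conjugate_mulB1 : (p - 1) * q = p.
Proof.
have P2 := p2; have PQ := pq.
have qE : q^-1 = 1 - p^-1 by lra.
have -> : q = (1 - p^-1)^-1 by rewrite -qE invrK.
have p0 : p != 0 by rewrite gt_eqF.
have p1 : p - 1 != 0 by rewrite gt_eqF//; lra.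
by field; rewrite p0 p1.
Qed.

Lemma frob_pw_powR a : frob (pw p a) `^ q = frob a `^ p.
Proof. by rewrite frob_pw -powRrM conjugate_mulB1. Qed.

Lemma young_powR (x y : R) : 0 <= x -> 0 <= y ->
  x * y `^ (p - 1) <= p^-1 * x `^ p + q^-1 * y `^ p.
Proof.
move=> x0 y0; apply: le_trans (conjugate_powR x0 (powR_ge0 _ _) p_gt0 q_gt0 pq) _.
by rewrite -powRrM conjugate_mulB1 mulrC [y `^ p * _]mulrC.
Qed.

Lemma young_dot a b : dot a (pw p b) <= p^-1 * frob a `^ p + q^-1 * frob b `^ p.
Proof.
by rewrite (le_trans (dot_le_frob _ _))// frob_pw young_powR ?frob_ge0.
Qed.

(** The function |.|^p lies above its tangent plane at c, its gradient there being p times [pw p c].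
    This is [young_dot] multiplied by p, since p / q = p - 1. *)
Lemma frob_powR_convex a c :
  frob c `^ p + p * dot (pw p c) (a - c) <= frob a `^ p.
Proof.
have P2 := p2; have PQ := pq.
have := young_dot a c; rewrite dotDr dotNr dotC [dot (pw p c) c]dotC dot_pw => h.
have h2 := ler_wpM2l (ltW p_gt0) h.
have qE : q^-1 = 1 - p^-1 by lra.
rewrite qE mulrDr !mulrA divff ?gt_eqF// mulrBr divff ?gt_eqF// in h2.
lra.
Qed.

(* With s = |b|/|a|, this is the weighted Young (or Bernoulli) inequality
   s <= s^(p-1)/(p-1) + (p-2)/(p-1). *)
Lemma bernoulli_powR (x y : R) : 0 <= y -> 0 <= x ->
  x `^ (p - 2) * y - y `^ (p - 1) <= (p - 2) * (x `^ (p - 2) * (x - y)).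
Proof.
have P2 := p2.
move=> y0 x0; have [->|p3] := eqVneq p 2.
  by rewrite subrr !powRr0 mul0r mul1r [2 - 1](_ : _ = 1) ?powRr1//; lra.
have p4 : 2 < p by rewrite lt_neqAle eq_sym p3 p2.
pose s := p - 1; have s0 : 0 < s by rewrite /s; lra.
pose t := (1 - s^-1)^-1.
have s1 : s^-1 < 1 by rewrite invf_lt1// /s; lra.
have t0 : 0 < t by rewrite invr_gt0 subr_gt0.
have st : s^-1 + t^-1 = 1 by rewrite /t invrK; lra.
have := conjugate_powR y0 (powR_ge0 x (p - 2)) s0 t0 st.
rewrite -powRrM.
have -> : (p - 2) * t = p - 1.
  have sN : s - 1 != 0 by rewrite gt_eqF// /s; lra.
  rewrite /t (_ : p - 2 = s - 1); last by rewrite /s; lra.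
  by rewrite -/s; field; rewrite sN gt_eqF.
have -> : t^-1 = 1 - s^-1 by lra.
rewrite -/s => h.
have h2 := ler_wpM2l (ltW s0) h.
have e : s * (y `^ s / s + x `^ s * (1 - s^-1)) = y `^ s + (s - 1) * x `^ s.
  by field; rewrite gt_eqF.
rewrite e in h2.
have : x * x `^ (p - 2) = x `^ s.
  have -> : p - 2 = s - 1 by rewrite /s; lra.
  by rewrite mulr_powRB1.
rewrite (_ : p - 2 = s - 1) in h2 *; last by rewrite /s; lra.
move=> e2; rewrite -e2 in h2; nra.
Qed.

(** For |b| <= |a| the difference is |a|^(p-2) (a - b) plus the change of the scalar factor applied
    to b. The size of the second term is the left side of [bernoulli_powR], which bounds it by (p -
    2) |a|^(p-2) (|a| - |b|). *)
Lemma pw_lip a b M : frob a <= M -> frob b <= M ->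
  frob (pw p a - pw p b) <= (p - 1) * (M `^ (p - 2) * frob (a - b)).
Proof.
have P2 := p2.
wlog ab : a b / frob b <= frob a => [wl aM bM|aM bM].
  have [ab|/ltW ab] := leP (frob b) (frob a); first exact: wl.
  by rewrite frobB (frobB a) wl.
have -> : pw p a - pw p b =
    frob a `^ (p - 2) *: (a - b) + (frob a `^ (p - 2) - frob b `^ (p - 2)) *: b.
  by rewrite /pw scalerBr scalerBl addrA subrK.
apply: le_trans (frobD _ _) _; rewrite !frobZ ger0_norm ?powR_ge0//.
have h0 : frob b `^ (p - 2) <= frob a `^ (p - 2).
  by rewrite ge0_ler_powR ?nnegrE ?frob_ge0//; lra.
rewrite ger0_norm ?subr_ge0//.
have aM2 : frob a `^ (p - 2) <= M `^ (p - 2).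
  by rewrite ge0_ler_powR ?nnegrE ?frob_ge0//; [lra | exact: le_trans (frob_ge0 a) aM].
have := bernoulli_powR (frob_ge0 b) (frob_ge0 a).
rewrite -[in X in X -> _]mul_frob_powR2 => h.
have d1 : frob a - frob b <= frob (a - b) by rewrite (le_trans (ler_norm _))// ler_dist_frob.
have d0 := frob_ge0 (a - b).
have pa := powR_ge0 (frob a) (p - 2).
have h1 : (p - 2) * (frob a `^ (p - 2) * (frob a - frob b)) <=
          (p - 2) * (M `^ (p - 2) * frob (a - b)).
  apply: ler_wpM2l; first by lra.
  by apply: ler_pM => //; rewrite subr_ge0.
have h2 : frob a `^ (p - 2) * frob (a - b) <= M `^ (p - 2) * frob (a - b).
  exact: ler_wpM2r.
lra.
Qed.

(** Young's inequality for x / e and y, multiplied by e; the coefficients 1/p and 1/q are bounded by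
    1. *)
Lemma young_eps (e : R) : 0 < e -> exists2 C : R, 0 <= C &
  forall x y : R, 0 <= x -> 0 <= y -> x * y `^ (p - 1) <= C * x `^ p + e * y `^ p.
Proof.
have PV := pV; have P2 := p2; have PQ := pq.
move=> e0; exists (e * e^-1 `^ p); first by rewrite mulr_ge0 ?powR_ge0// ltW.
move=> x y x0 y0.
have eV : 0 <= e^-1 by rewrite invr_ge0 ltW.
have := young_powR (mulr_ge0 eV x0) y0; rewrite powRM//.
have /andP[_ _] := PV.
have X0 := powR_ge0 x p; have Y0 := powR_ge0 y p; have E0 := powR_ge0 e^-1 p.
move=> h; have h1 : e^-1 * x * y `^ (p - 1) <= e^-1 `^ p * x `^ p + y `^ p.
  apply: (le_trans h); have := mulr_ge0 E0 X0; nra.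
have h2 := ler_wpM2l (ltW e0) h1.
by rewrite !mulrA divff ?gt_eqF// mul1r mulrDr mulrA in h2.
Qed.

Lemma powRD_le (x y : R) : 0 <= x -> 0 <= y ->
  (x + y) `^ p <= 2 `^ p * (x `^ p + y `^ p).
Proof.
have P2 := p2; move=> x0 y0.
wlog xy : x y x0 y0 / x <= y => [wl|].
  have [|/ltW] := leP x y; first exact: wl.
  by move=> yx; rewrite addrC [X in _ * X]addrC wl.
apply: (@le_trans _ _ ((2 * y) `^ p)).
  by rewrite ge0_ler_powR ?nnegrE; lra.
by rewrite powRM// ler_wpM2l ?powR_ge0// lerDr powR_ge0.
Qed.

(** Convexity gives |a + b|^p <= |a|^p + p [pw p (a + b)] . b, and a small multiple of |a + b|^p
    taken from the last term is absorbed on the left. A factor as close to 1 as desired is what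
    later makes [psn] continuous. *)
Lemma frob_powR_quasi (e : R) : 0 < e -> exists2 C : R, 0 <= C &
  forall a b, frob (a + b) `^ p <= (1 + e) * frob a `^ p + C * frob b `^ p.
Proof.
have P2 := p2; move=> e0.
(* This weight leaves the share e / (1 + e) of |a + b|^p on the right; absorbing it multiplies the
   rest by 1 + e. *)
have d0 : 0 < p^-1 * (e / (1 + e)) by rewrite mulr_gt0 ?invr_gt0// divr_gt0//; lra.
have [C C0 hC] := young_eps d0.
exists ((1 + e) * (p * C)); first by rewrite !mulr_ge0//; lra.
move=> a b.
have := frob_powR_convex a (a + b).
rewrite opprD addrA subrr add0r dotNr mulrN.
have := hC (frob b) (frob (a + b)) (frob_ge0 _) (frob_ge0 _).
have := dot_le_frob (pw p (a + b)) b; rewrite frob_pw mulrC.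
set Z := frob (a + b) `^ p; set D := dot _ _; set Y := _ `^ (p - 1).
set A := frob a `^ p; set B := frob b `^ p => h1 h2 h3.
have h4 : p * D <= p * (C * B) + e / (1 + e) * Z.
  apply: (@le_trans _ _ (p * (C * B + p^-1 * (e / (1 + e)) * Z))).
    by rewrite ler_pM2l//; exact: le_trans h2.
  by rewrite mulrDr !mulrA divff ?gt_eqF// mul1r.
have h5 : Z <= A + p * (C * B) + e / (1 + e) * Z by lra.
have h6 := ler_wpM2l (ltW (addr_gt0 ltr01 e0)) h5.
have e1 : 1 + e != 0 by rewrite gt_eqF//; lra.
have h7 : (1 + e) * (A + p * (C * B) + e / (1 + e) * Z) =
    (1 + e) * A + (1 + e) * (p * C) * B + e * Z by field.
rewrite h7 in h6; lra.
Qed.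

(** Adding the convexity inequalities at a + e b and a - e b leaves p e times the pairing of b with
    the difference of [pw] at these points. The Lipschitz bound contributes a second factor e, hence
    a quadratic modulus of smoothness. *)
Lemma frob_powR_smooth : exists2 C : R, 0 <= C &
  forall a b (e : R), 0 <= e <= 1 ->
  frob (a + e *: b) `^ p + frob (a - e *: b) `^ p <=
  2 * frob a `^ p + C * e ^+ 2 * (frob a `^ p + frob b `^ p).
Proof.
have P2 := p2; have p1 : 0 <= p - 1 by lra.
have p0 := ltW p_gt0.
exists (2 * p * (p - 1) * 2 `^ p).
  by rewrite !mulr_ge0 ?powR_ge0.
move=> a b e /andP[e0 e1].
have h1 := frob_powR_convex a (a + e *: b).
have h2 := frob_powR_convex a (a - e *: b).
rewrite opprD addrA subrr add0r dotNr dotZr in h1.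
rewrite opprB addrCA subrr addr0 dotZr in h2.
set M := frob a + frob b.
have hb1 : frob (a + e *: b) <= M.
  by rewrite (le_trans (frobD _ _))// lerD2l frobZ ger0_norm// ler_piMl// frob_ge0.
have hb2 : frob (a - e *: b) <= M.
  by rewrite (le_trans (frobD _ _))// lerD2l frobN frobZ ger0_norm// ler_piMl// frob_ge0.
have h3 := pw_lip hb1 hb2.
have E : a + e *: b - (a - e *: b) = (2 * e) *: b.
  by apply/matrixP => i j; rewrite !mxE; ring.
rewrite E frobZ ger0_norm in h3; last by rewrite mulr_ge0//; lra.
have h4 := dot_le_frob (pw p (a + e *: b) - pw p (a - e *: b)) b.
rewrite dotDl dotNl in h4.
have b0 := frob_ge0 b; have a0 := frob_ge0 a.
have h5 : M `^ (p - 2) * frob b * frob b <= M `^ p.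
  rewrite -mulrA; apply: (@le_trans _ _ (M `^ (p - 2) * (M * M))).
    by apply: ler_wpM2l; [exact: powR_ge0 | by apply: ler_pM => //; rewrite /M lerDr].
  rewrite -expr2 -(@powR_mulrn _ M 2); last by rewrite /M addr_ge0.
  rewrite -powRD ?subrK//; apply/implyP => h; exfalso.
  by move: h; rewrite gt_eqF// (lt_le_trans _ p2).
have h6 := le_trans h5 (powRD_le a0 b0).
have h7 : frob (pw p (a + e *: b) - pw p (a - e *: b)) * frob b <=
    2 * (p - 1) * e * (2 `^ p * (frob a `^ p + frob b `^ p)).
  apply: (le_trans (ler_wpM2r b0 h3)).
  have -> : (p - 1) * (M `^ (p - 2) * (2 * e * frob b)) * frob b =
    2 * (p - 1) * e * (M `^ (p - 2) * frob b * frob b) by ring.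
  by apply: ler_wpM2l => //; rewrite !mulr_ge0.
have pe : 0 <= p * e by rewrite mulr_ge0// (le_trans _ P2).
have h8 := ler_wpM2l pe (le_trans h4 h7).
move: h1 h2 h8; clear; set u := frob (a + _) `^ _; set w := frob (a - _) `^ _.
set A := frob a `^ p; set B := frob b `^ p; set x := dot _ _; set y := dot _ _.
set k := 2 `^ p; lra.
Qed.

(** Let S = |w| + |a| + |b|. If |a - b| <= d S, the Lipschitz bound is a small multiple of S^p;
    otherwise S < |a - b| / d and everything is a multiple of |a - b|^p. *)
Lemma dot_pw_lip_eps (e : R) : 0 < e -> exists2 C : R, 0 <= C &
  forall w a b, `|dot w (pw p a - pw p b)| <=
    e * (frob w `^ p + (frob a `^ p + frob b `^ p)) + C * frob (a - b) `^ p.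
Proof.
have P2 := p2; move=> e0.
(* [K] collects the Lipschitz constant p - 1 and the two factors 2^p lost in splitting the p-th
   power of the sum S. *)
pose K := (p - 1) * (2 `^ p * 2 `^ p).
have K0 : 0 < K by rewrite /K !mulr_gt0 ?powR_gt0//; lra.
pose d := e / K; have d0 : 0 < d by rewrite divr_gt0.
exists ((p - 1) * d^-1 `^ (p - 1)); first by rewrite mulr_ge0 ?powR_ge0//; lra.
move=> w a b; set S := frob w + (frob a + frob b).
have w0 := frob_ge0 w; have a0 := frob_ge0 a; have b0 := frob_ge0 b.
have S0 : 0 <= S by rewrite /S !addr_ge0.
have h1 : `|dot w (pw p a - pw p b)| <= (p - 1) * (S `^ (p - 1) * frob (a - b)).
  apply: (le_trans (normr_dot_le_frob _ _)).
  have aS : frob a <= S by rewrite /S; lra.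
  have bS : frob b <= S by rewrite /S; lra.
  have h := pw_lip aS bS.
  apply: (@le_trans _ _ (S * ((p - 1) * (S `^ (p - 2) * frob (a - b))))).
    by apply: ler_pM => //; [exact: frob_ge0 | rewrite /S; lra].
  have : S * S `^ (p - 2) = S `^ (p - 1).
    have -> : p - 2 = (p - 1) - 1 by lra.
    by rewrite mulr_powRB1//; lra.
  by move=> <-; rewrite le_eqVlt; apply/orP; left; apply/eqP; ring.
have ab0 := frob_ge0 (a - b).
have SP : S `^ p <= 2 `^ p * 2 `^ p * (frob w `^ p + (frob a `^ p + frob b `^ p)).
  apply: (le_trans (powRD_le w0 (addr_ge0 a0 b0))).
  rewrite -mulrA; apply: ler_wpM2l; first exact: powR_ge0.
  rewrite mulrDr; apply: lerD; last exact: powRD_le.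
  rewrite ler_peMl ?powR_ge0//.
  rewrite -[leLHS](powRr0 2); apply: ler_powR; first lra.
  by rewrite (le_trans _ P2).
have [h|h] := leP (frob (a - b)) (d * S).
  apply: ler_wpDr; first by rewrite !mulr_ge0 ?powR_ge0//; lra.
  apply: (le_trans h1).
  apply: (@le_trans _ _ ((p - 1) * (S `^ (p - 1) * (d * S)))).
    apply: ler_wpM2l; first lra.
    by apply: ler_wpM2l => //; exact: powR_ge0.
  have -> : (p - 1) * (S `^ (p - 1) * (d * S)) = (p - 1) * d * S `^ p.
    by rewrite -(@mulr_powRB1 _ S p)//; ring.
  apply: le_trans (ler_wpM2l _ SP) _; first by rewrite mulr_ge0//; lra.
  rewrite le_eqVlt; apply/orP; left; apply/eqP; rewrite /d /K.
  have p1 : p - 1 != 0 by rewrite gt_eqF//; lra.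
  have tp : 2 `^ p != 0 by rewrite gt_eqF// powR_gt0.
  by field; rewrite p1 tp.
apply: ler_wpDl; first by rewrite mulr_ge0 ?addr_ge0 ?powR_ge0// ltW.
apply: (le_trans h1); rewrite -mulrA; apply: ler_wpM2l; first lra.
rewrite -(mulr_powRB1 ab0); last lra.
rewrite mulrCA [_ * frob (a - b)]mulrC; apply: ler_wpM2l => //.
rewrite -powRM ?invr_ge0 ?(ltW d0)//.
apply: ge0_ler_powR; rewrite ?nnegrE ?mulr_ge0 ?invr_ge0 ?(ltW d0)//; first lra.
by rewrite mulrC ler_pdivlMr// mulrC ltW.
Qed.

End exponent.
End frobenius_theory.

(** * Integrals and null sets *)

Section insensitive_integral.
Import HBNNSimple.
Context d {T : measurableType d} {R : realType}.
Variable mu : {measure set T -> \bar R}.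
Local Open Scope ereal_scope.

(** A simple function below f, multiplied by the indicator of the complement of M, keeps its
    integral and lies below g everywhere. Only the simple functions have to be measurable. *)
Let nnint_le (f g : T -> \bar R) (M : set T) : measurable M -> mu M = 0 ->
  (forall x, 0 <= g x) -> (forall x, ~ M x -> f x <= g x) ->
  ereal_sup [set sintegral mu h | h in [set h : {nnsfun T >-> R} |
     forall x : T, (h x)%:E <= f x]] <=
  ereal_sup [set sintegral mu h | h in [set h : {nnsfun T >-> R} |
     forall x : T, (h x)%:E <= g x]].
Proof.
move=> mM M0 g0 fg; apply: ge_ereal_sup => _ [h hf <-].
pose k := proj_nnsfun h (measurableC mM).
have kE x : k x = (h x * \1_(~` M) x)%R by [].
have -> : sintegral mu h = sintegral mu k.
  rewrite -!integralT_nnsfun [LHS](ge0_negligible_integral mM)//; last 2 first.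
  - exact/measurable_EFinP.
  - by move=> x _; rewrite lee_fin.
  rewrite [RHS](ge0_negligible_integral mM)//; last 2 first.
  - exact/measurable_EFinP.
  - by move=> x _; rewrite lee_fin.
  apply: eq_integral => x; rewrite inE => -[_ Mx].
  by rewrite kE indicE in_setC memNset//= mulr1.
apply: ereal_sup_ubound; exists k => //= x.
rewrite -[mindic _ _ _]/(\1_(~` M) x) indicE; have [Mx|Mx] := pselect (M x).
  by rewrite in_setC mem_set//= mulr0.
by rewrite in_setC memNset//= mulr1 (le_trans (hf x))// fg.
Qed.

(* No measurability is assumed: the integral of a nonmeasurable function is a
   lower integral, which does not see null sets either. *)
Lemma ae_eq_integral_gen (D : set T) (f g : T -> \bar R) :
  {ae mu, forall x, D x -> f x = g x} ->
  \int[mu]_(x in D) f x = \int[mu]_(x in D) g x.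
Proof.
move=> [M [mM M0 sM]].
have fg x : ~ M x -> (f \_ D) x = (g \_ D) x.
  move=> Mx; rewrite !patchE; case: ifPn => // /set_mem Dx.
  by apply: contrapT => h; apply: Mx; apply: sM => /= /(_ Dx).
have le (u v : T -> \bar R) : (forall x, ~ M x -> u x = v x) ->
    forall x, ~ M x -> u^\+ x <= v^\+ x.
  by move=> uv x Mx; rewrite !funeposE uv.
have le' (u v : T -> \bar R) : (forall x, ~ M x -> u x = v x) ->
    forall x, ~ M x -> u^\- x <= v^\- x.
  by move=> uv x Mx; rewrite !funenegE uv.
have gf x : ~ M x -> (g \_ D) x = (f \_ D) x by move=> /fg.
rewrite /integral/=; congr (_ - _); apply/eqP; rewrite eq_le; apply/andP; split.
- by apply: (nnint_le mM M0); [move=> x; exact: funepos_ge0 | exact: le].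
- by apply: (nnint_le mM M0); [move=> x; exact: funepos_ge0 | exact: le].
- by apply: (nnint_le mM M0); [move=> x; exact: funeneg_ge0 | exact: le'].
- by apply: (nnint_le mM M0); [move=> x; exact: funeneg_ge0 | exact: le'].
Qed.

Lemma ae_eq_Rintegral_gen (D : set T) (f g : T -> R) :
  {ae mu, forall x, D x -> f x = g x} ->
  (\int[mu]_(x in D) f x = \int[mu]_(x in D) g x)%R.
Proof.
move=> fg; congr fine; apply: ae_eq_integral_gen.
by apply: filterS fg => x h /h ->.
Qed.

End insensitive_integral.

Section ae_theory.
Context d {T : measurableType d} {R : realType}.
Variable mu : {measure set T -> \bar R}.

Lemma ae_mono (P Q : T -> Prop) : {ae mu, forall x, P x} ->
  (forall x, P x -> Q x) -> {ae mu, forall x, Q x}.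
Proof. by move=> h PQ; apply: filterS h. Qed.

Lemma ae_mono2 (P Q S : T -> Prop) : {ae mu, forall x, P x} ->
  {ae mu, forall x, Q x} -> (forall x, P x -> Q x -> S x) -> {ae mu, forall x, S x}.
Proof. by move=> h1 h2 PQ; apply: filterS2 h1 h2. Qed.

Lemma ae_forall (P : nat -> T -> Prop) : (forall n, {ae mu, forall x, P n x}) ->
  {ae mu, forall x, forall n, P n x}.
Proof.
move=> h; have : mu.-negligible (\bigcup_n (~` [set x | P n x])).
  exact: negligible_bigcup.
apply: negligibleS => x /= /existsNP[n hn]; by exists n.
Qed.

End ae_theory.

Section Rintegral_theory.
Context d {T : measurableType d} {R : realType}.
Variable mu : {measure set T -> \bar R}.
Variable D : set T.
Hypothesis mD : measurable D.

Lemma dominated_cvg_Rintegral (f_ : (T -> R)^nat) (f g : T -> R) :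
  (forall n, measurable_fun D (f_ n)) ->
  mu.-integrable D (EFin \o g) ->
  (forall n x, D x -> `|f_ n x| <= g x) ->
  (forall x, D x -> f_ ^~ x @ \oo --> f x) ->
  mu.-integrable D (EFin \o f) /\
  (fun n => \int[mu]_(x in D) f_ n x) @ \oo --> \int[mu]_(x in D) f x.
Proof.
move=> mf_ ig fg ff.
have mf : measurable_fun D f.
  by apply: (measurable_fun_cvg (h := f_)) => // x Dx; exact: ff.
have [i _ c] : [/\ mu.-integrable D (EFin \o f),
  [sequence (\int[mu]_(x in D) `|(f_ n x)%:E - (f x)%:E|)%E]_n @ \oo --> 0%E &
  [sequence (\int[mu]_(x in D) (f_ n x)%:E)%E]_n @ \oo --> (\int[mu]_(x in D) (f x)%:E)%E].
  apply: (@dominated_convergence _ _ _ mu D mD (fun n x => (f_ n x)%:E)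
    (EFin \o f) (EFin \o g)) => //.
  - by move=> n; exact/measurable_EFinP.
  - exact/measurable_EFinP.
  - by apply: aeW => x Dx; apply: cvg_EFin; [exact: nearW | exact: ff].
  - by apply: aeW => x n Dx; rewrite /= lee_fin fg.
split => //; apply: fine_cvg.
rewrite fineK; first exact: c.
exact: integrable_fin_num.
Qed.

Lemma integrable_Rbound (f g : T -> R) : measurable_fun D f ->
  mu.-integrable D (EFin \o g) -> (forall x, D x -> `|f x| <= g x) ->
  mu.-integrable D (EFin \o f).
Proof.
move=> mf ig fg; apply: le_integrable ig => //; first exact/measurable_EFinP.
by move=> x Dx; rewrite /= lee_fin (le_trans (fg _ Dx))// ler_norm.
Qed.

Lemma integrableRD (f g : T -> R) : mu.-integrable D (EFin \o f) ->
  mu.-integrable D (EFin \o g) ->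
  mu.-integrable D (EFin \o (fun x => f x + g x)).
Proof. by move=> h1 h2; rewrite (_ : _ \o _ = ((EFin \o f) \+ (EFin \o g))%E); [exact: integrableD|]. Qed.

Lemma integrableRB (f g : T -> R) : mu.-integrable D (EFin \o f) ->
  mu.-integrable D (EFin \o g) ->
  mu.-integrable D (EFin \o (fun x => f x - g x)).
Proof. by move=> h1 h2; rewrite (_ : _ \o _ = ((EFin \o f) \- (EFin \o g))%E); [exact: integrableB|]. Qed.

Lemma integrableRZ (r : R) (f : T -> R) : mu.-integrable D (EFin \o f) ->
  mu.-integrable D (EFin \o (fun x => r * f x)).
Proof. by move=> h1; rewrite (_ : _ \o _ = (fun x => r%:E * (EFin \o f) x)%E); [exact: integrableZl|]. Qed.

Lemma integrableRnorm (f : T -> R) : mu.-integrable D (EFin \o f) ->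
  mu.-integrable D (EFin \o (fun x => `|f x|)).
Proof.
move=> fi; have mf := (measurable_EFinP _ _).1 (measurable_int _ fi).
apply: le_integrable fi => //; first by apply/measurable_EFinP; exact: measurableT_comp.
by move=> x _; rewrite /= normr_id.
Qed.

Lemma integrableR0 : mu.-integrable D (EFin \o (fun=> 0 : R)).
Proof. exact: integrable0. Qed.

Lemma integrableR_sum (I : Type) (s : seq I) (f : I -> T -> R) :
  (forall i, mu.-integrable D (EFin \o f i)) ->
  mu.-integrable D (EFin \o (fun x => \sum_(i <- s) f i x)).
Proof.
move=> h; elim: s => [|i s IH].
  by under [X in EFin \o X]funext => x do rewrite big_nil; exact: integrableR0.
under [X in EFin \o X]funext => x do rewrite big_cons.
exact: integrableRD.
Qed.

Lemma Rintegral_sum (I : Type) (s : seq I) (f : I -> T -> R) :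
  (forall i, mu.-integrable D (EFin \o f i)) ->
  \int[mu]_(x in D) (\sum_(i <- s) f i x) = \sum_(i <- s) \int[mu]_(x in D) f i x.
Proof.
move=> h; elim: s => [|i s IH].
  under eq_Rintegral do rewrite big_nil.
  by rewrite big_nil Rintegral_cst// mul0r.
rewrite big_cons -IH -RintegralD//; last exact: integrableR_sum.
by apply: eq_Rintegral => x _; rewrite big_cons.
Qed.

End Rintegral_theory.

(** * Integrals under measure-preserving maps, in particular translations *)

Section measure_preserving.
Context d {T : measurableType d} {R : realType}.
Variables (mu : {measure set T -> \bar R}) (phi : T -> T).
Hypothesis mphi : measurable_fun setT phi.
Hypothesis phiP : forall A, measurable A -> mu (phi @^-1` A) = mu A.

Let g := phi.
HB.instance Definition _ := isMeasurableFun.Build _ _ T T g mphi.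

Lemma ge0_integral_preserving (f : T -> \bar R) : measurable_fun setT f ->
  (forall t, 0 <= f t)%E -> (\int[mu]_t f (phi t) = \int[mu]_t f t)%E.
Proof.
move=> mf f0.
rewrite [RHS](eq_measure_integral (pushforward mu g)); last first.
  by move=> A mA _; exact/esym/phiP.
have h := @ge0_integral_pushforward _ _ _ _ R g mphi mu setT f measurableT mf (fun y _ => f0 y).
exact: esym h.
Qed.

Lemma integrable_preserving (f : T -> R) : mu.-integrable setT (EFin \o f) ->
  mu.-integrable setT (EFin \o (fun t => f (phi t))).
Proof.
move=> /integrableP[mf fi]; apply/integrableP; split.
  exact: (measurableT_comp mf mphi).
have mf' : measurable_fun setT (abse \o (EFin \o f)) by exact: measurableT_comp.
by have := @ge0_integral_preserving _ mf' (fun t => abse_ge0 _); rewrite /= => ->.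
Qed.

Lemma Rintegral_preserving (f : T -> R) : mu.-integrable setT (EFin \o f) ->
  \int[mu]_t f (phi t) = \int[mu]_t f t.
Proof.
move=> fi.
(* Splitting into positive and negative parts reduces the claim to nonnegative functions. *)
have e (h : T -> R) : mu.-integrable setT (EFin \o h) -> \int[mu]_t h t =
    fine (\int[mu]_t (Num.max (h t) 0)%:E)%E - fine (\int[mu]_t (Num.max (- h t) 0)%:E)%E.
  move=> gi; have mg := (measurable_EFinP _ _).1 (measurable_int _ gi).
  have i1 : mu.-integrable setT (EFin \o (fun t => Num.max (h t) 0)).
    apply: le_integrable gi => //.
      by apply/measurable_EFinP; exact: measurable_maxr.
    move=> x _; rewrite /= lee_fin ger0_norm; last by rewrite le_max lexx orbT.
    by rewrite ge_max ler_norm normr_ge0.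
  have i2 : mu.-integrable setT (EFin \o (fun t => Num.max (- h t) 0)).
    apply: le_integrable gi => //.
      by apply/measurable_EFinP; apply: measurable_maxr => //; exact: measurableT_comp.
    move=> x _; rewrite /= lee_fin ger0_norm; last by rewrite le_max lexx orbT.
    by rewrite ge_max -normrN ler_norm normr_ge0.
  have := RintegralB measurableT i1 i2; rewrite /Rintegral => <-.
  congr fine; apply: eq_integral => x _; congr EFin.
  rewrite /Num.max oppr_lt0; case: ltgtP; lra.
have mf := (measurable_EFinP _ _).1 (measurable_int _ fi).
rewrite e; last exact: integrable_preserving.
rewrite e//.
rewrite (@ge0_integral_preserving (fun t => (Num.max (f t) 0)%:E)); last 2 first.
- by apply/measurable_EFinP; exact: measurable_maxr.
- by move=> t; rewrite lee_fin le_max lexx orbT.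
rewrite (@ge0_integral_preserving (fun t => (Num.max (- f t) 0)%:E))//.
- by apply/measurable_EFinP; apply: measurable_maxr => //; exact: measurableT_comp.
- by move=> t; rewrite lee_fin le_max lexx orbT.
Qed.

Lemma ae_preserving (P : T -> Prop) : {ae mu, forall t, P t} -> {ae mu, forall t, P (phi t)}.
Proof.
move=> [M [mM M0 sM]]; exists (phi @^-1` M); split.
- by rewrite -[X in measurable X]setTI; exact: mphi.
- by rewrite phiP.
- by move=> t /= ?; exact: sM.
Qed.

End measure_preserving.

Section translation.
Context {R : realType}.
Notation mu := (@lebesgue_measure R).
Notation mR := (measurableTypeR R).

Lemma measurable_addr (h : R) : measurable_fun setT (fun t : mR => t + h : mR).
Proof. exact: measurable_funD. Qed.

Section shift_measure.
Variable h : R.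
Let sh : mR -> mR := fun t => t + h.
HB.instance Definition _ := isMeasurableFun.Build _ _ mR mR sh (measurable_addr h).

Let push_unique (A : set mR) : measurable A -> mu A = pushforward mu sh A.
Proof.
apply: (lebesgue_measure_unique (mu := pushforward mu sh)) => X /ocitvP[->|[[a b] /= ab ->]].
  by rewrite !measure0.
rewrite /pushforward (_ : sh @^-1` _ = `]a - h, b - h]%classic); last first.
  by apply/seteqP; split => t /=; rewrite !in_itv/= /sh ltrBlDr lerBrDr.
by rewrite !lebesgue_measure_itv/= !lte_fin ltrD2r -!EFinB; congr (if _ then _ else _); congr EFin; ring.
Qed.

Lemma lebesgue_measure_addr (A : set mR) : measurable A -> mu ((fun t => t + h) @^-1` A) = mu A.
Proof. by move=> mA; rewrite (push_unique mA). Qed.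

Definition ge0_integral_addr := ge0_integral_preserving (measurable_addr h) lebesgue_measure_addr.
Definition integrable_addr := integrable_preserving (measurable_addr h) lebesgue_measure_addr.
Definition Rintegral_addr := Rintegral_preserving (measurable_addr h) lebesgue_measure_addr.
Definition ae_addr := ae_preserving (measurable_addr h) lebesgue_measure_addr.

End shift_measure.
End translation.

(* [psn] stands for the p-th power of a seminorm: unlike the seminorm it is
   additive under integration, so that the axioms pass to integrals. *)
Record pseminorm (R : realType) (p : R) (E : lmodType R) := Pseminorm {
  ps_mem : set E ;
  psn : E -> R ;
  psn_ge0 : forall x, 0 <= psn x ;
  ps_mem0 : ps_mem 0 ;
  ps_lin : forall a x y, ps_mem x -> ps_mem y -> ps_mem (a *: x + y) ;
  psnZ : forall a x, ps_mem x -> psn (a *: x) = `|a| `^ p * psn x ;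
  psn_quasi : forall e : R, 0 < e -> exists2 C : R, 0 <= C &
    forall x y, ps_mem x -> ps_mem y ->
      psn (x + y) <= (1 + e) * psn x + C * psn y ;
  psn_smooth : exists2 C : R, 0 <= C &
    forall x y (e : R), ps_mem x -> ps_mem y -> 0 <= e <= 1 ->
      psn (x + e *: y) + psn (x - e *: y) <=
        2 * psn x + C * e ^+ 2 * (psn x + psn y) }.

(** * Vector spaces with the p-th power of a seminorm *)

Section pseminorm_theory.
Context {R : realType} {p : R} {E : lmodType R} (X : pseminorm p E).
Hypothesis p0 : 0 < p.
Implicit Types (x y : E) (u : nat -> E).

Lemma ps_memZ (a : R) x : ps_mem X x -> ps_mem X (a *: x).
Proof. by move=> mx; rewrite -[_ *: _]addr0; apply: ps_lin => //; exact: ps_mem0. Qed.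

Lemma ps_memD x y : ps_mem X x -> ps_mem X y -> ps_mem X (x + y).
Proof. by move=> mx my; rewrite -[x]scale1r; exact: ps_lin. Qed.

Lemma ps_memN x : ps_mem X x -> ps_mem X (- x).
Proof. by move=> mx; rewrite -scaleN1r; exact: ps_memZ. Qed.

Lemma ps_memB x y : ps_mem X x -> ps_mem X y -> ps_mem X (x - y).
Proof. by move=> mx my; apply: ps_memD => //; exact: ps_memN. Qed.

Lemma ps_mem_sum (I : Type) (s : seq I) (P : pred I) (F : I -> E) :
  (forall i, P i -> ps_mem X (F i)) -> ps_mem X (\sum_(i <- s | P i) F i).
Proof. by move=> mF; elim/big_ind : _ => //; [exact: ps_mem0 | exact: ps_memD]. Qed.

Lemma psn0 : psn X 0 = 0.
Proof.
rewrite -(scale0r 0) psnZ ?normr0 ?powR0 ?mul0r//; last exact: ps_mem0.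
by rewrite gt_eqF.
Qed.

Lemma psnN x : ps_mem X x -> psn X (- x) = psn X x.
Proof. by move=> mx; rewrite -scaleN1r psnZ// normrN1 powR1 mul1r. Qed.

Lemma psnB x y : ps_mem X x -> ps_mem X y -> psn X (x - y) = psn X (y - x).
Proof. by move=> mx my; rewrite -opprB psnN//; exact: ps_memB. Qed.

Lemma psnD_le : exists2 K : R, 1 <= K & forall x y, ps_mem X x -> ps_mem X y ->
  psn X (x + y) <= K * (psn X x + psn X y).
Proof.
have [C C0 hC] := psn_quasi X ltr01.
exists (2 + C) => [|x y mx my]; first lra.
have := hC x y mx my; have := psn_ge0 X x; have := psn_ge0 X y; nra.
Qed.

Definition ps_cvg u x := psn X (u k - x) @[k --> \oo] --> 0.

(** [psn_quasi] is applied to x + (u k - x) and to u k + (x - u k). Its factor 1 + d may be taken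
    close to 1; the constant of [psnD_le] would only give boundedness. *)
Lemma ps_cvg_psn u x : (forall k, ps_mem X (u k)) -> ps_mem X x ->
  ps_cvg u x -> psn X (u k) @[k --> \oo] --> psn X x.
Proof.
move=> mu_ mx ux; apply/cvgrPdist_le => e e0.
have x0 := psn_ge0 X x.
pose d := Num.min 1 (e / (4 * (psn X x + 1))).
have d0 : 0 < d by rewrite lt_min ltr01 divr_gt0// mulr_gt0//; lra.
have d1 : d <= 1 by rewrite ge_min lexx.
have dx : d * (4 * (psn X x + 1)) <= e.
  by rewrite -ler_pdivlMr ?ge_min ?lexx ?orbT// mulr_gt0//; lra.
have [C C0 hC] := psn_quasi X d0.
have eC : 0 < e / (4 * (C + 1)) by rewrite divr_gt0// mulr_gt0//; lra.
move/cvgrPdist_le : ux => /(_ _ eC); apply: filterS => k.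
rewrite sub0r normrN ger0_norm ?psn_ge0//.
rewrite ler_pdivlMr; last by rewrite mulr_gt0//; lra.
set dk := psn X (u k - x) => h.
have dk0 : 0 <= dk by exact: psn_ge0.
have h1 := hC _ _ mx (ps_memB (mu_ k) mx).
rewrite addrC subrK -/dk in h1.
have h2 := hC _ _ (mu_ k) (ps_memB mx (mu_ k)).
rewrite addrC subrK psnB// -/dk in h2.
have y0 := psn_ge0 X (u k).
have Cd : C * dk <= e / 4 by rewrite ler_pdivlMr//; nra.
have d2 : d * psn X x <= e / 4 by rewrite ler_pdivlMr//; nra.
have d3 : d * psn X (u k) <= psn X (u k) by rewrite ler_piMl.
rewrite ler_norml; apply/andP; split; first lra.
have : d * psn X (u k) <= d * ((1 + d) * psn X x + C * dk) by rewrite ler_pM2l.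
have : d * ((1 + d) * psn X x + C * dk) <= d * (2 * psn X x) + C * dk.
  rewrite mulrDr lerD//; first by rewrite ler_pM2l// ler_wpM2r//; lra.
  by rewrite ler_piMl// mulr_ge0.
lra.
Qed.

Lemma ps_cvg_lin (a : R) u v x y : (forall k, ps_mem X (u k)) -> (forall k, ps_mem X (v k)) ->
  ps_mem X x -> ps_mem X y -> ps_cvg u x -> ps_cvg v y ->
  ps_cvg (fun k => a *: u k + v k) (a *: x + y).
Proof.
move=> mu_ mv mx my ux vy; have [K K1 hK] := psnD_le.
apply: (@squeeze_cvgr _ _ _ _ (fun=> 0)
  (fun k => K * (`|a| `^ p * psn X (u k - x) + psn X (v k - y)))).
- apply: nearW => k; rewrite psn_ge0/=.
  have -> : a *: u k + v k - (a *: x + y) = a *: (u k - x) + (v k - y).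
    by rewrite scalerBr opprD addrACA.
  apply: (le_trans (hK _ _ _ _)); rewrite ?psnZ//; [|exact: ps_memB..].
  by apply: ps_memZ; exact: ps_memB.
- exact: cvg_cst.
- rewrite -[X in _ --> X](mulr0 K) -[X in _ --> K * X](addr0 0).
  rewrite -[X in _ --> K * (X + _)](mulr0 (`|a| `^ p)).
  by apply: cvgMr; apply: cvgD => //; exact: cvgMr.
Qed.

Definition ps_space : seminormed_space R E :=
  SeminormedSpace (ps_mem X) (fun x => (psn X x `^ p^-1)%:E).

End pseminorm_theory.

(** * Simple functions of time *)

Section simple_functions.
Context {R : realType} {E : lmodType R} (Y : seminormed_space R E).
Notation mR := (measurableTypeR R).
Implicit Types s : R -> E.

Lemma simple_fun0 : simple_fun Y (fun=> 0).
Proof.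
exists 0, (fun=> set0), (fun=> 0); split; first by case.
by apply/funext => t; rewrite big_ord0.
Qed.

Lemma simple_fun_add1 s (A : set mR) x : simple_fun Y s -> measurable A -> sp_mem Y x ->
  simple_fun Y (fun t => s t + \1_A t *: x).
Proof.
move=> [n [B [y [h ->]]]] mA mx.
(* [insub] sends the first n indices back to the old family; only the last index falls through to
   the new term. *)
exists n.+1, (fun j => if @insub nat (ltn^~ n) 'I_n j is Some i then B i else A),
  (fun j => if @insub nat (ltn^~ n) 'I_n j is Some i then y i else x).
split.
  by move=> j; case: insubP => [i _ _|_]//; exact: h.
apply/funext => t; rewrite big_ord_recr/= insubN ?ltnn//; congr (_ + _).
by apply: eq_bigr => j _ /=; rewrite insubT//= => jn; congr (\1_(B _) t *: y _); exact/val_inj.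
Qed.

Lemma simple_fun_ind (P : (R -> E) -> Prop) : P (fun=> 0) ->
  (forall s (A : set mR) x, simple_fun Y s -> P s -> measurable A -> sp_mem Y x ->
     P (fun t => s t + \1_A t *: x)) ->
  forall s, simple_fun Y s -> P s.
Proof.
move=> P0 P1 s [n [A [x [h ->]]]]; elim: n A x h => [|n IH] A x h.
  by rewrite (_ : (fun _ => _) = fun=> 0)//; apply/funext => t; rewrite big_ord0.
under [X in P X]funext => t do rewrite big_ord_recr/=.
apply: P1; [|exact: IH|exact: (h _).1|exact: (h _).2].
by exists n, (fun j => A (widen_ord (leqnSn n) j)), (fun j => x (widen_ord (leqnSn n) j)).
Qed.

Lemma simple_funD s s' : simple_fun Y s -> simple_fun Y s' ->
  simple_fun Y (fun t => s t + s' t).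
Proof.
move=> hs; move: s'; apply: simple_fun_ind.
  by rewrite (_ : (fun _ => _) = s)//; apply/funext => t; rewrite addr0.
move=> s' A x _ IH mA mx.
rewrite (_ : (fun _ => _) = fun t => s t + s' t + \1_A t *: x).
  exact: simple_fun_add1.
by apply/funext => t; rewrite addrA.
Qed.

Lemma simple_fun_comp_measurable (Phi : R -> E -> R) : sp_mem Y 0 ->
  (forall x y, sp_mem Y x -> sp_mem Y y -> sp_mem Y (x + y)) ->
  (forall x, sp_mem Y x -> measurable_fun setT (Phi ^~ x : mR -> R)) ->
  forall s, simple_fun Y s -> measurable_fun setT (fun t : mR => Phi t (s t)).
Proof.
move=> m0 mD mPhi s hs.
(* The translation z makes the induction work: on A, a new term of value x merely changes z into x +
   z. *)
suff : forall z, sp_mem Y z -> measurable_fun setT (fun t : mR => Phi t (s t + z)).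
  by move=> /(_ 0 m0); under eq_fun do rewrite addr0.
move: s hs; apply: simple_fun_ind => [z mz|s A x _ IH mA mx z mz].
  by under eq_fun do rewrite add0r; exact: mPhi.
rewrite (_ : (fun _ => _) = fun t : mR => if t \in A then Phi t (s t + (x + z))
  else Phi t (s t + z)); last first.
  apply/funext => t; rewrite indicE; case: ifPn => tA /=.
    by rewrite scale1r addrA.
  by rewrite scale0r addr0.
apply: measurable_fun_ifT; last exact: IH.
- apply: (measurable_fun_bool true).
  rewrite setTI (_ : _ @^-1` _ = A)//; apply/seteqP.
  by split => [t /set_mem//|t tA]; exact: mem_set.
- by apply: IH; exact: mD.
Qed.

Lemma simple_funZ (a : R) s : (forall x, sp_mem Y x -> sp_mem Y (a *: x)) ->
  simple_fun Y s -> simple_fun Y (fun t => a *: s t).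
Proof.
move=> mZ; move: s; apply: simple_fun_ind.
  rewrite (_ : (fun _ => _) = fun=> 0); first exact: simple_fun0.
  by apply/funext => t; rewrite scaler0.
move=> s A x _ IH mA mx.
rewrite (_ : (fun _ => _) = fun t => a *: s t + \1_A t *: (a *: x)).
  by apply: simple_fun_add1 => //; exact: mZ.
by apply/funext => t; rewrite scalerDr !scalerA mulrC.
Qed.

Lemma simple_fun_indic (B : set mR) s : measurable B ->
  simple_fun Y s -> simple_fun Y (fun t => \1_B t *: s t).
Proof.
move=> mB; move: s; apply: simple_fun_ind.
  rewrite (_ : (fun _ => _) = fun=> 0); first exact: simple_fun0.
  by apply/funext => t; rewrite scaler0.
move=> s A x _ IH mA mx.
rewrite (_ : (fun _ => _) = fun t => \1_B t *: s t + \1_(B `&` A) t *: x).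
  by apply: simple_fun_add1 => //; exact: measurableI.
by apply/funext => t; rewrite scalerDr scalerA indicI.
Qed.

Lemma simple_fun_addr (h : R) s : simple_fun Y s -> simple_fun Y (fun t => s (t + h)).
Proof.
move: s; apply: simple_fun_ind; first exact: simple_fun0.
move=> s A x _ IH mA mx.
apply: (simple_fun_add1 (A := (fun t => t + h) @^-1` A)) => //.
by rewrite -[X in measurable X]setTI; exact: measurable_addr.
Qed.

Lemma simple_fun_mem s : sp_mem Y 0 -> (forall x y, sp_mem Y x -> sp_mem Y y -> sp_mem Y (x + y)) ->
  simple_fun Y s -> forall t, sp_mem Y (s t).
Proof.
move=> m0 mD; move: s; apply: simple_fun_ind => // s A x _ IH mA mx t.
rewrite indicE; case: (_ \in _); first by rewrite scale1r; exact: mD.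
by rewrite scale0r addr0.
Qed.

End simple_functions.

(** * Bochner spaces *)

Section nice_functions.
Context {R : realType} {p : R} {E : lmodType R} (X : pseminorm p E).
Hypothesis p0 : 0 < p.
Notation mR := (measurableTypeR R).
Notation mu := (@lebesgue_measure R).
Implicit Types u v : R -> E.

Let Y := ps_space X.
Let memD x y : sp_mem Y x -> sp_mem Y y -> sp_mem Y (x + y).
Proof. exact: ps_memD. Qed.
Let mem0 : sp_mem Y 0. Proof. exact: ps_mem0. Qed.

(** Strong measurability without exceptional times: membership and approximation hold at every t, so
    scalar compositions are measurable outright. *)
Definition smeas u := (forall t, ps_mem X (u t)) /\
  exists s : nat -> R -> E, (forall k, simple_fun (ps_space X) (s k)) /\
    forall t, ps_cvg X (s ^~ t) (u t).

Let simple_mem s t : simple_fun Y s -> ps_mem X (s t).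
Proof. by move=> hs; apply: (simple_fun_mem (Y := Y)). Qed.

Lemma smeas_comp_measurable (Phi : R -> E -> R) u : smeas u ->
  (forall x, ps_mem X x -> measurable_fun setT (Phi ^~ x : mR -> R)) ->
  (forall t (w : nat -> E), (forall k, ps_mem X (w k)) -> ps_cvg X w (u t) ->
     Phi t (w k) @[k --> \oo] --> Phi t (u t)) ->
  measurable_fun setT (fun t : mR => Phi t (u t)).
Proof.
move=> [mu_ [s [hs su]]] mPhi cPhi.
apply: (measurable_fun_cvg (h := fun k t => Phi t (s k t))) => [k|t _].
  exact: (simple_fun_comp_measurable (Y := Y)).
by apply: cPhi => // k; exact: simple_mem.
Qed.

Lemma smeas_psn u : smeas u -> measurable_fun setT (fun t : mR => psn X (u t)).
Proof.
move=> su; apply: (smeas_comp_measurable (Phi := fun=> psn X)) => //.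
by move=> t w mw wu; apply: ps_cvg_psn => //; exact: su.1.
Qed.

Lemma smeas_simple s : simple_fun (ps_space X) s -> smeas s.
Proof.
move=> hs; split; first by move=> t; exact: simple_mem.
exists (fun=> s); split => // t; rewrite /ps_cvg.
rewrite (_ : (fun _ => _) = cst 0); first exact: cvg_cst.
by apply/funext => k; rewrite subrr psn0.
Qed.

Lemma smeas_lin (a : R) u v : smeas u -> smeas v -> smeas (fun t => a *: u t + v t).
Proof.
move=> [mu_ [s [hs su]]] [mv [s' [hs' sv]]]; split.
  by move=> t; exact: ps_lin.
exists (fun k t => a *: s k t + s' k t); split => [k|t].
  by apply: simple_funD => //; apply: simple_funZ => // x; exact: ps_memZ.
by apply: ps_cvg_lin => // k; exact: simple_mem.
Qed.

Lemma ps_cvgZ (a : R) (w : nat -> E) x : (forall k, ps_mem X (w k)) ->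
  ps_mem X x -> ps_cvg X w x -> ps_cvg X (fun k => a *: w k) (a *: x).
Proof.
move=> mw mx wx; rewrite /ps_cvg.
rewrite (_ : (fun _ => _) = fun k => `|a| `^ p * psn X (w k - x)).
  by rewrite -[X in _ --> X](mulr0 (`|a| `^ p)); exact: cvgMr.
by apply/funext => k; rewrite -scalerBr psnZ//; exact: ps_memB.
Qed.

Lemma smeas_indic (B : set mR) u : measurable B -> smeas u ->
  smeas (fun t => \1_B t *: u t).
Proof.
move=> mB [mu_ [s [hs su]]]; split; first by move=> t; exact: ps_memZ.
exists (fun k t => \1_B t *: s k t); split => [k|t]; first exact: simple_fun_indic.
by apply: ps_cvgZ => // k; exact: simple_mem.
Qed.

Lemma smeas_addr (h : R) u : smeas u -> smeas (fun t => u (t + h)).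
Proof.
move=> [mu_ [s [hs su]]]; split; first by move=> t; exact: mu_.
by exists (fun k t => s k (t + h)); split => // k; exact: simple_fun_addr.
Qed.

Lemma smeas_indic_cst (B : set mR) x : measurable B -> ps_mem X x ->
  smeas (fun t => \1_B t *: x).
Proof.
move=> mB mx; apply: smeas_simple.
rewrite (_ : (fun _ => _) = fun t => 0 + \1_B t *: x).
  by apply: simple_fun_add1 => //; exact: simple_fun0.
by apply/funext => t; rewrite add0r.
Qed.

Variable T : R.

(** Everywhere-defined representatives of the elements of L^p(0, T; X). Vanishing outside ]0, T[
    lets all integrals run over the line, where translations act freely. *)
Definition nice u := [/\ smeas u, (forall t, t \notin `]0, T[ -> u t = 0) &
  mu.-integrable setT (EFin \o (fun t => psn X (u t)))].

Definition psn_int u : R := \int[mu]_t psn X (u t).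

Lemma psn_int_ge0 u : 0 <= psn_int u.
Proof. by apply: Rintegral_ge0 => t _; exact: psn_ge0. Qed.

Lemma niceP u : smeas u -> (forall t, t \notin `]0, T[ -> u t = 0) ->
  (exists2 g : R -> R, mu.-integrable setT (EFin \o g) & forall t, psn X (u t) <= g t) ->
  nice u.
Proof.
move=> su u0 [g ig ug]; split => //.
apply: (integrable_Rbound measurableT _ ig); first exact: smeas_psn.
by move=> t _; rewrite ger0_norm ?psn_ge0.
Qed.

Lemma nice0 : nice 0.
Proof.
apply: niceP => //; first exact: (smeas_simple (simple_fun0 _)).
by exists (fun=> 0) => [|t]; [exact: integrableR0 | rewrite psn0].
Qed.

Lemma nice_lin (a : R) u v : nice u -> nice v -> nice (a *: u + v).
Proof.
move=> [su u0 iu] [sv v0 iv].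
have [K K1 hK] := psnD_le X.
apply: niceP.
- exact: (smeas_lin a su sv).
- by move=> t tT; change (a *: u t + v t = 0); rewrite u0// v0// scaler0 addr0.
- exists (fun t => K * (`|a| `^ p * psn X (u t) + psn X (v t))).
    apply: integrableRZ => //; apply: integrableRD => //; exact: integrableRZ.
  move=> t; rewrite -psnZ; last exact: su.1.
  by apply: hK; [apply: ps_memZ => //; exact: su.1 | exact: sv.1].
Qed.

Lemma nice_indic (B : set mR) u : measurable B -> nice u ->
  nice (fun t => \1_B t *: u t).
Proof.
move=> mB [su u0 iu]; apply: niceP; first exact: smeas_indic.
- by move=> t tT; rewrite u0// scaler0.
- exists (fun t => psn X (u t)) => // t.
  rewrite psnZ ?indicE; last exact: su.1.
  case: (_ \in _); first by rewrite normr1 powR1 mul1r.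
  by rewrite normr0 powR0 ?mul0r ?psn_ge0// gt_eqF.
Qed.

Let psn_intZ a u : nice u -> psn_int (a *: u) = `|a| `^ p * psn_int u.
Proof.
move=> [su _ iu]; rewrite /psn_int -RintegralZl//.
by apply: eq_Rintegral => t _; rewrite psnZ//; exact: su.1.
Qed.

Let psn_int_quasi (e : R) : 0 < e -> exists2 C : R, 0 <= C &
  forall u v, nice u -> nice v ->
    psn_int (u + v) <= (1 + e) * psn_int u + C * psn_int v.
Proof.
move=> e0; have [C C0 hC] := psn_quasi X e0; exists C => // u v nu nv.
have [[su _ iu] [sv _ iv]] := (nu, nv).
rewrite /psn_int -!RintegralZl// -RintegralD//; [|exact: integrableRZ..].
apply: le_Rintegral => //.
- by have := nice_lin 1 nu nv; rewrite scale1r => -[].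
- by apply: integrableRD => //; exact: integrableRZ.
- by move=> t _; apply: hC; [exact: su.1 | exact: sv.1].
Qed.

Let psn_int_smooth : exists2 C : R, 0 <= C &
  forall u v (e : R), nice u -> nice v -> 0 <= e <= 1 ->
    psn_int (u + e *: v) + psn_int (u - e *: v) <=
      2 * psn_int u + C * e ^+ 2 * (psn_int u + psn_int v).
Proof.
have [C C0 hC] := psn_smooth X; exists C => // u v e nu nv e01.
have [[su _ iu] [sv _ iv]] := (nu, nv).
have [_ _ i1] := nice_lin e nv nu.
have [_ _ i2] := nice_lin (- e) nv nu.
have e1 : u + e *: v = e *: v + u by rewrite addrC.
have e2 : u - e *: v = (- e) *: v + u by rewrite addrC scaleNr.
rewrite /psn_int e1 e2 -RintegralD// -(RintegralD measurableT iu iv) -!RintegralZl//.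
  rewrite -RintegralD//.
  - apply: le_Rintegral => //; first exact: integrableRD.
      by apply: integrableRD => //; repeat (apply: integrableRZ => //); exact: integrableRD.
    move=> t _; rewrite -e1 -e2; apply: hC => //; [exact: su.1 | exact: sv.1].
  - exact: integrableRZ.
  - by apply: integrableRZ => //; exact: integrableRD.
exact: integrableRD.
Qed.

Definition nice_pseminorm : pseminorm p (R -> E) :=
  Pseminorm psn_int_ge0 nice0 nice_lin psn_intZ psn_int_quasi psn_int_smooth.

End nice_functions.

(** * Density of step functions in the Bochner space *)

Section nice_density.
Context {R : realType} {p : R} {E : lmodType R} (X : pseminorm p E).
Hypothesis p0 : 0 < p.
Notation mR := (measurableTypeR R).
Notation mu := (@lebesgue_measure R).
Variable T : R.
Hypothesis T0 : 0 < T.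
Implicit Types u v : R -> E.
Notation nice := (nice X T).
Notation psn_int := (psn_int X).

Lemma nice_dominated_cvg (u_ : nat -> R -> E) u (g : R -> R) :
  (forall k, nice (u_ k)) -> nice u ->
  mu.-integrable setT (EFin \o g) -> (forall k t, psn X (u_ k t) <= g t) ->
  (forall t, ps_cvg X (u_ ^~ t) (u t)) ->
  psn_int (u_ k - u) @[k --> \oo] --> 0.
Proof.
move=> nu_ nu ig ug cu; have [K K1 hK] := psnD_le X.
have nd k : nice (u_ k - u).
  by have := nice_lin (-1) nu (nu_ k); rewrite scaleN1r addrC.
have bnd k t : setT t -> `|psn X ((u_ k - u) t)| <= K * (g t + psn X (u t)).
  move=> _; have [su _ _] := nu; have [suk _ _] := nu_ k.
  rewrite ger0_norm ?psn_ge0//.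
  apply: (le_trans (hK _ _ (suk.1 t) (ps_memN (su.1 t)))).
  by rewrite psnN//; [rewrite ler_pM2l ?lerD2r//; lra | exact: su.1].
have mk k : measurable_fun setT (fun t : mR => psn X ((u_ k - u) t)).
  by apply: smeas_psn; case: (nd k).
have ib : mu.-integrable setT (EFin \o (fun t => K * (g t + psn X (u t)))).
  by apply: integrableRZ => //; apply: integrableRD => //; case: nu.
have [_] := dominated_cvg_Rintegral measurableT mk ib bnd (fun t _ => cu t).
by rewrite Rintegral_cst// mul0r.
Qed.

Lemma integrable_indic_oo_cst (c a b : R) :
  mu.-integrable setT (EFin \o (fun t => \1_(`]a, b[%classic) t * c)).
Proof.
rewrite (_ : _ \o _ = EFin \o (fun t => c * \1_(`]a, b[%classic) t)); last first.
  by apply/funext => t /=; rewrite mulrC.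
by apply: integrableRZ => //; exact: integrable_indic_itv.
Qed.

Lemma nice_indic_cst (B : set mR) x : measurable B -> ps_mem X x ->
  nice (fun t => \1_(B `&` `]0, T[%classic) t *: x).
Proof.
move=> mB mx; apply: niceP => //.
- by apply: smeas_indic_cst => //; exact: measurableI.
- move=> t tT; rewrite indicE memNset ?scale0r// => -[_] /=.
  exact/negP.
- exists (fun t => \1_(`]0, T[%classic) t * psn X x); first exact: integrable_indic_oo_cst.
  move=> t; rewrite psnZ// !indicE in_setI; case: (t \in B) => /=; last first.
    by rewrite normr0 powR0 ?mul0r ?mulr_ge0 ?psn_ge0// gt_eqF.
  by case: (t \in _); rewrite /= ?normr1 ?powR1// normr0 powR0 ?gt_eqF.
Qed.

Section closed_subspace.
Variable P : (R -> E) -> Prop.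
Hypothesis Plin : forall a u v, nice u -> nice v -> P u -> P v -> P (a *: u + v).
Hypothesis Pclosed : forall (u_ : nat -> R -> E) u, (forall k, nice (u_ k)) -> nice u ->
  (forall k, P (u_ k)) -> psn_int (u_ k - u) @[k --> \oo] --> 0 -> P u.
Hypothesis Pind : forall b x, 0 < b < T -> ps_mem X x ->
  P (fun t => \1_(`]0, b]%classic) t *: x).

Let I := `]0, T[%classic : set mR.

Let mI : measurable I. Proof. exact: measurable_itv. Qed.

Let PB u v : nice u -> nice v -> P u -> P v -> P (u - v).
Proof. by move=> nu nv Pu Pv; rewrite addrC -scaleN1r; exact: Plin. Qed.

(** Indicators that agree eventually at each time, dominated by the constant [psn X x] on ]0, T[,
    converge in [psn_int], and P is closed. *)
Let ind_cvg (A_ : nat -> set mR) (A : set mR) x : ps_mem X x ->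
  (forall k, measurable (A_ k)) -> measurable A ->
  (forall t, \forall k \near \oo, (t \in A_ k `&` I) = (t \in A `&` I)) ->
  (forall k, P (fun t => \1_(A_ k `&` I) t *: x)) ->
  P (fun t => \1_(A `&` I) t *: x).
Proof.
move=> mx mA_ mA cA PA.
apply: (Pclosed _ _ PA) => [k||]; [exact: nice_indic_cst..|].
apply: (nice_dominated_cvg (g := fun t => \1_I t * psn X x)) => [k|||k t|t].
- exact: nice_indic_cst.
- exact: nice_indic_cst.
- exact: integrable_indic_oo_cst.
- rewrite psnZ// !indicE in_setI; case: (t \in A_ k) => /=; last first.
    by rewrite normr0 powR0 ?mul0r ?mulr_ge0 ?psn_ge0// gt_eqF.
  by case: (t \in _); rewrite /= ?normr1 ?powR1// normr0 powR0 ?gt_eqF.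
- rewrite /ps_cvg; apply: (@cvg_trans _ (nbhs (0 : R))) => //.
  apply: cvg_near_cst; apply: filterS (cA t) => k tk.
  by rewrite !indicE tk subrr psn0.
Qed.

Let PT x : ps_mem X x -> P (fun t => \1_I t *: x).
Proof.
move=> mx.
(* These points increase to T; the denominator starts at 2 so that they are all positive. *)
pose b k : R := T - T / k.+2%:R.
have b01 k : 0 < b k < T.
  have k2 : 1 < k.+2%:R :> R by rewrite ltr1n.
  have : 0 < T / k.+2%:R by rewrite divr_gt0.
  have : T / k.+2%:R < T by rewrite ltr_pdivrMr ?ltr_pMr//; lra.
  by rewrite /b => h1 h2; rewrite subr_gt0 h1 gtrBl.
rewrite -(setTI I); apply: (@ind_cvg (fun k => `]-oo, (b k)]%classic)) => //.
- move=> t; case: (boolP (t \in I)) => tI; last first.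
    by apply: nearW => k; rewrite !in_setI (negbTE tI) !andbF.
  have /andP[t0 tT] : 0 < t < T by have := set_mem tI; rewrite /I/= in_itv.
  have : T / k.+2%:R @[k --> \oo] --> 0.
    rewrite -(mulr0 T); apply: cvgMr.
    have := @cvg_harmonic R; rewrite -(cvg_shiftS _ _); exact.
  move=> /cvgrPdist_lt /(_ (T - t)); rewrite subr_gt0 => /(_ tT).
  apply: filterS => k; rewrite sub0r normrN ger0_norm ?divr_ge0 ?(ltW T0)// => h.
  rewrite !in_setI tI !andbT in_setT; apply: mem_set => /=.
  by rewrite in_itv/= /b lerBrDl -lerBrDr ltW.
- move=> k; rewrite (_ : _ `&` I = `]0, b k]%classic); first exact: Pind.
  have /andP[b0 bT] := b01 k.
  apply/seteqP; split => t; rewrite /I/= !in_itv/=.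
    by move=> [tb /andP[-> _]].
  by move=> /andP[-> tb]; split => //=; exact: le_lt_trans bT.
Qed.

(** The admissible sets form a Dynkin system: complements come from differences, disjoint unions
    from [ind_cvg]. It contains the rays ]a, +oo[, which are stable under intersection and generate
    the Borel sets. *)
Let Pmeas (A : set mR) : measurable A -> forall x, ps_mem X x ->
  P (fun t => \1_(A `&` I) t *: x).
Proof.
move=> mA; have P0 : P 0.
  by have := PT (ps_mem0 X); rewrite (_ : (fun _ => _) = 0)//; apply/funext => t; rewrite scaler0.
pose Q (B : set mR) := forall x, ps_mem X x -> P (fun t => \1_(B `&` I) t *: x).
suff H : forall S, <<s @RGenOInfty.G R >> S -> Q S.
  have mA' : (@RGenOInfty.G R).-sigma.-measurable A by rewrite -RGenOInfty.measurableE.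
  exact: (H A mA').
apply: dynkin_induction.
- exact: RGenOInfty.measurableE.
- move=> _ _ [a ->] [b ->]; exists (Num.max a b).
  apply/seteqP; split => t /=; rewrite !in_itv/= !andbT gt_max; last by move=> /andP.
  by move=> [-> ->].
- by move=> x mx; rewrite setTI; exact: PT.
- move=> _ [a ->] x mx; have [a0|a0] := leP a 0.
    rewrite (_ : _ `&` I = I); first exact: PT.
    apply/seteqP; split => t; rewrite /I/= !in_itv/=; first by case.
    by move=> /andP[t0 tT]; rewrite t0 tT andbT (le_lt_trans a0).
  have [aT|aT] := ltP a T; last first.
    rewrite (_ : (fun _ => _) = 0)//; apply/funext => t.
    rewrite indicE memNset ?scale0r//= !in_itv/= andbT => -[ta /andP[_ tT]].
    by have := lt_trans ta tT; rewrite ltNge aT.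
  rewrite (_ : (fun _ => _) = (fun t => \1_I t *: x) - (fun t => \1_(`]0, a]%classic) t *: x)).
    have e1 : (fun t => \1_(`]0, a]%classic) t *: x) =
        fun t => \1_(`]0, a]%classic `&` I) t *: x.
      apply/funext => t; congr (\1_(_) _ *: _); apply/seteqP; split => s; rewrite /I/= !in_itv/=.
        by move=> /andP[-> sa]; split=> //=; exact: le_lt_trans aT.
      by case.
    apply: PB; [|rewrite e1; exact: nice_indic_cst|exact: PT|by apply: Pind => //; rewrite a0].
    by rewrite -(setTI I); exact: nice_indic_cst.
  apply/funext => t; change (\1_(`]a, +oo[ `&` I) t *: x = \1_I t *: x - \1_(`]0, a]%classic) t *: x).
  rewrite -scalerBl !indicE !in_setI; congr (_ *: x).
  have -> : (t \in I) = (0 < t < T) by apply/idP/idP => [/set_mem|h]; [|apply/mem_set]; rewrite /I/= in_itv.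
  have -> : (t \in (`]0, a]%classic : set R)) = (0 < t <= a).
    by apply/idP/idP => [/set_mem|h]; [|apply/mem_set]; rewrite /= in_itv.
  have -> : (t \in (`]a, +oo[%classic : set R)) = (a < t).
    by apply/idP/idP => [/set_mem|h]; [|apply/mem_set]; rewrite /= in_itv/= andbT.
  have [t0|t0] /= := ltP 0 t; last by rewrite andbF subr0.
  have [ta|ta] /= := leP t a; last by rewrite subr0.
  by rewrite (le_lt_trans ta aT) subrr.
- move=> A' mA' PA' x mx.
  rewrite (_ : (fun _ => _) = (fun t => \1_I t *: x) - (fun t => \1_(A' `&` I) t *: x)).
    apply: PB; [|exact: nice_indic_cst|exact: PT|exact: PA'].
    by rewrite -(setTI I); exact: nice_indic_cst.
  apply/funext => t; change (\1_(~` A' `&` I) t *: x = \1_I t *: x - \1_(A' `&` I) t *: x).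
  rewrite -scalerBl !indicE !in_setI in_setC; congr (_ *: x).
  by case: (t \in A'); case: (t \in I) => /=; rewrite ?subrr ?subr0.
- move=> F mF tF PF x mx.
  apply: (@ind_cvg (fun k => \big[setU/set0]_(i < k) F i)) => //.
  + by move=> k; apply: bigsetU_measurable => i _; exact: mF.
  + by apply: bigcup_measurable => k _; exact: mF.
  + move=> t; have [[i _ Fit]|nF] := pselect ((\bigcup_k F k) t).
      near=> k; rewrite !in_setI; congr (_ && _); apply/idP/idP => _; apply/mem_set.
        by exists i.
      rewrite -bigcup_mkord; exists i => //=; near: k; exact: nbhs_infty_gt.
    apply: nearW => k; rewrite !in_setI (memNset nF) (memNset (A := \big[setU/set0]_(i < k) F i))//.
    by rewrite -bigcup_mkord => -[i _ Fit]; apply: nF; exists i.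
  + elim=> [|k IH].
      rewrite big_ord0 (_ : (fun _ => _) = 0)//; apply/funext => t.
      by rewrite set0I indic0 scale0r.
    rewrite big_ord_recr/= (_ : (fun _ => _) = 1 *: (fun t => \1_(F k `&` I) t *: x) +
      (fun t => \1_((\big[setU/set0]_(i < k) F i) `&` I) t *: x)).
      apply: Plin => //; [by apply: nice_indic_cst => //; exact: mF| |exact: PF mx].
      by apply: nice_indic_cst => //; apply: bigsetU_measurable => i _; exact: mF.
    apply/funext => t; change (\1_((\big[setU/set0]_(i < k) F i `|` F k) `&` I) t *: x =
      1 *: (\1_(F k `&` I) t *: x) + \1_((\big[setU/set0]_(i < k) F i) `&` I) t *: x).
    rewrite scale1r -scalerDl !indicE !in_setI in_setU; congr (_ *: x).
    case: (boolP (t \in F k)) => tk; last by rewrite orbF add0r.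
    rewrite (_ : (t \in \big[setU/set0]_(i < k) F i) = false) ?addr0//.
    apply/negbTE/negP => /set_mem; rewrite -bigcup_mkord => -[i /= ik Fit].
    have h := tF i k Logic.I Logic.I; have := h (ex_intro _ t (conj Fit (set_mem tk))) => ikE.
    by rewrite ikE ltnn in ik.
Unshelve. all: by end_near. Qed.

Let Psimple s : simple_fun (ps_space X) s -> P (fun t => \1_I t *: s t).
Proof.
move: s; apply: simple_fun_ind.
  have := PT (ps_mem0 X); rewrite (_ : (fun _ => _) = fun t => \1_I t *: (fun=> 0) t)//.
move=> s A x hs IH mA mx.
rewrite (_ : (fun _ => _) = 1 *: (fun t => \1_I t *: s t) + (fun t => \1_(A `&` I) t *: x)).
  apply: Plin => //; [|exact: nice_indic_cst|exact: Pmeas].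
  have [B [B0 hB]] : exists B : R, 0 <= B /\ forall t, psn X (s t) <= B.
    move: {IH} s hs; apply: simple_fun_ind.
      by exists 0; split => // t; rewrite psn0.
    move=> s A' y hs [B [B0 hB]] mA' my; have [K K1 hK] := psnD_le X.
    have K0 : 0 <= K by lra.
    exists (K * (B + psn X y)); split; first by rewrite mulr_ge0// addr_ge0// psn_ge0.
    move=> t; have ms : ps_mem X (s t).
      apply: (simple_fun_mem (Y := ps_space X)) => //; [exact: ps_mem0|exact: ps_memD].
    apply: le_trans (hK _ _ ms (ps_memZ _ my)) _; apply: ler_wpM2l => //; apply: lerD => //.
    rewrite psnZ// indicE; case: (_ \in _); first by rewrite normr1 powR1 mul1r.
    by rewrite normr0 powR0 ?mul0r ?psn_ge0// gt_eqF.
  have ss := smeas_simple p0 hs.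
  apply: niceP => //; first by apply: smeas_indic => //.
    move=> t tT; rewrite indicE memNset ?scale0r//; exact/negP.
  exists (fun t => \1_I t * B); first exact: integrable_indic_oo_cst.
  move=> t; rewrite psnZ; last exact: ss.1.
  rewrite indicE; case: (_ \in _); first by rewrite normr1 powR1 !mul1r.
  by rewrite normr0 powR0 ?mul0r// gt_eqF.
apply/funext => t; change (\1_I t *: (s t + \1_A t *: x) =
  1 *: (\1_I t *: s t) + \1_(A `&` I) t *: x).
by rewrite scale1r scalerDr scalerA indicI mulrC.
Qed.

Lemma nice_ind u : nice u -> P u.
Proof.
move=> nu; have [su u0 iu] := nu; have [mu_ [s [hs su']]] := su.
have mN := smeas_psn su.
have ms k t : ps_mem X (s k t).
  by apply: (simple_fun_mem (Y := ps_space X)) => //; [exact: ps_mem0|exact: ps_memD].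
(* The approximating simple functions have no common majorant. They are cut off outside [B k], where
   they exceed u by too much; since [psn] is continuous, the cut-off is eventually inactive at each
   t. *)
pose B k : set mR := [set t | psn X (s k t) < psn X (u t) + 1].
have mB k : measurable (B k).
  have mk : measurable_fun setT (fun t : mR => psn X (s k t)) by apply: smeas_psn; exact: smeas_simple.
  have mu1 : measurable_fun setT (fun t : mR => psn X (u t) + 1) by exact: measurable_funD.
  have -> : B k = (fun t : mR => psn X (s k t) < psn X (u t) + 1) @^-1` [set true].
    by apply/seteqP; split.
  by rewrite -[X in measurable X]setTI; exact: (measurable_fun_ltr mk mu1).
have nk k : nice (fun t => \1_I t *: (\1_(B k) t *: s k t)).
  have sk : smeas X (s k) by exact: smeas_simple.
  apply: niceP => //.
  - by apply: smeas_indic => //; exact: smeas_indic.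
  - by move=> t tT; rewrite [\1_I t]indicE memNset ?scale0r//; exact/negP.
  - exists (fun t => \1_I t * 1 + psn X (u t)).
      by apply: integrableRD => //; exact: integrable_indic_oo_cst.
    move=> t; rewrite !psnZ//; last exact: ps_memZ.
    rewrite [\1_I t]indicE; case: (_ \in I); last first.
      by rewrite normr0 powR0 ?mul0r ?add0r ?psn_ge0// gt_eqF.
    rewrite normr1 powR1 !mul1r indicE; case: (boolP (_ \in _)) => tB.
      by rewrite normr1 powR1 mul1r addrC; have := set_mem tB; exact: ltW.
    by rewrite normr0 powR0 ?mul0r ?addr_ge0 ?psn_ge0// gt_eqF.
apply: (Pclosed nk nu) => [k|].
  apply: Psimple; apply: simple_fun_indic => //.
apply: (nice_dominated_cvg (g := fun t => \1_I t * 1 + psn X (u t))) => // [|k t|t].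
- by apply: integrableRD => //; exact: integrable_indic_oo_cst.
- rewrite !psnZ//; last exact: ps_memZ.
  rewrite [\1_I t]indicE; case: (_ \in I); last first.
    by rewrite normr0 powR0 ?mul0r ?add0r ?psn_ge0// gt_eqF.
  rewrite normr1 powR1 !mul1r indicE; case: (boolP (_ \in _)) => tB.
    by rewrite normr1 powR1 mul1r addrC; have := set_mem tB; exact: ltW.
  by rewrite normr0 powR0 ?mul0r ?addr_ge0 ?psn_ge0// gt_eqF.
- case: (boolP (t \in I)) => tI; last first.
    rewrite u0; last by apply: contra tI => h; exact: mem_set.
    apply: cvg_near_cst; apply: nearW => k.
    by rewrite [\1_I t]indicE (negbTE tI) scale0r subrr psn0.
  have := ps_cvg_psn (ms ^~ t) (mu_ t) (su' t).
  move=> /cvgrPdist_lt /(_ 1 ltr01) nB.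
  apply: cvg_trans (su' t); apply: near_eq_cvg; apply: filterS nB => k h.
  rewrite [\1_I t]indicE tI scale1r indicE mem_set ?scale1r//=.
  move: h; rewrite ltr_distl => /andP[h _].
  by change (psn X (s k t) < psn X (u t) + 1); lra.
Qed.

End closed_subspace.
End nice_density.

(** * Elements of the Bochner space and their nice representatives *)

Section bochner_nice.
Context {R : realType} {p : R} {E : lmodType R} (X : pseminorm p E).
Hypothesis p0 : 0 < p.
Notation mR := (measurableTypeR R).
Notation mu := (@lebesgue_measure R).
Variables (T : R) (Y : seminormed_space R E).
Hypothesis memE : forall x, sp_mem Y x <-> ps_mem X x.
Hypothesis normE : forall x, ps_mem X x -> sp_norm Y x = (psn X x `^ p^-1)%:E.
Implicit Types u v : R -> E.

Definition ae_itv_eq u v := {ae mu, forall t, t \in `]0, T[ -> u t = v t}.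

Lemma powR_inv (x : R) : 0 <= x -> (x `^ p^-1) `^ p = x.
Proof. by move=> x0; rewrite -powRrM mulVf ?gt_eqF// powRr1. Qed.

Lemma simple_fun_sp s : simple_fun Y s <-> simple_fun (ps_space X) s.
Proof.
split=> -[n [A [x [h e]]]]; exists n, A, x; split => // j.
  by split; [exact: (h j).1 | exact/memE/(h j).2].
by split; [exact: (h j).1 | exact/memE/(h j).2].
Qed.

Let restr_norm u v : nice X T v -> ae_itv_eq u v ->
  (\int[mu]_t (`|((fun t => sp_norm Y (u t)) \_ `]0%R, T[) t| `^ p)%E =
   \int[mu]_t (psn X (v t))%:E)%E.
Proof.
move=> [sv v0 iv] uv; apply: ae_eq_integral_gen.
apply: (ae_mono uv) => t uvt _; rewrite patchE.
have [tT|tT] := boolP (t \in `]0, T[).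
  rewrite mem_set//= uvt//= normE; last exact: sv.1.
  by rewrite /= ger0_norm ?powR_ge0// powR_inv// psn_ge0.
rewrite memNset; last exact/negP.
by rewrite /point/= normr0 powR0 ?gt_eqF// v0// psn0.
Qed.

Lemma bochner_norm u v : nice X T v -> ae_itv_eq u v ->
  sp_norm (bochner p%:E T Y) u = (psn_int X v `^ p^-1)%:E.
Proof.
move=> nv uv; rewrite /= unlock (restr_norm nv uv) -poweR_EFin fineK//.
by have [_ _ iv] := nv; exact: integrable_fin_num.
Qed.

Lemma nice_bochner u v : nice X T v -> ae_itv_eq u v ->
  sp_mem (bochner p%:E T Y) u.
Proof.
move=> nv uv; split; last by have := bochner_norm nv uv => /= ->; exact: ltry.
have [[mv [s [hs sv]]] v0 iv] := nv.
exists s; split; first by move=> k; exact/simple_fun_sp.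
apply: (ae_mono uv) => t uvt tT; rewrite uvt//; split; first exact/memE.
have ms k : ps_mem X (s k t).
  by apply: (simple_fun_mem (Y := ps_space X)) => //; [exact: ps_mem0|exact: ps_memD].
rewrite (_ : (fun _ => _) = fun k => (psn X (s k t - v t) `^ p^-1)%:E); last first.
  by apply/funext => k; rewrite normE//; exact: ps_memB.
apply: cvg_EFin; first exact: nearW.
have h0 : (0:R) = 0 `^ p^-1 by rewrite powR0// invr_eq0 gt_eqF.
apply/cvgrPdist_lt => e e0; have ep : 0 < e `^ p by rewrite powR_gt0.
move/cvgrPdist_lt : (sv t) => /(_ _ ep); apply: filterS => k.
rewrite !sub0r !normrN !ger0_norm ?psn_ge0 ?powR_ge0// => h.
rewrite -(powRr1 (ltW e0)) -(@mulfV _ p) ?gt_eqF// powRrM.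
by rewrite gt0_ltr_powR ?invr_gt0 ?nnegrE ?psn_ge0 ?powR_ge0.
Qed.

(** The representative is u set to 0 outside ]0, T[ and on a null set containing all times where the
    simple functions fail to converge. *)
Lemma bochner_ae_nice u : sp_mem (bochner p%:E T Y) u ->
  exists2 v, nice X T v & ae_itv_eq u v.
Proof.
move=> [[s [hs [M [mM M0 sM]]]] nfin].
pose B : set mR := `]0, T[%classic `\` M.
have mB : measurable B by apply: measurableD => //; exact: measurable_itv.
have hs' k : simple_fun (ps_space X) (s k) by exact/simple_fun_sp.
have good t : B t -> sp_mem Y (u t) /\
    sp_norm Y (s k t - u t) @[k --> \oo] --> (0 : \bar R).
  move=> [tT Mt]; apply: contrapT => h; apply: Mt; apply: sM => /= h'.
  by apply: h; exact: h'.
pose v t := \1_B t *: u t.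
have vu t : B t -> v t = u t by move=> Bt; rewrite /v indicE mem_set// scale1r.
have v0 t : ~ B t -> v t = 0 by move=> Bt; rewrite /v indicE memNset// scale0r.
have uv : ae_itv_eq u v.
  exists M; split => //; move=> t /= h; apply: contrapT => Mt; apply: h => tT.
  by rewrite vu.
have ms k t : ps_mem X (s k t).
  by apply: (simple_fun_mem (Y := ps_space X)) => //; [exact: ps_mem0|exact: ps_memD].
have sv : smeas X v.
  split=> [t|].
    have [Bt|Bt] := pselect (B t); last by rewrite v0//; exact: ps_mem0.
    by rewrite vu//; apply/memE; exact: (good _ Bt).1.
  exists (fun k t => \1_B t *: s k t); split; first by move=> k; exact: simple_fun_indic.
  move=> t; have [Bt|Bt] := pselect (B t); last first.
    rewrite v0//; apply: cvg_near_cst; apply: nearW => k.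
    by rewrite indicE memNset// scale0r subrr psn0.
  have [/memE mut] := good _ Bt; rewrite vu//.
  rewrite (_ : (fun _ => _) = fun k => (psn X (s k t - u t) `^ p^-1)%:E); last first.
    by apply/funext => k; rewrite normE//; exact: ps_memB.
  move=> /fine_cvg /=.
  move=> /cvgrPdist_lt c; apply/cvgrPdist_lt => e e0.
  have ep : 0 < e `^ p^-1 by rewrite powR_gt0.
  apply: filterS (c _ ep) => k.
  rewrite /= !sub0r !normrN !ger0_norm ?psn_ge0 ?powR_ge0// indicE mem_set// scale1r => h.
  rewrite -(powR_inv (psn_ge0 X _)) -(powR_inv (ltW e0)).
  by rewrite gt0_ltr_powR ?nnegrE ?powR_ge0.
have vT t : t \notin `]0, T[ -> v t = 0.
  by move=> tT; apply: v0 => -[h _]; move: tT; rewrite h.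
exists v => //; split => //.
apply/integrableP; split; first by apply/measurable_EFinP; exact: smeas_psn.
rewrite (_ : (\int[mu]_x _)%E = \int[mu]_t (psn X (v t))%:E)%E; last first.
  by apply: eq_integral => t _ /=; rewrite ger0_norm// psn_ge0.
(* The norm of u in the Bochner space integrates a function not known to be measurable, hence the
   comparison by [ae_eq_integral_gen]. *)
rewrite (_ : (\int[mu]_t _)%E =
   \int[mu]_t (`|((fun t => sp_norm Y (u t)) \_ `]0%R, T[) t| `^ p)%E)%E; last first.
  apply: ae_eq_integral_gen.
  apply: (ae_mono uv) => t uvt _; rewrite patchE.
  have [tT|tT] := boolP (t \in `]0, T[).
    rewrite mem_set//= uvt//= normE; last exact: sv.1.
    by rewrite /= ger0_norm ?powR_ge0// powR_inv// psn_ge0.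
  rewrite memNset; last exact/negP.
  by rewrite /point/= normr0 powR0 ?gt_eqF// vT// psn0.
by rewrite -powR_Lnorm ?gt_eqF//; apply: poweR_lty.
Qed.

End bochner_nice.

Lemma ge2_gt0 (R : numDomainType) (p : R) : 2 <= p -> 0 < p.
Proof. exact: lt_le_trans. Qed.

(** * Bounded functionals and their time averages *)

Section functionals.
Context {R : realType} {p q : R} {E : lmodType R} (X : pseminorm p E).
Hypothesis p2 : 2 <= p.
Hypothesis pq : p^-1 + q^-1 = 1.
Implicit Types (F : E -> R) (x y : E).

Let p0 : 0 < p. Proof. exact: ge2_gt0. Qed.

Definition linear_on F := forall (a : R) x y, ps_mem X x -> ps_mem X y ->
  F (a *: x + y) = a * F x + F y.

Definition ball_bound F (M : R) := forall x, ps_mem X x -> psn X x <= 1 -> `|F x| <= M.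

Section linear_on_theory.
Variable F : E -> R.
Hypothesis lF : linear_on F.

Lemma linear_on0 : F 0 = 0.
Proof.
have := lF 1 (ps_mem0 X) (ps_mem0 X); rewrite scaler0 addr0 mul1r.
by move=> /eqP; rewrite -subr_eq0 opprD addNKr oppr_eq0 => /eqP.
Qed.

Lemma linear_onD x y : ps_mem X x -> ps_mem X y -> F (x + y) = F x + F y.
Proof. by move=> mx my; rewrite -[x]scale1r lF// mul1r scale1r. Qed.

Lemma linear_onZ a x : ps_mem X x -> F (a *: x) = a * F x.
Proof. by move=> mx; rewrite -[_ *: _]addr0 lF ?linear_on0 ?addr0//; exact: ps_mem0. Qed.

Lemma linear_onB x y : ps_mem X x -> ps_mem X y -> F (x - y) = F x - F y.
Proof. by move=> mx my; rewrite addrC -scaleN1r lF// mulN1r addrC. Qed.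

Lemma linear_on_sum (I : Type) (s : seq I) (f : I -> E) :
  (forall i, ps_mem X (f i)) -> F (\sum_(i <- s) f i) = \sum_(i <- s) F (f i).
Proof.
move=> mf; elim: s => [|i s IH]; first by rewrite !big_nil linear_on0.
by rewrite !big_cons linear_onD ?IH//; exact: ps_mem_sum.
Qed.

Lemma ball_bound_root M : ball_bound F M -> forall x, ps_mem X x ->
  `|F x| <= M * psn X x `^ p^-1.
Proof.
move=> bF x mx.
have M0 : 0 <= M.
  by have := bF _ (ps_mem0 X); rewrite psn0// linear_on0 normr0 => /(_ ler01).
have [n0|n0] := eqVneq (psn X x) 0.
  rewrite n0 powR0 ?invr_eq0 ?gt_eqF// mulr0.
  apply/ler_addgt0Pl => e e0; rewrite addr0.
  (* A vector with [psn] zero stays in the unit ball under any scaling; this factor yields |F x| <=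
     M e / (M + 1) <= e. *)
  have k0 : 0 < (M + 1) / e by rewrite divr_gt0//; lra.
  have := bF _ (ps_memZ ((M + 1) / e) mx).
  rewrite psnZ// n0 mulr0 => /(_ ler01); rewrite linear_onZ// normrM gtr0_norm//.
  rewrite -ler_pdivlMl// invf_div => /le_trans; apply.
  by rewrite mulrAC ler_pdivrMr ?ler_pM2l; lra.
have n1 : 0 < psn X x by rewrite lt_neqAle eq_sym n0 psn_ge0.
have s0 : 0 < psn X x `^ p^-1 by rewrite powR_gt0.
have := bF _ (ps_memZ (psn X x `^ p^-1)^-1 mx).
rewrite psnZ// linear_onZ// normrM gtr0_norm ?invr_gt0//.
have -> : (psn X x `^ p^-1)^-1 `^ p * psn X x = 1.
  by rewrite -powRN -powRrM mulNr mulVf ?gt_eqF// powRN powRr1 ?mulVf// ltW.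
by move=> /(_ (lexx _)); rewrite mulrC ler_pdivrMr.
Qed.

(** Young's inequality with second factor 1 makes the p-th root affine, so that the bound can be
    summed and integrated. It is sharp at [psn X x = 1] because 1/p + 1/q = 1, so no constant is
    lost there. *)
Lemma ball_bound_young M : ball_bound F M -> forall x, ps_mem X x ->
  `|F x| <= M * (p^-1 * psn X x + q^-1).
Proof.
move=> bF x mx; have := ball_bound_root bF mx => h; apply: le_trans h _.
have M0 : 0 <= M.
  by have := bF _ (ps_mem0 X); rewrite psn0// linear_on0 normr0 => /(_ ler01).
apply: ler_wpM2l => //.
have := young_powR p2 pq (powR_ge0 (psn X x) p^-1) (@ler01 R).
by rewrite !powR1 !mulr1 powR_inv// psn_ge0.
Qed.

End linear_on_theory.

Section strong_convergence.
Variables (F_ : nat -> E -> R) (F : E -> R) (M : R).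
Hypotheses (lF_ : forall k, linear_on (F_ k)) (lF : linear_on F).
Hypotheses (bF_ : forall k, ball_bound (F_ k) M) (bF : ball_bound F M).
Hypothesis Mleast : forall e : R, 0 < e ->
  exists x, [/\ ps_mem X x, psn X x <= 1 & M - e <= F x].
Hypothesis cF : forall x, ps_mem X x -> F_ k x @[k --> \oo] --> F x.

(* The bidual seminorm is never computed: the seminorm is uniformly smooth, so
   testing with x + e g and x - e g, where x nearly attains the norm of F,
   turns pointwise convergence into convergence in the dual norm. *)
Lemma strong_convergence (e : R) : 0 < e ->
  \forall k \near \oo, forall g, ps_mem X g -> psn X g <= 1 -> `|F_ k g - F g| <= e.
Proof.
move=> e0; have [C C0 hC] := psn_smooth X.
have M0 : 0 <= M.
  by have := bF (ps_mem0 X); rewrite psn0// linear_on0// normr0 => /(_ ler01).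
pose K := 2 * (M * C + 2).
have K0 : 0 < K by rewrite /K; have := mulr_ge0 M0 C0; lra.
pose d := Num.min 1 (e / K).
have d0 : 0 < d by rewrite lt_min ltr01 divr_gt0.
have d1 : d <= 1 by rewrite ge_min lexx.
have dK : d * K <= e by rewrite -ler_pdivlMr// ge_min lexx orbT.
have dd0 : 0 < d ^+ 2 by rewrite exprn_gt0.
have [x [mx nx Fx]] := Mleast dd0.
have := cF mx => /cvgrPdist_le /(_ _ dd0); apply: filterS => k hk.
have key g : ps_mem X g -> psn X g <= 1 -> F_ k g - F g <= e.
  move=> mg ng.
  have m1 : ps_mem X (x + d *: g) by apply: ps_memD => //; exact: ps_memZ.
  have m2 : ps_mem X (x - d *: g) by apply: ps_memB => //; exact: ps_memZ.
  have h1 := ball_bound_young (lF_ k) (bF_ k) m1.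
  have h2 := ball_bound_young lF bF m2.
  have d01 : 0 <= d <= 1 by rewrite ltW.
  have h3 := hC _ _ _ mx mg d01.
  have e1 : F_ k (x + d *: g) = F_ k x + d * F_ k g.
    by rewrite linear_onD ?linear_onZ//; exact: ps_memZ.
  have e2 : F (x - d *: g) = F x - d * F g.
    by rewrite linear_onB ?linear_onZ//; exact: ps_memZ.
  (* The choice of x and k makes the left side at least 2M - 3 d^2 + d (F_k g - F g), while
     smoothness caps the right side at 2M + M C d^2. Dividing by d leaves a bound of order d. *)
  have h4 : F_ k x + d * F_ k g + (F x - d * F g) <=
      M * (p^-1 * (psn X (x + d *: g) + psn X (x - d *: g)) + 2 * q^-1).
    rewrite -e1 -e2; apply: (le_trans (lerD (ler_norm _) (ler_norm _))).
    apply: (le_trans (lerD h1 h2)); rewrite -mulrDr; apply: ler_wpM2l => //.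
    by rewrite mulrDr; lra.
  have pV0 : 0 <= p^-1 by rewrite invr_ge0 ltW.
  have pV1 : p^-1 <= 2^-1 by rewrite lef_pV2 ?posrE.
  have h5 : psn X (x + d *: g) + psn X (x - d *: g) <= 2 + 2 * (C * d ^+ 2).
    apply: (le_trans h3); apply: lerD; first by rewrite ler_piMr.
    rewrite [leRHS]mulrC; apply: ler_wpM2l; first by rewrite mulr_ge0// ltW.
    by have := lerD nx ng; rewrite -[1 + 1]/2%:R.
  have h6 : M * (p^-1 * (psn X (x + d *: g) + psn X (x - d *: g)) + 2 * q^-1) <=
      2 * M + M * C * d ^+ 2.
    have Cd : 0 <= C * d ^+ 2 by rewrite mulr_ge0// ltW.
    have : p^-1 * (psn X (x + d *: g) + psn X (x - d *: g)) + 2 * q^-1 <=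
        2 + C * d ^+ 2.
      have := ler_wpM2l pV0 h5.
      have : p^-1 * (C * d ^+ 2) <= 2^-1 * (C * d ^+ 2) by rewrite ler_wpM2r.
      have : 2 * (p^-1 + q^-1) = 2 by rewrite pq mulr1.
      set a := p^-1; set b := q^-1; set c := C * _; set s := psn X _ + _.
      clear; lra.
    by move=> /(ler_wpM2l M0) h; rewrite (le_trans h)// mulrDr mulrA [M * 2]mulrC.
  move: hk; rewrite ler_distl => /andP[_ hk].
  have h7 : d * (F_ k g - F g) <= d * (d * (M * C + 3)).
    move: (le_trans h4 h6) hk Fx; rewrite expr2.
    set a := F_ k x; set b := F_ k g; set c := F g; set f := F x; clear; lra.
  have h8 : F_ k g - F g <= d * (M * C + 3) by rewrite -(ler_pM2l d0).
  apply: (le_trans h8); apply: le_trans dK; apply: ler_wpM2l; first exact: ltW.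
  by rewrite /K; have := mulr_ge0 M0 C0; lra.
move=> g mg ng; rewrite ler_norml key// andbT lerNl.
have := key _ (ps_memN mg); rewrite psnN// => /(_ ng).
rewrite -scaleN1r !linear_onZ//; lra.
Qed.

End strong_convergence.
End functionals.

(** * Functionals on step functions in time and their averages *)

Section time_functional.
Context {R : realType} {p q : R} {E : lmodType R} (X : pseminorm p E).
Hypothesis p2 : 2 <= p.
Hypothesis pq : p^-1 + q^-1 = 1.
Notation mR := (measurableTypeR R).
Notation mu := (@lebesgue_measure R).
Variable T : R.
Hypothesis T0 : 0 < T.
Implicit Types (u v : R -> E) (x y : E).

Let p0 : 0 < p. Proof. exact: ge2_gt0. Qed.
Let pV0 : p^-1 != 0. Proof. by rewrite invr_eq0 gt_eqF// (ge2_gt0 p2). Qed.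

Let I := `]0, T[%classic : set mR.

Let mI : measurable I. Proof. exact: measurable_itv. Qed.

(** The intersection with ]0, T[ keeps the function nice for arbitrary a and b, which grids and
    shifted intervals produce. *)
Definition step (a b : R) x : R -> E := fun t => \1_(`]a, b]%classic `&` `]0, T[%classic) t *: x.

Notation V := (nice_pseminorm X (ge2_gt0 p2) T).

Lemma nice_step a b x : ps_mem X x -> nice X T (step a b x).
Proof. by move=> mx; apply: nice_indic_cst => //; exact: measurable_itv. Qed.

Lemma psn_step a b x t : ps_mem X x ->
  psn X (step a b x t) = \1_(`]a, b]%classic `&` `]0, T[%classic) t * psn X x.
Proof.
move=> mx; rewrite psnZ// indicE; case: (_ \in _); first by rewrite normr1 powR1.
by rewrite normr0 powR0// gt_eqF.
Qed.

Lemma psn_int_step a b x : a <= b -> ps_mem X x ->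
  psn_int X (step a b x) <= (b - a) * psn X x.
Proof.
move=> ab mx; rewrite /psn_int; under eq_Rintegral do rewrite psn_step//.
have mJ : measurable (`]a, b]%classic `&` I : set mR) by exact: measurableI.
have leJ : (mu (`]a, b]%classic `&` I : set mR) <= (b - a)%:E)%E.
  apply: (@le_trans _ _ (mu (`]a, b]%classic : set mR))).
    by apply: le_measure; rewrite ?inE//; exact: subIsetl.
  rewrite lebesgue_measure_itv/= lte_fin; case: ifPn => [_|]; first by rewrite -EFinB.
  by rewrite lee_fin subr_ge0.
have iJ : mu.-integrable setT (EFin \o (\1_(`]a, b]%classic `&` I : set mR))).
  apply/integrableP; split; first by apply/measurable_EFinP; exact: measurable_indic.
  rewrite (_ : (\int[mu]_x _)%E = \int[mu]_x (\1_(`]a, b]%classic `&` I) x)%:E)%E.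
    by rewrite integral_indic// setIT (le_lt_trans leJ)// ltry.
  by apply: eq_integral => t _ /=; rewrite ger0_norm// indicE.
rewrite RintegralZr//; apply: ler_wpM2r; first exact: psn_ge0.
rewrite /Rintegral integral_indic// setIT.
rewrite -lee_fin fineK// ge0_fin_numE//.
by rewrite (le_lt_trans leJ)// ltry.
Qed.

Lemma step_cat a b c x : a <= b -> b <= c -> step a c x = step a b x + step b c x.
Proof.
move=> ab bc; apply/funext => t; change (step a c x t = step a b x t + step b c x t).
rewrite /step -scalerDl !indicE !in_setI; congr (_ *: x).
case: (t \in I) => /=; last by rewrite !andbF addr0.
rewrite !andbT.
have tE s1 s2 : (t \in (`]s1, s2]%classic : set R)) = (s1 < t <= s2).
  by apply/idP/idP => [/set_mem|h]; [|apply/mem_set]; rewrite /= in_itv.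
rewrite !tE; have [tb|tb] := leP t b; first by rewrite /= (le_trans tb bc) !andbT addr0.
by rewrite (le_lt_trans ab tb)/= add0r.
Qed.

Lemma step_nil a b x : b <= 0 -> step a b x = 0.
Proof.
move=> b0; apply/funext => t; rewrite /step indicE memNset ?scale0r//= !in_itv/=.
move=> [/andP[_ tb] /andP[t0 _]].
by have := lt_le_trans t0 (le_trans tb b0); rewrite ltxx.
Qed.

Lemma stepZ a b (r : R) x : step a b (r *: x) = r *: step a b x.
Proof. by apply/funext => t; rewrite /step/= scalerA mulrC -scalerA. Qed.

Lemma step_lin a b (r : R) x y : step a b (r *: x + y) = r *: step a b x + step a b y.
Proof.
apply/funext => t; change (step a b (r *: x + y) t = r *: step a b x t + step a b y t).
by rewrite /step scalerDr !scalerA mulrC.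
Qed.

Section one_functional.
Variables (F : (R -> E) -> R) (M : R).
Hypotheses (lF : linear_on V F) (bF : ball_bound V F M).

Let M0 : 0 <= M.
Proof.
have := bF (ps_mem0 V); rewrite psn0// (linear_on0 lF) normr0.
by move=> /(_ ler01).
Qed.

Lemma normr_step a b x : a <= b -> ps_mem X x ->
  `|F (step a b x)| <= M * ((b - a) * psn X x) `^ p^-1.
Proof.
move=> ab mx; apply: le_trans (ball_bound_root p2 lF bF (nice_step a b mx)) _.
apply: ler_wpM2l => //; apply: ge0_ler_powR.
- by rewrite invr_ge0 ltW.
- by rewrite nnegrE psn_int_ge0.
- by rewrite nnegrE mulr_ge0 ?psn_ge0// subr_ge0.
- exact: psn_int_step.
Qed.

(** By (K) this is, at almost every t, the change since time 0 of the pairing of x with v_p. *)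
Definition prim x (t : R) : R := F (step 0 t x).

Lemma step_prim t h x : 0 <= h -> ps_mem X x ->
  F (step t (t + h) x) = prim x (t + h) - prim x t.
Proof.
move=> h0 mx; rewrite /prim.
have th : t <= t + h by rewrite lerDl.
have [t0|/ltW t0] := leP 0 t.
  rewrite (@step_cat 0 t (t + h))// (linear_onD lF); [|exact: nice_step..].
  by rewrite addrAC subrr add0r.
rewrite (@step_nil 0 t)// (linear_on0 lF) subr0.
have [th0|/ltW th0] := leP (t + h) 0; first by rewrite !step_nil.
by rewrite (@step_cat t 0 (t + h))// (@step_nil t 0)// add0r.
Qed.

Lemma prim_hoelder x s t : s <= t -> ps_mem X x ->
  `|prim x t - prim x s| <= M * ((t - s) * psn X x) `^ p^-1.
Proof.
move=> st mx; have := @step_prim s (t - s) x.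
rewrite subr_ge0 addrC subrK => /(_ st mx) <-; exact: normr_step.
Qed.

(** Modulus of continuity at 0 of the Hoelder bounds; the shifts M + 1 and c + 1 admit M = 0 and c =
    0. *)
Lemma powR_small (c e : R) : 0 <= c -> 0 < e -> exists2 d : R, 0 < d &
  forall h, 0 <= h <= d -> M * (h * c) `^ p^-1 <= e.
Proof.
have M0' := M0; move=> c0 e0; pose k := (e / (M + 1)) `^ p.
have k0 : 0 < k by rewrite powR_gt0// divr_gt0//; lra.
exists (k / (c + 1)) => [|h /andP[h0 hd]]; first by rewrite divr_gt0//; lra.
have hc : h * c <= k.
  rewrite ler_pdivlMr in hd; last by lra.
  by apply: le_trans hd; apply: ler_wpM2l; lra.
have kE : k `^ p^-1 = e / (M + 1).
  by rewrite /k -powRrM mulfV ?gt_eqF// powRr1// divr_ge0; lra.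
apply: (@le_trans _ _ (M * (e / (M + 1)))).
  apply: ler_wpM2l => //; rewrite -kE.
  by apply: ge0_ler_powR; rewrite ?invr_ge0 ?nnegrE ?mulr_ge0 ?(ltW p0) ?(ltW k0).
rewrite mulrA ler_pdivrMr; last lra.
by rewrite mulrC; apply: ler_wpM2l; lra.
Qed.

Lemma continuous_prim x : ps_mem X x -> continuous (prim x).
Proof.
move=> mx t; apply/cvgrPdist_le => e e0.
have [d d0 hd] := powR_small (psn_ge0 X x) e0.
near=> s.
have st : `|s - t| <= d.
  by near: s; apply/nbhs_ballP; exists d => //= s; rewrite /ball/= distrC => /ltW.
have [ts|/ltW ts] := leP s t.
  apply: le_trans (prim_hoelder ts mx) _; apply: hd; rewrite subr_ge0 ts/=.
  by move: st; rewrite distrC; apply: le_trans; exact: ler_norm.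
rewrite distrC; apply: le_trans (prim_hoelder ts mx) _; apply: hd; rewrite subr_ge0 ts/=.
by move: st; apply: le_trans; exact: ler_norm.
Unshelve. all: by end_near. Qed.

(** For a constant vector the function is a difference of two values of the continuous function
    [prim], and at fixed t it is continuous in the vector; [smeas_comp_measurable] combines the
    two. *)
Lemma measurable_step h u : 0 <= h -> smeas X u ->
  measurable_fun setT (fun t : mR => F (step t (t + h) (u t))).
Proof.
move=> h0 su; apply: (smeas_comp_measurable (Phi := fun t x => F (step t (t + h) x)) su).
  move=> x mx.
  rewrite (_ : (fun _ => _) = fun t => prim x (t + h) - prim x t); last first.
    by apply/funext => t; rewrite step_prim.
  have mp : measurable_fun setT (prim x : mR -> R).
    by apply: continuous_measurable_fun; exact: continuous_prim.
  apply: measurable_funB => //.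
  by have := measurableT_comp mp (measurable_addr h).
move=> t w mw wu; apply/cvgrPdist_le => e e0.
have [d d0 hd] := powR_small h0 e0.
move/cvgrPdist_le : wu => /(_ _ d0); apply: filterS => k.
rewrite sub0r normrN ger0_norm ?psn_ge0// => hk.
have mut := su.1 t.
rewrite -(linear_onB lF); [|exact: nice_step..].
rewrite (_ : _ - _ = step t (t + h) (u t - w k)); last first.
  rewrite (_ : u t - w k = (-1) *: w k + u t); last by rewrite scaleN1r addrC.
  by rewrite step_lin scaleN1r addrC.
apply: le_trans (normr_step _ (ps_memB mut (mw k))) _; first by rewrite lerDl.
have -> : t + h - t = h by rewrite addrAC subrr add0r.
rewrite [h * _]mulrC psnB//; apply: hd.
by rewrite psn_ge0.
Qed.

(** The integrand of the average of F over forward intervals. Once (K) is known, [steklov] is the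
    pairing of u with the forward difference of v_p, but it is bounded and passed to the limit for
    an arbitrary functional. *)
Definition steklov_fun h u (t : R) : R :=
  \1_(`[0, T - h]%classic) t * F (step t (t + h) (u t)).

Definition steklov h u : R := h^-1 * \int[mu]_t steklov_fun h u t.

Lemma steklov_fun0 h u t : nice X T u -> t \notin `]0, T[ -> steklov_fun h u t = 0.
Proof.
move=> [_ u0 _] tT; rewrite /steklov_fun u0//.
rewrite (_ : step _ _ 0 = 0); first by rewrite (linear_on0 lF) mulr0.
by apply/funext => s; rewrite /step scaler0.
Qed.

Lemma integrable_steklov h u : 0 <= h -> nice X T u ->
  mu.-integrable setT (EFin \o steklov_fun h u).
Proof.
move=> h0 nu; have [su u0 iu] := nu.
have PV : 0 <= p^-1 by rewrite invr_ge0 ltW.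
have QV : 0 <= q^-1.
  have := pq; have : p^-1 <= 2^-1 by rewrite lef_pV2 ?posrE.
  lra.
apply: (@integrable_Rbound _ _ _ mu setT measurableT _
  (fun t => M * (p^-1 * (h * psn X (u t)) + \1_I t * q^-1))).
- apply: measurable_funM; first exact: measurable_indic.
  exact: measurable_step.
- apply: integrableRZ => //; apply: integrableRD => //; last exact: integrable_indic_oo_cst.
  by do 2 apply: integrableRZ => //.
- move=> t _; have [tT|tT] := boolP (t \in `]0, T[); last first.
    rewrite steklov_fun0// normr0 u0// psn0//.
    by rewrite mulr_ge0// addr_ge0 ?mulr_ge0// indicE ler0n.
  have mut := su.1 t.
  have IE : \1_I t = 1 :> R by rewrite indicE mem_set.
  rewrite /steklov_fun normrM IE mul1r.
  have le1 : `|\1_(`[0, T - h]%classic) t| <= 1 :> R.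
    by rewrite indicE; case: (_ \in _); rewrite /= ?normr1 ?normr0.
  apply: le_trans (ler_wpM2r (normr_ge0 _) le1) _; rewrite mul1r.
  have := ball_bound_young p2 pq lF bF (nice_step t (t + h) mut) => /le_trans; apply.
  apply: ler_wpM2l => //; rewrite lerD2r; apply: ler_wpM2l => //.
  have th : t <= t + h by rewrite lerDl.
  by have := psn_int_step th mut; rewrite addrAC subrr add0r.
Qed.

Lemma steklov_lin h (a : R) u v : 0 <= h -> nice X T u -> nice X T v ->
  steklov h (a *: u + v) = a * steklov h u + steklov h v.
Proof.
move=> h0 nu nv; rewrite /steklov mulrCA -mulrDr; congr (_ * _).
have iu := integrable_steklov h0 nu; have iv := integrable_steklov h0 nv.
rewrite -RintegralZl// -RintegralD//; last exact: integrableRZ.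
apply: eq_Rintegral => t _; rewrite /steklov_fun mulrCA -mulrDr; congr (_ * _).
have [su _ _] := nu; have [sv _ _] := nv.
rewrite -lF; [|by apply: nice_step; exact: su.1|by apply: nice_step; exact: sv.1].
by rewrite -step_lin.
Qed.

End one_functional.
End time_functional.

(** * Integrals over grids, increments and means *)

Section slices.
Context {R : realType}.
Notation mR := (measurableTypeR R).
Notation mu := (@lebesgue_measure R).

Lemma in_itvoc (a b t : R) : (t \in (`]a, b]%classic : set R)) = (a < t <= b).
Proof. by apply/idP/idP => [/set_mem|h]; [|apply/mem_set]; rewrite /= in_itv. Qed.

Lemma in_itvcc (a b t : R) : (t \in (`[a, b]%classic : set R)) = (a <= t <= b).
Proof. by apply/idP/idP => [/set_mem|h]; [|apply/mem_set]; rewrite /= in_itv. Qed.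

Lemma in_itvoo (a b t : R) : (t \in (`]a, b[%classic : set R)) = (a < t < b).
Proof. by apply/idP/idP => [/set_mem|h]; [|apply/mem_set]; rewrite /= in_itv. Qed.

Lemma sum_slices (h t : R) n : 0 < h ->
  \sum_(i < n) \1_(`]i%:R * h, i.+1%:R * h]%classic) t =
  \1_(`]0, n%:R * h]%classic) t :> R.
Proof.
move=> h0; elim: n => [|n IH].
  rewrite big_ord0 mul0r indicE in_itvoc (_ : _ && _ = false)//.
  by apply/negP => /andP[t0 /(lt_le_trans t0)]; rewrite ltxx.
rewrite big_ord_recr/= IH !indicE !in_itvoc.
have nh : 0 <= n%:R * h by rewrite mulr_ge0// ltW.
have nn : n%:R * h <= n.+1%:R * h by rewrite ler_pM2r// ler_nat.
have [tn|tn] := leP t (n%:R * h); first by rewrite /= (le_trans tn nn) !andbT addr0.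
by rewrite (le_lt_trans nh tn)/= add0r.
Qed.

Lemma integrable_indicM (A : set mR) (f : mR -> R) : measurable A ->
  mu.-integrable setT (EFin \o f) ->
  mu.-integrable setT (EFin \o (fun t => \1_A t * f t)).
Proof.
move=> mA fi; have mf := (measurable_EFinP _ _).1 (measurable_int _ fi).
apply: le_integrable fi => //.
  by apply/measurable_EFinP; apply: measurable_funM => //; exact: measurable_indic.
move=> t _; rewrite /= lee_fin normrM indicE; case: (_ \in _); rewrite /= ?normr1 ?mul1r//.
by rewrite normr0 mul0r.
Qed.

Lemma Rintegral_slices (f : mR -> R) h n : 0 < h ->
  mu.-integrable setT (EFin \o f) ->
  \int[mu]_t (\1_(`]0, n%:R * h]%classic) t * f t) =
  \int[mu]_t (\sum_(i < n) \1_(`]0, h]%classic) t * f (t + i%:R * h)).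
Proof.
move=> h0 fi.
have i1 (i : 'I_n) : mu.-integrable setT
    (EFin \o (fun t => \1_(`]i%:R * h, i.+1%:R * h]%classic) t * f t)).
  by apply: integrable_indicM.
transitivity (\sum_(i < n) \int[mu]_t (\1_(`]i%:R * h, i.+1%:R * h]%classic) t * f t)).
  rewrite -Rintegral_sum//; apply: eq_Rintegral => t _.
  by rewrite -mulr_suml sum_slices.
rewrite Rintegral_sum//; last first.
  by move=> i; apply: integrable_indicM => //; exact: integrable_addr.
apply: eq_bigr => i _; rewrite -(Rintegral_addr (i%:R * h))//.
apply: eq_Rintegral => t _; congr (_ * _); rewrite !indicE !in_itvoc.
by rewrite ltrDr -natr1 mulrDl mul1r [_ + h]addrC lerD2r.
Qed.

Lemma Rintegral_increment (f : mR -> R) b h : 0 <= b -> 0 < h ->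
  mu.-integrable setT (EFin \o f) ->
  \int[mu]_t (\1_(`]0, b]%classic) t * (f (t + h) - f t)) =
  \int[mu]_t (\1_(`]b, b + h]%classic) t * f t) -
  \int[mu]_t (\1_(`]0, h]%classic) t * f t).
Proof.
move=> b0 h0 fi.
have ish : mu.-integrable setT (EFin \o (fun t => \1_(`]0, b]%classic) t * f (t + h))).
  by apply: integrable_indicM => //; exact: integrable_addr.
have e1 : \int[mu]_t (\1_(`]0, b]%classic) t * f (t + h)) =
    \int[mu]_t (\1_(`]h, b + h]%classic) t * f t).
  rewrite -[RHS](Rintegral_addr h); last by apply: integrable_indicM.
  apply: eq_Rintegral => t _; congr (_ * _); rewrite !indicE !in_itvoc.
  by rewrite ltrDr lerD2r.
under eq_Rintegral do rewrite mulrBr.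
rewrite RintegralB//; last exact: integrable_indicM.
rewrite e1 -!RintegralB//; try exact: integrable_indicM.
apply: eq_Rintegral => t _; rewrite -!mulrBl; congr (_ * _).
rewrite !indicE !in_itvoc.
have bh : b <= b + h by rewrite lerDl ltW.
have hbh : h <= b + h by rewrite lerDr.
have [t0|t0] := leP t 0.
  by rewrite (le_gtF (ltW (le_lt_trans t0 h0))) (le_gtF (le_trans t0 b0)) subrr.
have [th|th] := leP t h; have [tb|tb] := leP t b => /=.
- by [].
- by rewrite (le_trans th hbh) !subrr.
- by rewrite (le_trans tb bh) !subrr.
- by [].
Qed.

Lemma norm_mean_diff (A B C e : R) : `|A - C| <= e / 2 -> `|B| <= e / 2 ->
  `|C - (A - B)| <= e.
Proof.
move=> h1 h2; have -> : C - (A - B) = B - (A - C) by ring.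
by apply: le_trans (ler_normB _ _) _; lra.
Qed.

Lemma Rintegral_indic_oc (a b : R) : a <= b ->
  \int[mu]_t \1_(`]a, b]%classic) t = b - a.
Proof.
move=> ab; have mE : mu (`]a, b]%classic : set mR) = (b - a)%:E.
  rewrite lebesgue_measure_itv/= lte_fin; case: ltP => [_|ba]; first by rewrite -EFinB.
  have -> : a = b by apply/le_anti; rewrite ab ba.
  by rewrite subrr.
rewrite /Rintegral integral_indic//.
by rewrite setIT [X in fine X](_ : _ = (b - a)%:E).
Qed.

Lemma mean_near (f : mR -> R) (a h c e : R) : 0 < h ->
  mu.-integrable setT (EFin \o f) ->
  (forall t, a < t <= a + h -> `|f t - c| <= e) ->
  `|h^-1 * \int[mu]_t (\1_(`]a, a + h]%classic) t * f t) - c| <= e.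
Proof.
move=> h0 fi fe.
have i1 (c' : R) : mu.-integrable setT (EFin \o (fun t => \1_(`]a, a + h]%classic) t * c')).
  rewrite (_ : _ \o _ = EFin \o (fun t => c' * \1_(`]a, a + h]%classic) t)).
    by apply: integrableRZ => //; exact: integrable_indic_itv.
  by apply/funext => t /=; rewrite mulrC.
have v1 (c' : R) : \int[mu]_t (\1_(`]a, a + h]%classic) t * c') = h * c'.
  rewrite RintegralZr//; last exact: integrable_indic_itv.
  by rewrite Rintegral_indic_oc ?lerDl ?(ltW h0)// addrAC subrr add0r.
have fi' := integrable_indicM (measurable_itv `]a, a + h]) fi.
have -> : h^-1 * \int[mu]_t (\1_(`]a, a + h]%classic) t * f t) - c =
    h^-1 * \int[mu]_t (\1_(`]a, a + h]%classic) t * (f t - c)).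
  under [in RHS]eq_Rintegral do rewrite mulrBr.
  by rewrite RintegralB// v1 mulrBr mulrA mulVf ?gt_eqF// mul1r.
have id : mu.-integrable setT (EFin \o (fun t => \1_(`]a, a + h]%classic) t * (f t - c))).
  rewrite (_ : (fun t => _) = (fun t => \1_(`]a, a + h]%classic) t * f t - \1_(`]a, a + h]%classic) t * c)).
    exact: integrableRB.
  by apply/funext => t; rewrite mulrBr.
rewrite normrM gtr0_norm ?invr_gt0// ler_pdivrMl// -v1.
apply: le_trans (le_normr_Rintegral measurableT id) _.
apply: le_Rintegral => //.
  exact: integrableRnorm.
move=> t _; rewrite normrM indicE in_itvoc; case: (boolP (a < t <= a + h)) => ht; last by rewrite normr0 !mul0r.
by rewrite normr1 !mul1r fe.
Qed.

End slices.

(** * The averages are bounded by the norm of the functional *)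

Section steklov_bound.
Context {R : realType} {p q : R} {E : lmodType R} (X : pseminorm p E).
Hypothesis p2 : 2 <= p.
Hypothesis pq : p^-1 + q^-1 = 1.
Notation mR := (measurableTypeR R).
Notation mu := (@lebesgue_measure R).
Variable T : R.
Hypothesis T0 : 0 < T.
Implicit Types (u v : R -> E) (x y : E).

Let p0 : 0 < p. Proof. exact: ge2_gt0. Qed.

Notation V := (nice_pseminorm X (ge2_gt0 p2) T).
Notation step := (step (E := E) T).
Variables (F : (R -> E) -> R) (M : R).
Hypotheses (lF : linear_on V F) (bF : ball_bound V F M).

Let M0 : 0 <= M.
Proof.
have := bF (ps_mem0 V); rewrite psn0// (linear_on0 lF) normr0.
by move=> /(_ ler01).
Qed.

(** [psn] is not subadditive in general; the bound holds because at each time at most one of the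
    disjoint steps is nonzero. *)
Lemma psn_int_slices (x : nat -> E) (s h : R) n : 0 < h -> (forall i, ps_mem X (x i)) ->
  psn_int X (\sum_(i < n) step (s + i%:R * h) (s + i.+1%:R * h) (x i)) <=
  \sum_(i < n) h * psn X (x i).
Proof.
move=> h0 mx.
pose f i := step (s + i%:R * h) (s + i.+1%:R * h) (x i).
have nf i : nice X T (f i) by exact: nice_step.
have pw n' t : psn X ((\sum_(i < n') f i) t) <= \sum_(i < n') psn X (f i t).
  elim: n' => [|n' IH]; first by rewrite !big_ord0 psn0.
  rewrite !big_ord_recr/=.
  have fD : (\sum_(i < n') f i + f n') t = (\sum_(i < n') f i) t + f n' t by [].
  rewrite fD.
  have [tn|tn] := boolP (s + n'%:R * h < t).
    have -> : (\sum_(i < n') f i) t = 0.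
      rewrite fct_sumE; apply: big1 => i _; rewrite /f /step indicE in_setI in_itvoc.
      rewrite (lt_geF (le_lt_trans _ tn)) ?andbF ?scale0r//.
      by rewrite lerD2l ler_pM2r// ler_nat.
    by rewrite add0r lerDr sumr_ge0// => i _; exact: psn_ge0.
  have -> : f n' t = 0.
    by rewrite /f /step indicE in_setI in_itvoc (negbTE tn) scale0r.
  by rewrite psn0// !addr0.
rewrite {1}/psn_int.
apply: (@le_trans _ _ (\int[mu]_t \sum_(i < n) psn X (f i t))).
  apply: le_Rintegral => //.
  - by have : nice X T (\sum_(i < n) f i) by [apply: (ps_mem_sum (X := V)) => i _; exact: nf]; case.
  - by apply: integrableR_sum => // i; case: (nf i).
rewrite Rintegral_sum//; last by move=> i; case: (nf i).
apply: ler_sum => i _; apply: le_trans (psn_int_step p2 T _ (mx i)) _.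
  by rewrite lerD2l ler_pM2r// ler_nat.
by rewrite (_ : _ - _ = h)//; rewrite -natr1; ring.
Qed.

(** The time integral is folded onto the offsets t in ]0, h]. Integrating Young's bound over them
    gives h M (1/p + 1/q) = h M, and the prefactor 1/h leaves exactly M. *)
Lemma steklov_bounded h u : 0 < h -> nice X T u -> psn_int X u <= 1 ->
  `|steklov T F h u| <= M.
Proof.
move=> h0 nu un; have [su u0 iu] := nu.
have [n hn] : exists n : nat, T <= n%:R * h.
  exists (Num.truncn (T / h)).+1; rewrite -ler_pdivrMr//.
  exact/ltW/truncnS_gt.
pose f := steklov_fun T F h u.
have fi : mu.-integrable setT (EFin \o f) by exact: (integrable_steklov pq lF bF (ltW h0) nu).
have psi_i := iu.
rewrite /steklov (_ : \int[mu]_t _ = \int[mu]_t (\1_(`]0, n%:R * h]%classic) t * f t)); last first.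
  apply: eq_Rintegral => t _; rewrite indicE in_itvoc.
  have [//|tT] := boolP (0 < t <= n%:R * h); first by rewrite mul1r.
  rewrite mul0r (steklov_fun0 lF)//; apply: contra tT; rewrite in_itv/= => /andP[-> tT].
  by rewrite (le_trans (ltW tT)).
rewrite Rintegral_slices// normrM gtr0_norm ?invr_gt0// ler_pdivrMl//.
have gi : mu.-integrable setT (EFin \o (fun t => \sum_(i < n) \1_(`]0, h]%classic) t * f (t + i%:R * h))).
  by apply: integrableR_sum => // i; apply: integrable_indicM => //; exact: integrable_addr.
apply: le_trans (le_normr_Rintegral measurableT gi) _.
(* Since the grid values are merged into one value of F before Young's inequality is used, the
   constant 1/q is paid once per offset and not once per slice. *)
pose g t := M * (p^-1 * (h * \sum_(i < n) \1_(`]0, h]%classic) t * psn X (u (t + i%:R * h))) + \1_(`]0, h]%classic) t * q^-1).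
have i1 (i : 'I_n) : mu.-integrable setT (EFin \o (fun t => \1_(`]0, h]%classic) t * psn X (u (t + i%:R * h)))).
  by apply: integrable_indicM => //; exact: (@integrable_addr _ _ (fun t => psn X (u t))).
have isum : mu.-integrable setT (EFin \o (fun t => \sum_(i < n) \1_(`]0, h]%classic) t * psn X (u (t + i%:R * h)))).
  exact: integrableR_sum.
have iq : mu.-integrable setT (EFin \o (fun t => \1_(`]0, h]%classic) t * q^-1)).
  rewrite (_ : _ \o _ = EFin \o (fun t => q^-1 * \1_(`]0, h]%classic) t)).
    by apply: integrableRZ => //; exact: integrable_indic_itv.
  by apply/funext => t /=; rewrite mulrC.
have ig : mu.-integrable setT (EFin \o g).
  by apply: integrableRZ => //; apply: integrableRD => //; do 2 apply: integrableRZ => //.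
apply: (@le_trans _ _ (\int[mu]_t g t)).
  apply: le_Rintegral => //.
    exact: integrableRnorm.
  move=> t _; rewrite /g -mulr_sumr indicE.
  case: (_ \in _); last by rewrite !mul0r normr0 big1 ?mulr0 ?addr0 ?mulr0// => i _; rewrite mul0r.
  rewrite !mul1r.
  (* The cut-off to [0, T - h] is moved into the vectors, so that all slices have the same form. *)
  pose x (i : nat) := \1_(`[0, T - h]%classic) (t + i%:R * h) *: u (t + i%:R * h).
  have mx i : ps_mem X (x i) by apply: ps_memZ => //; exact: su.1.
  have -> : \sum_(i < n) f (t + i%:R * h) =
      F (\sum_(i < n) step (t + i%:R * h) (t + i.+1%:R * h) (x i)).
    rewrite (linear_on_sum lF); last by move=> i; exact: nice_step.
    apply: eq_bigr => i _; rewrite /f /steklov_fun /x stepZ (linear_onZ lF)//; last first.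
      by apply: nice_step => //; exact: su.1.
    by rewrite -natr1 mulrDl mul1r addrA.
  apply: le_trans (ball_bound_young p2 pq lF bF _) _.
    by apply: (ps_mem_sum (X := V)) => i _; exact: nice_step.
  apply: ler_wpM2l; first exact: M0.
  rewrite lerD2r; apply: ler_wpM2l; first by rewrite invr_ge0 ltW.
  apply: le_trans (psn_int_slices t n h0 mx) _.
  rewrite -mulr_sumr; apply: ler_wpM2l; first exact: ltW.
  apply: ler_sum => i _; rewrite mul1r /x psnZ; last exact: su.1.
  rewrite indicE; case: (_ \in _); first by rewrite normr1 powR1 mul1r.
  by rewrite normr0 powR0 ?mul0r ?psn_ge0// gt_eqF.
rewrite RintegralZl//; last by apply: integrableRD => //; do 2 apply: integrableRZ => //.
rewrite RintegralD//; last by do 2 apply: integrableRZ => //.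
rewrite RintegralZl//; last by apply: integrableRZ.
rewrite RintegralZl// -(@Rintegral_slices _ (fun t => psn X (u t)))//.
have -> : \int[mu]_t (\1_(`]0, h]%classic) t * q^-1) = h * q^-1.
  rewrite RintegralZr//; last exact: integrable_indic_itv.
  by rewrite Rintegral_indic_oc ?(ltW h0)// subr0.
have le1 : \int[mu]_t (\1_(`]0, n%:R * h]%classic) t * psn X (u t)) <= 1.
  apply: le_trans un; apply: le_Rintegral => //; first exact: integrable_indicM.
  move=> t _; rewrite indicE; case: (_ \in _); first by rewrite mul1r.
  by rewrite mul0r psn_ge0.
rewrite mulrC; apply: ler_wpM2r; first exact: M0.
have pV0 : 0 <= p^-1 by rewrite invr_ge0 ltW.
have h1 : h * \int[mu]_t (\1_(`]0, n%:R * h]%classic) t * psn X (u t)) <= h.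
  by rewrite ler_piMr// ltW.
apply: (@le_trans _ _ (p^-1 * h + h * q^-1)); first by rewrite lerD2r ler_wpM2l.
by rewrite [h * _]mulrC -mulrDl pq mul1r.
Qed.

End steklov_bound.

(** * Convergence of translations and of averages *)

Section steklov_convergence.
Context {R : realType} {p q : R} {E : lmodType R} (X : pseminorm p E).
Hypothesis p2 : 2 <= p.
Hypothesis pq : p^-1 + q^-1 = 1.
Notation mR := (measurableTypeR R).
Notation mu := (@lebesgue_measure R).
Variable T : R.
Hypothesis T0 : 0 < T.
Implicit Types (u v : R -> E) (x y : E).

Let p0 : 0 < p. Proof. exact: ge2_gt0. Qed.

Notation V := (nice_pseminorm X (ge2_gt0 p2) T).
Notation step := (step (E := E) T).

Definition time_shift (h : R) u : R -> E := fun t => \1_(`]0, T[%classic) t *: u (t + h).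

Lemma nice_shift h u : nice X T u -> nice X T (time_shift h u).
Proof.
move=> [su u0 iu]; have sh := smeas_addr h su; apply: niceP => //.
- exact: smeas_indic.
- by move=> t tT; rewrite /time_shift indicE memNset ?scale0r//; exact/negP.
- exists (fun t => psn X (u (t + h))); first exact: (@integrable_addr _ _ (fun t => psn X (u t))).
  move=> t; rewrite /time_shift psnZ; last exact: su.1.
  rewrite indicE; case: (_ \in _); first by rewrite normr1 powR1 mul1r.
  by rewrite normr0 powR0 ?mul0r ?psn_ge0// gt_eqF.
Qed.

Lemma psn_int_shift h u : nice X T u -> psn_int X (time_shift h u) <= psn_int X u.
Proof.
move=> nu; have [su u0 iu] := nu; have [_ _ is_] := nice_shift h nu.
have ish : mu.-integrable setT (EFin \o (fun t => psn X (u (t + h)))).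
  exact: (@integrable_addr _ _ (fun t => psn X (u t))).
rewrite /psn_int -[leRHS](Rintegral_addr h)//; apply: le_Rintegral => //.
move=> t _; rewrite /time_shift psnZ; last exact: su.1.
rewrite indicE; case: (_ \in _); first by rewrite normr1 powR1 mul1r.
by rewrite normr0 powR0 ?mul0r ?psn_ge0// gt_eqF.
Qed.

Lemma shift_lin h (a : R) u v : time_shift h (a *: u + v) = a *: time_shift h u + time_shift h v.
Proof.
apply/funext => t; change (\1_(`]0, T[%classic) t *: (a *: u (t + h) + v (t + h)) =
  a *: (\1_(`]0, T[%classic) t *: u (t + h)) + \1_(`]0, T[%classic) t *: v (t + h)).
by rewrite scalerDr !scalerA mulrC.
Qed.

Lemma step0E b x : b < T -> (fun t => \1_(`]0, b]%classic) t *: x) = step 0 b x.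
Proof.
move=> bT; apply/funext => t; rewrite /step !indicE in_setI in_itvoc in_itvoo.
by have [t0|//] := ltP 0 t; have [tb|//] := leP t b; rewrite /= (le_lt_trans tb bT).
Qed.

Variables (h : nat -> R).
Hypothesis h0 : forall n, 0 < h n.
Hypothesis hcvg : h n @[n --> \oo] --> 0.

Let h_small (d : R) : 0 < d -> \forall n \near \oo, h n <= d.
Proof.
move=> d0; move/cvgrPdist_le : hcvg => /(_ _ d0); apply: filterS => n.
by rewrite sub0r normrN gtr0_norm.
Qed.

(** Translations do not increase [psn_int], so the property is closed. For 1_]0,b] x the difference
    is a step supported on ]b - h, b]. *)
Lemma shift_cvg u : nice X T u -> ps_cvg V (fun n => time_shift (h n) u) u.
Proof.
apply: (nice_ind p0 T0 (P := fun u => ps_cvg V (fun n => time_shift (h n) u) u)).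
- move=> a u1 u2 n1 n2 c1 c2.
  rewrite (_ : (fun n => _) = fun n => a *: time_shift (h n) u1 + time_shift (h n) u2).
    by apply: ps_cvg_lin => // k; exact: nice_shift.
  by apply/funext => n; rewrite shift_lin.
- move=> u_ u1 nu_ nu1 cu_ cu1; apply/cvgrPdist_le => e e0.
  have [K K1 hK] := psnD_le V.
  have K0 : 0 < K by lra.
  have d0 : 0 < e / (4 * (K * K)) by rewrite divr_gt0// !mulr_gt0.
  have : \forall j \near \oo, psn_int X (u_ j - u1) <= e / (4 * (K * K)).
    move/cvgrPdist_le : cu1 => /(_ _ d0); apply: filterS => j.
    by rewrite sub0r normrN ger0_norm// psn_int_ge0.
  move=> [j _ /(_ j (leqnn j)) hj].
  move/cvgrPdist_le : (cu_ j) => /(_ _ d0); apply: filterS => n.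
  rewrite !sub0r !normrN !ger0_norm ?psn_ge0// => hn.
  have n1 : nice X T (u_ j - u1) by exact: (ps_memB (X := V) (nu_ j) nu1).
  have n2 : nice X T (u1 - u_ j) by exact: (ps_memB (X := V) nu1 (nu_ j)).
  have n3 : nice X T (time_shift (h n) (u_ j) - u_ j).
    exact: (ps_memB (X := V) (nice_shift (h n) (nu_ j)) (nu_ j)).
  have -> : time_shift (h n) u1 - u1 =
      time_shift (h n) (u1 - u_ j) + ((time_shift (h n) (u_ j) - u_ j) + (u_ j - u1)).
    have -> : u1 - u_ j = (-1) *: u_ j + u1 by rewrite scaleN1r addrC.
    rewrite shift_lin scaleN1r.
    move: (time_shift (h n) (u_ j)) (time_shift (h n) u1) => s S.
    by rewrite [s - _ + _]addrA subrK addrACA addNr add0r.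
  have i1 : psn_int X (time_shift (h n) (u1 - u_ j)) <= e / (4 * (K * K)).
    apply: le_trans (psn_int_shift _ n2) _; have := psnB (X := V) nu1 (nu_ j).
    by move=> /= ->.
  have Ke : K * (e / (4 * (K * K)) + K * (e / (4 * (K * K)) + e / (4 * (K * K)))) <= e.
    have -> : K * (e / (4 * (K * K)) + K * (e / (4 * (K * K)) + e / (4 * (K * K)))) =
        e / 4 * K^-1 + e / 2.
      by field; rewrite gt_eqF.
    have : e / 4 * K^-1 <= e / 4 by rewrite ler_piMr ?invf_le1// divr_ge0// ltW.
    lra.
  apply: le_trans Ke; apply: le_trans (hK _ _ (nice_shift (h n) n2) (ps_memD (X := V) n3 n1)) _.
  apply: ler_wpM2l; first exact: ltW.
  apply: lerD => //; apply: le_trans (hK _ _ n3 n1) _.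
  by apply: ler_wpM2l; [exact: ltW | exact: lerD].
- move=> b x /andP[b0 bT] mx; rewrite step0E//; apply/cvgrPdist_le => e e0.
  have d0 : 0 < e / (psn X x + 1) by rewrite divr_gt0//; have := psn_ge0 X x; lra.
  apply: filterS (h_small d0) => n hn.
  rewrite sub0r normrN ger0_norm ?psn_ge0//.
  have -> : time_shift (h n) (step 0 b x) - step 0 b x = - step (b - h n) b x.
    apply/funext => t.
    change (\1_(`]0, T[%classic) t *: (\1_(`]0, b] `&` `]0, T[) (t + h n) *: x) -
      \1_(`]0, b] `&` `]0, T[) t *: x = - (\1_(`](b - h n), b] `&` `]0, T[) t *: x)).
    rewrite scalerA -scalerBl -scaleNr; congr (_ *: x).
    rewrite !indicE !in_setI !in_itvoo !in_itvoc.
    have [t0|t0] := ltP 0 t; last by rewrite /= andbF mul0r !subr0 oppr0.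
    have [tT|tT] := ltP t T; last by rewrite /= !andbF mul0r !subr0 oppr0.
    have th : 0 < t + h n by rewrite addr_gt0.
    rewrite th /= !andbT mul1r ltrBlDr.
    have [tb|tb] := leP (t + h n) b.
      have tb' : t <= b by apply: le_trans tb; rewrite lerDl ltW.
      by rewrite (le_lt_trans tb bT) tb'/= subrr oppr0.
    by case: (t <= b); rewrite /= ?sub0r ?subr0 ?oppr0.
  rewrite [psn _ _](_ : _ = psn_int X (- step (b - h n) b x))//.
  have ms := nice_step p2 T (b - h n) b mx.
  have -> : psn_int X (- step (b - h n) b x) = psn_int X (step (b - h n) b x).
    exact: (psnN (X := V) ms).
  have bh : b - h n <= b by rewrite gerBl ltW.
  apply: le_trans (psn_int_step p2 T bh mx) _.
  rewrite opprB addrCA subrr addr0.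
  rewrite ler_pdivlMr in hn; last by have := psn_ge0 X x; lra.
  by apply: le_trans hn; rewrite ler_pM2l// lerDl.
Qed.

Variables (F : (R -> E) -> R) (M : R).
Hypotheses (lF : linear_on V F) (bF : ball_bound V F M).

Let M0 : 0 <= M.
Proof.
have := bF (ps_mem0 V); rewrite psn0// (linear_on0 lF) normr0.
by move=> /(_ ler01).
Qed.

Lemma linear_on_steklov k : 0 < k -> linear_on V (steklov T F k).
Proof. by move=> k0 a u v nu nv; exact: (steklov_lin pq lF bF _ (ltW k0)). Qed.

Lemma ball_bound_steklov k : 0 < k -> ball_bound V (steklov T F k) M.
Proof. by move=> k0 u nu un; exact: (steklov_bounded pq lF bF k0 nu un). Qed.

Lemma integrable_prim x (a : R) : 0 <= a -> ps_mem X x ->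
  mu.-integrable setT (EFin \o (fun t => \1_(`]0, a]%classic) t * prim T F x t)).
Proof.
move=> a0 mx.
apply: (@integrable_Rbound _ _ _ mu setT measurableT _
  (fun t => M * (a * psn X x) `^ p^-1 * \1_(`]0, a]%classic) t)).
- apply: measurable_funM; first exact: measurable_indic.
  by apply: continuous_measurable_fun; exact: (continuous_prim lF bF).
- by apply: integrableRZ => //; exact: integrable_indic_itv.
- move=> t _; rewrite normrM indicE in_itvoc.
  case: (boolP (0 < t <= a)) => [/andP[t0 ta]|_]; last by rewrite normr0 mul0r mulr0.
  rewrite normr1 mul1r mulr1.
  have := prim_hoelder lF bF (ltW t0) mx.
  rewrite {2}/prim step_nil ?lexx// (linear_on0 lF) !subr0 => /le_trans; apply.
  apply: ler_wpM2l; first exact: M0.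
  apply: ge0_ler_powR; rewrite ?nnegrE ?invr_ge0 ?mulr_ge0 ?psn_ge0 ?(ltW p0) ?(ltW t0)//.
  by rewrite ler_wpM2r// psn_ge0.
Qed.

(** The index from which the bound holds is independent of G, so it serves F and all of its averages
    at once. *)
Lemma cvg_functional (u_ : nat -> R -> E) u (e : R) :
  0 < e -> (forall k, nice X T (u_ k)) -> nice X T u -> ps_cvg V u_ u ->
  \forall j \near \oo, forall G, linear_on V G -> ball_bound V G M -> `|G (u_ j - u)| <= e.
Proof.
move=> e0 nu_ nu cu.
have [d d0 hd] := powR_small lF bF ler01 e0.
move/cvgrPdist_le : cu => /(_ _ d0); apply: filterS => j.
rewrite sub0r normrN ger0_norm ?psn_ge0// => hj G lG bG.
apply: le_trans (ball_bound_root p2 lG bG (ps_memB (X := V) (nu_ j) nu)) _.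
rewrite -[psn _ _]mulr1; apply: hd; rewrite psn_ge0//.
Qed.

(** The uniform bound on the averages makes the property closed. For 1_]0,b] x the average is a mean
    of increments of [prim]; it telescopes to the mean of [prim] just after b minus its mean just
    after 0, and [prim] is continuous and vanishes at 0. *)
Lemma steklov_cvg u : nice X T u -> steklov T F (h n) u @[n --> \oo] --> F u.
Proof.
apply: (nice_ind p0 T0 (P := fun u => steklov T F (h n) u @[n --> \oo] --> F u)).
- move=> a u1 u2 n1 n2 c1 c2; rewrite lF//.
  rewrite (_ : (fun n => _) = fun n => a * steklov T F (h n) u1 + steklov T F (h n) u2).
    by apply: cvgD => //; exact: cvgMr.
  by apply/funext => n; rewrite linear_on_steklov.
- move=> u_ u1 nu_ nu1 cu_ cu1; apply/cvgrPdist_le => e e0.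
  have e3 : 0 < e / 3 by rewrite divr_gt0.
  have [j _ /(_ j (leqnn j)) hj] := cvg_functional e3 nu_ nu1 cu1.
  move/cvgrPdist_le : (cu_ j) => /(_ _ e3); apply: filterS => n.
  have := hj _ lF bF; have := hj _ (linear_on_steklov (h0 n)) (ball_bound_steklov (h0 n)).
  rewrite (linear_onB lF (nu_ j) nu1) (linear_onB (linear_on_steklov (h0 n)) (nu_ j) nu1).
  rewrite !ler_norml => /andP[? ?] /andP[? ?] /andP[? ?]; apply/andP; split; lra.
- move=> b x /andP[b0 bT] mx; rewrite step0E//.
  rewrite -/(prim T F x b); apply/cvgrPdist_le => e e0.
  have e2 : 0 < e / 2 by rewrite divr_gt0.
  have [d d0 hd] := powR_small lF bF (psn_ge0 X x) e2.
  have bT0 : 0 < T - b by rewrite subr_gt0.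
  apply: filterS2 (h_small d0) (h_small bT0) => n hn hbT.
  (* [prim] is cut off far enough to be integrable without affecting any time up to b + h n. *)
  pose f t := \1_(`]0, b + T]%classic) t * prim T F x t.
  have fi : mu.-integrable setT (EFin \o f).
    by apply: integrable_prim => //; rewrite addr_ge0// ltW.
  have hn0 := h0 n.
  have -> : steklov T F (h n) (step 0 b x) = (h n)^-1 * \int[mu]_t (\1_(`]0, b]%classic) t * (f (t + h n) - f t)).
    congr (_ * _); apply: eq_Rintegral => t _; rewrite /steklov_fun.
    have -> : step 0 b x t = \1_(`]0, b]%classic) t *: x by rewrite -step0E.
    rewrite stepZ (linear_onZ lF); last exact: nice_step.
    rewrite !indicE in_itvcc in_itvoc.
    case: (boolP (0 < t <= b)) => [/andP[t0 tb]|_]; last by rewrite !mul0r mulr0.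
    rewrite !mul1r (ltW t0)/= (_ : t <= T - h n) ?mul1r; last by lra.
    rewrite (step_prim lF _ (ltW hn0) mx) /f !indicE !in_itvoc.
    have q1 : t + h n <= b + T by rewrite lerD// (le_trans hbT)// gerBl ltW.
    have q2 : t <= b + T by rewrite (le_trans tb)// lerDl ltW.
    by rewrite t0 q2 addr_gt0//= q1 !mul1r.
  rewrite Rintegral_increment// ?(ltW b0)// mulrBr.
  have pd s t : s <= t -> t <= s + h n -> `|prim T F x t - prim T F x s| <= e / 2.
    move=> st ts; apply: le_trans (prim_hoelder lF bF st mx) _; apply: hd.
    by rewrite subr_ge0 st/= lerBlDl (le_trans ts)// lerD2l.
  have T0' := T0.
  have m1 : `|(h n)^-1 * \int[mu]_t (\1_(`]b, b + h n]%classic) t * f t) - prim T F x b| <= e / 2.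
    apply: mean_near => // t /andP[bt tb].
    rewrite /f indicE in_itvoc (lt_trans b0 bt)/= (_ : t <= b + T) ?mul1r; last lra.
    by apply: pd => //; exact: ltW.
  have m2 : `|(h n)^-1 * \int[mu]_t (\1_(`]0, 0 + h n]%classic) t * f t) - 0| <= e / 2.
    apply: mean_near => // t /andP[t0 th].
    rewrite /f indicE in_itvoc t0/= (_ : t <= b + T) ?mul1r; last lra.
    rewrite -(_ : prim T F x 0 = 0); last by rewrite /prim step_nil ?lexx// (linear_on0 lF).
    by apply: pd => //; exact: ltW.
  by rewrite add0r subr0 in m2; exact: norm_mean_diff.
Qed.

Lemma steklov_shift_cvg u : nice X T u ->
  steklov T F (h n) (time_shift (h n) u) @[n --> \oo] --> F u.
Proof.
move=> nu; apply/cvgrPdist_le => e e0; have e2 : 0 < e / 2 by rewrite divr_gt0.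
have ns n := nice_shift (h n) nu.
have c1 := cvg_functional e2 ns nu (shift_cvg nu).
have := steklov_cvg nu => /cvgrPdist_le /(_ _ e2) c2.
apply: filterS2 c1 c2 => n k1 k2.
have := k1 _ (linear_on_steklov (h0 n)) (ball_bound_steklov (h0 n)).
rewrite (linear_onB (linear_on_steklov (h0 n)) (ns n) nu); move: k2.
rewrite !ler_norml => /andP[? ?] /andP[? ?].
by apply/andP; split; lra.
Qed.

End steklov_convergence.

(** * The energy identity in an abstract space *)

Section averages.
Context {R : realType}.
Notation mR := (measurableTypeR R).
Notation mu := (@lebesgue_measure R).

Lemma ae_le_Rintegral (f g : mR -> R) : mu.-integrable setT (EFin \o f) ->
  mu.-integrable setT (EFin \o g) -> {ae mu, forall t, f t <= g t} ->
  \int[mu]_t f t <= \int[mu]_t g t.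
Proof.
move=> fi gi fg; pose f' t := Num.min (f t) (g t).
have mf := (measurable_EFinP _ _).1 (measurable_int _ fi).
have mg := (measurable_EFinP _ _).1 (measurable_int _ gi).
have f'i : mu.-integrable setT (EFin \o f').
  apply: (@integrable_Rbound _ _ _ mu setT measurableT _ (fun t => `|f t| + `|g t|)).
  - exact: measurable_minr.
  - by apply: integrableRD => //; exact: integrableRnorm.
  - move=> t _; rewrite /f' /Num.min; case: ifP => _; last by rewrite lerDr.
    by rewrite lerDl.
have -> : \int[mu]_t f t = \int[mu]_t f' t.
  apply: ae_eq_Rintegral_gen; apply: (ae_mono fg) => t h _.
  by rewrite /f' min_l.
by apply: le_Rintegral => // t _; rewrite /f' ge_min lexx orbT.
Qed.

Lemma integrable_average_cvg (f : mR -> R) (h : nat -> R) :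
  mu.-integrable setT (EFin \o f) -> (forall n, 0 < h n) -> h n @[n --> \oo] --> 0 ->
  {ae mu, forall b, (h n)^-1 * \int[mu]_t (\1_(`]b, b + h n]%classic) t * f t) @[n --> \oo] --> f b}.
Proof.
move=> fi h0 hc.
have iD (A : set mR) : measurable A -> mu.-integrable A (EFin \o f).
  by move=> mA; exact: integrableS fi.
have lf : locally_integrable [set: R] f.
  by apply: open_integrable_locally => //; exact: openT.
have := FTC1Ny (fun y => iD _ (measurable_itv _)) lf.
move=> /ae_mono; apply => b [] dF <-.
set G := (G in derivable G) in dF *.
have e n : (h n)^-1 * \int[mu]_t (\1_(`]b, b + h n]%classic) t * f t) =
    (h n)^-1 *: ((G \o shift b) (h n *: 1) - G b).
  congr (_ * _); rewrite /= [h n *: 1]mulr1 [h n + b]addrC /G.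
  rewrite Rintegral_itvB ?bnd_simp ?lerDl ?(ltW (h0 n))//; last exact: iD.
  rewrite Rintegral_mkcond; apply: eq_Rintegral => t _.
  by rewrite patchE indicE; case: ifPn => _; rewrite ?mul1r ?mul0r.
under eq_fun do rewrite e.
rewrite derive1E.
apply: (@cvg_comp _ _ _ h (fun k => k^-1 *: ((G \o shift b) (k *: 1) - G b)) _ (0 : R)^' _ _ dF).
move=> A hA; have hB : \forall n \near \oo, h n != 0 -> A (h n) := hc _ hA.
by apply: filterS hB => n; apply; rewrite gt_eqF.
Qed.

End averages.

Section energy_identity.
Context {R : realType} {p q : R} {E : lmodType R} (X : pseminorm p E).
Hypothesis p2 : 2 <= p.
Hypothesis pq : p^-1 + q^-1 = 1.
Notation mR := (measurableTypeR R).
Notation mu := (@lebesgue_measure R).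
Variable T : R.
Hypothesis T0 : 0 < T.

Let p0 : 0 < p. Proof. exact: ge2_gt0. Qed.

Notation V := (nice_pseminorm X (ge2_gt0 p2) T).
Notation step := (step (E := E) T).

Variables (F : (R -> E) -> R) (M : R).
Hypotheses (lF : linear_on V F) (bF : ball_bound V F M).

Let M0 : 0 <= M.
Proof.
have := bF (ps_mem0 V); rewrite psn0// (linear_on0 lF) normr0.
by move=> /(_ ler01).
Qed.

(* [b w u] stands for the pairing of w with |u|^(p-2) u, [b0 w] for its value
   at the initial datum and [N u] for the p-th power of the L^p norm *)
Variables (b : E -> E -> R) (b0 N : E -> R) (c0 : R) (v : R -> E).
Hypothesis nv : nice X T v.
Hypothesis iN : mu.-integrable setT (EFin \o (fun t => N (v t))).
Hypothesis key : {ae mu, forall t, t \in `]0, T[ ->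
  forall w, ps_mem X w -> b w (v t) = b0 w + F (step 0 t w)}.
Hypothesis young : forall w u, ps_mem X w -> ps_mem X u ->
  b w u <= p^-1 * N w + q^-1 * N u.
Hypothesis young0 : forall w, ps_mem X w -> b0 w <= p^-1 * N w + q^-1 * c0.
Hypothesis diag : forall u, ps_mem X u -> b u u = N u.
Hypothesis approx0 : forall e : R, 0 < e -> exists2 w, ps_mem X w &
  q^-1 * c0 - e <= b0 w - p^-1 * N w.

Let H t := q^-1 * N (v t).

Let iH : mu.-integrable setT (EFin \o H).
Proof. exact: integrableRZ. Qed.

Let mv t : ps_mem X (v t). Proof. by have [[]] := nv. Qed.

Let diagE u : ps_mem X u -> N u = p^-1 * N u + q^-1 * N u.
Proof. by move=> mu_; rewrite -mulrDl pq mul1r. Qed.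

(** Young's bound for the function divided by k: the constant part becomes as small as desired and
    the rest is linear in t times [psn X x]. This form can be averaged over ]0, h] with x = v(t),
    for which no uniform bound is available. *)
Lemma step_small (k t : R) x : 0 < k -> 0 <= t -> ps_mem X x ->
  `|F (step 0 t x)| <= k * M * p^-1 * k^-1 `^ p * (t * psn X x) + k * M * q^-1.
Proof.
move=> k0 t0 mx; have ns := nice_step p2 T 0 t mx.
have kV : 0 <= k^-1 by rewrite invr_ge0 ltW.
have := ball_bound_young p2 pq lF bF (ps_memZ (X := V) k^-1 ns).
rewrite (linear_onZ lF)// normrM ger0_norm// ler_pdivrMl// => /le_trans; apply.
have -> : psn V (k^-1 *: step 0 t x) = k^-1 `^ p * psn_int X (step 0 t x).
  by rewrite (@psnZ _ _ _ V)// ger0_norm.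
have := psn_int_step p2 T t0 mx; rewrite subr0 => h.
have -> : k * M * p^-1 * k^-1 `^ p * (t * psn X x) + k * M * q^-1 =
    k * (M * (p^-1 * (k^-1 `^ p * (t * psn X x)) + q^-1)) by ring.
apply: ler_wpM2l; first exact: ltW.
apply: ler_wpM2l; first exact: M0.
rewrite lerD2r; apply: ler_wpM2l; first by rewrite invr_ge0 ltW.
by apply: ler_wpM2l => //; exact: powR_ge0.
Qed.

Section sequence.
Variables (h : nat -> R).
Hypothesis h0 : forall n, 0 < h n.
Hypothesis hcvg : h n @[n --> \oo] --> 0.

Let h_small (d : R) : 0 < d -> \forall n \near \oo, h n <= d.
Proof.
move=> d0; move/cvgrPdist_le : hcvg => /(_ _ d0); apply: filterS => n.
by rewrite sub0r normrN gtr0_norm.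
Qed.

Let mean a n := (h n)^-1 * \int[mu]_t (\1_(`]a, a + h n]%classic) t * H t).

Let ind_int (c : R) n : (h n)^-1 * \int[mu]_t (\1_(`]0, h n]%classic) t * c) = c.
Proof.
have hn := h0 n; rewrite RintegralZr//; last exact: integrable_indic_itv.
by rewrite Rintegral_indic_oc ?ltW// subr0 mulrA mulVf ?mul1r// gt_eqF.
Qed.

Let icst (c : R) n : mu.-integrable setT (EFin \o (fun t => \1_(`]0, h n]%classic) t * c)).
Proof.
rewrite (_ : _ \o _ = EFin \o (fun t => c * \1_(`]0, h n]%classic) t)).
  by apply: integrableRZ => //; exact: integrable_indic_itv.
by apply/funext => t /=; rewrite mulrC.
Qed.

(** The identity [key] is tested with the fixed vector w of [approx0], for which F (step 0 t w)
    tends to 0 with t. *)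
Let mean0_ge (e : R) : 0 < e -> \forall n \near \oo, q^-1 * c0 - e <= mean 0 n.
Proof.
move=> e0; have e2 : 0 < e / 2 by rewrite divr_gt0.
have [w mw hw] := approx0 e2.
have [d d0 hd] := powR_small lF bF (psn_ge0 X w) e2.
have T2 : 0 < T / 2 by rewrite divr_gt0.
apply: filterS2 (h_small d0) (h_small T2) => n hn hT.
rewrite -[leLHS](ind_int _ n) /mean add0r ler_pM2l ?invr_gt0//.
apply: ae_le_Rintegral => //; first by apply: integrable_indicM.
apply: (ae_mono key) => t kt; rewrite indicE in_itvoc.
case: (boolP (0 < t <= h n)) => [/andP[t0 th]|_]; last by rewrite !mul0r.
rewrite !mul1r.
have tT : t \in `]0, T[.
  by rewrite in_itv/= t0 (le_lt_trans th)// (le_lt_trans hT)// ltr_pdivrMr// ltr_pMr// ltr1n.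
have := young mw (mv t); rewrite (kt tT _ mw) /H => hy.
have t0' : 0 <= t <= d by rewrite (ltW t0) (le_trans th).
have := le_trans (normr_step lF bF (ltW t0) mw) (_ : _ <= e / 2).
rewrite subr0 => /(_ (hd _ t0')); rewrite ler_norml => /andP[k1 _].
move: hw hy k1; set a := b0 w; set c := F _; set f := q^-1 * c0; set g := p^-1 * N w.
by set z := q^-1 * N _; move=> *; lra.
Qed.

(** Here [key] is tested at t with v(t) itself. By [step_small] with t <= h, the error averages to a
    multiple of the integral of [psn X (v t)] over ]0, h], which tends to 0, plus at most e / 2. *)
Let mean0_le (e : R) : 0 < e -> \forall n \near \oo, mean 0 n <= q^-1 * c0 + e.
Proof.
move=> e0; have e2 : 0 < e / 2 by rewrite divr_gt0.
have M0' := M0.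
have pV : p^-1 <= 2^-1 by rewrite lef_pV2 ?posrE.
have pV0 : 0 < p^-1 by rewrite invr_gt0.
have PQ := pq.
have [su _ ipsn] := nv.
pose k := e / (2 * (M + 1)).
have k0 : 0 < k by rewrite divr_gt0// mulr_gt0//; lra.
have kM : k * M * q^-1 <= e / 2.
  apply: (@le_trans _ _ (k * (M + 1))).
    rewrite -mulrA ler_pM2l//; apply: (@le_trans _ _ (M * 1)); last by lra.
    by apply: ler_wpM2l => //; lra.
  by rewrite /k invfM mulrA -[_ / 2 / _ * _]mulrA mulVf ?mulr1// gt_eqF//; lra.
pose A := k * M * p^-1 * k^-1 `^ p.
have A0 : 0 <= A.
  apply: mulr_ge0 (powR_ge0 _ _); apply: mulr_ge0 (ltW pV0).
  exact: mulr_ge0 (ltW k0) M0'.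
have small : (fun n => \int[mu]_t (\1_(`]0, h n]%classic) t * psn X (v t))) @ \oo --> 0.
  have mk n : measurable_fun setT (fun t : mR => \1_(`]0, h n]%classic) t * psn X (v t)).
    by apply: measurable_funM; [exact: measurable_indic | exact: smeas_psn].
  have bnd n t : setT t -> `|\1_(`]0, h n]%classic) t * psn X (v t)| <= psn X (v t).
    move=> _; rewrite normrM (ger0_norm (psn_ge0 _ _)) indicE.
    by case: (_ \in _); rewrite ?normr1 ?mul1r ?normr0 ?mul0r ?psn_ge0.
  have cv t : setT t -> \1_(`]0, h n]%classic) t * psn X (v t) @[n --> \oo] --> (0 : R).
    move=> _; have [t0|t0] := leP t 0.
      apply: cvg_near_cst; apply: nearW => n.
      by rewrite indicE in_itvoc (le_gtF t0) mul0r.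
    have t2 : 0 < t / 2 by rewrite divr_gt0.
    apply: cvg_near_cst; apply: filterS (h_small t2) => n hn.
    rewrite indicE in_itvoc t0/= lt_geF ?mul0r//.
    by rewrite (le_lt_trans hn)// ltr_pdivrMr// ltr_pMr// ltr1n.
  have [_] := dominated_cvg_Rintegral measurableT mk ipsn bnd cv.
  by rewrite Rintegral_cst// mul0r.
have eA : 0 < e / (2 * (A + 1)) by rewrite divr_gt0// mulr_gt0//; lra.
have T2 : 0 < T / 2 by rewrite divr_gt0.
move/cvgrPdist_le : small => /(_ _ eA) small.
apply: filterS2 small (h_small T2) => n hn hT.
have hn0 := h0 n.
set J := \int[mu]_t _ in hn.
have J0 : 0 <= J.
  by apply: Rintegral_ge0 => t _; rewrite mulr_ge0 ?psn_ge0// indicE ler0n.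
rewrite sub0r normrN ger0_norm// in hn.
have iJ : mu.-integrable setT (EFin \o (fun t => \1_(`]0, h n]%classic) t * psn X (v t))).
  exact: integrable_indicM.
apply: (@le_trans _ _ ((h n)^-1 * \int[mu]_t (\1_(`]0, h n]%classic) t * (q^-1 * c0 + e / 2) +
   A * h n * (\1_(`]0, h n]%classic) t * psn X (v t))))).
  rewrite /mean add0r ler_pM2l ?invr_gt0//.
  apply: ae_le_Rintegral; first exact: integrable_indicM.
    by apply: integrableRD => //; exact: integrableRZ.
  apply: (ae_mono key) => t kt; rewrite indicE in_itvoc.
  case: (boolP (0 < t <= h n)) => [/andP[t0 th]|_]; last by rewrite !mul0r mulr0 addr0.
  rewrite !mul1r.
  have tT : t \in `]0, T[.
    by rewrite in_itv/= t0 (le_lt_trans th)// (le_lt_trans hT)// ltr_pdivrMr// ltr_pMr// ltr1n.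
  have := kt tT _ (mv t); rewrite diag// => e1.
  have := young0 (mv t) => e3.
  have := step_small k0 (ltW t0) (mv t); rewrite -/A => e4.
  have e5 : A * (t * psn X (v t)) <= A * h n * psn X (v t).
    by rewrite -mulrA; apply: ler_wpM2l => //; apply: ler_wpM2r => //; exact: psn_ge0.
  have e6 := le_trans (ler_norm _) e4.
  have := diagE (mv t); move: e1 e3 e5 e6 kM; rewrite /H.
  set x1 := q^-1 * N _; set x2 := p^-1 * N _; set x3 := F _; set x4 := A * (t * _).
  by set x5 := A * h n * _; set x6 := k * M * _; set x7 := b0 _; set x8 := N _; move=> *; lra.
rewrite RintegralD//; last exact: integrableRZ.
rewrite mulrDr ind_int RintegralZl// -/J.
have -> : (h n)^-1 * (A * h n * J) = A * J by field; rewrite gt_eqF.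
have : A * J <= e / 2.
  apply: (@le_trans _ _ (A * (e / (2 * (A + 1))))); first exact: ler_wpM2l.
  rewrite invfM [2^-1 * _]mulrC !mulrA ler_pM2r//.
  rewrite ler_pdivrMr; last by lra.
  by rewrite mulrC ler_pM2l//; lra.
by move=> ?; lra.
Qed.

Let mean0_cvg : mean 0 n @[n --> \oo] --> q^-1 * c0.
Proof.
apply/cvgrPdist_le => e e0.
apply: filterS2 (mean0_ge e0) (mean0_le e0) => n k1 k2.
by rewrite ler_norml; apply/andP; split; lra.
Qed.

Variable a : R.
Hypothesis aT : a \in `]0, T[.

Let u s := \1_(`]0, a]%classic) s *: v s.

Let u_ n s := \1_(`]0, a]%classic) s *: time_shift T (h n) v s.

Let nice_u : nice X T u. Proof. exact: nice_indic. Qed.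

Let nice_u_ n : nice X T (u_ n).
Proof. by apply: nice_indic => //; exact: nice_shift. Qed.

Let u_cvg : ps_cvg V u_ u.
Proof.
apply: (@squeeze_cvgr _ _ _ _ (fun=> 0) (fun n => psn V (time_shift T (h n) v - v))); last 2 first.
- exact: cvg_cst.
- exact: (shift_cvg p2 T0 h0 hcvg nv).
apply: nearW => n; rewrite psn_ge0/=.
have n1 : nice X T (u_ n - u) by exact: (ps_memB (X := V) (nice_u_ n) nice_u).
have n2 : nice X T (time_shift T (h n) v - v).
  exact: (ps_memB (X := V) (nice_shift p2 (h n) nv) nv).
have [[_ _ i1] [s2 _ i2]] := (n1, n2).
apply: le_Rintegral => // t _.
have -> : (u_ n - u) t = \1_(`]0, a]%classic) t *: (time_shift T (h n) v - v) t.
  by rewrite scalerBr.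
rewrite psnZ; last exact: s2.1.
rewrite indicE; case: (_ \in _); first by rewrite normr1 powR1 mul1r.
by rewrite normr0 powR0 ?mul0r ?psn_ge0// gt_eqF.
Qed.

(** Subtracting [key] at t from [key] at t + h turns F (step t (t + h) w) into a difference of
    pairings. With w = v(t), [diag] at t and [young] at t + h give the lower bound for H(t + h) -
    H(t); w = v(t + h) gives the upper one with the roles exchanged. *)
Let steklov_le : \forall n \near \oo,
  steklov T F (h n) u <= mean a n - mean 0 n <= steklov T F (h n) (u_ n).
Proof.
have /andP[a0 aT'] : 0 < a < T by move: aT; rewrite in_itv.
(* Half the distance to T keeps t + h strictly below T for every t <= a. *)
have d0 : 0 < (T - a) / 2 by rewrite divr_gt0// subr_gt0.
apply: filterS (h_small d0) => n hn; have hn0 := h0 n.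
rewrite /mean add0r -mulrBr -Rintegral_increment ?(ltW a0)//.
rewrite /steklov !ler_pM2l ?invr_gt0//.
have iI : mu.-integrable setT (EFin \o (fun t => \1_(`]0, a]%classic) t * (H (t + h n) - H t))).
  by apply: integrable_indicM => //; apply: integrableRB => //; exact: integrable_addr.
have key' := ae_addr (h n) key.
have incr t w : 0 < t <= a -> (t \in `]0, T[ ->
    forall w, ps_mem X w -> b w (v t) = b0 w + F (step 0 t w)) ->
   (t + h n \in `]0, T[ -> forall w, ps_mem X w ->
      b w (v (t + h n)) = b0 w + F (step 0 (t + h n) w)) -> ps_mem X w ->
    F (step t (t + h n) w) = b w (v (t + h n)) - b w (v t) /\ t <= T - h n /\ t < T.
  move=> /andP[t0 ta] k1 k2 mw; have tT : t < T by exact: le_lt_trans aT'.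
  have tT' : t + h n < T by lra.
  rewrite k1//; last by rewrite in_itv/= t0.
  rewrite k2//; last by rewrite in_itv/= tT' addr_gt0.
  split; last by split => //; lra.
  by rewrite (step_prim lF _ (ltW hn0) mw) /prim; ring.
apply/andP; split; apply: ae_le_Rintegral => //.
- exact: (integrable_steklov pq lF bF (ltW hn0) nice_u).
- apply: (ae_mono2 key key') => t k1 k2; rewrite /steklov_fun /u stepZ.
  rewrite (linear_onZ lF); last exact: nice_step.
  rewrite mulrCA [\1_(`]0, a]) t]indicE in_itvoc.
  case: (boolP (0 < t <= a)) => ta; last by rewrite !mul0r.
  have [-> [tT _]] := incr t (v t) ta k1 k2 (mv t).
  have /andP[t0 _] := ta; rewrite indicE in_itvcc (ltW t0) tT !mul1r.
  have := young (mv t) (mv (t + h n)); rewrite (diag (mv t)) {2}(diagE (mv t)).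
  by rewrite /H => ?; lra.
- exact: (integrable_steklov pq lF bF (ltW hn0) (nice_u_ n)).
- apply: (ae_mono2 key key') => t k1 k2; rewrite /steklov_fun /u_ /time_shift !stepZ.
  rewrite (linear_onZ lF); last by apply: (ps_memZ (X := V)); exact: nice_step.
  rewrite (linear_onZ lF); last exact: nice_step.
  rewrite [X in _ <= X]mulrCA [\1_(`]0, a]) t]indicE in_itvoc.
  case: (boolP (0 < t <= a)) => ta; last by rewrite !mul0r.
  have [-> [tT tT']] := incr t (v (t + h n)) ta k1 k2 (mv _).
  have /andP[t0 _] := ta; rewrite !indicE in_itvcc in_itvoo (ltW t0) t0 tT tT' !mul1r.
  have := young (mv (t + h n)) (mv t); rewrite (diag (mv (t + h n))) {2}(diagE (mv (t + h n))).
  by rewrite /H => ?; lra.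
Qed.

Lemma energy_identity_at : mean a n @[n --> \oo] --> H a ->
  H a = q^-1 * c0 + F u.
Proof.
move=> ca.
have c1 := steklov_cvg pq T0 h0 hcvg lF bF nice_u.
have c2 : steklov T F (h n) (u_ n) @[n --> \oo] --> F u.
  apply/cvgrPdist_le => e e0; have e2 : 0 < e / 2 by rewrite divr_gt0.
  have k1 := cvg_functional lF bF e2 nice_u_ nice_u u_cvg.
  move/cvgrPdist_le : c1 => /(_ _ e2) k2.
  apply: filterS2 k1 k2 => n k1 k2.
  have := k1 _ (linear_on_steklov pq lF bF (h0 n)) (ball_bound_steklov pq lF bF (h0 n)).
  rewrite (linear_onB (linear_on_steklov pq lF bF (h0 n)) (nice_u_ n) nice_u); move: k2.
  by rewrite !ler_norml => /andP[? ?] /andP[? ?]; apply/andP; split; lra.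
have c3 : mean a n - mean 0 n @[n --> \oo] --> F u by apply: (squeeze_cvgr _ c1 c2); exact: steklov_le.
have c4 : mean a n - mean 0 n @[n --> \oo] --> H a - q^-1 * c0 by exact: cvgB.
by have -> := cvg_unique _ c3 c4 => //; rewrite addrC subrK.
Qed.

End sequence.

Theorem energy_identity : {ae mu, forall t, t \in `]0, T[ ->
  q^-1 * N (v t) = q^-1 * c0 + F (fun s => \1_(`]0, t]%classic) s *: v s)}.
Proof.
pose h n := T / n.+1%:R.
have h0 n : 0 < h n by rewrite divr_gt0.
have hcvg : h n @[n --> \oo] --> 0.
  by rewrite -(mulr0 T); apply: cvgMr; exact: cvg_harmonic.
apply: (ae_mono (integrable_average_cvg iH h0 hcvg)) => a ca aT.
exact: (energy_identity_at h0 hcvg aT ca).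
Qed.

End energy_identity.

(** * Lebesgue measure and Lebesgue spaces on R^n *)

Section lebesgue_rV_theory.
Context {R : realType}.
Notation mR := (measurableTypeR R).

Section topology.
Context {d : nat}.
Notation E := 'rV[R]_d.

Lemma rV_ballP (x : E) (e : R) (y : E) : 0 < e ->
  ball x e y <-> forall i, `|x ord0 i - y ord0 i| < e.
Proof.
move=> e0; split => [[_ h] i|h]; first exact: h.
by split => // i j; rewrite ord1; exact: h.
Qed.

Lemma rV_nbhsP (x : E) (A : set E) : nbhs x A <->
  exists2 e : R, 0 < e & forall y : E, (forall i, `|x ord0 i - y ord0 i| < e) -> A y.
Proof.
split => [/nbhs_ballP[e e0 h]|[e e0 h]].
  by exists e => // y hy; apply: h; apply/rV_ballP.
by apply/nbhs_ballP; exists e => // y /(rV_ballP _ _ e0); exact: h.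
Qed.

Definition box (a b : 'I_d -> R) : set E := [set x | forall i, a i < x ord0 i < b i].

Definition cbox (a b : 'I_d -> R) : set E := [set x | forall i, a i <= x ord0 i <= b i].

Lemma sub_box_cbox (a b : 'I_d -> R) : box a b `<=` cbox a b.
Proof. by move=> x h i; have /andP[/ltW -> /ltW ->] := h i. Qed.

Lemma measurable_box (a b : 'I_d -> R) : measurable (box a b).
Proof.
rewrite (_ : box a b = \big[setI/setT]_(i < d) ((fun x : E => x ord0 i) @^-1` `]a i, b i[%classic)).
  apply: bigsetI_measurable => i _; rewrite -[X in measurable X]setTI.
  exact: measurable_coor_rV.
rewrite -bigcap_seq; apply/seteqP; split => x h.
  by move=> i _ /=; rewrite in_itv/=; exact: h.
by move=> i; have := h i (mem_index_enum i); rewrite /= in_itv.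
Qed.

Lemma open_rat_box (U : set E) x : open U -> U x ->
  exists a b : {ffun 'I_d -> rat},
    box (fun i => ratr (a i)) (fun i => ratr (b i)) x /\
    cbox (fun i => ratr (a i)) (fun i => ratr (b i)) `<=` U.
Proof.
move=> oU Ux; have /rV_nbhsP[e e0 h] : nbhs x U by rewrite openE in oU; exact: oU.
have ea i : {r : rat | x ord0 i - e < ratr r < x ord0 i}.
  have /rat_in_itvoo /cid[r hr] : x ord0 i - e < x ord0 i by rewrite gtrBl.
  by exists r; move: hr; rewrite in_itv.
have eb i : {r : rat | x ord0 i < ratr r < x ord0 i + e}.
  have /rat_in_itvoo /cid[r hr] : x ord0 i < x ord0 i + e by rewrite ltrDl.
  by exists r; move: hr; rewrite in_itv.
exists [ffun i => sval (ea i)], [ffun i => sval (eb i)]; split => [i|y hy].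
  by rewrite !ffunE; have /andP[_ ->] := svalP (ea i); have /andP[-> _] := svalP (eb i).
apply: h => i; have := hy i; rewrite !ffunE => /andP[h1 h2].
have /andP[h3 _] := svalP (ea i); have /andP[_ h4] := svalP (eb i).
by rewrite ltr_norml; apply/andP; split; lra.
Qed.

(** The n-th rational box, replaced by the empty set unless its closure lies in U. This makes U a
    countable union of boxes whose closures are compact subsets of U. *)
Definition sub_box (U : set E) (n : nat) : set E :=
  if unpickle n is Some (a, b) then
    let a' i := ratr ((a : {ffun 'I_d -> rat}) i) in
    let b' i := ratr ((b : {ffun 'I_d -> rat}) i) in
    [set x | box a' b' x /\ cbox a' b' `<=` U]
  else set0.

Lemma open_sub_box (U : set E) : open U -> U = \bigcup_n sub_box U n.
Proof.
move=> oU; apply/seteqP; split => [x Ux|x [n _]].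
  have [a [b [h1 h2]]] := open_rat_box oU Ux.
  by exists (pickle (a, b)) => //; rewrite /sub_box pickleK.
rewrite /sub_box; case: (unpickle n) => // -[a b] [Bx]; apply.
exact: sub_box_cbox.
Qed.

Lemma sub_boxP (U : set E) n : sub_box U n = set0 \/
  exists a b : 'I_d -> R, sub_box U n = box a b /\ cbox a b `<=` U.
Proof.
rewrite /sub_box; case: (unpickle n) => [[a b]|]; last by left.
pose a' (i : 'I_d) : R := ratr (a i); pose b' (i : 'I_d) : R := ratr (b i).
rewrite -/a' -/b'.
have [BU|BU] := pselect (cbox a' b' `<=` U).
  by right; exists a', b'; split => //; apply/seteqP; split => [x []|x].
by left; apply/seteqP; split => // x [].
Qed.

Lemma open_measurable_rV (U : set E) : open U -> measurable U.
Proof.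
move=> oU; rewrite (open_sub_box oU); apply: bigcupT_measurable => n.
have [->|[a [b [-> _]]]] := sub_boxP U n; first exact: measurable0.
exact: measurable_box.
Qed.

Lemma continuous_measurable_rV (f : E -> R) : continuous f ->
  measurable_fun setT (f : E -> mR).
Proof.
move=> cf; apply: (measurability _ (RGenOpens.measurableE R)).
move=> /= _ [_ [a [b ->]] <-]; rewrite setTI; apply: open_measurable_rV.
by apply: open_comp => [x _|]; [exact: cf | exact: interval_open].
Qed.

End topology.

Section translation.

Definition tuple_add n (c t : n.-tuple mR) : n.-tuple mR :=
  [tuple (tnth t i : R) + (tnth c i : R) | i < n].

(** By induction on the dimension: the first coordinate is translated in the outer integral, the
    others inside each section. *)
Lemma lebesgue_tuple_add n (c : n.-tuple mR) (A : set (n.-tuple mR)) : measurable A ->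
  lebesgue_tuple n (tuple_add c @^-1` A) = lebesgue_tuple n A.
Proof.
elim: n c A => [|n IH] c A mA.
  by congr (lebesgue_tuple 0 _); apply/seteqP; split => t /=; rewrite [tuple_add c t]tuple0 [t]tuple0.
pose cons_pair (x : mR * n.-tuple mR) : n.+1.-tuple mR := [tuple of x.1 :: x.2].
have mcons : measurable_fun setT cons_pair by exact: measurable_cons.
have mB : measurable (cons_pair @^-1` A) by rewrite -[X in measurable X]setTI; exact: mcons.
change ((@lebesgue_measure R \x lebesgue_tuple n)%E (cons_pair @^-1` (tuple_add c @^-1` A)) =
  (@lebesgue_measure R \x lebesgue_tuple n)%E (cons_pair @^-1` A)).
rewrite /product_measure1.
rewrite -[RHS](@ge0_integral_addr _ (tnth c ord0))//; last first.
  by apply: measurable_fun_xsection.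
apply: eq_integral => x _ /=; rewrite -[RHS](IH [tuple of behead c]); last exact: measurable_xsection.
have e t : tuple_add c (cons_pair (x, t)) =
    cons_pair ((x : R) + (tnth c ord0 : R), tuple_add [tuple of behead c] t).
  apply: eq_from_tnth => i; rewrite tnth_mktuple; case: (unliftP ord0 i) => [j|] ->.
    by rewrite /cons_pair !tnthS tnth_mktuple !(tnth_nth 0)/= nth_behead.
  by rewrite /cons_pair !tnth0.
by congr (lebesgue_tuple n _); apply/seteqP; split => t; rewrite /xsection/= !inE/= e.
Qed.

Lemma measurable_addr_rV d (v : 'rV[R]_d) : measurable_fun setT (fun x : 'rV[R]_d => x + v).
Proof.
apply: measurable_fun_rVP => i.
rewrite (_ : (fun _ => _) = fun x : 'rV[R]_d => (x ord0 i : mR) + v ord0 i).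
  by apply: measurable_funD => //; exact: measurable_coor_rV.
by apply/funext => x; rewrite mxE.
Qed.

Lemma leb_addr d (v : 'rV[R]_d) (A : set 'rV[R]_d) : measurable A ->
  leb ((fun x => x + v) @^-1` A) = leb A.
Proof.
move=> mA; rewrite /leb.
pose c : d.-tuple mR := [tuple v ord0 i | i < d].
rewrite -[RHS](@lebesgue_tuple_add d c).
  congr (lebesgue_tuple d _); apply/funext => t; rewrite /preimage/=.
  by congr (A _); apply/rowP => i; rewrite !mxE !tnth_mktuple.
rewrite -[X in measurable X]setTI; apply: measurable_fun_rVP => // i.
rewrite (_ : (fun _ => _) = fun t : d.-tuple mR => tnth t i); first exact: measurable_tnth.
by apply/funext => t; rewrite mxE.
Qed.

Lemma measurable_cube k (r : R) : measurable [set t : k.-tuple mR | forall i, (- r <= (tnth t i : R) <= r)%R].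
Proof.
rewrite (_ : mkset _ = \big[setI/setT]_(i < k) ((fun t : k.-tuple mR => tnth t i) @^-1` `[- r, r]%classic)).
    apply: bigsetI_measurable => i _; rewrite -[X in measurable X]setTI.
    exact: measurable_tnth.
  rewrite -bigcap_seq; apply/seteqP; split => x h.
    by move=> i _ /=; rewrite in_itv/=; exact: h.
  by move=> i; have := h i (mem_index_enum i); rewrite /= in_itv.
Qed.

Lemma lebesgue_tuple_cube n (r : R) :
  (lebesgue_tuple n [set t : n.-tuple mR | forall i, (- r <= (tnth t i : R) <= r)%R] < +oo)%E.
Proof.
elim: n => [|n IH].
  by rewrite /= diracE; case: (_ \in _); rewrite ltry.
pose cons_pair (x : mR * n.-tuple mR) : n.+1.-tuple mR := [tuple of x.1 :: x.2].
change ((@lebesgue_measure R \x lebesgue_tuple n)%E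
  (cons_pair @^-1` [set t : n.+1.-tuple mR | forall i, (- r <= (tnth t i : R) <= r)%R]) < +oo)%E.
rewrite (_ : _ @^-1` _ = `[- r, r]%classic `*`
    [set t : n.-tuple mR | forall i, (- r <= (tnth t i : R) <= r)%R]); last first.
  apply/seteqP; split => -[x t] /=; rewrite in_itv/=.
    move=> h; split; first by have := h ord0; rewrite /cons_pair tnth0.
    by move=> i; have := h (lift ord0 i); rewrite /cons_pair tnthS.
  move=> [hx ht] i; case: (unliftP ord0 i) => [j|] ->; rewrite /cons_pair ?tnthS//.
have mc := @measurable_cube n r.
have li : (@lebesgue_measure R (`[(- r)%R, r]%classic : set mR) < +oo)%E.
  by rewrite lebesgue_measure_itv/=; case: ifP => _; rewrite ?ltry// -EFinB ltry.
by rewrite product_measure1E// lte_mul_pinfty// ge0_fin_numE.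
Qed.

Lemma leb_bounded_lty d (A : set 'rV[R]_d) : measurable A -> bounded_set A -> (leb A < +oo)%E.
Proof.
move=> mA [M [Mr bA]]; pose r := `|M| + 1.
have Ar x : A x -> forall i, - r <= x ord0 i <= r.
  move=> Ax i; rewrite -ler_norml.
  have : `|x| <= r by apply: bA => //; rewrite (le_lt_trans (ler_norm M))// ltrDl.
  apply: le_trans; rewrite -[`|x|]/(mx_norm x) mx_normrE.
  exact: (le_bigmax _ (fun ij : 'I_1 * 'I_d => `|x ij.1 ij.2|) (ord0, i)).
apply: le_lt_trans (lebesgue_tuple_cube d r); rewrite /leb.
apply: le_measure; rewrite ?inE.
- rewrite -[X in measurable X]setTI; apply: measurable_fun_rVP => // i.
  rewrite (_ : (fun _ => _) = fun t : d.-tuple mR => tnth t i); first exact: measurable_tnth.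
  by apply/funext => t; rewrite mxE.
- exact: measurable_cube.
- by move=> t /= /Ar h i; have := h i; rewrite mxE.
Qed.

End translation.

End lebesgue_rV_theory.

(** * Integrated forms of pointwise linear bounds *)

Section Rintegral_combinations.
Context {R : realType} d0 {T : measurableType d0} (mu : {measure set T -> \bar R}) (D : set T).
Hypothesis mD : measurable D.
Implicit Types f a b : T -> R.
Notation int f := (mu.-integrable D (EFin \o f)).

Lemma le_Rintegral_lin2 f a b (x y : R) : int f -> int a -> int b ->
  (forall t, D t -> f t <= x * a t + y * b t) ->
  \int[mu]_(t in D) f t <= x * \int[mu]_(t in D) a t + y * \int[mu]_(t in D) b t.
Proof.
move=> fi ai bi h.
have xa : int (fun t => x * a t) by exact: integrableRZ.
have yb : int (fun t => y * b t) by exact: integrableRZ.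
rewrite -(RintegralZl x mD ai) -(RintegralZl y mD bi) -(RintegralD mD xa yb).
by apply: le_Rintegral => //; exact: integrableRD.
Qed.

Lemma le_RintegralD_lin2 f g a b (x y : R) : int f -> int g -> int a -> int b ->
  (forall t, D t -> f t + g t <= x * a t + y * b t) ->
  \int[mu]_(t in D) f t + \int[mu]_(t in D) g t <=
  x * \int[mu]_(t in D) a t + y * \int[mu]_(t in D) b t.
Proof.
move=> fi gi ai bi h; rewrite -(RintegralD mD fi gi).
by apply: le_Rintegral_lin2 => //; exact: integrableRD.
Qed.

Lemma le_normr_Rintegral_lin2 f a b (x y : R) : int f -> int a -> int b ->
  (forall t, D t -> `|f t| <= x * a t + y * b t) ->
  `|\int[mu]_(t in D) f t| <= x * \int[mu]_(t in D) a t + y * \int[mu]_(t in D) b t.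
Proof.
move=> fi ai bi h; apply: le_trans (le_normr_Rintegral mD fi) _.
by apply: le_Rintegral_lin2 => //; exact: integrableRnorm.
Qed.

Lemma Rintegral_lin2 a b (x : R) : int a -> int b ->
  \int[mu]_(t in D) (x * a t + b t) = x * \int[mu]_(t in D) a t + \int[mu]_(t in D) b t.
Proof.
move=> ai bi; have xa : int (fun t => x * a t) by exact: integrableRZ.
by rewrite -(RintegralZl x mD ai) -(RintegralD mD xa bi).
Qed.

Lemma RintegralD3 f a b : int f -> int a -> int b ->
  \int[mu]_(t in D) (f t + (a t + b t)) =
  \int[mu]_(t in D) f t + (\int[mu]_(t in D) a t + \int[mu]_(t in D) b t).
Proof.
move=> fi ai bi; have ab := integrableRD mD ai bi.
by rewrite -(RintegralD mD ai bi) -(RintegralD mD fi ab).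
Qed.

Lemma le_normr_RintegralB_lin2 f g a b (x y : R) : int f -> int g -> int a -> int b ->
  (forall t, D t -> `|f t - g t| <= x * a t + y * b t) ->
  `|\int[mu]_(t in D) f t - \int[mu]_(t in D) g t| <=
  x * \int[mu]_(t in D) a t + y * \int[mu]_(t in D) b t.
Proof.
move=> fi gi ai bi h; rewrite -(RintegralB mD fi gi).
by apply: le_normr_Rintegral_lin2 => //; exact: integrableRB.
Qed.

End Rintegral_combinations.

(** * Lebesgue spaces of matrix fields and the pairing with |u|^(p-2) u *)

Section Lr_theory.
Context {R : realType} d0 {T : measurableType d0} (mu : {measure set T -> \bar R}) (D : set T).
Hypothesis mD : measurable D.
Variables (p q : R).
Hypotheses (p2 : 2 <= p) (pq : p^-1 + q^-1 = 1).

Let p0 : 0 < p. Proof. exact: ge2_gt0. Qed.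

Section fields.
Variables m n : nat.
Implicit Types f g : T -> 'M[R]_(m, n).

Definition entries_measurable f := forall i j, measurable_fun D (fun x => f x i j).

Lemma measurable_dot f g : entries_measurable f -> entries_measurable g ->
  measurable_fun D (fun x => dot (f x) (g x)).
Proof.
move=> mf mg; apply: measurable_sum => i; apply: measurable_sum => j.
exact: measurable_funM.
Qed.

Lemma measurable_frob f : entries_measurable f -> measurable_fun D (fun x => frob (f x)).
Proof.
move=> mf; rewrite (_ : (fun _ => _) = (@powR R ^~ 2^-1) \o (fun x => dot (f x) (f x))).
  by apply: measurableT_comp; [exact: measurable_powR | exact: measurable_dot].
by apply/funext => x; rewrite /= powR12_sqrt// dot_ge0.
Qed.

Lemma measurable_frob_powR f (r : R) : entries_measurable f ->
  measurable_fun D (fun x => frob (f x) `^ r).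
Proof.
move=> mf; apply: (measurableT_comp (measurable_powR r)).
exact: measurable_frob.
Qed.

Lemma entries_measurable_pw f : entries_measurable f ->
  entries_measurable (fun x => pw p (f x)).
Proof.
move=> mf i j; rewrite (_ : (fun _ => _) = fun x => frob (f x) `^ (p - 2) * f x i j).
  by apply: measurable_funM => //; exact: measurable_frob_powR.
by apply/funext => x; rewrite mxE.
Qed.

Lemma entries_measurable_lin (a : R) f g : entries_measurable f -> entries_measurable g ->
  entries_measurable (a *: f + g).
Proof.
move=> mf mg i j; rewrite (_ : (fun _ => _) = fun x => a * f x i j + g x i j).
  by apply: measurable_funD => //; exact: measurable_funM.
by apply/funext => x; rewrite !mxE.
Qed.

Definition Lmem f := entries_measurable f /\
  mu.-integrable D (EFin \o (fun x => frob (f x) `^ p)).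

Definition Lint f : R := \int[mu]_(x in D) frob (f x) `^ p.

Lemma Lint_ge0 f : 0 <= Lint f.
Proof. by apply: Rintegral_ge0 => x _; exact: powR_ge0. Qed.

Lemma LmemP f (g : T -> R) : entries_measurable f -> mu.-integrable D (EFin \o g) ->
  (forall x, D x -> frob (f x) `^ p <= g x) -> Lmem f.
Proof.
move=> mf ig fg; split => //; apply: (integrable_Rbound mD _ ig); first exact: measurable_frob_powR.
by move=> x Dx; rewrite ger0_norm ?powR_ge0// fg.
Qed.

Lemma Lmem0 : Lmem 0.
Proof.
apply: (@LmemP _ (fun=> 0)); first by move=> i j; apply: measurable_cst.
  exact: integrableR0.
by move=> x _; rewrite frob0 powR0// gt_eqF.
Qed.

Lemma Lmem_lin (a : R) f g : Lmem f -> Lmem g -> Lmem (a *: f + g).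
Proof.
move=> [mf fi] [mg gi].
apply: (@LmemP _ (fun x => 2 `^ p * (`|a| `^ p * frob (f x) `^ p + frob (g x) `^ p))).
- exact: entries_measurable_lin.
- by apply: integrableRZ => //; apply: integrableRD => //; exact: integrableRZ.
- move=> x _; have h : frob (a *: f x + g x) <= `|a| * frob (f x) + frob (g x).
    by rewrite -frobZ frobD.
  apply: (@le_trans _ _ ((`|a| * frob (f x) + frob (g x)) `^ p)).
    by rewrite ge0_ler_powR ?nnegrE ?frob_ge0// ?(ltW p0)// addr_ge0 ?mulr_ge0 ?frob_ge0.
  rewrite -powRM ?frob_ge0//; apply: (powRD_le p2) => //; last exact: frob_ge0.
  by rewrite mulr_ge0// frob_ge0.
Qed.

Let LintZ (a : R) f : Lmem f -> Lint (a *: f) = `|a| `^ p * Lint f.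
Proof.
move=> [mf fi]; rewrite /Lint -RintegralZl//.
by apply: eq_Rintegral => x _; rewrite /= frobZ powRM// frob_ge0.
Qed.

Let Lint_quasi (e : R) : 0 < e -> exists2 C : R, 0 <= C &
  forall f g, Lmem f -> Lmem g -> Lint (f + g) <= (1 + e) * Lint f + C * Lint g.
Proof.
move=> e0; have [C C0 hC] := @frob_powR_quasi R m n p q p2 pq _ e0; exists C => // f g mf mg.
have fg : Lmem (f + g) by have := Lmem_lin 1 mf mg; rewrite scale1r.
apply: (le_Rintegral_lin2 mD fg.2 mf.2 mg.2) => x _; exact: hC.
Qed.
Let Lint_smooth : exists2 C : R, 0 <= C &
  forall f g (e : R), Lmem f -> Lmem g -> 0 <= e <= 1 ->
    Lint (f + e *: g) + Lint (f - e *: g) <= 2 * Lint f + C * e ^+ 2 * (Lint f + Lint g).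
Proof.
have [C C0 hC] := @frob_powR_smooth R m n p q p2 pq; exists C => // f g e mf mg e01.
have m1 : Lmem (f + e *: g) by rewrite addrC; exact: Lmem_lin.
have m2 : Lmem (f - e *: g) by rewrite addrC -scaleNr; exact: Lmem_lin.
rewrite mulrDr addrA -mulrDl.
apply: (le_RintegralD_lin2 mD m1.2 m2.2 mf.2 mg.2) => x _.
by rewrite mulrDl -addrA -mulrDr; exact: hC.
Qed.
Definition Lpseminorm : pseminorm p (T -> 'M[R]_(m, n)) :=
  Pseminorm Lint_ge0 Lmem0 Lmem_lin LintZ Lint_quasi Lint_smooth.

Definition pairD (w u : T -> 'M[R]_(m, n)) : R :=
  \int[mu]_(x in D) dot (w x) (pw p (u x)).

Lemma integrable_pairD w u : Lmem w -> Lmem u ->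
  mu.-integrable D (EFin \o (fun x => dot (w x) (pw p (u x)))).
Proof.
move=> [mw iw] [mu_ iu].
apply: (@integrable_Rbound _ _ _ mu D mD _ (fun x => p^-1 * frob (w x) `^ p + q^-1 * frob (u x) `^ p)).
- by apply: measurable_dot => //; exact: entries_measurable_pw.
- by apply: integrableRD => //; exact: integrableRZ.
- move=> x _; rewrite ler_norml young_dot// andbT lerNl -dotNl.
  by have := young_dot p2 pq (- w x) (u x); rewrite frobN.
Qed.

Lemma pairD_lin (a : R) w w' u : Lmem w -> Lmem w' -> Lmem u ->
  pairD (a *: w + w') u = a * pairD w u + pairD w' u.
Proof.
move=> mw mw' mu_.
rewrite /pairD -(Rintegral_lin2 mD _ (integrable_pairD mw mu_) (integrable_pairD mw' mu_)).
by apply: eq_Rintegral => x _; rewrite dotDl dotZl.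
Qed.
Lemma pairD_young w u : Lmem w -> Lmem u ->
  pairD w u <= p^-1 * Lint w + q^-1 * Lint u.
Proof.
move=> mw mu_.
by apply: (le_Rintegral_lin2 mD (integrable_pairD mw mu_) mw.2 mu_.2) => x _; exact: young_dot.
Qed.
Lemma pairD_diag u : pairD u u = Lint u.
Proof. by apply: eq_Rintegral => x _; rewrite dot_pw. Qed.

Lemma pairD_eps (e : R) : 0 < e -> exists2 C : R, 0 <= C &
  forall w u, Lmem w -> Lmem u -> `|pairD w u| <= C * Lint w + e * Lint u.
Proof.
move=> e0; have [C C0 hC] := young_eps p2 pq e0; exists C => // w u mw mu_.
apply: (le_normr_Rintegral_lin2 mD (integrable_pairD mw mu_) mw.2 mu_.2) => x _.
by apply: (le_trans (normr_dot_le_frob _ _)); rewrite frob_pw//; apply: hC; exact: frob_ge0.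
Qed.
Lemma pairD_lip_eps (e : R) : 0 < e -> exists2 C : R, 0 <= C &
  forall w a b, Lmem w -> Lmem a -> Lmem b ->
   `|pairD w a - pairD w b| <= e * (Lint w + (Lint a + Lint b)) + C * Lint (a - b).
Proof.
move=> e0; have [C C0 hC] := @dot_pw_lip_eps R m n p p2 _ e0; exists C => // w a b mw ma mb.
have mab : Lmem (a - b) by have := Lmem_lin (-1) mb ma; rewrite scaleN1r addrC.
have wab := integrableRD mD mw.2 (integrableRD mD ma.2 mb.2).
rewrite -[Lint w + _](RintegralD3 mD mw.2 ma.2 mb.2).
apply: (le_normr_RintegralB_lin2 mD (integrable_pairD mw ma) (integrable_pairD mw mb) wab mab.2).
by move=> x _; rewrite -dotNr -dotDr; exact: hC.
Qed.
End fields.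
End Lr_theory.

Section Lr_space.
Context {R : realType} {d : nat} (D : set 'rV[R]_d).
Hypothesis mD : measurable D.
Variables (p : R).
Hypotheses (p2 : 2 <= p).
Notation mu := (@leb R d).
Variables m n : nat.
Implicit Types f : 'rV[R]_d -> 'M[R]_(m, n).
Let p0 : 0 < p. Proof. exact: ge2_gt0. Qed.

Let LnormE f : (\int[mu]_x (`|((fun x => (frob (f x))%:E) \_ D) x| `^ p))%E =
  (\int[mu]_(x in D) (frob (f x) `^ p)%:E)%E.
Proof.
rewrite [RHS]integral_mkcond; apply: eq_integral => x _; rewrite !patchE.
case: ifPn => _; first by rewrite /= ger0_norm// frob_ge0.
by rewrite /point/= normr0 powR0// gt_eqF.
Qed.

Lemma sp_mem_Lr f : sp_mem (Lr D p m n) f <-> Lmem mu D p f.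
Proof.
split => -[mf]; rewrite /= Lnorm.unlock /= (LnormE f) => h; split => //.
  apply/integrableP; split; first by apply/measurable_EFinP; exact: measurable_frob_powR.
  rewrite (eq_integral (fun x => (frob (f x) `^ p)%:E)); last first.
    by move=> x _ /=; rewrite ger0_norm// powR_ge0.
  move: h; set I := (\int[_]_(x in _) _)%E => h.
  have : ((I `^ p^-1) `^ p < +oo)%E by exact: poweR_lty.
  rewrite -poweRrM mulVf ?gt_eqF// poweRe1//.
  by apply: integral_ge0 => x _; rewrite lee_fin powR_ge0.
apply: poweR_lty.
have /integrableP[_] := h; apply: le_lt_trans.
rewrite le_eqVlt; apply/orP; left; apply/eqP; apply: eq_integral => x _ /=.
by rewrite ger0_norm// powR_ge0.
Qed.

Lemma sp_norm_Lr f : Lmem mu D p f -> sp_norm (Lr D p m n) f = (Lint mu D p f `^ p^-1)%:E.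
Proof.
move=> [mf fi]; rewrite /= Lnorm.unlock /= (LnormE f) -poweR_EFin /Lint fineK//.
exact: integrable_fin_num.
Qed.

End Lr_space.

(** * Bump functions and weak derivatives *)

Section flat_functions.
Context {R : realType}.

(* The derivatives of exp(-1/t) are combinations of these functions *)
Definition flat (k : nat) (t : R) : R :=
  if 0 < t then t^-1 ^+ k * expR (- t^-1) else 0.

Lemma flat_ge0 k t : 0 <= flat k t.
Proof.
rewrite /flat; case: ifPn => // t0.
by rewrite mulr_ge0 ?expR_ge0// exprn_ge0// invr_ge0 ltW.
Qed.

(** A single term of the exponential series at 1/t, of order k + 2, outweighs the power of 1/t. The
    quadratic bound forces the derivative at 0 to vanish. *)
Lemma flat_le k t : flat k t <= k.+2`!%:R * t ^+ 2.
Proof.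
rewrite /flat; case: ifPn => [t0|_]; last by rewrite mulr_ge0// sqr_ge0.
have s0 : 0 < t^-1 by rewrite invr_gt0.
have h := expR_ge1Dxn k.+1 (ltW s0).
have {}h : t^-1 ^+ k.+2 / k.+2`!%:R <= expR t^-1 by apply: le_trans h; rewrite lerDr.
rewrite expRN ler_pdivrMr ?expR_gt0//.
have f0 : 0 < k.+2`!%:R :> R by rewrite ltr0n fact_gt0.
rewrite ler_pdivrMr// in h.
have -> : t^-1 ^+ k = t ^+ 2 * t^-1 ^+ k.+2.
  have e : t ^+ 2 * t^-1 ^+ 2 = 1 by rewrite -exprMn divff ?gt_eqF// expr1n.
  by rewrite -[k.+2]addn2 exprD mulrCA e mulr1.
rewrite (_ : _ * _ * expR _ = t ^+ 2 * (expR t^-1 * k.+2`!%:R)); last by ring.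
by apply: ler_wpM2l => //; exact: sqr_ge0.
Qed.

Lemma is_derive_flat k (t : R) :
  is_derive t 1 (flat k) (- k%:R * flat k.+1 t + flat k.+2 t).
Proof.
have [t0|t0|->] := ltgtP t 0.
- have -> : - k%:R * flat k.+1 t + flat k.+2 t = 0.
    by rewrite /flat !ifF ?mulr0 ?addr0//; apply/negbTE; rewrite -leNgt ltW.
  have d0 := @is_derive_cst R R R 0 t 1.
  apply: (near_eq_is_derive _ d0).
  near=> s; rewrite /flat ifF//; apply/negbTE; rewrite -leNgt ltW//.
  by near: s; exact: lt_nbhsl.
- have tn0 : t != 0 by rewrite gt_eqF.
  have dV : is_derive t 1 (fun s : R => s^-1) (- t^-1 ^+ 2).
    split; first exact: derivableV.
    by rewrite deriveV// derive_id exprVn; rewrite [_ *: _]mulr1.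
  have dE : is_derive t 1 (fun s : R => expR (- s^-1)) (t^-1 ^+ 2 * expR (- t^-1)).
    have dN := is_deriveN dV.
    have := @is_derive1_comp _ expR (fun s : R => - s^-1) t _ _ _ dN.
    move=> /(_ _ (is_derive_expR _)) h; apply: is_derive_eq h _.
    by rewrite opprK mulrC.
  have dX := is_deriveX k dV.
  have dM := is_deriveM dX dE.
  apply: (@near_eq_is_derive _ _ _ ((fun s : R => s^-1) ^+ k * (fun s : R => expR (- s^-1)))).
    near=> s; rewrite /flat ifT//; last by near: s; exact: lt_nbhsr.
    rewrite /GRing.mul/= -/GRing.mul; congr (_ * _).
    by rewrite fctE.
  apply: is_derive_eq dM _.
  have -> : ((fun s : R => s^-1) ^+ k) t = t^-1 ^+ k by rewrite fctE.
  rewrite /flat t0 /GRing.scale/=; case: k {dX} => [|k]; first by rewrite !expr0; ring.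
  by rewrite /= !exprS; ring.
- have -> : - k%:R * flat k.+1 0 + flat k.+2 0 = 0 by rewrite /flat ltxx mulr0 addr0.
  have f0 : flat k 0 = 0 by rewrite /flat ltxx.
  have h : (fun h => h^-1 *: ((flat k \o shift 0) (h *: 1) - flat k 0)) @ 0^' --> (0 : R).
    apply/cvgrPdist_le => e e0.
    have F0 : 0 < k.+2`!%:R :> R by rewrite ltr0n fact_gt0.
    near=> h.
    have hn0 : h != 0 by near: h; exact: nbhs_dnbhs_neq.
    rewrite f0 subr0 sub0r normrN /= addr0 [h *: 1]mulr1 normrM (ger0_norm (flat_ge0 _ _)).
    rewrite normfV ler_pdivrMl ?normr_gt0//.
    apply: le_trans (flat_le _ _) _.
    rewrite -real_normK ?num_real// expr2 mulrA [leRHS]mulrC ler_pM2r ?normr_gt0//.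
    rewrite mulrC -ler_pdivlMr//.
    by near: h; apply: dnbhs0_le; rewrite divr_gt0.
  by apply: DeriveDef; [apply/cvg_ex; exists 0 | exact: cvg_lim h].
Unshelve. all: by end_near. Qed.

Lemma flat_cvg1 (t : R) : 0 < t -> flat 0 (n.+1%:R * t) @[n --> \oo] --> (1 : R).
Proof.
move=> t0; rewrite -[X in _ --> X]expR0.
rewrite (_ : (fun n => _) = expR \o (fun n : nat => - (n.+1%:R^-1 * t^-1))); last first.
  by apply/funext => n; rewrite /flat mulr_gt0//= expr0 mul1r invfM.
apply: continuous_cvg; first exact: continuous_expR.
rewrite -oppr0; apply: cvgN; rewrite -(mul0r t^-1).
by apply: cvgM; [exact: cvg_harmonic | exact: cvg_cst].
Qed.

Lemma flat0_le1 (t : R) : flat 0 t <= 1.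
Proof.
rewrite /flat; case: ifPn => // t0; rewrite expr0 mul1r -expR0 ler_expR.
by rewrite oppr_le0 invr_ge0 ltW.
Qed.

End flat_functions.

(** * Smooth functions and test functions *)

Section smooth_theory.
Context {R : realType}.
Implicit Types V W : normedModType R.

Lemma iter_deriv_lin V W s (a : R) (f g : V -> W) : smooth f -> smooth g ->
  iter_deriv s (a *: f + g) = a *: iter_deriv s f + iter_deriv s g.
Proof.
move=> sf sg; elim: s => //= v s ->; apply/funext => x.
have [df dg] := ((sf s).2 v x, (sg s).2 v x).
by rewrite deriveD ?deriveZ//; exact: derivableZ.
Qed.

Lemma smooth_lin V W (a : R) (f g : V -> W) : smooth f -> smooth g -> smooth (a *: f + g).
Proof.
move=> sf sg s; rewrite iter_deriv_lin//.
have [[cf df] [cg dg]] := (sf s, sg s); split=> [x|v x].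
  by apply: continuousD; [apply: continuousZr; exact: cf | exact: cg].
by apply: derivableD => //; exact: derivableZ.
Qed.

Lemma test_fun_lin V W (D : set V) (a : R) (f g : V -> W) :
  test_fun D f -> test_fun D g -> test_fun D (a *: f + g).
Proof.
move=> [sf [K [cK KD f0]]] [sg [L [cL LD g0]]]; split; first exact: smooth_lin.
exists (K `|` L); split; first exact: compactU.
  by rewrite subUset.
move=> x /not_orP[Kx Lx].
by rewrite -[LHS]/(a *: f x + g x) f0// g0// scaler0 addr0.
Qed.

Lemma iter_deriv_supp V W s (f : V -> W) (K : set V) : closed K ->
  (forall x, ~ K x -> f x = 0) -> forall x, ~ K x -> iter_deriv s f x = 0.
Proof.
move=> cK f0; elim: s => //= v s IH x Kx.
rewrite (@near_eq_derive _ _ _ _ (cst 0)) ?derive_cst//.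
have : nbhs x (~` K) by apply: open_nbhs_nbhs; split => //; exact: closed_openC.
by apply: filterS => y; exact: IH.
Qed.

Lemma iter_deriv_mx V m n s (f : V -> 'M[R]_(m, n)) i j : smooth f ->
  iter_deriv s (fun x => f x i j) = fun x => iter_deriv s f x i j.
Proof.
move=> sf; elim: s => //= v s ->; apply/funext => x.
by rewrite derive_mx ?mxE//; exact: (sf s).2.
Qed.

Lemma smooth_mx V m n (f : V -> 'M[R]_(m, n)) i j : smooth f -> smooth (fun x => f x i j).
Proof.
move=> sf s; rewrite iter_deriv_mx//; have [cf df] := sf s; split => [x|v x].
  apply: (@continuous_comp _ _ _ (iter_deriv s f) (fun M : 'M[R]_(m, n) => M i j)); first exact: cf.
  exact: coord_continuous.
by move/derivable_mxP : (df v x); exact.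
Qed.

Lemma test_fun_mx V m n (D : set V) (f : V -> 'M[R]_(m, n)) i j :
  test_fun D f -> test_fun D (fun x => f x i j).
Proof.
move=> [sf [K [cK KD f0]]]; split; first exact: smooth_mx.
by exists K; split => // x Kx; rewrite f0// mxE.
Qed.

End smooth_theory.

Section integral_pi_system.
Context {R : realType} d0 {T : measurableType d0} (mu : {measure set T -> \bar R}).

(** The sets S for which g integrates to 0 over B [&] S form a Dynkin system; the vanishing integral
    over B itself starts it and yields complements. *)
Lemma pi_system_integral_eq0 (G : set (set T)) (B : set T) (g : T -> \bar R) :
  measurable = <<s G >> -> setI_closed G -> measurable B -> mu.-integrable B g ->
  (\int[mu]_(x in B) g x = 0)%E ->
  (forall A, G A -> \int[mu]_(x in B `&` A) g x = 0)%E ->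
  ae_eq mu B g (cst 0%E).
Proof.
move=> GE IG mB ig B0 AG.
have H S : <<s G >> S -> (\int[mu]_(x in B `&` S) g x = 0)%E.
  move: S; apply: dynkin_induction => //; first by rewrite setIT.
  - move=> S mS S0.
    have e : (\int[mu]_(x in B `&` S) g x + \int[mu]_(x in B `&` ~` S) g x = 0)%E.
      rewrite -integral_setU//.
      - by rewrite -setIUr setUv setIT.
      - exact: measurableI.
      - by apply: measurableI => //; exact: measurableC.
      - by rewrite -setIUr setUv setIT; exact: measurable_int ig.
      - apply/disj_setPS => x [[_ h] [_]]; exact.
    by move: e; rewrite S0 add0e.
  - move=> F mF tF F0; rewrite setI_bigcupr integral_bigcup//.
    + by rewrite eseries0// => k _ _; exact: F0.
    + move=> i j _ _ [x [[_ h1] [_ h2]]]; apply: tF => //; by exists x.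
    + by move=> k; exact: measurableI.
    + by rewrite -setI_bigcupr; apply: integrableS ig => //; apply: measurableI => //; exact: bigcup_measurable.
apply: integral_ae_eq => // E EB mE; rewrite integral0 -(setIidr EB).
by apply: H; rewrite -GE.
Qed.

Lemma Rintegral_subset0 (A B : set T) (f : T -> R) : A `<=` B ->
  (forall x, B x -> ~ A x -> f x = 0) ->
  \int[mu]_(x in B) f x = \int[mu]_(x in A) f x.
Proof.
move=> AB f0; rewrite Rintegral_mkcond [RHS]Rintegral_mkcond; apply: eq_Rintegral => x _.
rewrite !patchE; case: ifPn => [/set_mem Bx|/negP nB]; case: ifPn => [/set_mem Ax|/negP nA] //.
- by apply: f0 => // Ax; apply: nA; exact/mem_set.
- by exfalso; apply: nB; apply/mem_set; exact: AB.
Qed.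

End integral_pi_system.

(** * Smooth bumps approximating indicators of boxes *)

Section bumps.
Context {R : realType} {d : nat}.
Notation E := 'rV[R]_d.

Lemma rV_measurable_box : measurable = <<s [set A : set E | exists a b, A = box a b] >>.
Proof.
apply/seteqP; split; last first.
  apply: smallest_sub; first exact: sigma_algebra_measurable.
  by move=> _ [a [b ->]]; exact: measurable_box.
apply: smallest_sub; first exact: smallest_sigma_algebra.
move=> A; rewrite -bigcup_seq/= => -[i _ [Y mY <-]]; rewrite setTI.
pose G := [set A : set E | exists a b, A = box a b].
pose f (x : g_sigma_algebraType G) : measurableTypeR R := (x : E) ord0 i.
suff mf : measurable_fun setT f by rewrite -[X in <<s _ >> X]setTI; exact: mf.
apply: (measurability _ (RGenOpens.measurableE R)).
move=> /= _ [_ [a [b ->]] <-]; rewrite setTI.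
(* A strip in one coordinate is the union of the boxes whose other sides are ]-n, n[. *)
rewrite (_ : _ @^-1` _ = \bigcup_n box (fun j => if j == i then a else - n%:R)
    (fun j => if j == i then b else n%:R)).
  by apply: bigcupT_measurable => n; apply: sub_sigma_algebra; eexists; eexists.
apply/seteqP; split => x /=; rewrite in_itv/=.
  move=> xab; exists (Num.bound `|x|) => // j; case: eqVneq => [->//|_].
  rewrite -ltr_norml; apply: le_lt_trans (archi_boundP (normr_ge0 x)).
  rewrite [leRHS]/Num.Def.normr/= mx_normrE.
  exact: (le_bigmax _ (fun ij : 'I_1 * 'I_d => `|x ij.1 ij.2|) (ord0, j)).
by move=> [n _ /(_ i)]; rewrite eqxx.
Qed.

Lemma box_setI_closed : setI_closed [set A : set E | exists a b, A = box a b].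
Proof.
move=> _ _ [a [b ->]] [a' [b' ->]].
exists (fun i => Num.max (a i) (a' i)), (fun i => Num.min (b i) (b' i)).
apply/seteqP; split => x; first by move=> [h h'] i; have := h i; have := h' i; rewrite gt_max lt_min => /andP[-> ->] /andP[-> ->].
by move=> h; split => i; have := h i; rewrite gt_max lt_min => /andP[/andP[? ?] /andP[? ?]]; apply/andP.
Qed.

Lemma compact_cbox (a b : 'I_d -> R) : compact (cbox a b : set E).
Proof.
have := @rV_compact R d (fun i => `[a i, b i]%classic) (fun i => @segment_compact R (a i) (b i)).
set S := [set v | _]; move=> cS; rewrite (_ : cbox a b = S)//.
Qed.

(** A class of functions stable under directional derivatives, so that smoothness of its members
    needs no formula for iterated derivatives. *)
Inductive flat_alg : (E -> R) -> Prop :=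
| flat_gen k (c a : R) (j : 'I_d) : flat_alg (fun x => flat k (c * x ord0 j + a))
| flat_cst (c : R) : flat_alg (fun=> c)
| flat_add f g : flat_alg f -> flat_alg g -> flat_alg (fun x => f x + g x)
| flat_mul f g : flat_alg f -> flat_alg g -> flat_alg (fun x => f x * g x).

Lemma is_derive_affine (f : R -> R) (f' c a : R) (j : 'I_d) (x v : E) :
  is_derive (c * x ord0 j + a) 1 f f' ->
  is_derive x v (fun y : E => f (c * y ord0 j + a)) (c * v ord0 j * f').
Proof.
set y := c * x ord0 j + a; set w := c * v ord0 j => -[df Df].
have dif : differentiable f y by apply/derivable1_diffP.
have dw : is_derive y w f (w * f').
  split; first exact: diff_derivable.
  by rewrite deriveE// diff1E// derive1E Df.
have [dw1 dw2] := dw.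
have e : (fun h : R => h^-1 *: ((f \o shift y) (h *: w) - f y)) =
    (fun h => h^-1 *: (((fun y : E => f (c * y ord0 j + a)) \o shift x) (h *: v) - f (c * x ord0 j + a))).
  apply/funext => h; rewrite /= !mxE /y /w; congr (_ *: (f _ - _)).
  by rewrite /GRing.scale/=; ring.
split; first by rewrite /derivable -e.
by rewrite /derive -e.
Qed.

Lemma flat_alg_derive (v : E) f : flat_alg f ->
  (forall x, derivable f x v) /\ flat_alg ('D_v f).
Proof.
elim => {f} [k c a j|c|f g _ [df Df] _ [dg Dg]|f g Ff [df Df] Fg [dg Dg]].
- have h (x : E) := is_derive_affine v (is_derive_flat k (c * x ord0 j + a)).
  split=> [x|]; first by have [] := h x.
  rewrite (_ : 'D_v _ = fun x => (c * v ord0 j) * ((- k%:R) * flat k.+1 (c * x ord0 j + a) + flat k.+2 (c * x ord0 j + a))).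
    apply: flat_mul; first exact: flat_cst.
    apply: flat_add; last exact: flat_gen.
    by apply: flat_mul; [exact: flat_cst | exact: flat_gen].
  by apply/funext => x; have [] := h x.
- split=> [x|]; first exact: derivable_cst.
  rewrite (_ : 'D_v _ = fun=> 0); first exact: flat_cst.
  by apply/funext => x; rewrite derive_cst.
- split=> [x|]; first exact: (derivableD (df x) (dg x)).
  rewrite (_ : 'D_v _ = fun x => 'D_v f x + 'D_v g x); first exact: flat_add.
  by apply/funext => x; rewrite -(deriveD (df x) (dg x)).
- split=> [x|]; first exact: (derivableM (df x) (dg x)).
  rewrite (_ : 'D_v _ = fun x => f x * 'D_v g x + g x * 'D_v f x).
    by apply: flat_add; apply: flat_mul.
  by apply/funext => x; have := deriveM (df x) (dg x).
Qed.

Lemma continuous_flat k : continuous (@flat R k).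
Proof.
move=> t; apply: differentiable_continuous; apply/derivable1_diffP.
by have [] := is_derive_flat k t.
Qed.

Lemma flat_alg_continuous f : flat_alg f -> continuous f.
Proof.
elim => {f} [k c a j|c|f g _ cf _ cg|f g _ cf _ cg] x.
- apply: (@continuous_comp _ _ _ (fun y : E => c * y ord0 j + a) (@flat R k)); last exact: continuous_flat.
  apply: continuousD; last exact: cst_continuous.
  apply: continuousM; first exact: cst_continuous.
  exact: coord_continuous.
- exact: cst_continuous.
- by apply: continuousD; [exact: cf | exact: cg].
- by apply: continuousM; [exact: cf | exact: cg].
Qed.

Lemma flat_alg_smooth f : flat_alg f -> smooth f.
Proof.
move=> Ff s; suff Fs : flat_alg (iter_deriv s f).
  split; first exact: flat_alg_continuous.
  by move=> v x; have [] := flat_alg_derive v Fs.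
by elim: s => //= v s IH; have [] := flat_alg_derive v IH.
Qed.

(** For each s, [flat 0 (n.+1%:R * s)] tends to 1 if s > 0 and is 0 otherwise; two such factors per
    coordinate detect the open interval. *)
Definition bump (a b : 'I_d -> R) (n : nat) (x : E) : R :=
  \prod_j (flat 0 (n.+1%:R * (x ord0 j - a j)) * flat 0 (n.+1%:R * (b j - x ord0 j))).

Lemma smooth_bump a b n : smooth (bump a b n).
Proof.
apply: flat_alg_smooth; rewrite /bump; elim: (index_enum _) => [|j s IH].
  by under eq_fun do rewrite big_nil; exact: flat_cst.
under eq_fun do rewrite big_cons; apply: flat_mul => //; apply: flat_mul.
  rewrite (_ : (fun _ => _) = fun x : E => flat 0 (n.+1%:R * x ord0 j + n.+1%:R * - a j)).
    exact: flat_gen.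
  by apply/funext => x; rewrite -mulrDr.
rewrite (_ : (fun _ => _) = fun x : E => flat 0 (- n.+1%:R * x ord0 j + n.+1%:R * b j)).
  exact: flat_gen.
by apply/funext => x; rewrite mulNr -mulrN -mulrDr addrC.
Qed.

Lemma bump_out a b n (x : E) : ~ box a b x -> bump a b n x = 0.
Proof.
move=> /existsNP[j /negP hj]; rewrite /bump (bigD1 j)//=.
have [xa|ax] := leP (x ord0 j) (a j).
  rewrite {1}/flat ifF ?mul0r//; apply/negbTE; rewrite -leNgt pmulr_rle0 ?subr_le0//.
have [bx|xb] := leP (b j) (x ord0 j); last by rewrite ax xb in hj.
rewrite (_ : flat 0 (_ * (b j - _)) = 0) ?mulr0 ?mul0r//.
rewrite /flat ifF//; apply/negbTE; rewrite -leNgt pmulr_rle0 ?subr_le0//.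
Qed.

Lemma bump_bounds a b n (x : E) : 0 <= bump a b n x <= 1.
Proof.
rewrite /bump; elim/big_ind : _ => [|u w /andP[u0 u1] /andP[w0 w1]|j _].
- by rewrite ler01 lexx.
- by rewrite mulr_ge0//= mulr_ile1.
- by rewrite mulr_ge0 ?flat_ge0//= mulr_ile1 ?flat_ge0 ?flat0_le1.
Qed.

Lemma bump_cvg a b (x : E) : bump a b n x @[n --> \oo] --> (\1_(box a b) x : R).
Proof.
have [bx|nbx] := pselect (box a b x); last first.
  rewrite indicE memNset// (_ : (fun _ => _) = fun=> 0); first exact: cvg_cst.
  by apply/funext => n; exact: bump_out.
rewrite indicE mem_set//= /bump; elim: (index_enum _) => [|j s IH].
  by under eq_fun do rewrite big_nil; exact: cvg_cst.
have /andP[h1 h2] := bx j; rewrite -subr_gt0 in h1; rewrite -subr_gt0 in h2.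
have H := cvgM (cvgM (flat_cvg1 h1) (flat_cvg1 h2)) IH; rewrite !mulr1 in H.
by under eq_fun do rewrite big_cons; exact: H.
Qed.

Lemma test_fun_bump (D : set E) a b n : cbox a b `<=` D -> test_fun D (bump a b n).
Proof.
move=> bD; split; first exact: smooth_bump.
exists (cbox a b); split => //; first exact: compact_cbox.
by move=> x h; apply: bump_out => /sub_box_cbox.
Qed.

End bumps.

(** * The fundamental lemma of the calculus of variations *)

Section weak_uniqueness.
Context {R : realType} {d : nat} (D : set 'rV[R]_d).
Hypothesis oD : open D.
Notation mu := (@leb R d).

Let mD : measurable D. Proof. exact: open_measurable_rV. Qed.

Lemma L1loc_cbox (g : 'rV[R]_d -> R) a b : L1loc D g -> cbox a b `<=` D ->
  mu.-integrable (cbox a b) (EFin \o g).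
Proof. by move=> [_ h] bD; apply: h => //; exact: compact_cbox. Qed.

Lemma compact_measurable_rV (K : set 'rV[R]_d) : compact K -> measurable K.
Proof.
move=> cK; rewrite -(setCK K); apply: measurableC; apply: open_measurable_rV.
by apply: closed_openC; apply: compact_closed => //; exact: norm_hausdorff.
Qed.

(** The bumps converge to the indicator of the open box and are dominated by 1 on the closed box,
    where g is integrable. *)
Lemma L1loc_integral_box (g : 'rV[R]_d -> R) : L1loc D g ->
  (forall f : 'rV[R]_d -> R, test_fun D f -> \int[mu]_(x in D) (g x * f x) = 0) ->
  forall a b, cbox a b `<=` D -> \int[mu]_(x in box a b) g x = 0.
Proof.
move=> Lg h a b bD; have ig := L1loc_cbox Lg bD.
have mK : measurable (cbox a b : set 'rV[R]_d) by apply: compact_measurable_rV; exact: compact_cbox.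
have mg : measurable_fun (cbox a b) g by apply/measurable_EFinP; exact: measurable_int ig.
have [] := @dominated_cvg_Rintegral _ _ _ mu _ mK (fun n x => g x * bump a b n x)
   (fun x => g x * \1_(box a b) x) (fun x => `|g x|).
- move=> n; apply: measurable_funM => //; apply: measurable_funS (continuous_measurable_rV _) => //.
  by have [] := smooth_bump a b n [::].
- exact: integrableRnorm.
- move=> n x _; have /andP[b0 b1] := bump_bounds a b n x.
  by rewrite normrM (ger0_norm b0) ler_piMr.
- by move=> x _; apply: cvgM; [exact: cvg_cst | exact: bump_cvg].
move=> _; rewrite (_ : (fun n => _) = fun=> 0); last first.
  apply/funext => n; rewrite -(h _ (test_fun_bump n bD)).
  apply/esym/Rintegral_subset0 => // x _ nK.
  by rewrite bump_out ?mulr0// => /sub_box_cbox.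
move=> c; have := cvg_unique (@norm_hausdorff _ R) c (cvg_cst (0 : R)).
rewrite (@Rintegral_subset0 _ _ _ mu (box a b)); last 2 first.
- exact: sub_box_cbox.
- by move=> x _ nb; rewrite indicE memNset// mulr0.
by move=> <-; apply: eq_Rintegral => x xb; rewrite indicE xb mulr1.
Qed.

(** Inside a box with closure in D, g integrates to 0 over all intersections with boxes, which
    generate the Borel sets; D is a countable union of such boxes. *)
Lemma L1loc_ae_eq0 (g : 'rV[R]_d -> R) : L1loc D g ->
  (forall f : 'rV[R]_d -> R, test_fun D f -> \int[mu]_(x in D) (g x * f x) = 0) ->
  {ae mu, forall x, D x -> g x = 0}.
Proof.
move=> Lg h; have H := L1loc_integral_box Lg h.
have hb a b : cbox a b `<=` D -> {ae mu, forall x, box a b x -> g x = 0}.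
  move=> bD; have ig := L1loc_cbox Lg bD.
  have mK : measurable (cbox a b : set 'rV[R]_d) by apply: compact_measurable_rV; exact: compact_cbox.
  have mB := measurable_box a b.
  have igB : mu.-integrable (box a b) (EFin \o g).
    exact: (integrableS mK mB (@sub_box_cbox _ _ a b)).
  have zero a' b' : cbox a' b' `<=` D -> (\int[mu]_(x in box a' b') (g x)%:E = 0)%E.
    move=> bD'; rewrite -[LHS]fineK; first by congr EFin; exact: H.
    apply: integrable_fin_num; first exact: measurable_box.
    have mK' : measurable (cbox a' b' : set 'rV[R]_d) by apply: compact_measurable_rV; exact: compact_cbox.
    exact: (integrableS mK' (measurable_box a' b') (@sub_box_cbox _ _ a' b') (L1loc_cbox Lg bD')).
  have e : ae_eq mu (box a b) (EFin \o g) (cst 0%E).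
    apply: (pi_system_integral_eq0 rV_measurable_box box_setI_closed mB igB); first exact: zero.
    move=> _ [a' [b' ->]].
    have [a2 [b2 e2]] := box_setI_closed (ex_intro _ a (ex_intro _ b erefl)) (ex_intro _ a' (ex_intro _ b' erefl)).
    rewrite /= in e2.
    rewrite (_ : box a b `&` box a' b' = box (fun i => Num.max (a i) (a' i)) (fun i => Num.min (b i) (b' i))); last first.
      apply/seteqP; split => x; first by move=> [h1 h2] i; have := h1 i; have := h2 i; rewrite gt_max lt_min => /andP[-> ->] /andP[-> ->].
      by move=> h1; split => i; have := h1 i; rewrite gt_max lt_min => /andP[/andP[? ?] /andP[? ?]]; apply/andP.
    apply: zero => x hx; apply: bD => i; have := hx i.
    by rewrite ge_max le_min => /andP[/andP[-> _] /andP[-> _]].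
  have e' : {ae mu, forall x, box a b x -> (g x)%:E = 0%E} by exact: e.
  by apply: (ae_mono e') => x h1 /h1 [].
have : {ae mu, forall x, forall n, sub_box D n x -> g x = 0}.
  apply: ae_forall => n; have [->|[a [b [-> bD]]]] := sub_boxP D n; last exact: hb.
  by apply: aeW => x [].
move/ae_mono; apply => x hx Dx; move: (Dx); rewrite {1}(open_sub_box oD) => -[n _]; exact: hx.
Qed.

End weak_uniqueness.

Section difference_quotients.
Context {R : realType} {V : normedModType R}.

Lemma derivable_cvg_seq (f : V -> R) (x v : V) (h : nat -> R) : derivable f x v ->
  (forall n, 0 < h n) -> h n @[n --> \oo] --> 0 ->
  (h n)^-1 * (f (x + h n *: v) - f x) @[n --> \oo] --> 'D_v f x.
Proof.
move=> df h0 h0cvg.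
have hN : h n @[n --> \oo] --> (0 : R)^'.
  move=> A [e /= e0 hA].
  have H := (cvgrPdist_lt _ _).1 h0cvg e e0.
  change (\forall n \near \oo, A (h n)); apply: (filterS _ (H _)) => n hn.
  by apply: hA => //=; rewrite gt_eqF.
have dfc : (fun h : R => h^-1 *: ((f \o shift x) (h *: v) - f x)) @ 0^' --> 'D_v f x by exact: df.
rewrite (_ : (fun n => (h n)^-1 * _) =
  (fun h : R => h^-1 *: ((f \o shift x) (h *: v) - f x)) \o h); first exact: cvg_comp hN dfc.
by apply/funext => n; rewrite /= [_ *: v + x]addrC.
Qed.

End difference_quotients.

(** * Compactly supported functions and integration by parts *)

Section compact_support.
Context {R : realType} {d : nat}.
Notation mu := (@leb R d).
Notation E := 'rV[R]_d.

Lemma compact_le (K : set E) (f : E -> R) : compact K -> continuous f ->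
  exists2 M, 0 <= M & forall x, K x -> `|f x| <= M.
Proof.
move=> cK cf.
have := @compact_bounded _ _ _ (continuous_compact (continuous_subspaceT cf) cK).
move=> [M [Mr hM]]; exists (`|M| + 1); first by rewrite addr_ge0.
move=> x Kx; apply: (hM (`|M| + 1)); last by exists x.
by rewrite (le_lt_trans (ler_norm M))// ltrDl.
Qed.

Lemma compact_leb (K : set E) : compact K -> (mu K < +oo)%E.
Proof.
by move=> cK; apply: leb_bounded_lty; [exact: compact_measurable_rV | exact: compact_bounded].
Qed.

Lemma continuous_integrable (K : set E) (f : E -> R) : compact K -> continuous f ->
  mu.-integrable K (EFin \o f).
Proof.
move=> cK cf; have [M M0 hM] := compact_le cK cf.
have mK := compact_measurable_rV cK.
apply: (@integrable_Rbound _ _ _ mu K mK _ (fun=> M)).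
- exact: measurable_funS (continuous_measurable_rV cf).
- apply/integrableP; split; first exact: measurable_cst.
  rewrite (_ : (\int[mu]_(x in K) _)%E = (`|M|%:E * mu K)%E); last by rewrite -integral_cst.
  by rewrite lte_mul_pinfty// compact_leb.
- exact: hM.
Qed.

Lemma restrict_integrable (K : set E) (f : E -> R) (D : set E) : measurable K -> measurable D ->
  K `<=` D -> (forall x, D x -> ~ K x -> f x = 0) -> mu.-integrable K (EFin \o f) ->
  mu.-integrable D (EFin \o f).
Proof.
move=> mK mD KD f0 fi.
have := (integrable_mkcond (EFin \o f) mK).1 fi.
move/(integrableS measurableT mD (@subsetT _ D)).
apply: eq_integrable => // x /set_mem Dx; rewrite patchE.
by case: ifPn => // /negP nK; rewrite /= f0// => Kx; apply: nK; exact/mem_set.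
Qed.

(* Translation invariance makes the integral of every difference quotient
   vanish *)
Lemma Rintegral_derive_eq0 (f : E -> R) (v : E) (K : set E) : compact K -> continuous f ->
  (forall x, derivable f x v) -> continuous ('D_v f) ->
  (forall x, ~ K x -> f x = 0) -> \int[mu]_x 'D_v f x = 0.
Proof.
move=> cK cf df cdf f0.
have df0 := @iter_deriv_supp _ _ _ [:: v] f K (compact_closed (@norm_hausdorff _ _) cK) f0.
have [M M0 hM] := compact_le cK cdf.
have {}hM x : `|'D_v f x| <= M.
  by have [/hM//|/df0/= ->] := pselect (K x); rewrite normr0.
have line (x : E) (s : R) : is_derive s 1 (fun s : R => f (x + s *: v)) ('D_v f (x + s *: v)).
  have e : (fun h : R => h^-1 *: (((fun s : R => f (x + s *: v)) \o shift s) (h *: 1) - f (x + s *: v))) =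
      (fun h => h^-1 *: ((f \o shift (x + s *: v)) (h *: v) - f (x + s *: v))).
    apply/funext => h; congr (_ *: (f _ - _)); rewrite /= [h *: 1]mulr1 scalerDl.
    by rewrite addrCA.
  by split; [rewrite /derivable e; exact: df | rewrite /derive e].
have lip (x : E) (h : R) : 0 < h -> `|f (x + h *: v) - f x| <= M * h.
  move=> h0.
  have [|s _] := @MVT R (fun s : R => f (x + s *: v)) (fun s : R => 'D_v f (x + s *: v)) 0 h h0 (fun s _ => line x s).
    apply: derivable_within_continuous => s _; by have [] := line x s.
  rewrite scale0r addr0 subr0 => ->; rewrite normrM (gtr0_norm h0).
  by apply: ler_wpM2r => //; exact: ltW.
have [r [r1 Kr]] : exists r : R, 0 <= r /\ K `<=` cbox (fun=> - r) (fun=> r).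
  have [A [Ar hA]] := compact_bounded cK; exists (`|A| + 1); split; first by rewrite addr_ge0.
  move=> x Kx i; rewrite -ler_norml.
  have : `|x| <= `|A| + 1 by apply: hA => //; rewrite (le_lt_trans (ler_norm A))// ltrDl.
  apply: le_trans; rewrite -[`|x|]/(mx_norm x) mx_normrE.
  exact: (le_bigmax _ (fun ij : 'I_1 * 'I_d => `|x ij.1 ij.2|) (ord0, i)).
have vi i : `|v ord0 i| <= `|v|.
  rewrite -[leRHS]/(mx_norm v) mx_normrE.
  exact: (le_bigmax _ (fun ij : 'I_1 * 'I_d => `|v ij.1 ij.2|) (ord0, i)).
(* The margin |v| makes all translates of f by h v with 0 <= h <= 1 vanish outside [Q], which
   therefore carries the common majorant. *)
pose Q : set E := cbox (fun=> - (r + `|v|)) (fun=> r + `|v|).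
have cQ : compact Q by exact: compact_cbox.
have mQ := compact_measurable_rV cQ.
have out (x : E) (h : R) : 0 <= h <= 1 -> ~ Q x -> f (x + h *: v) = 0.
  move=> /andP[h0 h1] nQ; apply: f0 => /Kr xr; apply: nQ => i.
  have := xr i; rewrite !mxE -!ler_norml => hx.
  have hv : `|h * v ord0 i| <= `|v|.
    by rewrite normrM (ger0_norm h0) (le_trans _ (vi i))// ler_piMl.
  rewrite -[x ord0 i](addrK (h * v ord0 i)).
  by apply: (le_trans (ler_normB _ _)); exact: lerD.
have out0 (x : E) : ~ Q x -> f x = 0.
  by move=> nQ; rewrite -(addr0 x) -(scale0r v); apply: out => //; rewrite lexx ler01.
have fi : mu.-integrable setT (EFin \o f).
  by apply: (@restrict_integrable Q) => //; [move=> x _; exact: out0 | exact: continuous_integrable].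
pose h n : R := n.+1%:R^-1.
have h0 n : 0 < h n by rewrite invr_gt0.
have h1 n : h n <= 1 by rewrite invf_le1// ler1n.
have fih n : mu.-integrable setT (EFin \o (fun x => f (x + h n *: v))).
  exact: (integrable_preserving (measurable_addr_rV (h n *: v)) (leb_addr (h n *: v)) fi).
have [] := @dominated_cvg_Rintegral _ _ _ mu setT measurableT
   (fun n x => (h n)^-1 * (f (x + h n *: v) - f x)) ('D_v f) (fun x => M * \1_Q x).
- move=> n; apply: measurable_funM => //.
  by apply: measurable_funB; [have := measurable_int _ (fih n)|have := measurable_int _ fi]; move/measurable_EFinP.
- apply: (@restrict_integrable Q) => //; first by move=> x _ nQ; rewrite indicE memNset// mulr0.
  apply: eq_integrable (continuous_integrable cQ (@cst_continuous _ _ M)) => // x xQ.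
  by rewrite /= indicE xQ mulr1.
- move=> n x _; have [Qx|nQ] := pselect (Q x); last first.
    by rewrite out ?out0// ?subrr ?mulr0 ?normr0 ?h1 ?(ltW (h0 n))// mulr_ge0.
  rewrite indicE mem_set// mulr1 normrM gtr0_norm ?invr_gt0// mulrC ler_pdivrMr//.
  exact: lip.
- move=> x _; apply: derivable_cvg_seq => //; exact: cvg_harmonic.
move=> _ c; have := cvg_unique (@norm_hausdorff _ R) c; apply.
rewrite (_ : (fun n => _) = fun=> 0); first exact: cvg_cst.
apply/funext => n; rewrite RintegralZl//; last exact: integrableRB.
rewrite RintegralB// (Rintegral_preserving (measurable_addr_rV (h n *: v)) (leb_addr (h n *: v)) fi).
by rewrite subrr mulr0.
Qed.

End compact_support.

(** * Weak derivatives *)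

Section weak_derivatives.
Context {R : realType} {d : nat} (D : set 'rV[R]_d).
Hypothesis oD : open D.
Notation mu := (@leb R d).
Notation E := 'rV[R]_d.
Implicit Types u g f : E -> R.

Let mD : measurable D. Proof. exact: open_measurable_rV. Qed.

Lemma L1loc_mul_integrable u h (K : set E) : L1loc D u -> continuous h -> compact K ->
  K `<=` D -> (forall x, ~ K x -> h x = 0) ->
  mu.-integrable D (EFin \o (fun x => u x * h x)).
Proof.
move=> [mu_ Lu] ch cK KD h0; have mK := compact_measurable_rV cK.
have [M M0 hM] := compact_le cK ch.
apply: (@restrict_integrable _ _ K) => //; first by move=> x _ /h0 ->; rewrite mulr0.
apply: (@integrable_Rbound _ _ _ mu K mK _ (fun x => M * `|u x|)).
- apply: measurable_funM; first exact: measurable_funS mu_.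
  exact: measurable_funS (continuous_measurable_rV ch).
- by apply: integrableRZ => //; apply: integrableRnorm => //; exact: Lu.
- by move=> x Kx; rewrite normrM mulrC ler_wpM2r// hM.
Qed.

Lemma L1loc_test_integrable u f s : L1loc D u -> test_fun D f ->
  mu.-integrable D (EFin \o (fun x => u x * iter_deriv s f x)).
Proof.
move=> Lu [sf [K [cK KD f0]]]; apply: (L1loc_mul_integrable Lu _ cK KD).
  by have [] := sf s.
by apply: iter_deriv_supp => //; apply: compact_closed => //; exact: norm_hausdorff.
Qed.

Lemma L1loc_lin (a : R) u g : L1loc D u -> L1loc D g -> L1loc D (a *: u + g).
Proof.
move=> [mu_ Lu] [mg Lg]; split.
  by apply: measurable_funD => //; exact: measurable_funM.
move=> K cK KD; have mK := compact_measurable_rV cK.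
by apply: integrableRD => //; [apply: integrableRZ => //; exact: Lu | exact: Lg].
Qed.

Lemma continuous_L1loc u : continuous u -> L1loc D u.
Proof.
move=> cu; split; first exact: measurable_funS (continuous_measurable_rV cu).
by move=> K cK _; exact: continuous_integrable.
Qed.

Lemma weak_deriv_lin s (a : R) u u' g g' : weak_deriv D s u g -> weak_deriv D s u' g' ->
  weak_deriv D s (a *: u + u') (a *: g + g').
Proof.
move=> [Lu Lg h] [Lu' Lg' h']; split; [exact: L1loc_lin..|] => f tf.
have iu := L1loc_test_integrable (map e_ s) Lu tf.
have iu' := L1loc_test_integrable (map e_ s) Lu' tf.
have ig := L1loc_test_integrable [::] Lg tf.
have ig' := L1loc_test_integrable [::] Lg' tf.
have := Rintegral_lin2 mD a iu iu'; have := Rintegral_lin2 mD a ig ig'.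
rewrite /= (h f tf) (h' f tf) => e1 e2.
have -> : \int[mu]_(x in D) ((a *: u + u') x * iter_deriv (map e_ s) f x) =
    \int[mu]_(t in D) (a * (u t * iter_deriv (map e_ s) f t) + u' t * iter_deriv (map e_ s) f t).
  by apply: eq_Rintegral => x _; rewrite /= mulrDl -mulrA.
have -> : \int[mu]_(x in D) ((a *: g + g') x * f x) =
    \int[mu]_(t in D) (a * (g t * f t) + g' t * f t).
  by apply: eq_Rintegral => x _; rewrite /= mulrDl -mulrA.
by rewrite e1 e2; ring.
Qed.

Lemma weak_deriv_ae_unique s u g g' : weak_deriv D s u g -> weak_deriv D s u g' ->
  {ae mu, forall x, D x -> g x = g' x}.
Proof.
move=> [Lu Lg h] [_ Lg' h'].
have Ld : L1loc D ((-1) *: g + g') by exact: L1loc_lin.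
have := L1loc_ae_eq0 oD Ld.
have zero f : test_fun D f -> \int[mu]_(x in D) (((-1) *: g + g') x * f x) = 0.
  move=> tf; have ig := L1loc_test_integrable [::] Lg tf.
  have ig' := L1loc_test_integrable [::] Lg' tf.
  have := Rintegral_lin2 mD (-1) ig ig'.
  have -> : \int[mu]_(x in D) ((-1 *: g + g') x * f x) =
      \int[mu]_(t in D) (-1 * (g t * f t) + g' t * f t).
    by apply: eq_Rintegral => x _; rewrite /= mulrDl -mulrA.
  move=> /= ->; have := h f tf; rewrite (h' f tf) => /(congr1 (fun z => (-1) ^+ size s * z)).
  by rewrite !mulrA -!exprMn mulrNN mulr1 expr1n !mul1r => ->; ring.
move=> /(_ zero)/ae_mono; apply => x hx Dx; have := hx Dx.
by rewrite -[LHS]/(-1 * g x + g' x) => e; lra.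
Qed.

Lemma wpart_weak_deriv i u g : weak_deriv D [:: i] u g -> weak_deriv D [:: i] u (wpart D i u).
Proof. by move=> h; exact: (@xgetPex _ (fun=> 0) (weak_deriv D [:: i] u) (ex_intro _ g h)). Qed.

(** [wpart] is an arbitrary choice among weak derivatives, so every identity for it, linearity
    included, holds only almost everywhere. *)
Lemma wpart_ae i u g : weak_deriv D [:: i] u g -> {ae mu, forall x, D x -> wpart D i u x = g x}.
Proof. by move=> h; apply: (weak_deriv_ae_unique _ h); exact: wpart_weak_deriv h. Qed.

(** The product u f has compact support, so its derivative integrates to 0; the product rule splits
    this integral. *)
Lemma test_fun_weak_deriv i u : test_fun D u -> weak_deriv D [:: i] u ('D_(e_ i) u).
Proof.
move=> [su [K [cK KD u0]]].
have [[cu du] [cdu _]] := (su [::], su [:: e_ i]); rewrite /= in cu du cdu.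
have Lu := continuous_L1loc cu; have Ldu := continuous_L1loc cdu.
split => // f [sf [L [cL LD f0]]]; rewrite /= expr1 mulN1r.
have [[cf df] [cdf _]] := (sf [::], sf [:: e_ i]); rewrite /= in cf df cdf.
have tf : test_fun D f by split => //; exists L.
have Dm x : 'D_(e_ i) (u * f) x = u x * 'D_(e_ i) f x + f x * 'D_(e_ i) u x.
  by rewrite deriveM.
have cp : continuous (u * f) by move=> x; apply: continuousM; [exact: cu | exact: cf].
have dp x : derivable (u * f) x (e_ i) by exact: derivableM.
have cdp : continuous ('D_(e_ i) (u * f)).
  rewrite (_ : 'D_(e_ i) _ = u * 'D_(e_ i) f + f * 'D_(e_ i) u); last first.
    by apply/funext => x; rewrite Dm.
  by move=> x; apply: continuousD; apply: continuousM; [exact: cu|exact: cdf|exact: cf|exact: cdu].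
have p0 x : ~ K x -> (u * f) x = 0 by move=> /u0 e; rewrite -[LHS]/(u x * f x) e mul0r.
have := Rintegral_derive_eq0 cK cp dp cdp p0.
have df0 := @iter_deriv_supp _ _ _ [:: e_ i] _ K (compact_closed (@norm_hausdorff _ _) cK) p0.
rewrite (@Rintegral_subset0 _ _ _ _ D) //; last first.
  by move=> x _ nD; apply: df0 => /KD.
have i1 := L1loc_test_integrable [:: e_ i] Lu tf.
have i2 := L1loc_test_integrable [::] Ldu tf.
have -> : \int[mu]_(x in D) 'D_(e_ i) (u * f) x =
    \int[mu]_(x in D) (1 * (u x * 'D_(e_ i) f x) + 'D_(e_ i) u x * f x).
  by apply: eq_Rintegral => x _; rewrite Dm mul1r; congr (_ + _); exact: mulrC.
have := Rintegral_lin2 mD 1 i1 i2; rewrite /= => -> /eqP.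
by rewrite mul1r addr_eq0 => /eqP.
Qed.

End weak_derivatives.

(** * Sobolev spaces as spaces with a p-th power of a seminorm *)

Section sub_pseminorms.
Context {R : realType} {p : R} {E : lmodType R} (X : pseminorm p E) (S : set E).
Hypotheses (SX : S `<=` ps_mem X) (S0 : S 0)
  (Slin : forall a x y, S x -> S y -> S (a *: x + y)).

Let subZ (a : R) x : S x -> psn X (a *: x) = `|a| `^ p * psn X x.
Proof. by move=> /SX; exact: psnZ. Qed.

Let sub_quasi (e : R) : 0 < e -> exists2 C : R, 0 <= C &
  forall x y, S x -> S y -> psn X (x + y) <= (1 + e) * psn X x + C * psn X y.
Proof.
move=> e0; have [C C0 h] := psn_quasi X e0.
by exists C => // x y /SX mx /SX; exact: h.
Qed.

Let sub_smooth : exists2 C : R, 0 <= C & forall x y (e : R), S x -> S y -> 0 <= e <= 1 ->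
  psn X (x + e *: y) + psn X (x - e *: y) <= 2 * psn X x + C * e ^+ 2 * (psn X x + psn X y).
Proof.
have [C C0 h] := psn_smooth X.
by exists C => // x y e /SX mx /SX; exact: h.
Qed.

Definition sub_pseminorm : pseminorm p E :=
  Pseminorm (psn_ge0 X) S0 Slin subZ sub_quasi sub_smooth.

End sub_pseminorms.

Lemma quasi_arith (R : realDomainType) (e C C' a b v1 v2 w1 w2 : R) :
  0 <= C -> 0 <= C' -> 0 <= w1 -> 0 <= w2 ->
  b <= e * v2 + C' * w2 -> a <= e * v1 + C * w1 ->
  a + b <= e * (v1 + v2) + (C + C') * (w1 + w2).
Proof.
move=> C0 C'0 w10 w20 hb ha; apply: le_trans (lerD ha hb) _.
by have := mulr_ge0 C0 w20; have := mulr_ge0 C'0 w10; lra.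
Qed.

Lemma smooth_arith (R : realDomainType) (e C C' a a' b b' v1 v2 w1 w2 : R) :
  0 <= C -> 0 <= C' -> 0 <= v1 -> 0 <= v2 -> 0 <= w1 -> 0 <= w2 -> 0 <= e ->
  b + b' <= 2 * v2 + C' * e * (v2 + w2) -> a + a' <= 2 * v1 + C * e * (v1 + w1) ->
  (a + b) + (a' + b') <= 2 * (v1 + v2) + (C + C') * e * ((v1 + v2) + (w1 + w2)).
Proof.
move=> C0 C'0 v10 v20 w10 w20 e0 hb ha; rewrite addrACA; apply: le_trans (lerD ha hb) _.
have : 0 <= C * e * (v2 + w2) by rewrite mulr_ge0 ?addr_ge0// mulr_ge0.
have : 0 <= C' * e * (v1 + w1) by rewrite mulr_ge0 ?addr_ge0// mulr_ge0.
by move=> ? ?; lra.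
Qed.

Lemma sum_powR_inv (R : realType) (p a b : R) : 0 < p -> 0 <= a -> 0 <= b ->
  (((a `^ p^-1)%:E `^ p + (b `^ p^-1)%:E `^ p) `^ p^-1 = ((a + b) `^ p^-1)%:E)%E.
Proof. by move=> p0 a0 b0; rewrite !poweR_EFin !powR_inv. Qed.

Lemma powR_seq_cvg0 (R : realType) (u : nat -> R) (r : R) : 0 < r -> (forall k, 0 <= u k) ->
  u k `^ r @[k --> \oo] --> 0 <-> u k @[k --> \oo] --> 0.
Proof.
move=> r0 u0; split => h; apply/cvgrPdist_lt => e e0.
  have er : 0 < e `^ r by exact: powR_gt0.
  have H := (cvgrPdist_lt _ _).1 h _ er.
  apply: (filterS _ (H _)) => k; rewrite !sub0r !normrN !ger0_norm ?powR_ge0// => hk.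
  by rewrite ltNge; apply/negP => ek; move: hk; rewrite ltNge ge0_ler_powR ?nnegrE ?(ltW r0) ?(ltW e0).
have er : 0 < e `^ r^-1 by exact: powR_gt0.
have H := (cvgrPdist_lt _ _).1 h _ er.
apply: (filterS _ (H _)) => k; rewrite !sub0r !normrN !ger0_norm ?powR_ge0// => hk.
have -> : e = (e `^ r^-1) `^ r by rewrite -powRrM mulVf ?gt_eqF// powRr1// ltW.
by rewrite gt0_ltr_powR ?nnegrE ?powR_ge0.
Qed.

Lemma scvg_ps_cvg (R : realType) (p : R) (F : lmodType R) (Y : seminormed_space R F) (X : pseminorm p F)
    (u : nat -> F) v : 0 < p -> (forall x, ps_mem X x -> sp_norm Y x = (psn X x `^ p^-1)%:E) ->
  (forall k, ps_mem X (u k)) -> ps_mem X v -> scvg Y u v <-> ps_cvg X u v.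
Proof.
move=> p0 nE mu_ mv; rewrite /scvg /ps_cvg.
rewrite (_ : (fun k => sp_norm Y (u k - v)) = fun k => (psn X (u k - v) `^ p^-1)%:E); last first.
  by apply/funext => k; apply: nE; exact: ps_memB.
have p1 : 0 < p^-1 by rewrite invr_gt0.
rewrite -(powR_seq_cvg0 p1); last by move=> k; exact: psn_ge0.
split => [h|h].
  by have /fine_cvgP[] := h.
by apply/fine_cvgP; split; first exact: nearW.
Qed.

Section sobolev_pseminorm.
Context {R : realType} {d : nat} (D : set 'rV[R]_d).
Hypothesis oD : open D.
Variables (p q : R).
Hypotheses (p2 : 2 <= p) (pq : p^-1 + q^-1 = 1).
Notation mu := (@leb R d).
Notation E := 'rV[R]_d.

Let mD : measurable D. Proof. exact: open_measurable_rV. Qed.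
Let p0 : 0 < p. Proof. exact: ge2_gt0. Qed.

Section ae.
Variables m n : nat.
Implicit Types f g : E -> 'M[R]_(m, n).

Lemma Lint_ae f g : {ae mu, forall x, D x -> f x = g x} -> Lint mu D p f = Lint mu D p g.
Proof. by move=> fg; apply: ae_eq_Rintegral_gen; apply: (ae_mono fg) => x h /h ->. Qed.

Lemma Lmem_ae f g : entries_measurable D g -> {ae mu, forall x, D x -> f x = g x} ->
  Lmem mu D p f -> Lmem mu D p g.
Proof.
move=> mg fg [mf /integrableP[_ fi]]; split => //; apply/integrableP; split.
  by apply/measurable_EFinP; exact: measurable_frob_powR.
apply: le_lt_trans fi; rewrite le_eqVlt; apply/orP; left; apply/eqP.
by apply: ae_eq_integral_gen; apply: (ae_mono fg) => x h /h /= ->.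
Qed.

End ae.

Section W1.
Variable n : nat.
Implicit Types v w : E -> 'rV[R]_n.

Definition weakly_derivable v := forall i j, exists g, weak_deriv D [:: i] (comp_ v j) g.

Lemma weakly_derivable_lin (a : R) v w : weakly_derivable v -> weakly_derivable w ->
  weakly_derivable (a *: v + w).
Proof.
move=> hv hw i j; have [g hg] := hv i j; have [g' hg'] := hw i j.
exists (a *: g + g'); have := weak_deriv_lin oD a hg hg'; congr (weak_deriv _ _ _ _).
by apply/funext => x; rewrite /comp_ -[RHS]/((a *: v x + w x) ord0 j) !mxE.
Qed.

Lemma entries_measurable_wgrad v : weakly_derivable v -> entries_measurable D (wgrad D v).
Proof.
move=> hv i j; have [g /wpart_weak_deriv[_ [mg _] _]] := hv i j.
by apply: eq_measurable_fun mg => x _; rewrite mxE.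
Qed.

Lemma wgrad_lin (a : R) v w : weakly_derivable v -> weakly_derivable w ->
  {ae mu, forall x, D x -> wgrad D (a *: v + w) x = (a *: wgrad D v + wgrad D w) x}.
Proof.
move=> hv hw.
have h i j : {ae mu, forall x, D x -> wgrad D (a *: v + w) x i j = (a *: wgrad D v + wgrad D w) x i j}.
  have [g /wpart_weak_deriv hg] := hv i j; have [g' /wpart_weak_deriv hg'] := hw i j.
  have hl := weak_deriv_lin oD a hg hg'.
  apply: (ae_mono (wpart_ae oD hl)) => x e Dx; move: (e Dx).
  have -> : (a *: wgrad D v + wgrad D w) x i j = (a *: wpart D i (comp_ v j) + wpart D i (comp_ w j)) x.
    by rewrite -[LHS]/((a *: wgrad D v x + wgrad D w x) i j) !mxE.
  move=> <-; rewrite mxE; congr (wpart _ _ _ _); apply/funext => y.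
  by rewrite /comp_ -[LHS]/((a *: v y + w y) ord0 j) !mxE.
(* The exceptional sets, one per entry, are merged by [ae_forall] after numbering the entries with
   [pickle]. *)
have : {ae mu, forall x, forall k : nat, forall i j, (pickle (i, j) = k) -> D x ->
    wgrad D (a *: v + w) x i j = (a *: wgrad D v + wgrad D w) x i j}.
  apply: ae_forall => k.
  case e : (@unpickle ('I_d * 'I_n)%type k) => [[i j]|]; last first.
    by apply: aeW => x i j kij; rewrite -kij pickleK in e.
  apply: (ae_mono (h i j)) => x hx i' j' kij; rewrite -kij pickleK in e.
  by case: e => -> ->.
move/ae_mono; apply => x hx Dx; apply/matrixP => i j; exact: hx.
Qed.

Lemma weakly_derivable0 : weakly_derivable (0 : E -> 'rV[R]_n).
Proof.
move=> i j; exists 0; have -> : comp_ (0 : E -> 'rV[R]_n) j = 0.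
  by apply/funext => x; rewrite /comp_ mxE.
have L0 : L1loc D (0 : E -> R) by apply: continuous_L1loc => //; exact: cst_continuous.
have z (h : E -> R) : \int[mu]_(x in D) ((0 : E -> R) x * h x) = 0.
  by rewrite /Rintegral integral0_eq// => x _; rewrite mul0r.
by split => // f _; rewrite /= !z mulr0.
Qed.

Lemma wgrad0 : {ae mu, forall x, D x -> wgrad D (0 : E -> 'rV[R]_n) x = 0}.
Proof.
have w0 := weakly_derivable0.
apply: (ae_mono (wgrad_lin (-1) w0 w0)) => x h Dx; have := h Dx.
rewrite scaler0 addr0 => ->.
by rewrite -[LHS]/(-1 *: wgrad D 0 x + wgrad D 0 x) scaleN1r addNr.
Qed.

Definition W1mem v := [/\ Lmem mu D p v, weakly_derivable v & Lmem mu D p (wgrad D v)].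

Definition W1int v := Lint mu D p v + Lint mu D p (wgrad D v).

Let L1 := Lpseminorm mu mD p2 pq 1 n.
Let Lg := Lpseminorm mu mD p2 pq d n.

Lemma W1mem0 : W1mem 0.
Proof.
split; [exact: Lmem0 | exact: weakly_derivable0 |].
apply: (@Lmem_ae _ _ 0); last exact: Lmem0.
  by apply: entries_measurable_wgrad; exact: weakly_derivable0.
by apply: (ae_mono wgrad0) => x h /h ->.
Qed.

Lemma W1mem_lin (a : R) v w : W1mem v -> W1mem w -> W1mem (a *: v + w).
Proof.
move=> [mv hv gv] [mw hw gw]; split; [exact: Lmem_lin | exact: weakly_derivable_lin |].
apply: (Lmem_ae _ _ (Lmem_lin mD p2 a gv gw)).
  by apply: entries_measurable_wgrad; exact: weakly_derivable_lin.
by apply: (ae_mono (wgrad_lin a hv hw)) => x h /h ->.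
Qed.

Lemma Lint_wgrad_lin (a : R) v w : weakly_derivable v -> weakly_derivable w ->
  Lint mu D p (wgrad D (a *: v + w)) = Lint mu D p (a *: wgrad D v + wgrad D w).
Proof. by move=> hv hw; apply: Lint_ae; exact: wgrad_lin. Qed.

Let W1int_ge0 v : 0 <= W1int v.
Proof. by rewrite addr_ge0// Lint_ge0. Qed.

Let W1intZ (a : R) v : W1mem v -> W1int (a *: v) = `|a| `^ p * W1int v.
Proof.
move=> [mv hv gv]; rewrite /W1int.
have e := Lint_wgrad_lin a hv weakly_derivable0; rewrite addr0 in e.
rewrite e (@psnZ R p _ L1 a v mv : Lint mu D p (a *: v) = _).
have -> : Lint mu D p (a *: wgrad D v + wgrad D (0 : E -> 'rV[R]_n)) = Lint mu D p (a *: wgrad D v).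
  apply: Lint_ae; apply: (ae_mono wgrad0) => x h /h z.
  by rewrite -[LHS]/(a *: wgrad D v x + wgrad D 0 x) z addr0.
by rewrite (@psnZ R p _ Lg a _ gv : Lint mu D p (a *: wgrad D v) = _) mulrDr.
Qed.

Let W1int_quasi (e : R) : 0 < e -> exists2 C : R, 0 <= C &
  forall v w, W1mem v -> W1mem w -> W1int (v + w) <= (1 + e) * W1int v + C * W1int w.
Proof.
move=> e0; have [C C0 h] := psn_quasi L1 e0; have [C' C'0 h'] := psn_quasi Lg e0.
exists (C + C'); first exact: addr_ge0.
move=> v w [mv hv gv] [mw hw gw]; rewrite /W1int.
have := Lint_wgrad_lin 1 hv hw; rewrite !scale1r => ->.
have /= := h _ _ mv mw; have /= := h' _ _ gv gw.
by apply: quasi_arith => //; exact: Lint_ge0.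
Qed.

Let W1int_smooth : exists2 C : R, 0 <= C &
  forall v w (e : R), W1mem v -> W1mem w -> 0 <= e <= 1 ->
    W1int (v + e *: w) + W1int (v - e *: w) <= 2 * W1int v + C * e ^+ 2 * (W1int v + W1int w).
Proof.
have [C C0 h] := psn_smooth L1; have [C' C'0 h'] := psn_smooth Lg.
exists (C + C'); first exact: addr_ge0.
move=> v w e [mv hv gv] [mw hw gw] e01.
have := Lint_wgrad_lin e hw hv; rewrite ![e *: _ + _]addrC => e1.
have := Lint_wgrad_lin (- e) hw hv; rewrite ![- e *: _ + _]addrC !scaleNr => e2.
have H := h _ _ e mv mw e01; have H' := h' _ _ e gv gw e01.
have I := Lint_ge0 mu D p.
rewrite /W1int e1 e2.
exact: (smooth_arith C0 C'0 (I _ _ v) (I _ _ (wgrad D v)) (I _ _ w) (I _ _ (wgrad D w)) (sqr_ge0 e) H' H).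
Qed.

Definition W1pseminorm : pseminorm p (E -> 'rV[R]_n) :=
  Pseminorm W1int_ge0 W1mem0 W1mem_lin W1intZ W1int_quasi W1int_smooth.

Lemma sp_mem_W1r v : sp_mem (W1r D p n) v <-> W1mem v.
Proof.
have [h1 h1'] := sp_mem_Lr D p2 v; have [h3 h3'] := sp_mem_Lr D p2 (wgrad D v).
by split => -[mv wv gv]; split => //; [exact: h1|exact: h3|exact: h1'|exact: h3'].
Qed.

Lemma sp_norm_W1r v : W1mem v -> sp_norm (W1r D p n) v = (W1int v `^ p^-1)%:E.
Proof.
move=> [mv hv gv]; rewrite -[LHS]/((sp_norm (Lr D p 1 n) v `^ p + sp_norm (Lr D p d n) (wgrad D v) `^ p) `^ p^-1)%E.
rewrite (sp_norm_Lr mD p2 mv) (sp_norm_Lr mD p2 gv).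
by move: (Lint_ge0 mu D p v) (Lint_ge0 mu D p (wgrad D v)); exact: sum_powR_inv.
Qed.

Lemma test_fun_W1mem v : test_fun D v -> W1mem v.
Proof.
move=> tv; have [sv [K [cK KD v0]]] := tv.
have mK := compact_measurable_rV cK.
have cKc := compact_closed (@norm_hausdorff _ _) cK.
have cpt m k (f : E -> 'M[R]_(m, k)) : (forall i j, continuous (fun x => f x i j)) ->
    (forall x, ~ K x -> f x = 0) -> Lmem mu D p f.
  move=> cf f0.
  have mf : entries_measurable D f.
    by move=> i j; exact: measurable_funS (continuous_measurable_rV (cf i j)).
  split => //; apply: (@restrict_integrable _ _ K) => //.
    by move=> x _ /f0 ->; rewrite frob0 powR0// gt_eqF.
  have [M M0 hM] : exists2 M : R, 0 <= M & forall x, K x -> frob (f x) <= M.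
    have [M hM] : exists M : 'I_m -> 'I_k -> R, forall i j, 0 <= M i j /\ forall x, K x -> `|f x i j| <= M i j.
      have /choice[M hM] : forall ij : 'I_m * 'I_k, exists r : R, 0 <= r /\ forall x, K x -> `|f x ij.1 ij.2| <= r.
        by move=> [i j]; have [r r0 hr] := compact_le cK (cf i j); exists r.
      by exists (fun i j => M (i, j)) => i j; exact: hM (i, j).
    exists (\sum_i \sum_j M i j).
      by apply: sumr_ge0 => i _; apply: sumr_ge0 => j _; have [] := hM i j.
    move=> x Kx; apply: le_trans (frob_le_entries _) _.
    by apply: ler_sum => i _; apply: ler_sum => j _; have [_] := hM i j; exact.
  apply: (@integrable_Rbound _ _ _ mu K mK _ (fun=> M `^ p)).
  - by apply: measurable_funS (measurable_frob_powR p mf).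
  - exact: (continuous_integrable cK (@cst_continuous _ _ _)).
  - move=> x Kx; rewrite ger0_norm ?powR_ge0// ge0_ler_powR ?nnegrE ?frob_ge0// ?(ltW p0)//.
    exact: hM.
have wd : weakly_derivable v.
  move=> i j; exists ('D_(e_ i) (comp_ v j)).
  by apply: test_fun_weak_deriv => //; exact: (test_fun_mx ord0 j tv).
split => //.
  apply: cpt => // i j; have := smooth_mx i j sv [::].
  by move=> [].
pose g x : 'M[R]_(d, n) := \matrix_(i, j) 'D_(e_ i) (comp_ v j) x.
apply: (@Lmem_ae _ _ g).
- exact: entries_measurable_wgrad.
- have h i j := wpart_ae oD (test_fun_weak_deriv oD i (test_fun_mx ord0 j tv)).
  have : {ae mu, forall x, forall k : nat, forall i j, (pickle (i, j) = k) -> D x ->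
      g x i j = wgrad D v x i j}.
    apply: ae_forall => k.
    case e : (@unpickle ('I_d * 'I_n)%type k) => [[i j]|]; last first.
      by apply: aeW => x i j kij; rewrite -kij pickleK in e.
    apply: (ae_mono (h i j)) => x hx i' j' kij; rewrite -kij pickleK in e.
    by case: e => -> -> Dx; rewrite !mxE; apply/esym; exact: hx.
  by move/ae_mono; apply => x hx Dx; apply/matrixP => i j; exact: hx.
- apply: cpt => [i j|x Kx].
    have := smooth_mx ord0 j sv [:: e_ i]; rewrite /= => -[c _].
    by rewrite (_ : (fun _ => _) = 'D_(e_ i) (comp_ v j))//; apply/funext => x; rewrite mxE.
  apply/matrixP => i j; rewrite !mxE.
  have := @iter_deriv_supp _ _ _ [:: e_ i] (comp_ v j) K cKc; apply => // y Ky.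
  by rewrite /comp_ v0// mxE.
Qed.

End W1.

Lemma Wdiv_W1mem v : sp_mem (Wdiv D p) v -> W1mem v.
Proof. by move=> [[/sp_mem_W1r]]. Qed.

Lemma Wdiv_lin (a : R) v w : sp_mem (Wdiv D p) v -> sp_mem (Wdiv D p) w ->
  sp_mem (Wdiv D p) (a *: v + w).
Proof.
move=> hv hw; have [mv mw] := (Wdiv_W1mem hv, Wdiv_W1mem hw).
have ml := W1mem_lin a mv mw.
have [[[_ [f [tf fv]]] dv] [[_ [g [tg gw]]] dw]] := (hv, hw).
split; last first.
  have [[_ wv _] [_ ww _]] := (mv, mw).
  apply: (ae_mono2 (wgrad_lin a wv ww)); first exact: (ae_mono2 dv dw (fun x h h' => conj h h')).
  move=> x e [h h'] Dx; rewrite /wdiv e//.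
  rewrite -[LHS]/(\tr (a *: wgrad D v x + wgrad D w x)) linearP/=.
  by rewrite -!/(wdiv D _ x) h// h'// mulr0 addr0.
split; first exact/sp_mem_W1r.
exists (fun k => a *: f k + g k); split => [k|]; first exact: test_fun_lin.
have P u x := @scvg_ps_cvg R p _ (W1r D p d) (W1pseminorm d) u x p0 (@sp_norm_W1r d).
have mf k := test_fun_W1mem (tf k); have mg k := test_fun_W1mem (tg k).
have {}fv := (P _ _ mf mv).1 fv; have {}gw := (P _ _ mg mw).1 gw.
apply: (P _ _ _ ml).2; first by move=> k; exact: W1mem_lin (mf k) (mg k).
have H := @ps_cvg_lin _ _ _ (W1pseminorm d) a f g v w mf mg mv mw fv gw.
exact H.
Qed.

Lemma Wdiv0 : sp_mem (Wdiv D p) 0.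
Proof.
split; last first.
  by apply: (ae_mono (wgrad0 d)) => x h /h e; rewrite /wdiv e mxtrace0.
split; first by apply/sp_mem_W1r; exact: W1mem0.
exists (fun=> 0); split.
  move=> _; have t0 s : iter_deriv s (0 : E -> 'rV[R]_d) = 0.
    elim: s => //= v s ->; apply/funext => x.
    by rewrite -[LHS]/('D_v (cst 0) x) derive_cst.
  split=> [s|]; first by rewrite t0; split => [x|v x]; [exact: cst_continuous | exact: derivable_cst].
  by exists set0; split => //; exact: compact0.
have m0 := W1mem0 d.
apply: (@scvg_ps_cvg R p _ (W1r D p d) (W1pseminorm d) _ _ p0 (@sp_norm_W1r d) (fun=> m0) m0).2.
rewrite /ps_cvg subrr; under eq_fun do rewrite (psn0 _ p0).
exact: cvg_cst.
Qed.

Definition Wpseminorm : pseminorm p (E -> 'rV[R]_d) :=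
  sub_pseminorm (X := W1pseminorm d) Wdiv_W1mem Wdiv0 Wdiv_lin.

Lemma sp_norm_Wdiv v : sp_mem (Wdiv D p) v -> sp_norm (Wdiv D p) v = (psn Wpseminorm v `^ p^-1)%:E.
Proof. by move=> /Wdiv_W1mem; exact: sp_norm_W1r. Qed.

Lemma Lmem_Wdiv v : sp_mem (Wdiv D p) v -> Lmem mu D p v.
Proof. by move=> /Wdiv_W1mem[]. Qed.

Lemma Lint_le_Wdiv v : Lint mu D p v <= psn Wpseminorm v.
Proof. by rewrite lerDl; exact: Lint_ge0. Qed.

End sobolev_pseminorm.

(** * Galerkin approximations *)

Section lipschitz_FTC.
Context {R : realType}.
Notation mR := (measurableTypeR R).
Notation mu := (@lebesgue_measure R).

Lemma clamp_lipschitz (c s t : R) :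
  `|Num.max 0 (Num.min s c) - Num.max 0 (Num.min t c)| <= `|s - t|.
Proof.
wlog st : s t / s <= t => [H|].
  by have [/H//|/ltW/H] := leP s t; rewrite distrC [in leRHS]distrC.
rewrite distrC [leRHS]distrC (ger0_norm (_ : 0 <= t - s)) ?subr_ge0// ger0_norm ?subr_ge0.
  have h : Num.min t c <= Num.min s c + (t - s).
    rewrite /Num.min; case: ltP => ?; case: ltP => ?; lra.
  move: h; set x := Num.min t c; set y := Num.min s c => h.
  rewrite /Num.max; case: ltP => ?; case: ltP => ?; lra.
rewrite ge_max le_max lexx/= le_max ge_min; apply/orP; right.
by rewrite le_min !ge_min lexx orbT st.
Qed.

(** The difference quotients are dominated by the Lipschitz constant and their integrals telescope
    to two means of g. Convergence of the quotients along the steps 1 / (n + 1) is enough. *)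
Lemma lipschitz_FTC (g I : R -> R) (b K : R) : 0 < b ->
  (forall s t, 0 <= s <= b + 1 -> 0 <= t <= b + 1 -> `|g s - g t| <= K * `|s - t|) ->
  (forall t, 0 < t <= b -> n.+1%:R * (g (t + n.+1%:R^-1) - g t) @[n --> \oo] --> I t) ->
  \int[mu]_t (\1_(`]0, b]%classic) t * I t) = g b - g 0.
Proof.
move=> b0 lip dg.
have K0 : 0 <= K.
  have := lip (b + 1) 0; rewrite subr0 lexx lexx andbT => /(_ _ _).
  have b1 : 0 < b + 1 by lra.
  by move=> /(_ (ltW b1) (ltW b1)) h; rewrite -(pmulr_lge0 _ b1) -(gtr0_norm b1) (le_trans _ h).
(* Clamping extends g continuously to the line, which gives measurability; the extra unit leaves
   room for t + h with h <= 1. *)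
pose cl (t : R) := Num.max 0 (Num.min t (b + 1)).
have clb t : 0 <= cl t <= b + 1.
  by rewrite /cl le_max lexx/= ge_max ge_min lexx orbT andbT; lra.
have clE t : 0 <= t <= b + 1 -> cl t = t.
  by move=> /andP[t0 tb]; rewrite /cl min_l// max_r.
have cllip s t : `|cl s - cl t| <= `|s - t| by exact: clamp_lipschitz.
pose G t := g (cl t).
have cG : continuous G.
  move=> t; apply/cvgrPdist_le => e e0; have K1 : 0 < K + 1 by lra.
  near=> s.
  apply: (le_trans (lip _ _ (clb t) (clb s))).
  apply: (@le_trans _ _ (K * `|t - s|)); first by rewrite ler_wpM2l.
  apply: (@le_trans _ _ ((K + 1) * `|t - s|)); first by rewrite ler_wpM2r// lerDl.
  rewrite -ler_pdivlMl// mulrC.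
  near: s; apply/nbhs_ballP; exists (e / (K + 1)); first by rewrite /= divr_gt0.
  by move=> y /ltW.
have mG : measurable_fun setT (G : mR -> mR) by exact: continuous_measurable_fun.
pose f t := \1_(`]-1, b + 1]%classic) t * G t.
have fi : mu.-integrable setT (EFin \o f).
  apply: (@integrable_Rbound _ _ _ mu setT measurableT _
    (fun t => (`|g 0| + K * (b + 1)) * \1_(`]-1, b + 1]%classic) t)).
  - by apply: measurable_funM => //; exact: measurable_indic.
  - by apply: integrableRZ => //; exact: integrable_indic_itv.
  - move=> t _; rewrite /f normrM ger0_norm// mulrC ler_wpM2r//.
    rewrite -[G t](subrK (g 0)) (le_trans (ler_normD _ _))// addrC lerD2l.
    have /andP[c0 c1] := clb t.
    apply: (le_trans (lip _ _ (clb t) _)); first by rewrite lexx; lra.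
    by rewrite subr0 ger0_norm// ler_wpM2l.
have fE t : 0 <= t <= b + 1 -> f t = g t.
  by move=> h; rewrite /f indicE in_itvoc /G clE// (_ : _ && _ = true) ?mul1r//; lra.
pose h n : R := n.+1%:R^-1.
have h0 n : 0 < h n by rewrite invr_gt0.
have h1 n : h n <= 1 by rewrite invf_le1// ler1n.
have hc : h n @[n --> \oo] --> 0 by exact: cvg_harmonic.
have mf : measurable_fun setT (f : mR -> mR).
  by apply/measurable_EFinP; exact: measurable_int fi.
have [] := @dominated_cvg_Rintegral _ _ _ mu setT measurableT
   (fun n t => \1_(`]0, b]%classic) t * (n.+1%:R * (f (t + h n) - f t)))
   (fun t => \1_(`]0, b]%classic) t * I t) (fun t => K * \1_(`]0, b]%classic) t).
- move=> n; apply: measurable_funM; first exact: measurable_indic.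
  apply: measurable_funM => //; apply: measurable_funB => //.
  exact: (measurableT_comp mf (measurable_addr (h n))).
- by apply: integrableRZ => //; exact: integrable_indic_itv.
- move=> n t _; rewrite normrM ger0_norm// mulrC indicE in_itvoc.
  have [/andP[t0 tb]|_] := boolP (0 < t <= b); last by rewrite !mulr0.
  have hn1 := h1 n; have hn0 := h0 n.
  rewrite !mulr1 !fE; [|by apply/andP; split; lra..].
  rewrite normrM ger0_norm// mulrC -ler_pdivlMr//.
  apply: (le_trans (lip _ _ _ _)); [by apply/andP; split; lra..|].
  by rewrite addrAC subrr add0r (gtr0_norm hn0).
- move=> t _; rewrite indicE in_itvoc; have [/andP[t0 tb]|_] := boolP (0 < t <= b); last first.
    by under eq_fun do rewrite mul0r; rewrite mul0r; exact: cvg_cst.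
  apply: cvgMr; have := dg t; rewrite t0 tb => /(_ isT).
  apply: cvg_trans; apply: near_eq_cvg; apply: nearW => n.
  have hn1 := h1 n; have hn0 := h0 n.
  by rewrite !fE//; apply/andP; split; lra.
move=> _ c; apply: (cvg_unique (@norm_hausdorff _ R) c).
have -> : (fun n => \int[mu]_t (\1_(`]0, b]%classic) t * (n.+1%:R * (f (t + h n) - f t)))) =
    (fun n => (h n)^-1 * \int[mu]_t (\1_(`]b, b + h n]%classic) t * f t) -
              (h n)^-1 * \int[mu]_t (\1_(`]0, 0 + h n]%classic) t * f t)).
  apply/funext => n; rewrite -mulrBr add0r -(Rintegral_increment (ltW b0) (h0 n) fi).
  rewrite invrK -RintegralZl//; last first.
    apply: integrable_indicM => //; apply: integrableRB => //; exact: integrable_addr.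
  by apply: eq_Rintegral => t _; rewrite mulrCA.
have mean a : 0 <= a <= b ->
    (h n)^-1 * \int[mu]_t (\1_(`]a, a + h n]%classic) t * f t) @[n --> \oo] --> g a.
  move=> /andP[a0 ab]; apply/cvgrPdist_le => e e0.
  have K1 : 0 < K + 1 by lra.
  have H := (cvgrPdist_le _ _).1 hc _ (divr_gt0 e0 K1).
  apply: (filterS _ (H _)) => n; rewrite sub0r normrN (gtr0_norm (h0 n)) ler_pdivlMr// => hn.
  rewrite distrC; apply: mean_near => // t /andP[ta tb].
  have hn1 := h1 n; have hn0 := h0 n.
  rewrite fE; last by apply/andP; split; lra.
  apply: (le_trans (lip _ _ _ _)); [by apply/andP; split; lra..|].
  rewrite ger0_norm; last by lra.
  apply: le_trans hn; rewrite mulrC ler_pM//; lra.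
by apply: cvgB; apply: mean; rewrite lexx (ltW b0).
Unshelve. all: by end_near. Qed.

End lipschitz_FTC.

(** * Differentiability of |a|^(p-2) a along a curve *)

Section derivable_pw.
Context {R : realType} {p q : R} {m n : nat}.
Hypotheses (p2 : 2 <= p) (pq : p^-1 + q^-1 = 1).

Lemma derivable_sum_fun k (h : 'I_k -> R -> R) (t : R) :
  (forall i, derivable (h i) t 1) -> derivable (fun s => \sum_i h i s) t 1.
Proof. by move=> /derivable_sum; rewrite fct_sumE. Qed.

Lemma derivable_cvg_continuous (f : R -> R) t : derivable f t 1 ->
  f (h *: 1 + t) @[h --> 0^'] --> f t.
Proof.
move=> df; have /derivable1_diffP/differentiable_continuous cf := df.
apply: (@cvg_comp _ _ _ (fun h : R => h *: 1 + t) f _ (nbhs t)); last exact: cf.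
apply: cvg_within_filter.
apply/cvgrPdist_lt => e e0; near=> h.
rewrite [h *: 1]mulr1 opprD addrCA subrr addr0 normrN.
near: h; apply/nbhs_ballP; exists e => //= y; by rewrite /ball/= sub0r normrN.
Unshelve. all: by end_near. Qed.

(** Where a(t) is nonzero this is the chain rule. Where it vanishes and p > 2, the factor |a|^(p-2)
    tends to 0 while the difference quotients of the entries converge, so the derivative is 0; for p
    = 2 the map is the identity. *)
Lemma derivable_pw (a : R -> 'M[R]_(m, n)) t : derivable a t 1 ->
  derivable (fun s => pw p (a s)) t 1.
Proof.
move=> /derivable_mxP da; apply/derivable_mxP => i j.
(* The factor is written as a power of a . a, which, unlike |a|, is differentiable also at the zeros
   of a. *)
pose r := (p - 2) / 2; have r0 : 0 <= r by rewrite divr_ge0// subr_ge0.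
have pwE s : pw p (a s) i j = dot (a s) (a s) `^ r * a s i j.
  by rewrite mxE /frob -powR12_sqrt ?dot_ge0// -powRrM /r [2^-1 * _]mulrC.
have dd : derivable (fun s => dot (a s) (a s)) t 1.
  by do 2!apply: derivable_sum_fun => ?; exact: derivableM.
rewrite (_ : (fun _ => _) = (fun s => dot (a s) (a s) `^ r) * (fun s => a s i j)); last first.
  by apply/funext => s; rewrite pwE.
have [d0|dn0] := eqVneq (dot (a t) (a t)) 0; last first.
  apply: derivableM; last exact: da.
  have dgt : 0 < dot (a t) (a t) by rewrite lt_neqAle eq_sym dn0 dot_ge0.
  apply/derivable1_diffP; apply: (@differentiable_comp _ _ _ _ (fun s => dot (a s) (a s)) (@powR R ^~ r)).
    exact/derivable1_diffP.
  by apply/derivable1_diffP; have [] := is_derive1_powR r dgt.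
have at0 k l : a t k l = 0.
  have /eqP f0 : frob (a t) == 0 by rewrite /frob d0 sqrtr0.
  by move/eqP : f0; rewrite frob_eq0 => /eqP ->; rewrite mxE.
move: r0; rewrite le_eqVlt => /orP[/eqP r0|r0].
  rewrite (_ : _ * _ = (fun s => a s i j)); first exact: da.
  by apply/funext => s; rewrite -[LHS]/(dot (a s) (a s) `^ r * a s i j) -r0 powRr0 mul1r.
have dij : (fun h : R => h^-1 *: (((fun s => a s i j) \o shift t) (h *: 1) - a t i j)) @ 0^' -->
   'D_1 (fun s => a s i j) t by exact: da.
have pc : dot (a (h *: 1 + t)) (a (h *: 1 + t)) `^ r @[h --> 0^'] --> (0 : R).
  have := derivable_cvg_continuous dd; rewrite d0 => /cvgrPdist_lt c.
  apply/cvgrPdist_lt => e e0.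
  have er : 0 < e `^ r^-1 by exact: powR_gt0.
  apply: filterS (c _ er) => h; rewrite !sub0r !normrN !ger0_norm ?powR_ge0 ?dot_ge0// => hk.
  have -> : e = (e `^ r^-1) `^ r by rewrite -powRrM mulVf ?gt_eqF// powRr1// ltW.
  by rewrite gt0_ltr_powR ?nnegrE ?powR_ge0 ?dot_ge0.
apply/cvg_ex; exists (0 * 'D_1 (fun s => a s i j) t).
apply: (cvg_trans _ (cvgM pc dij)); apply: near_eq_cvg; apply: nearW => h.
rewrite /= at0 subr0.
rewrite -[((_ * _) (h *: 1 + t))]/(dot (a (h *: 1 + t)) (a (h *: 1 + t)) `^ r * a (h *: 1 + t) i j).
rewrite -[((_ * _) t)]/(dot (a t) (a t) `^ r * a t i j) at0 mulr0 subr0.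
by rewrite /GRing.scale/= mulrCA.
Qed.

End derivable_pw.

Lemma cvg_sum_fun (R : realType) (I : Type) (r : seq I) (f : nat -> I -> R) (l : I -> R) :
  (forall i, f k i @[k --> \oo] --> l i) ->
  \sum_(i <- r) f k i @[k --> \oo] --> \sum_(i <- r) l i.
Proof.
move=> fl; elim: r => [|i r IH].
  by under eq_fun do rewrite big_nil; rewrite big_nil; exact: cvg_cst.
by under eq_fun do rewrite big_cons; rewrite big_cons; apply: cvgD.
Qed.

(** * Time increments of the Galerkin approximations *)

Section galerkin_increments.
Context {R : realType} {d : nat} (D : set 'rV[R]_d).
Hypothesis mD : measurable D.
Variables (p q : R).
Hypotheses (p2 : 2 <= p) (pq : p^-1 + q^-1 = 1).
Notation mu := (@leb R d).
Notation E := 'rV[R]_d.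
Notation mR := (measurableTypeR R).

Let p0 : 0 < p. Proof. exact: ge2_gt0. Qed.

Lemma C1_halfline_lipschitz (c : R -> R) (S : R) : 0 < S -> C1_halfline c ->
  exists2 K, 0 <= K & (forall t, 0 <= t <= S -> `|c t| <= K) /\
    (forall s t, 0 <= s <= S -> 0 <= t <= S -> `|c s - c t| <= K * `|s - t|).
Proof.
move=> S0 [cc [c' [cc' dc]]].
have sub : (`[0, S]%classic : set R) `<=` `[0, +oo[%classic.
  by move=> t /=; rewrite !in_itv/= => /andP[->].
have bnd (f : R -> R) : {within `[0, +oo[, continuous f} ->
    exists2 M, 0 <= M & forall t, 0 <= t <= S -> `|f t| <= M.
  move=> cf; have cf' : {within `[0, S], continuous f} by exact: continuous_subspaceW cf.
  have [M [Mr hM]] := compact_bounded (continuous_compact cf' (@segment_compact R 0 S)).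
  exists (`|M| + 1) => [|t tS]; first by rewrite addr_ge0.
  apply: (hM (`|M| + 1)); first by rewrite (le_lt_trans (ler_norm M))// ltrDl.
  by exists t => //=; rewrite in_itv.
have [M M0 hM] := bnd _ cc; have [L L0 hL] := bnd _ cc'.
exists (M + L); first exact: addr_ge0.
split => [t tS|s t]; first by rewrite (le_trans (hM t tS))// lerDl.
wlog st : s t / s <= t => [H|] sS tS.
  by have [/H|/ltW/H] := leP s t; rewrite 2?(distrC (c s)) 2?(distrC s); exact.
move: st; rewrite le_eqVlt => /orP[/eqP ->|st]; first by rewrite !subrr !normr0 mulr0.
have [s0 sS'] := andP sS; have [t0 tS'] := andP tS.
have dst z : z \in `]s, t[ -> is_derive z 1 c (c' z).
  by rewrite in_itv/= => /andP[sz zt]; apply: dc; exact: le_lt_trans sz.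
have cst : {within `[s, t], continuous c}.
  apply: continuous_subspaceW cc => z /=; rewrite !in_itv/= andbT => /andP[sz _].
  exact: le_trans sz.
rewrite distrC (distrC s); have [z + ->] := MVT st dst cst.
rewrite in_itv/= => /andP[sz zt]; rewrite normrM ler_wpM2r//.
apply: (le_trans (hL z _)); last by rewrite lerDr.
by rewrite (le_trans s0 (ltW sz)) (le_trans (ltW zt) tS').
Qed.

Variables (phi : nat -> E -> 'rV[R]_d) (N : nat) (c : nat -> R -> R).
Hypothesis mphi : forall n, Lmem mu D p (phi n).
Hypothesis hc : forall n, (n < N)%N -> C1_halfline (c n).

Let v := galerkin_fun phi N c.
(** The majorant of everything that follows: on bounded time intervals the approximation and its
    Lipschitz constant in time are bounded by multiples of [Phi], whose p-th power is integrable. *)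
Let Phi (x : E) : R := \sum_(n < N) frob (phi n x).

Let vE t x : v t x = \sum_(n < N) c n t *: phi n x.
Proof. by rewrite /v /galerkin_fun fct_sumE. Qed.

Let Phi_ge0 x : 0 <= Phi x.
Proof. by apply: sumr_ge0 => n _; exact: frob_ge0. Qed.

Lemma Lmem_galerkin t : Lmem mu D p (v t).
Proof.
apply: (ps_mem_sum (X := Lpseminorm mu mD p2 pq 1 d)) => n _.
by apply: (ps_memZ (X := Lpseminorm mu mD p2 pq 1 d)); exact: mphi.
Qed.

Let integrable_Phi : mu.-integrable D (EFin \o (fun x => Phi x `^ p)).
Proof.
rewrite /Phi; elim: N => [|k IH].
  rewrite (_ : _ \o _ = EFin \o (fun=> 0)); first exact: integrableR0.
  by apply/funext => x; rewrite /= big_ord0 powR0// gt_eqF.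
have [mk ik] := mphi k.
have mPhi : measurable_fun D (fun x => (\sum_(n < k.+1) frob (phi n x)) `^ p).
  apply: (measurableT_comp (measurable_powR p)); apply: measurable_sum => i.
  by apply: measurable_frob; have [] := mphi i.
apply: (@integrable_Rbound _ _ _ mu D mD _ (fun x => 2 `^ p * ((\sum_(n < k) frob (phi n x)) `^ p + frob (phi k x) `^ p))) => //.
  by apply: integrableRZ => //; exact: integrableRD.
move=> x _; rewrite ger0_norm ?powR_ge0// big_ord_recr/=.
by apply: (powRD_le p2); [apply: sumr_ge0 => i _; exact: frob_ge0 | exact: frob_ge0].
Qed.

Let v_bounds (S : R) : 0 < S -> exists2 K, 0 <= K &
  (forall t x, 0 <= t <= S -> frob (v t x) <= K * Phi x) /\
  (forall s t x, 0 <= s <= S -> 0 <= t <= S -> frob (v s x - v t x) <= K * `|s - t| * Phi x).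
Proof.
move=> S0.
have /choice[K hK] : forall n : 'I_N, exists K, [/\ 0 <= K, (forall t, 0 <= t <= S -> `|c n t| <= K) &
    (forall s t, 0 <= s <= S -> 0 <= t <= S -> `|c n s - c n t| <= K * `|s - t|)].
  by move=> n; have [K K0 [h1 h2]] := C1_halfline_lipschitz S0 (hc (ltn_ord n)); exists K.
have K0 n : 0 <= K n by have [] := hK n.
have KS n : K n <= \sum_n K n.
  by rewrite (bigD1 n)//= lerDl; apply: sumr_ge0.
exists (\sum_n K n); first exact: sumr_ge0.
split => [t x tS|s t x sS tS].
  rewrite vE; apply: (le_trans (frob_sum _ _)).
  rewrite /Phi mulr_sumr; apply: ler_sum => n _; rewrite frobZ ler_wpM2r ?frob_ge0//.
  by apply: le_trans (KS n); have [_ h _] := hK n; exact: h.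
rewrite !vE -sumrB; apply: (le_trans (frob_sum _ _)).
rewrite /Phi mulr_sumr; apply: ler_sum => n _; rewrite -scalerBl frobZ ler_wpM2r ?frob_ge0//.
have [_ _ h] := hK n; apply: le_trans (h s t sS tS) _.
by rewrite ler_wpM2r.
Qed.

Lemma galerkin_Lint_bounds (S : R) : 0 < S -> exists2 K, 0 <= K &
  (forall t, 0 <= t <= S -> Lint mu D p (v t) <= K) /\
  (forall s t, 0 <= s <= S -> 0 <= t <= S -> Lint mu D p (v s - v t) <= K * `|s - t| `^ p).
Proof.
move=> S0; have [K K0 [h1 h2]] := v_bounds S0.
pose I := \int[mu]_(x in D) Phi x `^ p.
have le (f : E -> 'rV[R]_d) (k : R) : 0 <= k -> Lmem mu D p f ->
    (forall x, frob (f x) <= k * Phi x) -> Lint mu D p f <= k `^ p * I.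
  move=> k0 [_ fi] fk.
  have := le_Rintegral_lin2 mD (x := k `^ p) (y := 0) fi integrable_Phi integrable_Phi.
  rewrite mul0r addr0; apply => x _; rewrite mul0r addr0 -powRM//.
  by rewrite ge0_ler_powR ?nnegrE ?(ltW p0) ?mulr_ge0 ?frob_ge0.
have I0 : 0 <= I by apply: Rintegral_ge0 => x _; exact: powR_ge0.
exists (K `^ p * I); first by rewrite mulr_ge0 ?powR_ge0.
split => [t tS|s t sS tS].
  by apply: le => // [|x]; [exact: Lmem_galerkin | exact: h1].
rewrite mulrAC -powRM//; apply: le => [||x]; [exact: mulr_ge0| |exact: h2].
exact: (ps_memB (X := Lpseminorm mu mD p2 pq 1 d) (Lmem_galerkin s) (Lmem_galerkin t)).
Qed.

Let frob_phi (n : 'I_N) x : frob (phi n x) <= Phi x.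
Proof. by rewrite /Phi (bigD1 n)//= lerDl; apply: sumr_ge0 => k _; exact: frob_ge0. Qed.

Let integrand_lipschitz (S : R) (n : 'I_N) : 0 < S -> exists2 C, 0 <= C &
  forall s t x, 0 <= s <= S -> 0 <= t <= S ->
    `|dot (phi n x) (pw p (v s x)) - dot (phi n x) (pw p (v t x))| <= C * `|s - t| * Phi x `^ p.
Proof.
move=> S0; have [K K0 [h1 h2]] := v_bounds S0.
exists ((p - 1) * (K `^ (p - 2) * K)).
  by rewrite mulr_ge0 ?mulr_ge0 ?powR_ge0// subr_ge0 (le_trans _ p2)// ler1n.
move=> s t x sS tS; rewrite -dotNr -dotDr.
apply: (le_trans (normr_dot_le_frob _ _)).
have := pw_lip p2 (h1 s x sS) (h1 t x tS).
rewrite powRM// => h3.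
have e : Phi x `^ p = Phi x * (Phi x `^ (p - 2) * Phi x).
  have [->|n0] := eqVneq (Phi x) 0; first by rewrite powR0 ?gt_eqF// mul0r.
  have P0 : 0 < Phi x by rewrite lt_neqAle eq_sym n0 Phi_ge0.
  rewrite -{2}(powRr1 (Phi_ge0 x)) -{4}(powRr1 (Phi_ge0 x)) -!powRD ?n0 ?implybT//.
  by congr (_ `^ _); lra.
apply: (@le_trans _ _ (Phi x * ((p - 1) * (K `^ (p - 2) * Phi x `^ (p - 2) * (K * `|s - t| * Phi x))))).
  apply: ler_pM; rewrite ?frob_ge0 ?frob_phi//; apply: le_trans h3 _.
  have p1 : 0 <= p - 1 by rewrite subr_ge0 (le_trans _ p2)// ler1n.
  by rewrite ler_wpM2l// ler_wpM2l ?mulr_ge0 ?powR_ge0//; exact: h2.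
rewrite e le_eqVlt; apply/orP; left; apply/eqP; ring.
Qed.

Let integrand_derivable n t x : 0 < t ->
  k.+1%:R * (dot (phi n x) (pw p (v (t + k.+1%:R^-1) x)) - dot (phi n x) (pw p (v t x))) @[k --> \oo]
  --> dot (phi n x) (derive1 (fun s => vpow p v s x) t).
Proof.
move=> t0; have dv : derivable (fun s => v s x) t 1.
  apply/derivable_mxP => i j; rewrite (_ : (fun _ => _) = fun s => \sum_(n < N) c n s * phi n x i j).
    apply: derivable_sum_fun => k; apply: derivableM; last exact: derivable_cst.
    by have [_ [c' [_ h]]] := hc (ltn_ord k); have [] := h t t0.
  by apply/funext => s; rewrite vE summxE; apply: eq_bigr => k _; rewrite mxE.
have dw := derivable_pw p2 dv.
have dwij := (derivable_mxP _ _ _).1 dw.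
rewrite (_ : (fun k : nat => _) = (fun k : nat => \sum_i \sum_j phi n x i j *
   (k.+1%:R^-1^-1 * (pw p (v (t + k.+1%:R^-1 *: 1) x) i j - pw p (v t x) i j)))); last first.
  apply/funext => k; rewrite -dotNr -dotDr /dot mulr_sumr; apply: eq_bigr => i _.
  rewrite mulr_sumr; apply: eq_bigr => j _; rewrite [_ *: 1]mulr1 invrK !mxE.
  by rewrite mulrCA.
have -> : dot (phi n x) (derive1 (fun s => vpow p v s x) t) =
    \sum_i \sum_j phi n x i j * 'D_1 (fun s => pw p (v s x) i j) t.
  rewrite derive1E derive_mx// /dot.
  by apply: eq_bigr => i _; apply: eq_bigr => j _; rewrite [X in _ * X]mxE.
apply: cvg_sum_fun => i; apply: cvg_sum_fun => j; apply: cvgMr.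
by apply: derivable_cvg_seq; [exact: dwij | move=> k; rewrite invr_gt0 | exact: cvg_harmonic].
Qed.

Lemma galerkin_increment (T b : R) (n : nat) : (n < N)%N -> 0 < b < T ->
  pairing D T (fun t x => derive1 (fun s => vpow p v s x) t)
    (fun t => \1_(`]0, b]%classic) t *: phi n) =
  pairD mu D p (phi n) (v b) - pairD mu D p (phi n) (v 0).
Proof.
move=> nN /andP[b0 bT]; pose n' := Ordinal nN.
pose I t := \int[mu]_(x in D) dot (phi n x) (derive1 (fun s => vpow p v s x) t).
have b1 : 0 < b + 1 by lra.
have [C C0 hC] := integrand_lipschitz n' b1.
pose g t := pairD mu D p (phi n) (v t).
have ig t := integrable_pairD mD p2 pq (mphi n) (Lmem_galerkin t).
have lip s t : 0 <= s <= b + 1 -> 0 <= t <= b + 1 ->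
    `|g s - g t| <= (C * \int[mu]_(x in D) Phi x `^ p) * `|s - t|.
  move=> sb tb.
  have := le_normr_RintegralB_lin2 mD (x := C * `|s - t|) (y := 0) (ig s) (ig t) integrable_Phi integrable_Phi.
  rewrite mul0r addr0 mulrAC; apply => x _.
  by rewrite mul0r addr0; exact: hC.
have dg t : 0 < t <= b -> k.+1%:R * (g (t + k.+1%:R^-1) - g t) @[k --> \oo] --> I t.
  move=> /andP[t0 tb].
  have [] := @dominated_cvg_Rintegral _ _ _ mu D mD
    (fun k x => k.+1%:R * (dot (phi n x) (pw p (v (t + k.+1%:R^-1) x)) - dot (phi n x) (pw p (v t x))))
    (fun x => dot (phi n x) (derive1 (fun s => vpow p v s x) t)) (fun x => C * Phi x `^ p).
  - move=> k; apply: measurable_funM => //; apply: measurable_funB.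
      by apply/measurable_EFinP; exact: measurable_int (ig _).
    by apply/measurable_EFinP; exact: measurable_int (ig _).
  - exact: integrableRZ.
  - move=> k x _; have k0 : 0 < k.+1%:R^-1 :> R by rewrite invr_gt0.
    have k1 : k.+1%:R^-1 <= 1 :> R by rewrite invf_le1// ler1n.
    rewrite normrM ger0_norm// -ler_pdivlMl//.
    move: k0 k1; set h := k.+1%:R^-1 => k0 k1.
    apply: (le_trans (hC _ _ x _ _)); [by apply/andP; split; lra..|].
    rewrite addrAC subrr add0r gtr0_norm// le_eqVlt; apply/orP; left; apply/eqP; ring.
  - by move=> x _; exact: integrand_derivable.
  move=> _; apply: cvg_trans; apply: near_eq_cvg; apply: nearW => k.
  rewrite RintegralZl//; last exact: (integrableRB mD (ig _) (ig _)).
  by rewrite (RintegralB mD (ig _) (ig _)).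
rewrite -[RHS](lipschitz_FTC b0 lip dg).
rewrite [RHS](@Rintegral_subset0 _ _ _ (@lebesgue_measure R) `]0, T[%classic)//; last first.
  move=> t _ nt; rewrite indicE memNset ?mul0r// => /=; rewrite in_itv/= => /andP[t0 tb].
  by apply: nt; rewrite /= in_itv/= t0 (le_lt_trans tb).
apply: eq_Rintegral => t _; rewrite indicE; case: (t \in _).
  by rewrite mul1r; apply: eq_Rintegral => x _; rewrite -[(_ *: phi n) x]/(1 *: phi n x) scale1r.
rewrite mul0r /Rintegral integral0_eq// => x _.
by rewrite -[(_ *: phi n) x]/(0 *: phi n x) scale0r dot0l.
Qed.

End galerkin_increments.

Section budgets.
Context {R : realFieldType}.

Lemma le_self_add1 (x : R) : x <= x + 1.
Proof. by rewrite lerDl. Qed.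

(** Each of the two summands takes at most half of e; C + 1 allows for C = 0. *)
Lemma budget_arith (A C L S e : R) : 0 <= C -> 0 <= L -> L <= e / (2 * (C + 1)) ->
  0 < S -> A <= S -> 0 < e -> e / (2 * S) * A + C * L <= e.
Proof.
move=> C0 L0 Le S0 AS e0; have C1 : 0 < C + 1 by rewrite ltr_wpDl.
rewrite [leRHS](splitr e); apply: lerD.
  apply: (@le_trans _ _ (e / (2 * S) * S)).
    by apply: ler_wpM2l => //; rewrite divr_ge0// ?mulr_ge0// ltW.
  by rewrite invfM mulrA mulfVK ?gt_eqF.
apply: (@le_trans _ _ ((C + 1) * (e / (2 * (C + 1))))).
  by apply: ler_pM => //; rewrite lerDl.
by rewrite (_ : _ * _ = e / 2)//; field; rewrite gt_eqF.
Qed.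

Lemma budget_pos (K U W : R) : 0 <= K -> 0 <= U -> 0 <= W -> exists2 S : R, 0 < S &
  forall L U', L <= 1 -> U' <= K * (L + U) -> W + (U' + U) <= S.
Proof.
move=> K0 U0 W0; exists (W + (K * (1 + U) + U) + 1).
  by rewrite ltr_wpDl// !addr_ge0// mulr_ge0// addr_ge0.
move=> L U' L1 hU; apply: (@le_trans _ _ (W + (K * (1 + U) + U))); last exact: le_self_add1.
rewrite lerD2l lerD2r (le_trans hU)// ler_wpM2l// lerD2r//.
Qed.

End budgets.

(** * Continuity of the pairing in each argument *)

Section pairing_continuity.
Context {R : realType} d0 {T : measurableType d0} (mu : {measure set T -> \bar R}) (D : set T).
Hypothesis mD : measurable D.
Variables (p q : R).
Hypotheses (p2 : 2 <= p) (pq : p^-1 + q^-1 = 1).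
Variables m n : nat.
Implicit Types u w : T -> 'M[R]_(m, n).
Notation Lm := (Lmem mu D p).
Notation Li := (Lint mu D p).
Notation pair := (pairD mu D p).

Lemma pairD_small u (e : R) : Lm u -> 0 < e -> exists2 r : R, 0 < r &
  forall w, Lm w -> Li w <= r -> `|pair w u| <= e.
Proof.
move=> mu_ e0; have u0 : 0 <= Li u by exact: Lint_ge0.
have U0 : 0 < Li u + 1 by rewrite ltr_wpDl.
have e1 : 0 < e / (2 * (Li u + 1)) by rewrite divr_gt0// mulr_gt0.
have [C C0 hC] := pairD_eps mu mD p2 pq m n e1.
have C1 : 0 < C + 1 by rewrite ltr_wpDl.
exists (e / (2 * (C + 1))); first by rewrite divr_gt0// mulr_gt0.
move=> w mw wr; apply: (le_trans (hC w u mw mu_)); rewrite addrC.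
apply: (budget_arith (S := Li u + 1) C0 (Lint_ge0 mu D p w) wr U0 _ e0).
exact: le_self_add1.
Qed.

Lemma pairD_near w u (e : R) : Lm w -> Lm u -> 0 < e -> exists2 r : R, 0 < r &
  forall u', Lm u' -> Li (u' - u) <= r -> `|pair w u' - pair w u| <= e.
Proof.
move=> mw mu_ e0.
have [K K1 hK] := psnD_le (Lpseminorm mu mD p2 pq m n).
have K0 : 0 <= K by rewrite (le_trans _ K1).
(* [S] bounds the total of the p-th powers for w, u and every u' with Lint (u' - u) <= 1, so the
   weight e / (2 S) can be fixed before u'. *)
have [S S0 hS] := budget_pos K0 (Lint_ge0 mu D p u) (Lint_ge0 mu D p w).
have e1 : 0 < e / (2 * S) by rewrite divr_gt0// mulr_gt0.
have [C C0 hC] := pairD_lip_eps mu mD p2 pq m n e1.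
have C1 : 0 < C + 1 by rewrite ltr_wpDl.
exists (Num.min 1 (e / (2 * (C + 1)))).
  by rewrite lt_min ltr01/= divr_gt0// mulr_gt0.
move=> u' mu'; rewrite le_min => /andP[ur1 ur].
apply: (le_trans (hC w u' u mw mu' mu_)).
have mB : Lm (u' - u) by exact: (ps_memB (X := Lpseminorm mu mD p2 pq m n) mu' mu_).
have := hK (u' - u) u mB mu_; rewrite subrK => h.
exact: (budget_arith C0 (Lint_ge0 mu D p (u' - u)) ur S0 (hS _ _ ur1 h) e0).
Qed.

Lemma pairD_cvgr w (u_ : nat -> T -> 'M[R]_(m, n)) u : Lm w -> (forall k, Lm (u_ k)) ->
  Lm u -> Li (u_ k - u) @[k --> \oo] --> 0 -> pair w (u_ k) @[k --> \oo] --> pair w u.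
Proof.
move=> mw mu_ mu0 c; apply/cvgrPdist_le => e e0.
have [r r0 h] := pairD_near mw mu0 e0.
have H := (cvgrPdist_le _ _).1 c _ r0.
apply: (filterS _ (H _)) => k; rewrite sub0r normrN ger0_norm ?Lint_ge0// => hk.
by rewrite distrC; exact: (h _ (mu_ k) hk).
Qed.

Lemma pairD_cvgl u (w_ : nat -> T -> 'M[R]_(m, n)) w : Lm u -> (forall k, Lm (w_ k)) ->
  Lm w -> Li (w_ k - w) @[k --> \oo] --> 0 -> pair (w_ k) u @[k --> \oo] --> pair w u.
Proof.
move=> mu0 mw_ mw c; apply/cvgrPdist_le => e e0.
have [r r0 h] := pairD_small mu0 e0.
have H := (cvgrPdist_le _ _).1 c _ r0.
apply: (filterS _ (H _)) => k; rewrite sub0r normrN ger0_norm ?Lint_ge0// => hk.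
have mB : Lm (w_ k - w) by exact: (ps_memB (X := Lpseminorm mu mD p2 pq m n) (mw_ k) mw).
have := h _ mB hk; have := pairD_lin mD p2 pq (-1) mw (mw_ k) mu0.
rewrite scaleN1r [- w + _]addrC mulN1r => ->.
by rewrite addrC distrC.
Qed.

End pairing_continuity.

(** * Schauder expansions and evaluation functionals *)

Section schauder_bases.
Context {R : realType} {p : R} {E : lmodType R} (X : pseminorm p E) (Y : seminormed_space R E).
Hypothesis p0 : 0 < p.
Hypothesis memE : forall x, sp_mem Y x <-> ps_mem X x.
Hypothesis normE : forall x, ps_mem X x -> sp_norm Y x = (psn X x `^ p^-1)%:E.
Variable phi : nat -> E.

Lemma expansion_ps_cvg x c : (forall n, ps_mem X (phi n)) -> ps_mem X x ->
  expansion Y phi x c <-> ps_cvg X (fun N => \sum_(n < N) c n *: phi n) x.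
Proof.
move=> mphi mx; apply: (scvg_ps_cvg p0 normE) => // N.
by apply: ps_mem_sum => n _; apply: ps_memZ; exact: mphi.
Qed.

Hypothesis basis : schauder_basis Y phi.

Lemma basis_mem n : ps_mem X (phi n).
Proof. by apply/memE; have [] := basis. Qed.

(** The partial sums of this sequence are eventually constant, and expansions are unique. It follows
    that Q_N fixes the basis vectors with index below N. *)
Lemma coefs_basis (a : R) n : coefs Y phi (a *: phi n) = fun k => if k == n then a else 0.
Proof.
have man : ps_mem X (a *: phi n) by apply: ps_memZ; exact: basis_mem.
have [c [hc cu]] := basis.2 _ ((memE _).2 man).
have e : expansion Y phi (a *: phi n) (fun k => if k == n then a else 0).
  apply/(expansion_ps_cvg _ basis_mem man); rewrite /ps_cvg.
  apply: cvg_near_cst; near=> N.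
  have nN : (n < N)%N by near: N; exact: nbhs_infty_gt.
  rewrite (bigD1 (Ordinal nN))//= eqxx big1 ?addr0 ?subrr ?psn0// => k kn.
  by rewrite ifN ?scale0r.
rewrite /coefs -(cu _ e); apply/esym/cu.
by apply: xgetPex; exists c.
Unshelve. all: by end_near. Qed.

Lemma proj_span_basis N (a : R) n : (n < N)%N -> proj_span Y phi N (a *: phi n) = a *: phi n.
Proof.
move=> nN; rewrite /proj_span coefs_basis (bigD1 (Ordinal nN))//= eqxx big1 ?addr0// => k kn.
by rewrite ifN ?scale0r.
Qed.

Lemma coefs_cvg x : ps_mem X x ->
  ps_cvg X (fun N => \sum_(n < N) coefs Y phi x n *: phi n) x.
Proof.
move=> mx; apply/(expansion_ps_cvg _ basis_mem mx).
have [c [hc _]] := basis.2 _ ((memE _).2 mx).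
by apply: xgetPex; exists c.
Qed.

End schauder_bases.

Section dual_evaluation.
Context {R : realType} {p : R} {E : lmodType R} (X : pseminorm p E) (Y : seminormed_space R E).
Hypothesis p0 : 0 < p.
Hypothesis memE : forall x, ps_mem X x -> sp_mem Y x.
Hypothesis normE : forall x, ps_mem X x -> sp_norm Y x = (psn X x `^ p^-1)%:E.

(** Turns weak convergence in the dual, tested on the bidual, into pointwise convergence. Scaling by
    r + 1 instead of r avoids dividing by a vanishing norm. *)
Lemma evaluation_bidual x : ps_mem X x -> sp_mem (dual (dual Y)) (fun F : E -> R => F x).
Proof.
move=> mx; split => [//|]; pose r := psn X x `^ p^-1.
have r0 : 0 < r + 1 by rewrite ltr_wpDl// powR_ge0.
exists (r + 1) => F [lF [C bF]].
have mz : ps_mem X ((r + 1)^-1 *: x) by exact: ps_memZ.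
have eF : F x = (r + 1) * F ((r + 1)^-1 *: x).
  have := lF (r + 1) ((r + 1)^-1 *: x) 0 (memE mz) (memE (ps_mem0 X)).
  rewrite addr0 scalerA divff ?gt_eqF// scale1r => ->.
  have := lF 1 0 0 (memE (ps_mem0 X)) (memE (ps_mem0 X)).
  by rewrite scaler0 addr0 mul1r => /eqP; rewrite -subr_eq0 opprD addNKr oppr_eq0 => /eqP ->; rewrite addr0.
rewrite eF normrM gtr0_norm// EFinM; apply: lee_wpmul2l; first by rewrite lee_fin ltW.
apply: ereal_sup_ubound; exists ((r + 1)^-1 *: x) => //; split; first exact: memE.
rewrite normE// lee_fin psnZ// powRM ?powR_ge0 ?psn_ge0// -powRrM mulfV ?gt_eqF// powRr1//.
rewrite gtr0_norm ?invr_gt0// -/r mulrC ler_pdivrMr// mul1r lerDl//.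
Qed.

End dual_evaluation.

Section lipschitz_curves.
Context {R : realType} {p : R} {E : lmodType R} (X : pseminorm p E).
Hypothesis p0 : 0 < p.
Notation mR := (measurableTypeR R).

Lemma slice_value (h t : R) (x : nat -> E) n : 0 < h ->
  if 0 < t <= n%:R * h then exists2 i : nat, i%:R * h < t <= i.+1%:R * h &
    \sum_(i < n) \1_(`]i%:R * h, i.+1%:R * h]%classic) t *: x i = x i
  else \sum_(i < n) \1_(`]i%:R * h, i.+1%:R * h]%classic) t *: x i = 0.
Proof.
move=> h0; elim: n => [|n IH].
  by rewrite big_ord0 mul0r; case: ltP => // t0; case: leP => //= /(lt_le_trans t0); rewrite ltxx.
rewrite big_ord_recr/= [\1_(`]n%:R * h, _]%classic) _]indicE in_itvoc.
have nh : n%:R * h < n.+1%:R * h by rewrite ltr_pM2r// ltr_nat.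
have nh0 : 0 <= n%:R * h by rewrite mulr_ge0// ltW.
move: IH; case: (ltP 0 t) => t0 /=; last first.
  by move=> ->; rewrite ltNge (le_trans t0 nh0)/= scale0r addr0.
case: (leP t (n%:R * h)) => tn /=.
  by rewrite (le_trans tn (ltW nh)) => -[i hi ->]; exists i => //; rewrite scale0r addr0.
move=> ->; case: (leP t (n.+1%:R * h)) => tn1; last by rewrite scale0r addr0.
by exists n; rewrite ?tn ?tn1// scale1r add0r.
Qed.

(** The curve is the limit of the step functions that sample it at the left ends of a uniform
    grid. *)
Lemma smeas_lipschitz (u : R -> E) (S K : R) : 0 < S -> (forall t, ps_mem X (u t)) ->
  (forall s t, 0 <= s <= S -> 0 <= t <= S -> psn X (u s - u t) <= K * `|s - t| `^ p) ->
  smeas X (fun t => \1_(`]0, S]%classic) t *: u t).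
Proof.
move=> S0 mu_ lip; split => [t|]; first exact: ps_memZ.
pose h j : R := S / j.+1%:R.
have h0 j : 0 < h j by rewrite divr_gt0.
have hj j : j.+1%:R * h j = S by rewrite mulrC divfK.
exists (fun j t => \sum_(i < j.+1) \1_(`]i%:R * h j, i.+1%:R * h j]%classic) t *: u (i%:R * h j)).
split => [j|t].
  exists j.+1, (fun i => `]i%:R * h j, i.+1%:R * h j]%classic), (fun i => u (i%:R * h j)).
  by split => // i; split => //; exact: mu_.
have hc : h j `^ p @[j --> \oo] --> 0.
  apply/(powR_seq_cvg0 p0); first by move=> j; exact: ltW.
  by rewrite -(mulr0 S); apply: cvgMr; exact: cvg_harmonic.
have K0 : 0 <= K.
  have := lip S 0; rewrite subr0 lexx (ltW S0) lexx => /(_ isT isT) /(le_trans (psn_ge0 _ _)).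
  by rewrite gtr0_norm// pmulr_lge0// powR_gt0.
apply: (@squeeze_cvgr _ _ _ _ (fun=> 0) (fun j => K * h j `^ p)); [|exact: cvg_cst|]; last first.
  by rewrite -(mulr0 K); exact: cvgMr.
apply: nearW => j; rewrite psn_ge0/=.
have := slice_value t (fun i => u (i%:R * h j)) j.+1 (h0 j); rewrite hj.
rewrite indicE in_itvoc; have [/andP[t0 tS]|_] := boolP (0 < t <= S); last first.
  by move=> ->; rewrite scale0r subrr psn0// mulr_ge0// powR_ge0.
move=> [i /andP[it ti] ->]; rewrite scale1r.
have ih0 : 0 <= i%:R * h j by rewrite mulr_ge0// ltW.
apply: (le_trans (lip _ _ _ _)).
- by rewrite ih0 (le_trans (ltW it)).
- by rewrite (ltW t0).
rewrite ler_wpM2l// ge0_ler_powR ?nnegrE ?(ltW p0) ?(ltW (h0 j))//.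
rewrite ltr0_norm ?subr_lt0// opprB lerBlDl.
by move: ti; rewrite -addn1 natrD mulrDl mul1r.
Qed.

Lemma smeas_restrict_oo (u : R -> E) (S : R) : smeas X (fun t => \1_(`]0, S]%classic) t *: u t) ->
  smeas X (fun t => \1_(`]0, S[%classic) t *: u t).
Proof.
move=> h; rewrite (_ : (fun _ => _) = fun t => \1_(`]0, S[%classic) t *: (\1_(`]0, S]%classic) t *: u t)).
  exact: smeas_indic.
apply/funext => t; rewrite !indicE in_itvoc in_itvoo.
have [/andP[t0 /ltW tS]|_] := boolP (0 < t < S); first by rewrite t0 tS /= !scale1r.
by rewrite !scale0r.
Qed.

End lipschitz_curves.

Section liminf.
Context {R : realType} d0 {T : measurableType d0} (mu : {measure set T -> \bar R}) (D : set T).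
Hypothesis mD : measurable D.

(** By Fatou's lemma the lower limit of f k has integral 0, hence vanishes almost everywhere. This
    stands in for extracting an almost everywhere convergent subsequence. *)
Lemma integral_cvg0_ae_small (f : nat -> T -> R) : (forall k, measurable_fun D (f k)) ->
  (forall k x, 0 <= f k x) -> (\int[mu]_(x in D) (f k x)%:E)%E @[k --> \oo] --> 0%E ->
  {ae mu, forall x, D x -> forall e : R, 0 < e -> forall n : nat, exists2 k, (n <= k)%N & f k x < e}.
Proof.
move=> mf f0 fc.
have mf' k : measurable_fun D (fun x => (f k x)%:E) by exact/measurable_EFinP.
have f0' k x : D x -> (0 <= (f k x)%:E)%E by rewrite lee_fin.
have := fatou mu mD mf' f0'.
have -> : limn_einf (fun k => \int[mu]_(x in D) (f k x)%:E)%E = 0%E.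
  by have [-> _] := cvg_limn_einf_sup fc.
set g := fun x => _ => gle.
have g0 x : (0 <= g x)%E.
  rewrite /g limn_einf_lim; apply: lime_ge; first exact: is_cvg_einfs.
  by apply: nearW => n; apply: le_ereal_inf_tmp => _ [k _ <-]; rewrite lee_fin.
have mg : measurable_fun D g.
  rewrite (_ : g = fun x => limn (einfs (fun k => (f k x)%:E))); last first.
    by apply/funext => x; rewrite /g limn_einf_lim.
  apply: (emeasurable_fun_cvg (fun n x => einfs (fun k => (f k x)%:E) n)).
    by move=> n; exact: measurable_fun_einfs.
  by move=> x _; exact: is_cvg_einfs.
have ig : (\int[mu]_(x in D) `|g x| = 0)%E.
  apply/eqP; rewrite eq_le integral_ge0// andbT.
  by under eq_integral do rewrite gee0_abs//.
have := (ae_eq_integral_abs mu mD mg).1 ig.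
move=> e; have e' : {ae mu, forall x, D x -> g x = 0%E} by exact: e.
apply: (ae_mono e') => x gx Dx r r0 n; apply: contrapT => nk.
have ge k : (n <= k)%N -> r <= f k x.
  by move=> nk'; rewrite leNgt; apply/negP => fr; apply: nk; exists k.
have : (r%:E <= g x)%E.
  rewrite /g limn_einf_lim; apply: lime_ge; first exact: is_cvg_einfs.
  near=> m; apply: le_ereal_inf_tmp => _ [k /= mk <-]; rewrite lee_fin; apply: ge.
  by apply: leq_trans mk; near: m; exact: nbhs_infty_ge.
by rewrite gx// lee_fin leNgt r0.
Unshelve. all: by end_near. Qed.

End liminf.

(** * The dual of the Bochner space and the identity (K) *)

Section bochner_dual.
Context {R : realType} {p q : R} {E : lmodType R} (X : pseminorm p E).
Hypotheses (p2 : 2 <= p) (pq : p^-1 + q^-1 = 1).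
Variables (T : R) (Y : seminormed_space R E).
Hypothesis memE : forall x, sp_mem Y x <-> ps_mem X x.
Hypothesis normE : forall x, ps_mem X x -> sp_norm Y x = (psn X x `^ p^-1)%:E.
Notation mu := (@lebesgue_measure R).
Notation B := (bochner p%:E T Y).
Notation V := (nice_pseminorm X (ge2_gt0 p2) T).
Implicit Types (F G : (R -> E) -> R) (u w : R -> E).

Let p0 : 0 < p. Proof. exact: ge2_gt0. Qed.

Lemma ae_itv_eq_refl u : ae_itv_eq T u u.
Proof. exact: aeW. Qed.

Lemma ae_itv_eq_lin (a : R) u u' w w' : ae_itv_eq T w u -> ae_itv_eq T w' u' ->
  ae_itv_eq T (a *: w + w') (a *: u + u').
Proof.
move=> h h'; apply: (ae_mono2 h h') => t e e' tT.
by rewrite -[LHS]/(a *: w t + w' t) -[RHS]/(a *: u t + u' t) e// e'.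
Qed.

Lemma nice_mem u w : nice X T u -> ae_itv_eq T w u -> sp_mem B w.
Proof. exact: nice_bochner. Qed.

Lemma nice_norm u w : nice X T u -> ae_itv_eq T w u -> sp_norm B w = (psn V u `^ p^-1)%:E.
Proof. exact: bochner_norm. Qed.

Lemma mem_nice w : sp_mem B w -> exists2 u, nice X T u & ae_itv_eq T w u.
Proof. exact: bochner_ae_nice. Qed.

Lemma nice_norm_le1 u w : nice X T u -> ae_itv_eq T w u -> (sp_norm B w <= 1)%E <-> psn V u <= 1.
Proof.
move=> nu wu; rewrite (nice_norm nu wu) lee_fin; have u0 := psn_ge0 V u.
split => h.
  have -> : 1 = 1 `^ p :> R by rewrite powR1.
  rewrite -(powR_inv p0 u0).
  by rewrite ge0_ler_powR ?nnegrE ?powR_ge0// ltW.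
have -> : 1 = 1 `^ p^-1 :> R by rewrite powR1.
by rewrite ge0_ler_powR ?nnegrE ?invr_ge0// ltW.
Qed.

Lemma dual_linear_on F : sp_mem (dual B) F -> linear_on V F.
Proof.
move=> [lF _] a u u' nu nu'; apply: lF.
  exact: nice_mem nu (ae_itv_eq_refl u).
exact: nice_mem nu' (ae_itv_eq_refl u').
Qed.

Let dual_bound F : sp_mem (dual B) F -> exists2 C, 0 <= C & forall w, sp_mem B w ->
  (`|F w|%:E <= C%:E * sp_norm B w)%E.
Proof.
move=> [_ [C hC]]; exists `|C| => // w mw; apply: (le_trans (hC w mw)).
have [u nu wu] := mem_nice mw; rewrite (nice_norm nu wu) -!EFinM lee_fin.
by rewrite ler_wpM2r ?powR_ge0// ler_norm.
Qed.

(** Functionals act on functions and not on classes; a function vanishing almost everywhere has norm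
    0, so boundedness forces F to vanish on it. *)
Lemma dual_ae F u w : sp_mem (dual B) F -> nice X T u -> ae_itv_eq T w u -> F w = F u.
Proof.
move=> dF nu wu; have [C C0 hC] := dual_bound dF; have [lF _] := dF.
have mw := nice_mem nu wu; have mu_ := nice_mem nu (ae_itv_eq_refl u).
have e := lF (-1) u w mu_ mw.
have z : ae_itv_eq T (-1 *: u + w) 0.
  apply: (ae_mono wu) => t h tT.
  by rewrite -[LHS]/(-1 *: u t + w t) h// scaleN1r addNr.
have n0 := nice0 X p0 T.
have := hC _ (nice_mem n0 z); rewrite (nice_norm n0 z) psn0// powR0 ?invr_eq0 ?gt_eqF// mule0.
rewrite lee_fin normr_le0 e => /eqP; lra.
Qed.

(** The dual norm is a supremum of |F w|; exchanging u for -u when needed makes F itself nearly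
    maximal, as [strong_convergence] requires. *)
Lemma dual_ball_bound F : sp_mem (dual B) F -> exists M,
  [/\ sp_norm (dual B) F = M%:E, ball_bound V F M &
   forall e : R, 0 < e -> exists x, [/\ ps_mem V x, psn V x <= 1 & M - e <= F x]].
Proof.
move=> dF; have [C C0 hC] := dual_bound dF.
set S := sp_norm (dual B) F.
have n0 := nice0 X p0 T.
have SC : (S <= C%:E)%E.
  apply: ge_ereal_sup => _ [w [mw w1] <-]; apply: (le_trans (hC w mw)).
  by rewrite -[leRHS]mule1; apply: lee_wpmul2l; rewrite ?lee_fin.
have S0 : (0 <= S)%E.
  apply: (@le_trans _ _ `|F 0|%:E); first by rewrite lee_fin.
  apply: ereal_sup_ubound; exists 0 => //; split; first exact: nice_mem n0 (ae_itv_eq_refl 0).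
  by apply/(nice_norm_le1 n0 (ae_itv_eq_refl 0)); rewrite psn0.
have Sfin : S \is a fin_num by rewrite ge0_fin_numE// (le_lt_trans SC)// ltry.
exists (fine S); split; first by rewrite fineK.
  move=> u nu u1; rewrite -lee_fin fineK//; apply: ereal_sup_ubound; exists u => //.
  by split; [exact: nice_mem nu (ae_itv_eq_refl u) | exact/(nice_norm_le1 nu (ae_itv_eq_refl u))].
move=> e e0; have [_ [w [mw w1] <-] h] := ub_ereal_sup_adherent e0 Sfin.
have [u nu wu] := mem_nice mw.
have u1 := (nice_norm_le1 nu wu).1 w1.
have {}h : fine S - e <= `|F u|.
  rewrite -(dual_ae dF nu wu) -lee_fin EFinB fineK//; exact: ltW.
have lF := dual_linear_on dF.
have [Fu|Fu] := leP 0 (F u); first by exists u; split => //; rewrite ger0_norm in h.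
exists (- u); split; first exact: (ps_memN (X := V)).
  by rewrite (psnN (X := V)).
by rewrite ltr0_norm// in h; have := linear_onZ lF (-1) nu; rewrite scaleN1r mulN1r => ->.
Qed.

Lemma dual_of_nice G G' (M : R) : (forall u w, nice X T u -> ae_itv_eq T w u -> G w = G' u) ->
  linear_on V G' -> ball_bound V G' M -> sp_mem (dual B) G /\ (sp_norm (dual B) G <= M%:E)%E.
Proof.
move=> GG' lG bG; split.
  split => [a w w' mw mw'|].
    have [u nu wu] := mem_nice mw; have [u' nu' wu'] := mem_nice mw'.
    rewrite (GG' _ _ nu wu) (GG' _ _ nu' wu') -lG//.
    apply: GG'; first exact: (@ps_lin _ _ _ V a _ _ nu nu').
    exact: ae_itv_eq_lin.
  exists M => w mw; have [u nu wu] := mem_nice mw.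
  rewrite (GG' _ _ nu wu) (nice_norm nu wu) -EFinM lee_fin.
  exact: (ball_bound_root p2 lG bG).
apply: ge_ereal_sup => _ [w [mw w1] <-]; have [u nu wu] := mem_nice mw.
by rewrite (GG' _ _ nu wu) lee_fin; apply: bG => //; exact/(nice_norm_le1 nu wu).
Qed.

(** Any Psi in the bidual is bounded by a multiple of the dual norm, and the dual norm of [F - G_ k]
    tends to 0 by [strong_convergence]. The common bound M must be the norm of F itself. *)
Lemma dual_strong_wcvg (G_ G'_ : nat -> (R -> E) -> R) F (M : R) : sp_mem (dual B) F ->
  sp_norm (dual B) F = M%:E ->
  (forall k u w, nice X T u -> ae_itv_eq T w u -> G_ k w = G'_ k u) ->
  (forall k, linear_on V (G'_ k)) -> (forall k, ball_bound V (G'_ k) M) ->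
  (forall u, nice X T u -> G'_ k u @[k --> \oo] --> F u) ->
  wcvg (dual B) G_ F.
Proof.
move=> dF FM GG' lG bG cG; have lF := dual_linear_on dF.
have [M' [FM' bF Mleast]] := dual_ball_bound dF.
have eM : M' = M by move: FM'; rewrite FM => -[].
rewrite eM in bF Mleast.
have mG k : sp_mem (dual B) (G_ k) by have [] := dual_of_nice (GG' k) (lG k) (bG k).
split => // Psi [lPsi [C hC]].
apply/cvgrPdist_le => e e0.
have e1 : 0 < e / (`|C| + 1) by rewrite divr_gt0// ltr_wpDl.
have := strong_convergence p2 pq lG lF bG bF Mleast cG e1.
apply: filterS => k hk.
have mB : sp_mem (dual B) (-1 *: G_ k + F).
  have [lGk [C1 hC1]] := mG k; have [lF' [C2 hC2]] := dF; split.
    move=> a x y mx my.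
    rewrite -[LHS]/(-1 * G_ k (a *: x + y) + F (a *: x + y)) lGk// lF'//.
    rewrite -[RHS]/(a * (-1 * G_ k x + F x) + (-1 * G_ k y + F y)); ring.
  have [C1' C10 hC1'] := dual_bound (mG k); have [C2' C20 hC2'] := dual_bound dF.
  exists (C1' + C2') => x mx; have [u nu wu] := mem_nice mx.
  have := hC1' x mx; have := hC2' x mx; rewrite (nice_norm nu wu) -!EFinM !lee_fin.
  rewrite -[(_ *: _ + _) x]/(-1 * G_ k x + F x) mulN1r mulrDl => h2 h1.
  by apply: (le_trans (ler_normD _ _)); rewrite normrN lerD.
have eP : Psi F - Psi (G_ k) = Psi (-1 *: G_ k + F) by rewrite lPsi// mulN1r addrC.
rewrite eP -lee_fin; apply: (le_trans (hC _ mB)).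
have nB : (sp_norm (dual B) (-1 *: G_ k + F)%R <= (e / (`|C| + 1))%:E)%E.
  apply: ge_ereal_sup => _ [w [mw w1] <-]; have [u nu wu] := mem_nice mw.
  rewrite -[X in `|X|]/(-1 * G_ k w + F w) (GG' _ _ _ nu wu) (dual_ae dF nu wu) mulN1r addrC.
  rewrite lee_fin distrC; apply: hk => //; exact/(nice_norm_le1 nu wu).
have nB0 : (0 <= sp_norm (dual B) (-1 *: G_ k + F)%R)%E.
  have n0 := nice0 X p0 T.
  apply: (@le_trans _ _ `|(-1 *: G_ k + F) 0|%:E); first by rewrite lee_fin.
  apply: ereal_sup_ubound; exists 0 => //; split; first exact: nice_mem n0 (ae_itv_eq_refl 0).
  by apply/(nice_norm_le1 n0 (ae_itv_eq_refl 0)); rewrite psn0.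
apply: (@le_trans _ _ (`|C|%:E * (e / (`|C| + 1))%:E)%E).
  apply: (@le_trans _ _ (`|C|%:E * sp_norm (dual B) (-1 *: G_ k + F)%R)%E).
    by apply: lee_wpmul2r => //; rewrite lee_fin ler_norm.
  by apply: lee_wpmul2l; rewrite ?lee_fin.
rewrite -EFinM lee_fin mulrCA ler_piMr//; first exact: ltW.
by rewrite ler_pdivrMr ?ltr_wpDl// mul1r lerDl.
Qed.

End bochner_dual.

(** * The identity (K) *)

Section key_identity.
Context {R : realType} {d : nat} (D : set 'rV[R]_d).
Hypothesis oD : open D.
Variables (p q : R).
Hypotheses (p2 : 2 <= p) (pq : p^-1 + q^-1 = 1).
Variable T : R.
Hypothesis T0 : 0 < T.
Notation mu := (@leb R d).
Notation E := 'rV[R]_d.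
Notation F1 := (E -> 'rV[R]_d).
Notation X := (Wpseminorm oD p2 pq).
Notation step := (step (E := F1) T).

Let mD : measurable D. Proof. exact: open_measurable_rV. Qed.
Let p0 : 0 < p. Proof. exact: ge2_gt0. Qed.

Notation L := (Lpseminorm mu mD p2 pq 1 d).
Notation Lm := (Lmem mu D p).
Notation Li := (Lint mu D p).
Notation pair := (pairD mu D p).

Lemma memW v : sp_mem (Wdiv D p) v <-> ps_mem X v.
Proof. by []. Qed.

Lemma normW v : ps_mem X v -> sp_norm (Wdiv D p) v = (psn X v `^ p^-1)%:E.
Proof. exact: sp_norm_Wdiv. Qed.

Lemma Lm_W v : ps_mem X v -> Lm v.
Proof. exact: Lmem_Wdiv. Qed.

Lemma ps_cvg_W_L (u : nat -> F1) v : ps_cvg X u v -> Li (u k - v) @[k --> \oo] --> 0.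
Proof.
move=> c; apply: (@squeeze_cvgr _ _ _ _ (fun=> 0) (fun k => psn X (u k - v))) => //; last exact: cvg_cst.
by apply: nearW => k; apply/andP; split; [exact: Lint_ge0 | exact: (Lint_le_Wdiv oD p2 pq)].
Qed.

Lemma nice_W_L v : nice X T v -> nice L T v.
Proof.
move=> [[mv [s [hs sv]]] v0 iv]; apply: niceP => //.
  split => [t|]; first exact: Lm_W.
  exists s; split => [k|t]; last exact: ps_cvg_W_L.
  have [n [A [x [h e]]]] := hs k; exists n, A, x; split => // j; have [mA mx] := h j.
  by split => //; exact: Lm_W.
exists (fun t => psn X (v t)) => // t; exact: Lint_le_Wdiv.
Qed.

Variables (phi : nat -> F1) (v0 : F1) (c0 : nat -> R) (c : nat -> nat -> R -> R)
  (N : nat -> nat) (v v' : R -> F1) (F : (R -> F1) -> R).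
Hypothesis basis : schauder_basis (Wdiv D p) phi.
Hypothesis mv0 : Lm v0.
Hypothesis v0_expansion : Li (\sum_(n < k) c0 n *: phi n - v0) @[k --> \oo] --> 0.
Hypothesis hc : forall k n, (n < N k)%N -> C1_halfline (c (N k) n) /\ c (N k) n 0 = c0 n.
Hypothesis leN : forall k, (k <= N k)%N.
Hypothesis nv' : nice X T v'.
Hypothesis vv' : ae_itv_eq T v v'.
Hypothesis strong : scvg (bochner p%:E T (Lr D p 1 d))
    (fun k => galerkin_fun phi (N k) (c (N k))) v.
Hypothesis weak_dt : wcvg (Vdual D p T)
    (fun k => proj_adj D p phi (N k) (pairing D T (fun t x =>
       derive1 (fun s => vpow p (galerkin_fun phi (N k) (c (N k))) s x) t))) F.

Let g k := galerkin_fun phi (N k) (c (N k)).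

Let mphiW n : ps_mem X (phi n). Proof. exact: (basis_mem memW). Qed.
Let mphi n : Lm (phi n). Proof. exact: Lm_W. Qed.
Let hcN k n : (n < N k)%N -> C1_halfline (c (N k) n). Proof. by case/hc. Qed.
Let mg k t : Lm (g k t). Proof. exact: (Lmem_galerkin mD p2 pq (N k) (c (N k)) mphi t). Qed.

Let dF : sp_mem (Vdual D p T) F. Proof. by have [] := weak_dt. Qed.
Let lF : linear_on (nice_pseminorm X (ge2_gt0 p2) T) F.
Proof. exact: (dual_linear_on memW normW). Qed.

Let g0_cvg n : pair (phi n) (g k 0) @[k --> \oo] --> pair (phi n) v0.
Proof.
have := pairD_cvgr mD p2 pq (mphi n) (fun k => mg k 0) mv0; apply.
rewrite (_ : (fun k => Li (g k 0 - v0)) = (fun k => Li (\sum_(n < k) c0 n *: phi n - v0)) \o N).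
  apply: cvg_comp v0_expansion => A [m _ mA]; exists m => // k /= mk.
  by apply: mA; exact: leq_trans mk (leN k).
apply/funext => k; congr (Li (_ - v0)); rewrite /g /galerkin_fun.
by apply: eq_bigr => i _; have [_ ->] := hc (ltn_ord i).
Qed.

(** The weak convergence in V' is tested on the evaluation at 1_]0,b] phi_n, which Q_N leaves
    unchanged as soon as N > n; [galerkin_increment] computes the left side. *)
Lemma increment_limit n b : 0 < b < T ->
  pair (phi n) (g k b) @[k --> \oo] --> pair (phi n) v0 + F (step 0 b (phi n)).
Proof.
move=> bT; have [_ _ wk] := weak_dt.
have ns : nice X T (step 0 b (phi n)) by exact: nice_step.
have ev := @evaluation_bidual R p _ (nice_pseminorm X (ge2_gt0 p2) T) (Vsp D p T) p0
  (fun u nu => nice_mem p2 memW normW nu (ae_itv_eq_refl T u))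
  (fun u nu => nice_norm p2 normW nu (ae_itv_eq_refl T u)) _ ns.
have cF := wk _ ev; have c0' := @g0_cvg n.
apply: (cvg_trans _ (cvgD c0' cF)); apply: near_eq_cvg; near=> k.
have nN : (n < N k)%N by apply: leq_trans (leN k); near: k; exact: nbhs_infty_gt.
have e : (fun t => proj_span (Wdiv D p) phi (N k) (step 0 b (phi n) t)) =
    fun t => \1_(`]0, b]%classic) t *: phi n.
  rewrite (@step0E _ _ T b (phi n)); last by case/andP: bT.
  by apply/funext => t; rewrite (proj_span_basis p0 memW normW basis).
change (pair (phi n) (g k 0) + pairing D T (fun t x => derive1 (fun s => vpow p (g k) s x) t)
  (fun t => proj_span (Wdiv D p) phi (N k) (step 0 b (phi n) t)) = pair (phi n) (g k b)).
rewrite e.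
by have := galerkin_increment mD p2 pq mphi (@hcN k) nN bT => /= ->; rewrite addrC subrK.
Unshelve. all: by end_near. Qed.

Let u k : R -> F1 := -1 *: v' + (fun t => \1_(`]0, T[%classic) t *: g k t).

Let uE k t : t \in `]0, T[ -> u k t = g k t - v' t.
Proof.
move=> tT; rewrite /u -[LHS]/(-1 *: v' t + \1_(`]0, T[%classic) t *: g k t).
by rewrite indicE mem_set// scale1r scaleN1r addrC.
Qed.

Let nu k : nice L T (u k).
Proof.
apply: nice_lin => //; first exact: nice_W_L.
have [K K0 [h1 h2]] := galerkin_Lint_bounds mD p2 pq mphi (@hcN k) T0.
apply: niceP => //.
- apply: smeas_restrict_oo => //.
  exact: (smeas_lipschitz (X := L) p0 (K := K) T0 (mg k) h2).
- by move=> t tT; rewrite indicE memNset ?scale0r//; exact/negP.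
- exists (fun t => \1_(`]0, T[%classic) t * K) => [|t]; first exact: integrable_indic_oo_cst.
  rewrite psnZ ?indicE ?in_itvoo; last exact: mg.
  have [/andP[t0 tT]|_] := boolP (0 < t < T); last by rewrite normr0 powR0 ?gt_eqF// !mul0r.
  by rewrite normr1 powR1 !mul1r; apply: h1; rewrite !ltW.
Qed.

Let u_cvg : psn_int L (u k) @[k --> \oo] --> 0.
Proof.
have e k : sp_norm (bochner p%:E T (Lr D p 1 d)) (g k - v) = (psn_int L (u k) `^ p^-1)%:E.
  have nE (f : F1) : ps_mem L f -> sp_norm (Lr D p 1 d) f = (psn L f `^ p^-1)%:E.
    exact: (sp_norm_Lr mD p2).
  have ae : ae_itv_eq T (g k - v) (u k).
    apply: (ae_mono vv') => t h tT; rewrite uE//.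
    by rewrite -[LHS]/(g k t - v t) h.
  exact: (bochner_norm p0 nE (nu k) ae).
move: strong; rewrite /scvg; under eq_fun do rewrite e.
move=> /fine_cvgP[_] /=.
by move=> /(powR_seq_cvg0 _ (fun k => psn_int_ge0 L (u k))); apply; rewrite invr_gt0.
Qed.

(** At almost every time the approximations come arbitrarily close to v' at arbitrarily large
    indices. These indices may depend on t, since [increment_limit] holds along the whole
    sequence. *)
Let ae_close : {ae @lebesgue_measure R, forall t, t \in `]0, T[ -> forall e : R, 0 < e ->
  forall n : nat, exists2 k, (n <= k)%N & Li (g k t - v' t) < e}.
Proof.
have := @integral_cvg0_ae_small R _ _ (@lebesgue_measure R) setT measurableT (fun k t => psn L (u k t)).
move=> /(_ _ _ _)/ae_mono; apply.
- by move=> k; apply: smeas_psn => //; have [] := nu k.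
- by move=> k t; exact: psn_ge0.
- rewrite (_ : (fun k => _) = fun k => (psn_int L (u k))%:E).
    by apply/fine_cvgP; split; [exact: nearW | exact: u_cvg].
  apply/funext => k; rewrite /psn_int /Rintegral fineK//.
  by apply: integrable_fin_num => //; have [] := nu k.
move=> t h tT e e0 n; have [k nk hk] := h Logic.I e e0 n; exists k; first exact: nk.
by rewrite uE in hk.
Qed.

Let key_basis : {ae @lebesgue_measure R, forall t, forall n, t \in `]0, T[ ->
  pair (phi n) (v' t) = pair (phi n) v0 + F (step 0 t (phi n))}.
Proof.
apply: ae_forall => n; apply: (ae_mono ae_close) => t h tT.
have mv't : Lm (v' t) by apply: Lm_W; have [[]] := nv'.
have bT : 0 < t < T by move: tT; rewrite in_itv.
set l := pair (phi n) v0 + _.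
have cl := (cvgrPdist_le _ _).1 (@increment_limit n t bT).
apply/eqP; rewrite -subr_eq0 -normr_le0; apply/ler_addgt0Pl => e e0; rewrite addr0.
have e2 : 0 < e / 2 by rewrite divr_gt0.
have [r r0 hr] := pairD_near mD p2 pq (mphi n) mv't e2.
have [m _ hm] := cl _ (e / 2) e2.
have [k mk hk] := h tT r r0 m.
have h1 := hr _ (mg k t) (ltW hk); have h2 := hm k mk.
rewrite /= -/l in h2.
rewrite -(subrKA (pair (phi n) (g k t))) (splitr e) (le_trans (ler_normD _ _))// lerD//.
  by rewrite distrC.
by rewrite distrC.
Qed.

(** Both sides are linear in w and converge along the partial sums of its expansion in W. The null
    set of exceptional times is independent of w because the basis is countable. *)
Lemma key_identity : {ae @lebesgue_measure R, forall t, t \in `]0, T[ ->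
  forall w, ps_mem X w -> pair w (v' t) = pair w v0 + F (step 0 t w)}.
Proof.
have [M [_ bF _]] := dual_ball_bound p2 memW normW dF.
apply: (ae_mono key_basis) => t kt tT w mw.
have mv't : Lm (v' t) by apply: Lm_W; have [[]] := nv'.
have /andP[t0 tT'] : 0 < t < T by move: tT; rewrite in_itv.
pose A x := pair x (v' t) - pair x v0 - F (step 0 t x).
have lA : linear_on X A.
  move=> a x y mx my; rewrite /A step_lin.
  have [lx ly] := (Lm_W mx, Lm_W my).
  rewrite (pairD_lin mD p2 pq a lx ly mv't) (pairD_lin mD p2 pq a lx ly mv0).
  rewrite lF; [ring|exact: nice_step..].
pose s k := \sum_(n < k) coefs (Wdiv D p) phi w n *: phi n.
have ms k : ps_mem X (s k) by apply: ps_mem_sum => i _; exact: ps_memZ.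
have As k : A (s k) = 0.
  rewrite /s (linear_on_sum lA); last by move=> i; exact: ps_memZ.
  rewrite big1// => i _; rewrite (linear_onZ lA)// /A (kt i tT).
  by rewrite -addrA -opprD subrr mulr0.
have cs : ps_cvg X s w := coefs_cvg p0 memW normW basis mw.
have cL := ps_cvg_W_L cs.
have c1 := pairD_cvgl mD p2 pq mv't (fun k => Lm_W (ms k)) (Lm_W mw) cL.
have c2 := pairD_cvgl mD p2 pq mv0 (fun k => Lm_W (ms k)) (Lm_W mw) cL.
have c3 : F (step 0 t (s k)) @[k --> \oo] --> F (step 0 t w).
  apply/cvgrPdist_le => e e0.
  have [r r0 hr] := powR_small lF bF (ltW t0) e0.
  apply: filterS ((cvgrPdist_le _ _).1 cs _ r0) => k; rewrite sub0r normrN ger0_norm ?psn_ge0// => hk.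
  rewrite distrC -(linear_onB lF); [|exact: nice_step..].
  have -> : step 0 t (s k) - step 0 t w = step 0 t (s k - w).
    by rewrite [s k - w]addrC -scaleN1r [RHS]step_lin scaleN1r addrC.
  have := normr_step lF bF (ltW t0) (ps_memB (ms k) mw).
  by rewrite subr0 [t * _]mulrC => /le_trans; apply; apply: hr; rewrite hk psn_ge0.
have cA : A (s k) @[k --> \oo] --> A w.
  by apply: cvgB => //; apply: cvgB.
have : A w = 0.
  apply: (cvg_unique (@norm_hausdorff _ R) cA).
  have -> : (fun k => A (s k)) = fun=> 0 by apply/funext => k; exact: As.
  exact: cvg_cst.
by rewrite /A => /eqP; rewrite -addrA -opprD subr_eq0 => /eqP.
Qed.

End key_identity.

(** * Difference quotients and energy of the limit *)

Section pairing_increments.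
Context {R : realType} d0 {T : measurableType d0} (mu : {measure set T -> \bar R}) (D : set T).
Hypothesis mD : measurable D.
Variables (p q : R).
Hypotheses (p2 : 2 <= p) (pq : p^-1 + q^-1 = 1).
Variables m n : nat.
Implicit Types w a b : T -> 'M[R]_(m, n).

Lemma Rintegral_dot_increment (i k : R) w a b : Lmem mu D p w -> Lmem mu D p a -> Lmem mu D p b ->
  \int[mu]_(x in D) dot (w x) (i *: (k *: (pw p (a x) - pw p (b x)))) =
  i * (k * (pairD mu D p w a - pairD mu D p w b)).
Proof.
move=> mw ma mb; have ia := integrable_pairD mD p2 pq mw ma.
have ib := integrable_pairD mD p2 pq mw mb.
rewrite /pairD -RintegralB// mulrA -RintegralZl//; last exact: integrableRB.
apply: eq_Rintegral => x _.
by rewrite scalerA dotZr dotDr dotNr.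
Qed.

Lemma Rintegral_dot_scale0 (f w : T -> 'M[R]_(m, n)) (i : R) : i = 0 ->
  \int[mu]_(x in D) dot (w x) (i *: f x) = 0.
Proof.
move=> ->; transitivity (\int[mu]_(x in D) 0).
  by apply: eq_Rintegral => x _; rewrite scale0r dot0r.
by rewrite /Rintegral integral0_eq.
Qed.

Lemma Rintegral_frob_pw (f : T -> 'M[R]_(m, n)) :
  \int[mu]_(x in D) (frob (pw p (f x)) `^ q) = Lint mu D p f.
Proof. by apply: eq_Rintegral => x _; rewrite (frob_pw_powR p2 pq). Qed.

End pairing_increments.

Lemma ae_neq (R : realType) (c : R) : {ae @lebesgue_measure R, forall t, t != c}.
Proof.
exists [set c]; split; [exact: measurable_set1|exact: lebesgue_measure_set1|].
by move=> t /= /negP; rewrite negbK => /eqP.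
Qed.

Section difference_quotients.
Context {R : realType} {d : nat} (D : set 'rV[R]_d).
Hypothesis oD : open D.
Variables (p q : R).
Hypotheses (p2 : 2 <= p) (pq : p^-1 + q^-1 = 1).
Variable T : R.
Hypothesis T0 : 0 < T.
Notation mu := (@leb R d).
Notation E := 'rV[R]_d.
Notation F1 := (E -> 'rV[R]_d).
Notation X := (Wpseminorm oD p2 pq).
Notation step := (step (E := F1) T).
Notation pair := (pairD mu D p).
Notation Lm := (Lmem mu D p).
Notation V := (nice_pseminorm X (ge2_gt0 p2) T).

Let mD : measurable D. Proof. exact: open_measurable_rV. Qed.
Let p0 : 0 < p. Proof. exact: ge2_gt0. Qed.

Variables (v0 : F1) (v v' : R -> F1) (F : (R -> F1) -> R) (M : R).
Hypothesis nv' : nice X T v'.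
Hypothesis vv' : ae_itv_eq T v v'.
Hypotheses (lF : linear_on V F) (bF : ball_bound V F M).
Hypothesis key : {ae @lebesgue_measure R, forall t, t \in `]0, T[ ->
  forall w, ps_mem X w -> pair w (v' t) = pair w v0 + F (step 0 t w)}.

Let good t := t \in `]0, T[ -> v t = v' t /\
  forall w, ps_mem X w -> pair w (v' t) = pair w v0 + F (step 0 t w).

Let ae_good : {ae @lebesgue_measure R, forall t, good t}.
Proof. by apply: (ae_mono2 key vv') => t kt vt tT; split; [exact: vt|exact: kt]. Qed.

Let Lv' t : Lm (v' t).
Proof. by have [[mv _] _ _] := nv'; exact: Lm_W (mv t). Qed.

Let increment t h (w : F1) : good t -> good (t + h) -> 0 < t -> 0 < h -> t + h < T -> ps_mem X w ->
  [/\ v t = v' t, v (t + h) = v' (t + h) &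
     pair w (v' (t + h)) - pair w (v' t) = F (step t (t + h) w)].
Proof.
move=> g1 g2 t0 h0 thT mw.
have [|e1 k1] := g1; first by rewrite in_itv/= t0 (lt_trans _ thT)// ltrDl.
have [|e2 k2] := g2; first by rewrite in_itv/= thT addr_gt0.
split => //; rewrite k1// k2// (step_prim lF t (ltW h0) mw).
by rewrite /prim; ring.
Qed.

(** At almost every time (K) is available at t and at t + h; the difference is the value of F on the
    step over ]t, t + h]. *)
Lemma pairing_diff_fwd (h : R) psi u : 0 < h -> nice X T u -> ae_itv_eq T psi u ->
  pairing D T (diff_fwd T h (vpow p v)) psi = steklov T F h u.
Proof.
move=> h0 nu pu; have [[mu_ _] u0 _] := nu.
rewrite /pairing Rintegral_mkcond /steklov -RintegralZl//; last first.
  exact: (integrable_steklov pq lF bF (ltW h0) nu).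
(* The time T - h is discarded because the cut-off is closed there, while (K) is known only for
   times strictly below T. *)
apply: ae_eq_Rintegral_gen; apply: (ae_mono2 (ae_mono2 ae_good (ae_addr h ae_good) (fun t a b => conj a b))
  (ae_mono2 pu (ae_neq (T - h)) (fun t a b => conj a b))) => t [g1 g2] [put tTh] _.
rewrite patchE in_itvoo; case: ifPn => [tT|tT]; last first.
  by rewrite (steklov_fun0 lF) ?mulr0// in_itv.
have /andP[t0 _] := tT.
rewrite /steklov_fun mulrCA; have [th|th] := boolP (t \in `[0, T - h]%classic); last first.
  have i0 : \1_(`[0, T - h]%classic) t = 0 :> R by rewrite indicE (negbTE th).
  by rewrite i0 mul0r; exact: (Rintegral_dot_scale0 _ _ _ _ i0).
have thT : t + h < T by move: th; rewrite in_itvcc => /andP[_]; rewrite le_eqVlt (negbTE tTh)/= ltrBrDr.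
have [e1 e2 e3] := increment g1 g2 t0 h0 thT (mu_ t).
rewrite -e3; have := Rintegral_dot_increment mD p2 pq (\1_(`[0, T - h]%classic) t) h^-1
   (Lm_W (mu_ t)) (Lv' (t + h)) (Lv' t).
by rewrite -e1 -e2 -(put tT) => <-.
Qed.

(** Substituting t - h for the time turns the backward difference into a forward one tested with
    psi(. + h). *)
Lemma pairing_diff_bwd (h : R) psi u : 0 < h -> nice X T u -> ae_itv_eq T psi u ->
  pairing D T (diff_bwd T h (vpow p v)) psi = steklov T F h (time_shift T h u).
Proof.
move=> h0 nu pu; have [[mu_ _] u0 _] := nu.
have nsu := nice_shift p2 h nu.
have iS := integrable_steklov pq lF bF (ltW h0) nsu.
rewrite /pairing Rintegral_mkcond /steklov -(Rintegral_addr (- h) iS) -RintegralZl//; last first.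
  exact: (integrable_addr (- h) iS).
have ae1 := ae_mono2 ae_good (ae_addr (- h) ae_good) (fun t a b => conj a b).
have ae2 := ae_mono2 pu (ae_mono2 (ae_neq h) (ae_neq T) (fun t a b => conj a b)) (fun t a b => conj a b).
apply: ae_eq_Rintegral_gen; apply: (ae_mono2 ae1 ae2) => t [g1 g2] [put [th tT']] _.
rewrite patchE in_itvoo /steklov_fun mulrCA.
have [th0|th0] := boolP (t - h \in `[0, T - h]%classic); last first.
  rewrite [\1_(`[0, T - h]%classic) _]indicE (negbTE th0) mul0r.
  case: ifPn => // /andP[t0 tT]; apply: (Rintegral_dot_scale0 _ _ _ _).
  rewrite indicE; move: th0; rewrite !in_itvcc subr_ge0 lerD2r (ltW tT) !andbT.
  by move=> /negbTE ->.
move: (th0); rewrite in_itvcc subr_ge0 lerD2r le_eqVlt eq_sym (negbTE th) /= => /andP[ht].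
rewrite le_eqVlt (negbTE tT') /= => tT.
have t0 : 0 < t := lt_trans h0 ht.
have i1 : \1_(`[0, T - h]%classic) (t - h) = 1 :> R by rewrite indicE th0.
have i1' : \1_(`[h, T]%classic) t = 1 :> R by rewrite indicE in_itvcc !ltW.
have us : time_shift T h u (t - h) = u t.
  rewrite /time_shift subrK indicE in_itvoo subr_gt0 ht.
  by rewrite (lt_trans _ tT) ?ltrBlDr ?ltrDl// scale1r.
have g1' : good (t - h + h) by rewrite subrK.
have thT : t - h + h < T by rewrite subrK.
have sh0 : 0 < t - h by rewrite subr_gt0.
have [e1 e2 e3] := increment g2 g1' sh0 h0 thT (mu_ t).
rewrite t0 tT /= us i1 mul1r -e3.
have := Rintegral_dot_increment mD p2 pq (\1_(`[h, T]%classic) t) h^-1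
   (Lm_W (mu_ t)) (Lv' (t - h + h)) (Lv' (t - h)).
rewrite -e1 -e2 subrK -(put _) ?in_itv/= ?t0// i1' mul1r => <-.
by rewrite /diff_bwd i1'.
Qed.

Let shift_linear h : 0 < h -> linear_on V (fun u => steklov T F h (time_shift T h u)).
Proof.
move=> h0 a x y mx my; rewrite shift_lin.
exact: (linear_on_steklov pq lF bF h0 a (nice_shift p2 h mx) (nice_shift p2 h my)).
Qed.

Let shift_bound h : 0 < h -> ball_bound V (fun u => steklov T F h (time_shift T h u)) M.
Proof.
move=> h0 u nu u1; apply: (ball_bound_steklov pq lF bF h0); first exact: nice_shift.
exact: (le_trans (psn_int_shift p2 h nu) u1).
Qed.

Lemma diff_fwd_dual h : 0 < h ->
  sp_mem (Vdual D p T) (pairing D T (diff_fwd T h (vpow p v))) /\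
  (sp_norm (Vdual D p T) (pairing D T (diff_fwd T h (vpow p v))) <= M%:E)%E.
Proof.
move=> h0; apply: (dual_of_nice (X := X) (p2 := p2) (@memW _ _ _ oD _ _ p2 pq) (@normW _ _ _ oD _ _ p2 pq)
  (G' := steklov T F h)).
- by move=> u w nu wu; exact: pairing_diff_fwd.
- exact: (linear_on_steklov pq lF bF h0).
- exact: (ball_bound_steklov pq lF bF h0).
Qed.

Lemma diff_bwd_dual h : 0 < h ->
  sp_mem (Vdual D p T) (pairing D T (diff_bwd T h (vpow p v))) /\
  (sp_norm (Vdual D p T) (pairing D T (diff_bwd T h (vpow p v))) <= M%:E)%E.
Proof.
move=> h0; apply: (dual_of_nice (X := X) (p2 := p2) (@memW _ _ _ oD _ _ p2 pq) (@normW _ _ _ oD _ _ p2 pq)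
  (G' := fun u => steklov T F h (time_shift T h u))).
- by move=> u w nu wu; exact: pairing_diff_bwd.
- exact: shift_linear.
- exact: shift_bound.
Qed.

Hypothesis dF : sp_mem (Vdual D p T) F.
Hypothesis normF : sp_norm (Vdual D p T) F = M%:E.

Lemma diff_fwd_wcvg (h : nat -> R) : (forall n, 0 < h n) -> h n @[n --> \oo] --> 0 ->
  wcvg (Vdual D p T) (fun k => pairing D T (diff_fwd T (h k) (vpow p v))) F.
Proof.
move=> h0 hc; apply: (dual_strong_wcvg (X := X) (p2 := p2) pq (@memW _ _ _ oD _ _ p2 pq)
  (@normW _ _ _ oD _ _ p2 pq) (G'_ := fun k => steklov T F (h k)) dF normF).
- by move=> k u w nu wu; exact: pairing_diff_fwd.
- by move=> k; exact: (linear_on_steklov pq lF bF (h0 k)).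
- by move=> k; exact: (ball_bound_steklov pq lF bF (h0 k)).
- by move=> u nu; exact: (steklov_cvg pq T0 h0 hc lF bF nu).
Qed.

Lemma diff_bwd_wcvg (h : nat -> R) : (forall n, 0 < h n) -> h n @[n --> \oo] --> 0 ->
  wcvg (Vdual D p T) (fun k => pairing D T (diff_bwd T (h k) (vpow p v))) F.
Proof.
move=> h0 hc; apply: (dual_strong_wcvg (X := X) (p2 := p2) pq (@memW _ _ _ oD _ _ p2 pq)
  (@normW _ _ _ oD _ _ p2 pq) (G'_ := fun k u => steklov T F (h k) (time_shift T (h k) u)) dF normF).
- by move=> k u w nu wu; exact: pairing_diff_bwd.
- by move=> k; exact: shift_linear.
- by move=> k; exact: shift_bound.
- by move=> u nu; exact: (steklov_shift_cvg pq T0 h0 hc lF bF nu).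
Qed.

End difference_quotients.

(** * Continuity in time of F (1_]0,t] v) *)

Section primitive.
Context {R : realType} {p q : R} {E : lmodType R} (X : pseminorm p E).
Hypothesis p2 : 2 <= p.
Hypothesis pq : p^-1 + q^-1 = 1.
Notation mR := (measurableTypeR R).
Notation mu := (@lebesgue_measure R).
Variable T : R.
Hypothesis T0 : 0 < T.
Notation V := (nice_pseminorm X (ge2_gt0 p2) T).

Let p0 : 0 < p. Proof. exact: ge2_gt0. Qed.

Variables (F : (R -> E) -> R) (M : R) (v : R -> E).
Hypotheses (lF : linear_on V F) (bF : ball_bound V F M).
Hypothesis nv : nice X T v.

Definition restrict_oc (s t : R) : R -> E := fun x => \1_(`]s, t]%classic) x *: v x.

Lemma nice_restrict_oc s t : nice X T (restrict_oc s t).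
Proof. by apply: nice_indic => //; exact: measurable_itv. Qed.

Lemma restrict_oc_cat r s t : r <= s -> s <= t ->
  restrict_oc r t = restrict_oc r s + restrict_oc s t.
Proof.
move=> rs st; apply/funext => x; change (restrict_oc r t x = restrict_oc r s x + restrict_oc s t x).
rewrite /restrict_oc -scalerDl !indicE !in_itvoc; congr (_ *: _).
have [xs|sx] := leP x s; first by rewrite (le_trans xs st) ?andbT ?addr0.
by rewrite (le_lt_trans rs sx)/= add0r.
Qed.

Lemma functional_restrict_oc s t : 0 <= s -> s <= t ->
  F (restrict_oc 0 t) - F (restrict_oc 0 s) = F (restrict_oc s t).
Proof.
move=> s0 st; rewrite (restrict_oc_cat s0 st).
by rewrite (linear_onD lF (nice_restrict_oc 0 s) (nice_restrict_oc s t)) addrAC subrr add0r.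
Qed.

Let iv : mu.-integrable setT (EFin \o (fun t => psn X (v t))).
Proof. by have [] := nv. Qed.

Let P t := \int[mu]_(x in `[0, t]) psn X (v x).

Let PE t : P t = \int[mu]_x (\1_(`]0, t]%classic) x * psn X (v x)).
Proof.
rewrite /P Rintegral_mkcond; apply: ae_eq_Rintegral_gen; apply: (ae_mono (ae_neq 0)) => x x0 _.
rewrite patchE in_itvcc indicE in_itvoc [0 < x]lt_neqAle eq_sym x0/=.
by case: (_ && _); rewrite ?mul1r ?mul0r.
Qed.

Let psn_restrict s t : 0 <= s -> s <= t -> psn V (restrict_oc s t) = P t - P s.
Proof.
move=> s0 st; rewrite !PE -RintegralB//; try by apply: integrable_indicM => //; exact: measurable_itv.
apply: eq_Rintegral => x _; have [[mv _] _ _] := nv.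
rewrite (psnZ _ (mv x)) -mulrBl; congr (_ * _).
rewrite !indicE !in_itvoc; have [xs|sx] := leP x s.
  by rewrite (le_trans xs st) !andbT subrr normr0 powR0// gt_eqF.
rewrite (le_lt_trans s0 sx)/= subr0.
by case: (x <= t); rewrite ?normr1 ?powR1 ?normr0 ?powR0// gt_eqF.
Qed.

(** The increment is F at 1_]s,t] v, and the p-th power of the norm of that function is the
    increment of the continuous function [P]. *)
Let modulus s t : 0 <= s -> 0 <= t ->
  `|F (restrict_oc 0 t) - F (restrict_oc 0 s)| <= M * `|P t - P s| `^ p^-1.
Proof.
wlog st : s t / s <= t.
  by move=> h s0 t0; have [/h|/ltW/h] := leP s t; [exact|rewrite distrC [`|P _ - _|]distrC; exact].
move=> s0 t0; rewrite functional_restrict_oc// -psn_restrict// ger0_norm; last exact: (psn_ge0 V).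
exact: (ball_bound_root p2 lF bF (nice_restrict_oc s t)).
Qed.

Lemma continuous_functional_restrict_oc :
  {within `[0, T], continuous (fun t => F (restrict_oc 0 t))}.
Proof.
have iT : mu.-integrable `[0, T] (EFin \o (fun t => psn X (v t))).
  by apply: (integrableS measurableT) => //; exact: measurable_itv.
have /subspace_continuousP cP := parameterized_integral_continuous (ltW T0) iT.
apply/subspace_continuousP => x xT; apply/cvgrPdist_le => e e0.
have [r r0 hr] := powR_small lF bF ler01 e0.
have h := (cvgrPdist_le _ _).1 (cP x xT) _ r0.
near=> y.
have yT : `[0, T]%classic y by near: y; exact: withinT.
have hxy : `|P x - P y| <= r by near: y; exact: h.
move: xT yT; rewrite /= !in_itv/= => /andP[x0' _] /andP[y0 _].
have := modulus y0 x0' => /le_trans; apply.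
by have := hr `|P x - P y|; rewrite mulr1 normr_ge0; apply.
Unshelve. all: by end_near. Qed.

End primitive.

(** * The energy identity for the pairing on L^p *)

Section kinetic_energy.
Context {R : realType} {d : nat} (D : set 'rV[R]_d).
Hypothesis oD : open D.
Variables (p q : R).
Hypotheses (p2 : 2 <= p) (pq : p^-1 + q^-1 = 1).
Variable T : R.
Hypothesis T0 : 0 < T.
Notation mu := (@leb R d).
Notation F1 := ('rV[R]_d -> 'rV[R]_d).
Notation X := (Wpseminorm oD p2 pq).
Notation pair := (pairD mu D p).
Notation Li := (Lint mu D p).
Notation Lm := (Lmem mu D p).
Notation V := (nice_pseminorm X (ge2_gt0 p2) T).

Let mD : measurable D. Proof. exact: open_measurable_rV. Qed.
Let p0 : 0 < p. Proof. exact: ge2_gt0. Qed.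
Notation L := (Lpseminorm mu mD p2 pq 1 d).

Variables (v0 : F1) (s : nat -> F1) (v : R -> F1) (F : (R -> F1) -> R) (M : R).
Hypothesis mv0 : Lm v0.
Hypotheses (ms : forall k, ps_mem X (s k)) (cs : Li (s k - v0) @[k --> \oo] --> 0).
Hypothesis nv : nice X T v.
Hypotheses (lF : linear_on V F) (bF : ball_bound V F M).
Hypothesis key : {ae @lebesgue_measure R, forall t, t \in `]0, T[ ->
  forall w, ps_mem X w -> pair w (v t) = pair w v0 + F (step T 0 t w)}.

Lemma kinetic_energy_identity : {ae @lebesgue_measure R, forall t, t \in `]0, T[ ->
  q^-1 * Li (v t) = q^-1 * Li v0 + F (restrict_oc v 0 t)}.
Proof.
have [_ _ iN] := nice_W_L nv.
have young w u : ps_mem X w -> ps_mem X u -> pair w u <= p^-1 * Li w + q^-1 * Li u.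
  by move=> mw mu_; exact: (pairD_young mD p2 pq (Lm_W mw) (Lm_W mu_)).
have young0 w : ps_mem X w -> pair w v0 <= p^-1 * Li w + q^-1 * Li v0.
  by move=> mw; exact: (pairD_young mD p2 pq (Lm_W mw) mv0).
have diag u : ps_mem X u -> pair u u = Li u by move=> _; exact: pairD_diag.
(* The witness is a term of the sequence [s] approximating v0 in L^p: the right side converges to (1
   - 1/p) [Li v0]. *)
have approx0 (e : R) : 0 < e -> exists2 w, ps_mem X w & q^-1 * Li v0 - e <= pair w v0 - p^-1 * Li w.
  move=> e0; have c1 := pairD_cvgl mD p2 pq mv0 (fun k => Lm_W (ms k)) mv0 cs.
  have c2 := @ps_cvg_psn _ _ _ L s v0 (fun k => Lm_W (ms k)) mv0 cs.
  have c : pair (s k) v0 - p^-1 * Li (s k) @[k --> \oo] --> pair v0 v0 - p^-1 * Li v0.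
    exact: (cvgB c1 (cvgMl_tmp c2)).
  have [k _ hk] := (cvgrPdist_le _ _).1 c e e0.
  exists (s k) => //.
  have := ler_normlW (hk k (leqnn k)); rewrite pairD_diag//.
  have -> : Li v0 - p^-1 * Li v0 = q^-1 * Li v0 by rewrite -{1}[Li v0]mul1r -mulrBl -pq addrAC subrr add0r.
  by rewrite lerBlDl lerBlDr addrC.
exact: (@energy_identity _ _ _ _ _ p2 pq _ T0 _ _ lF bF (fun w u => pair w u) (fun w => pair w v0)
  (fun u => Li u) (Li v0) v
  nv iN key young young0 diag approx0).
Qed.

End kinetic_energy.

Theorem proposition5p1 (R : realType) (d : nat) (D : set 'rV[R]_d)
    (p q nu : R) :
  (2 <= d)%N -> regular_domain D -> d%:R <= p -> p^-1 + q^-1 = 1 -> 0 < nu ->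
  exists m0 : nat, forall m : nat, (m0 <= m)%N ->
  forall phi : nat -> 'rV[R]_d -> 'rV[R]_d,
    eigenbasis D m phi ->
    schauder_basis (Usol D p) phi -> schauder_basis (Wdiv D p) phi ->
  forall (v0 : 'rV[R]_d -> 'rV[R]_d) (c0 : nat -> R) (nstar : nat),
    sp_mem (Usol D p) v0 -> sp_norm (Usol D p) v0 <> 0%E ->
    expansion (Usol D p) phi v0 c0 ->
    c0 nstar <> 0 -> (forall n, (n < nstar)%N -> c0 n = 0) ->
  forall c : nat -> nat -> R -> R,
    (forall N, (nstar < N)%N -> galerkin_solution D p nu phi c0 N (c N)) ->
  forall (T : R) (N : nat -> nat) (v : R -> 'rV[R]_d -> 'rV[R]_d)
    (chi : R -> 'rV[R]_d -> 'M[R]_d)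
    (dtvp : (R -> 'rV[R]_d -> 'rV[R]_d) -> R),
    0 < T -> (forall k, (nstar < N k)%N /\ (N k < N k.+1)%N) ->
    galerkin_limit D p q T phi v0 c N v chi dtvp ->
  let fwd h := pairing D T (diff_fwd T h (vpow p v)) in
  let bwd h := pairing D T (diff_bwd T h (vpow p v)) in
  [/\ exists C : R, forall h, 0 < h < T ->
        [/\ sp_mem (Vdual D p T) (fwd h), sp_mem (Vdual D p T) (bwd h),
            (sp_norm (Vdual D p T) (fwd h) <= C%:E)%E &
            (sp_norm (Vdual D p T) (bwd h) <= C%:E)%E],
      weak_subseq_limit (Vdual D p T) T fwd dtvp,
      weak_subseq_limit (Vdual D p T) T bwd dtvp &
      exists H : R -> R,
        [/\ {within `[0, T], continuous H},
            {ae @lebesgue_measure R, forall t, t \in `]0, T[ ->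
               H t = q^-1 * \int[@leb R d]_(x in D) (frob (v t x) `^ p) /\
               H t = q^-1 * \int[@leb R d]_(x in D) (frob (vpow p v t x) `^ q)},
            H 0 = q^-1 * fine (sp_norm (Usol D p) v0) `^ p &
            forall s t, 0 <= s -> s <= t -> t <= T ->
              dtvp (fun tau => \1_(`[s, t]%classic) tau *: v tau) = H t - H s]].

Proof.
(* The basis property in W is assumed of phi for the given m, so 0 can serve as the threshold. *)
move=> d2 [oD _ _ _] dp pq _; exists 0%N => m _ phi _ _ basis v0 c0 nstar [Lv0 _] _ ev0 _ _.
move=> c gc T N v chi dtvp T0 hN lim fwd bwd.
have p2 : 2 <= p by apply: le_trans dp; rewrite ler_nat.
have p0 : 0 < p := ge2_gt0 p2.
have mD : measurable D := open_measurable_rV oD.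
have mv0 : Lmem (@leb R d) D p v0 := (sp_mem_Lr D p2 v0).1 Lv0.
pose X := Wpseminorm oD p2 pq.
(* The partial sums lie in W although v0 is only given in U_p; they are the admissible test vectors
   close to v0. *)
pose s k := \sum_(n < k) c0 n *: phi n.
have ms k : ps_mem X (s k) by apply: ps_mem_sum => i _; apply: ps_memZ; exact: basis.1.
have cs : Lint (@leb R d) D p (s k - v0) @[k --> \oo] --> 0.
  exact: (scvg_ps_cvg (Y := Usol D p) (X := Lpseminorm (@leb R d) mD p2 pq 1 d) p0
    (fun x mx => sp_norm_Lr mD p2 mx) (fun k => Lm_W (ms k)) mv0).1 ev0.
have hc k n : (n < N k)%N -> C1_halfline (c (N k) n) /\ c (N k) n 0 = c0 n.
  exact: (gc (N k) (hN k).1).1.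
have leN k : (k <= N k)%N by elim: k => // k IH; exact: leq_ltn_trans IH (hN k).2.
have memX := memW oD p2 pq; have normX := normW (oD := oD) (p2 := p2) (pq := pq).
have [v' nv' vv'] := mem_nice p2 memX normX (limit_V lim).
have [dF _] := limit_dt lim.
have lF := dual_linear_on (p2 := p2) memX normX dF.
have [M [normF bF _]] := dual_ball_bound p2 memX normX dF.
have key := key_identity T0 basis mv0 cs hc leN nv' vv' (limit_strong lim) (limit_weak_dt lim).
have Fae := dual_ae p2 memX normX dF.
split.
- exists M => h /andP[h0 _].
  have [mf nf] := diff_fwd_dual nv' vv' lF bF key h0.
  have [mb nb] := diff_bwd_dual nv' vv' lF bF key h0.
  exact: (And4 mf mb nf nb).
(* The whole sequence converges, so it is its own subsequence. *)
- move=> h hT h0; exists id => //.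
  have hp n : 0 < h n by have /andP[] := hT n.
  exact: (diff_fwd_wcvg T0 nv' vv' lF bF key dF normF hp h0).
- move=> h hT h0; exists id => //.
  have hp n : 0 < h n by have /andP[] := hT n.
  exact: (diff_bwd_wcvg T0 nv' vv' lF bF key dF normF hp h0).
have F0 : dtvp (restrict_oc v' 0 0) = 0.
  have -> : restrict_oc v' 0 0 = 0; last exact: (linear_on0 lF).
  by apply/funext => t; rewrite /restrict_oc set_itvoc0 indic0 scale0r.
(* The continuous version of H is the right side of the energy identity, defined at every t. *)
exists (fun t => q^-1 * Lint (@leb R d) D p v0 + dtvp (restrict_oc v' 0 t)); split.
- have cF := continuous_functional_restrict_oc T0 lF bF nv'.
  by move=> x; apply: cvgD; [exact: cvg_cst|exact: cF].
- have en := kinetic_energy_identity T0 mv0 ms cs nv' lF bF key.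
  apply: (ae_mono2 en vv') => t et vt tT;
  have e : q^-1 * Lint (@leb R d) D p v0 + dtvp (restrict_oc v' 0 t) = q^-1 * Lint (@leb R d) D p (v t).
    exact: (etrans (esym (et tT)) (congr1 (fun w => q^-1 * Lint (@leb R d) D p w) (esym (vt tT)))).
  exact: (conj e (etrans e (congr1 (fun z => q^-1 * z) (esym (Rintegral_frob_pw (@leb R d) D p2 pq (v t)))))).
- rewrite F0 addr0; congr (_ * _).
  by rewrite [sp_norm _ _](sp_norm_Lr mD p2 mv0) /= powR_inv// Lint_ge0.
- move=> a b a0 ab bT; rewrite (_ : dtvp _ = dtvp (restrict_oc v' a b)).
    by rewrite -(functional_restrict_oc lF nv' a0 ab); ring.
  (* The closed interval and the representative v both differ from the half-open interval and v'
     only on null sets, which F does not see. *)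
  apply: Fae; first exact: (nice_restrict_oc p2 nv').
  apply: (ae_mono2 vv' (ae_neq a)) => t vt ta tT; rewrite (vt tT) /restrict_oc !indicE.
  by rewrite in_itvcc in_itvoc [a < t]lt_neqAle eq_sym ta.
Qed.
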